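(* Let $\Gamma$ and $\tilde\Gamma$ be Kleinian groups whose limit sets $S$ and $\tilde S$ are Schottky sets, and assume $\Gamma$ acts on $S$ and $\tilde\Gamma$ acts on $\tilde S$ as uniform convergence groups. Equip $S,\tilde S\subset\mathbb S^2$ with the spherical metric. Let $p\in S$ and $\tilde p\in\tilde S$. If there exist a weak tangent of $S$ at $p$ and a weak tangent of $\tilde S$ at $\tilde p$ which are quasisymmetrically equivalent, then there exists a Möbius transformation mapping $S$ onto $\tilde S$.
   Context: A Kleinian group is a discrete group of isometries of hyperbolic space $\mathbb H^3$; its limit set is the set of accumulation points in $\partial_\infty\mathbb H^3=\mathbb S^2$ of an orbit. A Schottky set is a compact subset of $\mathbb S^2$ whose complement is a union of at least three open round disks whose closures are pairwise disjoint. A group $G$ acting by homeomorphisms on a compact metrizable space $Z$ with at least three points acts as a uniform convergence group if the induced diagonal action on the space of triples of distinct points of $Z$ is properly discontinuous and cocompact. A weak tangent of a metric space $(X,d)$ at $p$ is a pointed Gromov–Hausdorff limit of $(X,p_n,d/\lambda_n)$ with $\lambda_n\to0^+$ and $p_n\to p$, where $(X_n,p_n,d_n)\to(Z,z,d)$ ($Z$ complete) means: for every $r,\varepsilon>0$, for all large $n$ there is a map $g:B(p_n,r)\to Z$ with $g(p_n)=z$, $\sup|d_n(x,y)-d(g(x),g(y))|<\varepsilon$ and $B(z,r-\varepsilon)$ in the $\varepsilon$-neighborhood of $g(B(p_n,r))$. Two metric spaces are quasisymmetrically equivalent if there is a quasisymmetric homeomorphism between them. *)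

(* Defs.v *)
From HB Require Import structures.
From mathcomp Require Import all_boot all_order all_algebra.
From mathcomp Require Import all_classical all_reals all_analysis.
Set Implicit Arguments. Unset Strict Implicit. Unset Printing Implicit Defensive.
Import Order.TTheory GRing.Theory Num.Theory.
Import numFieldNormedType.Exports.
Local Open Scope classical_set_scope.
Local Open Scope ring_scope.

Notation pt R := 'rV[R^o]_3.

Section Defs.
Variable R : realType.

(* Euclidean 3-space; S^2 = unit sphere, H^3 = open unit ball (Poincare ball model). *)
Local Notation pt := 'rV[R^o]_3.
Definition dot (x y : pt) : R := \sum_(i < 3) x ord0 i * y ord0 i.
Definition enorm (x : pt) : R := Num.sqrt (dot x x).
(* chordal (Euclidean) metric; restricted to S^2 this is the spherical chordal metric *)
Definition edist (x y : pt) : R := enorm (x - y).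
Definition sphere : set pt := [set x | dot x x = 1].

(* Reflections in hyperbolic planes of the ball model:
   Euclidean reflection in a plane through the origin with unit normal n, and
   inversion in the sphere centered at a (|a|>1) orthogonal to S^2. *)
Definition plane_refl (n : pt) (x : pt) : pt := x - (2 * dot x n) *: n.
Definition sphere_inv (a : pt) (x : pt) : pt :=
  a + ((dot a a - 1) / dot (x - a) (x - a)) *: (x - a).

(* finite compositions of such reflections = isometries of H^3 *)
Inductive hyp_isom : (pt -> pt) -> Prop :=
| hi_id : hyp_isom id
| hi_refl n f : dot n n = 1 -> hyp_isom f -> hyp_isom (plane_refl n \o f)
| hi_inv a f : 1 < dot a a -> hyp_isom f -> hyp_isom (sphere_inv a \o f).

(* canonical representative: the isometry on the closed ball (incl. its
   boundary extension to S^2 = the Moebius transformation), identity outside *)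
Definition mobius (g : pt -> pt) : Prop :=
  exists f, hyp_isom f /\ forall x, g x = if dot x x <= 1 then f x else x.

(* Kleinian group: discrete group of isometries of H^3 (identity isolated
   for the topology of uniform convergence on S^2) *)
Definition kleinian (G : set (pt -> pt)) : Prop :=
  [/\ G `<=` mobius, G id,
      (forall g h, G g -> G h -> G (g \o h)),
      (forall g, G g -> exists2 h, G h & h \o g = id)
    & exists2 e : R, 0 < e & forall g, G g ->
        (forall x, sphere x -> edist (g x) x < e) -> g = id].

Definition limit_set (G : set (pt -> pt)) : set pt :=
  [set zeta | sphere zeta /\ forall e, 0 < e ->
     exists2 g, G g & g 0 <> zeta /\ edist (g 0) zeta < e].

Definition open_cap (c : pt) (h : R) : set pt := [set x | sphere x /\ h < dot x c].
Definition closed_cap (c : pt) (h : R) : set pt := [set x | sphere x /\ h <= dot x c].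

Definition schottky_set (S : set pt) : Prop :=
  compact S /\ S `<=` sphere /\
  exists (I : Type) (c : I -> pt) (h : I -> R),
    (forall i, dot (c i) (c i) = 1 /\ -1 < h i < 1) /\
    (exists i j k : I, [/\ i <> j, j <> k & i <> k]) /\
    (forall i j, i <> j -> closed_cap (c i) (h i) `&` closed_cap (c j) (h j) = set0) /\
    sphere `\` S = \bigcup_i open_cap (c i) (h i).

Definition triples (S : set pt) : set (pt * pt * pt) :=
  [set t | [/\ S t.1.1, S t.1.2 & S t.2] /\ [/\ t.1.1 <> t.1.2, t.1.2 <> t.2 & t.1.1 <> t.2]].
Definition act3 (g : pt -> pt) (t : pt * pt * pt) : pt * pt * pt :=
  (g t.1.1, g t.1.2, g t.2).

Definition uniform_convergence_action (G : set (pt -> pt)) (S : set pt) : Prop :=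
  (forall g, G g -> g @` S = S) /\
  (forall K, K `<=` triples S -> compact K ->
     finite_set [set g | G g /\ (act3 g @` K `&` K !=set0)]) /\
  (exists K, [/\ K `<=` triples S, compact K &
     triples S = \bigcup_(g in G) (act3 g @` K)]).

Definition is_metric (Z : Type) (d : Z -> Z -> R) : Prop :=
  [/\ forall x y, 0 <= d x y, forall x y, d x y = 0 <-> x = y,
      forall x y, d x y = d y x & forall x y w, d x w <= d x y + d y w].

Definition complete_metric (Z : Type) (d : Z -> Z -> R) : Prop :=
  forall u : nat -> Z,
    (forall e, 0 < e -> exists N, forall m n, (N <= m)%N -> (N <= n)%N -> d (u m) (u n) < e) ->
    exists l, forall e, 0 < e -> exists N, forall n, (N <= n)%N -> d (u n) l < e.

Definition weak_tangent (S : set pt) (p : pt) (Z : Type) (d : Z -> Z -> R) (z : Z) : Prop :=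
  exists (lam : nat -> R) (pn : nat -> pt),
    [/\ (forall n, 0 < lam n), lam @ \oo --> (0 : R),
        (forall n, S (pn n)), pn @ \oo --> p &
    forall r eps, 0 < r -> 0 < eps -> exists N, forall n, (N <= n)%N ->
      exists g : pt -> Z,
        let B := [set x | S x /\ edist x (pn n) / lam n < r] in
        [/\ g (pn n) = z,
            (exists2 delta, delta < eps & forall x y, B x -> B y ->
               `|edist x y / lam n - d (g x) (g y)| <= delta) &
            forall w, d z w < r - eps -> exists2 x, B x & d w (g x) < eps]].

Definition metric_continuous (Z Z' : Type) (d : Z -> Z -> R) (d' : Z' -> Z' -> R)
  (f : Z -> Z') : Prop :=
  forall x e, 0 < e -> exists2 de, 0 < de & forall y, d x y < de -> d' (f x) (f y) < e.

Definition quasisymmetric (Z Z' : Type) (d : Z -> Z -> R) (d' : Z' -> Z' -> R)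
  (f : Z -> Z') : Prop :=
  (exists g : Z' -> Z, [/\ cancel f g, cancel g f,
       metric_continuous d d' f & metric_continuous d' d g]) /\
  exists eta : R -> R,
    [/\ eta 0 = 0,
        (forall s t, 0 <= s -> s < t -> eta s < eta t),
        (forall t e, 0 <= t -> 0 < e -> exists2 de, 0 < de &
            forall s, 0 <= s -> `|s - t| < de -> `|eta s - eta t| < e),
        (forall y, 0 <= y -> exists2 t, 0 <= t & eta t = y) &
        forall x y w, x <> w ->
          d' (f x) (f y) / d' (f x) (f w) <= eta (d x y / d x w)].

End Defs.

(* Main.v *)
(* The discs of a Schottky set S are recorded as unit spacelike vectors of Lorentz space R^{3,1}, on which
   Moebius maps act linearly. Blowing up with the cocompact group identifies a weak tangent with S minus a
   point q, so a quasisymmetry of weak tangents yields a homeomorphism f from S to S~ which is quasisymmetric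
   away from q; by the Jordan curve theorem f matches the complementary discs.

   Normalise a disc o of S and its partner so that both become the exterior of the unit disc, and let J(o) be
   the integral over y of the jump of f between the ends of the chord of the unit circle at height y. The
   other discs n then have radii r_n, r~_n with sum r_n^2 <= 1 and sum r~_n^2 <= 1. The part of S on a line
   contributes nothing to the jump, because small discs matched by f are plentiful at every scale while
   sum r_n r~_n converges; hence J(o) <= sum_n r_n r~_n J(n). Near the supremum of J this forces sum r_n r~_n
   to be almost 1, so that r_n and r~_n almost agree, and the same holds one level further down. Cocompactness
   moves such discs to a compact family, and in the limit all these radii agree exactly. They determine the
   Lorentz products of the vectors of the discs, so some Lorentz transformation maps the discs of S to those
   of S~. *)

(* The jump inequality does the work of a length-area estimate. The change of variable in y supplies
   the factor r_n, the target chart supplies r~_n, and Cauchy-Schwarz against the two packing bounds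
   is nearly sharp only if the two families of radii nearly agree. Nothing says that the supremum of
   J is attained. Near-extremal states are therefore moved by symmetries into a bounded family, and
   only the comparison of radii passes to the limit. The matching found there is a limit of moved
   matchings, not f itself; local finiteness of the discs makes these matchings stabilise disc by
   disc. The radii in one chart give only the products of the discs with the point at infinity of
   the chart. The radius of k in the chart adapted to n then gives the product of n and k, hence the
   two levels. The point q, near which f is not controlled, costs a strip of heights of arbitrarily
   small width, because a jump is at most 2. All limits are taken along one fixed ultrafilter on
   nat, which replaces every extraction of a subsequence. *)
Require Import Defs.
From HB Require Import structures.
From mathcomp Require Import all_boot all_order all_algebra.
From mathcomp Require Import all_classical all_reals all_analysis.
From mathcomp Require Import measurable_realfun.
From mathcomp Require Import ring lra.
Import Order.TTheory GRing.Theory Num.Theory.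
Import numFieldNormedType.Exports.
Set Implicit Arguments. Unset Strict Implicit. Unset Printing Implicit Defensive.
Local Open Scope classical_set_scope.
Local Open Scope ring_scope.

(* [lra] inspects every hypothesis, which is slow in large contexts. *)
Ltac light_lra :=
  repeat match goal with
  | H : ?P |- _ =>
    lazymatch P with
    | is_true (@Order.le _ _ _ _) => fail
    | is_true (@Order.lt _ _ _ _) => fail
    | @eq _ _ _ => fail
    | _ => lazymatch type of P with Prop => clear H end
    end
  end; lra.
Tactic Notation "lra_from" ne_hyp_list(hs) := clear - hs; lra.

Notation vec R := (R * R * R * R)%type.

(** * Moebius maps as Lorentz transformations *)

Section Lorentz.
Variable R : realType.
Implicit Types (u v w : vec R) (x y : pt R) (a b k : R) (M : vec R -> vec R).

Definition c1 u : R := u.1.1.1.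
Definition c2 u : R := u.1.1.2.
Definition c3 u : R := u.1.2.
Definition c4 u : R := u.2.

Lemma vext u v : c1 u = c1 v -> c2 u = c2 v -> c3 u = c3 v -> c4 u = c4 v -> u = v.
Proof.
case: u => [[[? ?] ?] ?]; case: v => [[[? ?] ?] ?].
by rewrite /c1 /c2 /c3 /c4 /= => -> -> -> ->.
Qed.

Definition lf u v : R := c1 u * c1 v + c2 u * c2 v + c3 u * c3 v - c4 u * c4 v.

Definition lc a u b v : vec R :=
  (a * c1 u + b * c1 v, a * c2 u + b * c2 v, a * c3 u + b * c3 v, a * c4 u + b * c4 v).

Definition sc k u : vec R := (k * c1 u, k * c2 u, k * c3 u, k * c4 u).

(** The future cone with its light-like boundary and without 0: it contains both the points of
    hyperbolic space and those of the sphere at infinity. *)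
Definition fut u : Prop := lf u u <= 0 /\ 0 < c4 u.

Lemma lfC u v : lf u v = lf v u.
Proof. rewrite /lf; ring. Qed.

Lemma lf_lcl a u b v w : lf (lc a u b v) w = a * lf u w + b * lf v w.
Proof. rewrite /lf /lc /c1 /c2 /c3 /c4 /=; ring. Qed.

Lemma lf_lcr a u b v w : lf w (lc a u b v) = a * lf w u + b * lf w v.
Proof. by rewrite lfC lf_lcl !(lfC w). Qed.

Lemma lf_scl k u v : lf (sc k u) v = k * lf u v.
Proof. rewrite /lf /sc /c1 /c2 /c3 /c4 /=; ring. Qed.

Lemma lf_scr k u v : lf u (sc k v) = k * lf u v.
Proof. by rewrite lfC lf_scl lfC. Qed.

Lemma sc_lc k u : sc k u = lc k u 0 u.
Proof. by apply: vext; rewrite /lc /sc /c1 /c2 /c3 /c4 /= mul0r addr0. Qed.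

Lemma scA a b u : sc a (sc b u) = sc (a * b) u.
Proof. by apply: vext; rewrite /sc /c1 /c2 /c3 /c4 /= mulrA. Qed.

Lemma sc1 u : sc 1 u = u.
Proof. by apply: vext; rewrite /sc /c1 /c2 /c3 /c4 /= mul1r. Qed.

Lemma cauchy3 (a1 a2 a3 b1 b2 b3 : R) :
  (a1 * b1 + a2 * b2 + a3 * b3) ^+ 2 <=
  (a1 ^+ 2 + a2 ^+ 2 + a3 ^+ 2) * (b1 ^+ 2 + b2 ^+ 2 + b3 ^+ 2).
Proof.
rewrite -subr_ge0.
have -> : (a1 ^+ 2 + a2 ^+ 2 + a3 ^+ 2) * (b1 ^+ 2 + b2 ^+ 2 + b3 ^+ 2) -
  (a1 * b1 + a2 * b2 + a3 * b3) ^+ 2 =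
  (a1 * b2 - a2 * b1) ^+ 2 + (a1 * b3 - a3 * b1) ^+ 2 + (a2 * b3 - a3 * b2) ^+ 2
  by ring.
by rewrite !addr_ge0 ?sqr_ge0.
Qed.

(** Orthochronous Lorentz maps. The inverse is carried along because every chart is used in both
    directions; preservation of the future excludes maps such as minus the identity. *)
Record LT (M M' : vec R -> vec R) : Prop := mkLT {
  LT_lin : forall a u b v, M (lc a u b v) = lc a (M u) b (M v);
  LT_lin' : forall a u b v, M' (lc a u b v) = lc a (M' u) b (M' v);
  LT_K : cancel M M';
  LT_K' : cancel M' M;
  LT_lf : forall u v, lf (M u) (M v) = lf u v;
  LT_fut : forall u, fut u -> fut (M u);
  LT_fut' : forall u, fut u -> fut (M' u) }.

Lemma LT_sym M M' : LT M M' -> LT M' M.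
Proof.
by case=> l l' k k' f u u'; split=> // x y; rewrite -(f (M' x)) !k'.
Qed.

Lemma LT_id : LT id id.
Proof. by split. Qed.

Lemma LT_comp M M' M1 M1' : LT M M' -> LT M1 M1' -> LT (M \o M1) (M1' \o M').
Proof.
case=> l l' k k' f u u' [l1 l1' k1 k1' f1 u1 u1']; split => /=.
- by move=> *; rewrite l1 l.
- by move=> *; rewrite l' l1'.
- by move=> x /=; rewrite k k1.
- by move=> x /=; rewrite k1' k'.
- by move=> *; rewrite f f1.
- by move=> *; apply/u/u1.
- by move=> *; apply/u1'/u'.
Qed.

Lemma LT_sc M M' k u : LT M M' -> M (sc k u) = sc k (M u).
Proof. by move=> H; rewrite !sc_lc (LT_lin H). Qed.

Lemma LT_adj M M' u v : LT M M' -> lf (M u) v = lf u (M' v).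
Proof. by move=> H; rewrite -(LT_lf H u) (LT_K' H). Qed.

Definition refl n u : vec R := lc 1 u (- (2 * lf u n)) n.

Lemma refl_LT n : lf n n = 1 -> LT (refl n) (refl n).
Proof.
move=> n1.
have K : involutive (refl n).
  move=> u; rewrite /refl lf_lcl n1.
  by apply: vext; rewrite /lc /c1 /c2 /c3 /c4 /=; ring.
have L a u b v : refl n (lc a u b v) = lc a (refl n u) b (refl n v).
  rewrite /refl lf_lcl.
  by apply: vext; rewrite /lc /c1 /c2 /c3 /c4 /=; ring.
have I u v : lf (refl n u) (refl n v) = lf u v.
  rewrite /refl !lf_lcl !lf_lcr n1 (lfC n v); ring.
have F u : fut u -> fut (refl n u).
  move=> [h h4]; split; first by rewrite I.
  rewrite /refl /lc /c4 /= -!/(c4 _).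
  have E : c1 n ^+ 2 + c2 n ^+ 2 + c3 n ^+ 2 = 1 + c4 n ^+ 2.
    by move: n1; rewrite /lf !expr2; light_lra.
  have hu' : c1 u ^+ 2 + c2 u ^+ 2 + c3 u ^+ 2 <= c4 u ^+ 2 by move: h; rewrite /lf !expr2; light_lra.
  have C := cauchy3 (c1 u) (c2 u) (c3 u) (c1 n) (c2 n) (c3 n).
  have -> : lf u n = (c1 u * c1 n + c2 u * c2 n + c3 u * c3 n) - c4 u * c4 n by [].
  set P := c1 u * _ + _ + _ in C *.
  have CP : P ^+ 2 <= c4 u ^+ 2 * (1 + c4 n ^+ 2).
    apply: (le_trans C); rewrite E; apply: ler_wpM2r => //.
    by rewrite addr_ge0 ?sqr_ge0.
  set t := c4 u in h4 CP *; set s := c4 n in CP *.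
  have -> : 1 * t + - (2 * (P - t * s)) * s = t * (1 + 2 * s ^+ 2) - 2 * (s * P) by ring.
  (* Cauchy-Schwarz has given P^2 <= t^2 (1 + s^2), and t^2 (1 + 2 s^2)^2 = 4 s^2 t^2 (1 + s^2) +
     t^2, so the time coordinate of the image stays positive. *)
  have : (2 * (s * P)) ^+ 2 < (t * (1 + 2 * s ^+ 2)) ^+ 2.
    have -> : (2 * (s * P)) ^+ 2 = 4 * s ^+ 2 * P ^+ 2 by ring.
    have -> : (t * (1 + 2 * s ^+ 2)) ^+ 2 = 4 * s ^+ 2 * (t ^+ 2 * (1 + s ^+ 2)) + t ^+ 2 by ring.
    apply: (@le_lt_trans _ _ (4 * s ^+ 2 * (t ^+ 2 * (1 + s ^+ 2)))).
      by apply: ler_wpM2l => //; rewrite mulr_ge0 ?sqr_ge0.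
    by rewrite ltrDl exprn_gt0.
  rewrite subr_gt0 => hh.
  have tp : 0 <= t * (1 + 2 * s ^+ 2).
    by rewrite mulr_ge0 ?ltW // ltr_pwDl // mulr_ge0 // sqr_ge0.
  case: (leP 0 (2 * (s * P))) => hp; first by rewrite -(ltr_pXn2r (n := 2)) ?nnegrE.
  exact: lt_le_trans tp.
by split.
Qed.

Definition px x : R := x ord0 (@Ordinal 3 0 isT).
Definition py x : R := x ord0 (@Ordinal 3 1 isT).
Definition pz x : R := x ord0 (@Ordinal 3 2 isT).
Definition mkpt (a b c : R) : pt R := \row_(i < 3) [:: a; b; c]`_i.

Lemma px_mk a b (c : R) : px (mkpt a b c) = a. Proof. by rewrite /px mxE. Qed.
Lemma py_mk a b (c : R) : py (mkpt a b c) = b. Proof. by rewrite /py mxE. Qed.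
Lemma pz_mk a b (c : R) : pz (mkpt a b c) = c. Proof. by rewrite /pz mxE. Qed.

Lemma pext x y : px x = px y -> py x = py y -> pz x = pz y -> x = y.
Proof.
move=> h1 h2 h3; apply/rowP => -[[|[|[|//]]] Hi].
- by rewrite (_ : Ordinal Hi = @Ordinal 3 0 isT) //; apply: val_inj.
- by rewrite (_ : Ordinal Hi = @Ordinal 3 1 isT) //; apply: val_inj.
- by rewrite (_ : Ordinal Hi = @Ordinal 3 2 isT) //; apply: val_inj.
Qed.

Lemma dotE x y : dot x y = px x * px y + py x * py y + pz x * pz y.
Proof.
rewrite /dot !big_ord_recl big_ord0 addr0 addrA /px /py /pz.
by congr (_ + _ + _); congr (_ * _); congr (fun_of_matrix _ _ _); apply: val_inj.
Qed.

Lemma px_lin x y k : px (x - k *: y) = px x - k * px y.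
Proof. by rewrite /px !mxE. Qed.
Lemma py_lin x y k : py (x - k *: y) = py x - k * py y.
Proof. by rewrite /py !mxE. Qed.
Lemma pz_lin x y k : pz (x - k *: y) = pz x - k * pz y.
Proof. by rewrite /pz !mxE. Qed.

(** The representative with time coordinate 1 of the light ray over a point of the sphere. On such
    vectors the Lorentz product is minus half the squared chordal distance. *)
Definition X x : vec R := (px x, py x, pz x, 1).

Lemma lfXX x y : lf (X x) (X y) = dot x y - 1.
Proof. by rewrite dotE /lf /X /c1 /c2 /c3 /c4 /= mulr1. Qed.

Lemma fut_X x : sphere x -> fut (X x).
Proof. by rewrite /sphere /= => h; split; rewrite ?lfXX ?h ?subrr //; exact: ltr01. Qed.

Lemma lfXX0 x : sphere x -> lf (X x) (X x) = 0.
Proof. by rewrite lfXX /sphere /= => ->; rewrite subrr. Qed.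

Definition prj u : pt R := mkpt (c1 u / c4 u) (c2 u / c4 u) (c3 u / c4 u).

Lemma prjX x : prj (X x) = x.
Proof. by apply: pext; rewrite ?px_mk ?py_mk ?pz_mk /X /c1 /c2 /c3 /c4 /= divr1. Qed.

Lemma prj_sc k u : k != 0 -> prj (sc k u) = prj u.
Proof.
by move=> k0; apply: pext; rewrite ?px_mk ?py_mk ?pz_mk /sc /c1 /c2 /c3 /c4 /= -mulf_div divff ?mul1r.
Qed.

Lemma prjK u : c4 u != 0 -> sc (c4 u) (X (prj u)) = u.
Proof.
move=> h; apply: vext; rewrite /X /sc /c1 /c2 /c3 /c4 /= ?px_mk ?py_mk ?pz_mk ?mulr1 //;
 by rewrite mulrC divfK.
Qed.

Lemma prj_sphere u : c4 u != 0 -> lf u u = 0 -> sphere (prj u).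
Proof.
move=> h; rewrite -{1 2}(prjK h) lf_scl lf_scr lfXX /sphere /= => /eqP.
by rewrite !mulf_eq0 (negbTE h) /= subr_eq0 => /eqP.
Qed.

Definition act M x : pt R := prj (M (X x)).

Lemma LT_c4 M M' x : LT M M' -> sphere x -> 0 < c4 (M (X x)).
Proof. by move=> H /fut_X /(LT_fut H) []. Qed.

Lemma actE M M' x : LT M M' -> sphere x -> M (X x) = sc (c4 (M (X x))) (X (act M x)).
Proof. by move=> H hx; rewrite prjK // gt_eqF // (LT_c4 H). Qed.

Lemma act_sphere M M' x : LT M M' -> sphere x -> sphere (act M x).
Proof.
move=> H hx; apply: prj_sphere; first by rewrite gt_eqF // (LT_c4 H).
by rewrite (LT_lf H) lfXX0.
Qed.

Lemma act_eq M x y k : k != 0 -> M (X x) = sc k (X y) -> act M x = y.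
Proof. by rewrite /act => k0 ->; rewrite prj_sc // prjX. Qed.

Lemma act_comp M M' M1 M1' x : LT M M' -> LT M1 M1' -> sphere x ->
  act (M \o M1) x = act M (act M1 x).
Proof.
move=> H H1 hx; apply: (@act_eq _ _ _ (c4 (M1 (X x)) * c4 (M (X (act M1 x))))).
  by rewrite mulf_neq0 // gt_eqF //; [exact: LT_c4 H1 hx | exact: LT_c4 H (act_sphere H1 hx)].
rewrite /= {1}(actE H1 hx) (LT_sc _ _ H) {1}(actE H (act_sphere H1 hx)).
by rewrite scA.
Qed.

Lemma actK M M' x : LT M M' -> sphere x -> act M' (act M x) = x.
Proof.
move=> H hx; rewrite -(act_comp (LT_sym H) H hx).
by rewrite /act /= (LT_K H) prjX.
Qed.

(* x in the cap of n is expressed by the sign of [lf (X x) n] *)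
Lemma lf_act M M' x n : LT M M' -> sphere x ->
  lf (X x) n = c4 (M (X x)) * lf (X (act M x)) (M n).
Proof. by move=> H hx; rewrite -(LT_lf H) {1}(actE H hx) lf_scl. Qed.

(** Agreement is asked on the sphere, which is where the limit sets lie. *)
Definition represents (f : pt R -> pt R) M := forall x, sphere x -> sphere (f x) /\ act M x = f x.

Lemma represents_comp f g M M' M1 M1' : LT M M' -> LT M1 M1' ->
  represents f M -> represents g M1 -> represents (f \o g) (M \o M1).
Proof.
move=> H H1 hf hg x hx /=; have [s1 e1] := hg _ hx; have [s2 e2] := hf _ s1.
by split=> //; rewrite (act_comp H H1 hx) e1.
Qed.

Lemma plane_refl_rep n : dot n n = 1 ->
  let m : vec R := (px n, py n, pz n, 0) in lf m m = 1 /\ represents (plane_refl n) (refl m).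
Proof.
move=> n1 m.
have m1 : lf m m = 1 by rewrite -n1 dotE /lf /m /c1 /c2 /c3 /c4 /=; ring.
split=> // x hx.
have E : refl m (X x) = sc 1 (X (plane_refl n x)).
  have e : lf (X x) m = dot x n by rewrite dotE /lf /m /X /c1 /c2 /c3 /c4 /=; ring.
  rewrite /refl e; apply: vext; rewrite /lc /sc /X /c1 /c2 /c3 /c4 /m /= /plane_refl
    ?px_lin ?py_lin ?pz_lin; ring.
have E2 := act_eq (oner_neq0 R) E.
by rewrite -{1}E2; split=> //; apply: (act_sphere (refl_LT m1)).
Qed.

(** [m] is the unit spacelike normal of the hyperbolic plane cut out by the sphere of inversion. The
    reflected vector is [X] of the inverted point times D / s^2, the reciprocal of the conformal
    factor of the inversion. *)
Lemma sphere_inv_rep n : 1 < dot n n ->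
  let s := Num.sqrt (dot n n - 1) in
  let m : vec R := (px n / s, py n / s, pz n / s, s^-1) in
  lf m m = 1 /\ represents (sphere_inv n) (refl m).
Proof.
move=> n1 s m.
have k0 : 0 < dot n n - 1 by rewrite subr_gt0.
have s0 : s != 0 by rewrite gt_eqF // sqrtr_gt0.
have s2 : s ^+ 2 = dot n n - 1 by rewrite sqr_sqrtr // ltW.
have m1 : lf m m = 1.
  have -> : lf m m = (dot n n - 1) / s ^+ 2.
    by rewrite dotE /lf /m /c1 /c2 /c3 /c4 /=; field.
  by rewrite s2 divff // gt_eqF.
split=> // x hx.
have x1 : px x * px x + py x * py x + pz x * pz x = 1 by rewrite -dotE.
set D := dot (x - n) (x - n).
have DE : D = (px x - px n) ^+ 2 + (py x - py n) ^+ 2 + (pz x - pz n) ^+ 2.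
  by rewrite /D dotE /px /py /pz !mxE; ring.
have D0 : 0 < D.
  have C := cauchy3 (px x) (py x) (pz x) (px n) (py n) (pz n).
  have n1' : 1 < px n ^+ 2 + py n ^+ 2 + pz n ^+ 2 by move: n1; rewrite dotE !expr2.
  have x1' : px x ^+ 2 + py x ^+ 2 + pz x ^+ 2 = 1 by rewrite -x1 !expr2.
  rewrite x1' mul1r in C.
  set q := px n ^+ 2 + _ + _ in n1' C.
  set p := _ + _ + _ in C.
  have -> : D = 1 + q - 2 * p.
    by move: x1'; rewrite DE /q /p !expr2; light_lra.
  have : (2 * p) ^+ 2 < (1 + q) ^+ 2.
    have -> : (2 * p) ^+ 2 = 4 * p ^+ 2 by ring.
    have : (1 - q) ^+ 2 > 0 by rewrite exprn_even_gt0 //= subr_eq0 lt_eqF.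
    rewrite !expr2; move: C; rewrite !expr2; nra.
  rewrite subr_gt0 => hh; case: (leP 0 (2 * p)) => hp.
    by rewrite -(ltr_pXn2r (n := 2)) ?nnegrE //; light_lra.
  by apply: (lt_trans hp); light_lra.
have E : refl m (X x) = sc (D / s ^+ 2) (X (sphere_inv n x)).
  have e : lf (X x) m = (s ^+ 2 - D) / (2 * s).
    apply: (mulfI s0); have -> : s * ((s ^+ 2 - D) / (2 * s)) = (s ^+ 2 - D) / 2 by field.
    have -> : s * lf (X x) m = px x * px n + py x * py n + pz x * pz n - 1.
      by rewrite /lf /X /m /c1 /c2 /c3 /c4 /=; field.
    by move: x1; rewrite s2 DE dotE; light_lra.
  rewrite /refl e.
  have cx i : (sphere_inv n x) ord0 i = n ord0 i + (s ^+ 2 / D) * (x ord0 i - n ord0 i) :> R.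
    by rewrite /sphere_inv !mxE s2.
  have D00 : D != 0 by rewrite gt_eqF.
  by apply: vext; rewrite /lc /sc /X /c1 /c2 /c3 /c4 /m /= /px /py /pz ?cx; field; rewrite ?s0 ?D00.
have k1 : D / s ^+ 2 != 0 by rewrite mulf_neq0 ?invr_eq0 ?gt_eqF // exprn_gt0 // sqrtr_gt0.
have E2 := act_eq k1 E.
by rewrite -{1}E2; split=> //; apply: (act_sphere (refl_LT m1)).
Qed.

Lemma hyp_isom_LT f : hyp_isom f -> exists M M', LT M M' /\ represents f M.
Proof.
elim=> {f} [|n f n1 _ [M [M' [H h]]]|n f n1 _ [M [M' [H h]]]].
- exists id, id; split; first exact: LT_id.
  by move=> x hx; split=> //; rewrite /act prjX.
- have [m1 h1] := plane_refl_rep n1.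
  by do 2 eexists; split; [exact: LT_comp (refl_LT m1) H | exact: represents_comp (refl_LT m1) H h1 h].
- have [m1 h1] := sphere_inv_rep n1.
  by do 2 eexists; split; [exact: LT_comp (refl_LT m1) H | exact: represents_comp (refl_LT m1) H h1 h].
Qed.

Lemma mobius_LT g : mobius g -> exists M M', LT M M' /\ represents g M.
Proof.
case=> f [/hyp_isom_LT [M [M' [H h]]] e]; exists M, M'; split=> // x hx.
have hx1 : dot x x = 1 by exact: hx.
by rewrite e hx1 lexx; apply: h.
Qed.

(** Reflection in the bisector of [u] and [v]; 0 < k says that their difference is spacelike. A
    vector with equal products against both is orthogonal to the difference, hence fixed. *)
Lemma refl_move u v (k : R) : lf u u = lf v v -> lf (lc 1 u (-1) v) (lc 1 u (-1) v) = k -> 0 < k ->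
  let n := sc (Num.sqrt k)^-1 (lc 1 u (-1) v) in
  [/\ lf n n = 1, refl n u = v & forall w, lf u w = lf v w -> refl n w = w].
Proof.
move=> huv hk k0; set s := Num.sqrt k; move=> n.
have s2 : s ^+ 2 = k by rewrite sqr_sqrtr // ltW.
have s0 : s != 0 by rewrite gt_eqF // sqrtr_gt0.
have hk' : k = 2 * (lf u u - lf u v).
  by rewrite -hk lf_lcl !lf_lcr (lfC v u) -huv; ring.
split.
- by rewrite /n lf_scl lf_scr hk -s2; field.
- have e : lf u n = s / 2.
    rewrite /n lf_scr lf_lcr.
    have -> : 1 * lf u u + -1 * lf u v = k / 2 by rewrite hk'; field.
    by rewrite -s2; field.
  by rewrite /refl e; apply: vext; rewrite /n /lc /sc /c1 /c2 /c3 /c4 /=; field.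
- move=> w hw.
  have e : lf w n = 0 by rewrite /n lf_scr lf_lcr !(lfC w) hw; ring.
  by rewrite /refl e; apply: vext; rewrite /lc /c1 /c2 /c3 /c4 /=; ring.
Qed.

Definition e1 : vec R := (1, 0, 0, 0).
Definition e2 : vec R := (0, 1, 0, 0).
Definition e3 : vec R := (0, 0, 1, 0).
Definition e4 : vec R := (0, 0, 0, 1).

Lemma plane_back m : c4 m = 0 -> lf m m = 1 ->
  exists r, (forall f, hyp_isom f -> hyp_isom (r \o f)) /\ represents r (refl m).
Proof.
move=> m4 m1; pose n := mkpt (c1 m) (c2 m) (c3 m).
have n1 : dot n n = 1 by rewrite dotE !px_mk !py_mk !pz_mk -m1 /lf m4; ring.
exists (plane_refl n); split; first by move=> f hf; apply: hi_refl.
have [_] := plane_refl_rep n1; rewrite px_mk py_mk pz_mk.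
by have -> : (c1 m, c2 m, c3 m, 0) = m by apply: vext => //; rewrite m4.
Qed.

Lemma sphere_back m : 0 < c4 m -> lf m m = 1 ->
  exists r, (forall f, hyp_isom f -> hyp_isom (r \o f)) /\ represents r (refl m).
Proof.
move=> m4 m1; pose n := mkpt (c1 m / c4 m) (c2 m / c4 m) (c3 m / c4 m).
have m40 : c4 m != 0 by rewrite gt_eqF.
have nn : dot n n - 1 = (c4 m)^-1 ^+ 2.
  rewrite dotE !px_mk !py_mk !pz_mk.
  apply: (mulIf (expf_neq0 2 m40)); rewrite -exprMn mulVf // expr1n -[RHS]m1 /lf.
  by field.
have n1 : 1 < dot n n by rewrite -subr_gt0 nn exprn_gt0 // invr_gt0.
exists (sphere_inv n); split; first by move=> f hf; apply: hi_inv.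
have [_] := sphere_inv_rep n1; rewrite nn sqrtr_sqr gtr0_norm ?invr_gt0 // px_mk py_mk pz_mk invrK.
by have -> : (c1 m / c4 m * c4 m, c2 m / c4 m * c4 m, c3 m / c4 m * c4 m, c4 m) = m
  by apply: vext; rewrite //= /c1 /c2 /c3 /= divfK.
Qed.

Lemma back m M M' r : LT M M' -> lf m m = 1 ->
  (forall f, hyp_isom f -> hyp_isom (r \o f)) -> represents r (refl m) ->
  (exists f, hyp_isom f /\ represents f (refl m \o M)) -> exists f, hyp_isom f /\ represents f M.
Proof.
move=> H m1 hr rr [f [hf rf]]; exists (r \o f); split; first exact: hr.
have R1 := refl_LT m1.
move=> x hx; have [s e] := represents_comp R1 (LT_comp R1 H) rr rf hx; split=> //.
by rewrite -e /act /= (LT_K R1).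
Qed.

(** As [e4] is fixed, [e] and [M e] both lie in its Euclidean complement. The bisector is then a
    plane through the origin of the ball, and the reflection fixes whatever [M] already fixes. *)
Lemma stage M M' e : LT M M' -> M e4 = e4 -> lf e e = 1 -> c4 e = 0 -> M e <> e ->
  exists m, [/\ lf m m = 1, c4 m = 0, refl m (M e) = e & forall w, M w = w -> refl m w = w].
Proof.
move=> H h4 he e40 ne.
have M1 : lf (M e) (M e) = lf e e by rewrite (LT_lf H).
have M4 : c4 (M e) = 0.
  have : lf (M e) (M e4) = lf e e4 by rewrite (LT_lf H).
  by rewrite h4 /lf /e4 /c1 /c2 /c3 /c4 /= -!/(c4 _) e40 => h; light_lra.
set d := lc 1 (M e) (-1) e.
have dE : lf d d = c1 d ^+ 2 + c2 d ^+ 2 + c3 d ^+ 2.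
  have : c4 d = 0 by rewrite /d /lc /c4 /= -!/(c4 _) M4 e40; ring.
  by rewrite /lf => ->; ring.
have dp : 0 < lf d d.
  rewrite lt_neqAle dE !addr_ge0 ?sqr_ge0 // andbT eq_sym.
  apply/negP; rewrite !paddr_eq0 ?addr_ge0 ?sqr_ge0 // !sqrf_eq0 => /andP[/andP[/eqP a /eqP b] /eqP c].
  apply: ne; apply: vext; move: a b c; rewrite /d /lc /c1 /c2 /c3 /c4 /= -!/(c1 _) -!/(c2 _) -!/(c3 _) -!/(c4 _) ?M4 ?e40 //; light_lra.
have [n1 nm nf] := refl_move M1 erefl dp.
eexists; split; [exact: n1| | exact: nm|].
  by rewrite /sc /lc /c4 /= -!/(c4 _) M4 e40; ring.
by move=> w hw; apply: nf; rewrite -{1}hw (LT_lf H).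
Qed.

Lemma basis_id M M' : LT M M' -> M e1 = e1 -> M e2 = e2 -> M e3 = e3 -> M e4 = e4 -> M =1 id.
Proof.
move=> H h1 h2 h3 h4 u.
have -> : u = lc 1 (lc (c1 u) e1 (c2 u) e2) 1 (lc (c3 u) e3 (c4 u) e4).
  by apply: vext; rewrite /lc /e1 /e2 /e3 /e4 /c1 /c2 /c3 /c4 /=; ring.
by rewrite !(LT_lin H) h1 h2 h3 h4.
Qed.

(** Cartan-Dieudonne by hand: one inversion brings [e4] back, then plane reflections bring back
    [e1], [e2], [e3] in turn, each keeping the vectors already restored. What remains is the
    identity on a basis. *)
Lemma LT_hyp_isom M M' : LT M M' -> exists f, hyp_isom f /\ represents f M.
Proof.
have P0 M0 M0' : LT M0 M0' -> M0 e1 = e1 -> M0 e2 = e2 -> M0 e3 = e3 -> M0 e4 = e4 ->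
    exists f, hyp_isom f /\ represents f M0.
  move=> H h1 h2 h3 h4; exists id; split; first exact: hi_id.
  by move=> x hx; split=> //; rewrite /act (basis_id H) // prjX.
have P1 M0 M0' : LT M0 M0' -> M0 e1 = e1 -> M0 e2 = e2 -> M0 e4 = e4 ->
    exists f, hyp_isom f /\ represents f M0.
  move=> H h1 h2 h4; have [h3|h3] := EM (M0 e3 = e3); first exact: P0 H h1 h2 h3 h4.
  have e31 : lf e3 e3 = 1 by rewrite /lf /e3 /c1 /c2 /c3 /c4 /=; ring.
  have [m [m1 m4 mm mf]] := stage H h4 e31 erefl h3.
  have [r [hr rr]] := plane_back m4 m1.
  apply: (back H m1 hr rr); apply: (P0 _ _ (LT_comp (refl_LT m1) H)) => //=.
  - by rewrite h1 mf.
  - by rewrite h2 mf.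
  - by rewrite h4 mf.
have P2 M0 M0' : LT M0 M0' -> M0 e1 = e1 -> M0 e4 = e4 ->
    exists f, hyp_isom f /\ represents f M0.
  move=> H h1 h4; have [h3|h3] := EM (M0 e2 = e2); first exact: P1 H h1 h3 h4.
  have e31 : lf e2 e2 = 1 by rewrite /lf /e2 /c1 /c2 /c3 /c4 /=; ring.
  have [m [m1 m4 mm mf]] := stage H h4 e31 erefl h3.
  have [r [hr rr]] := plane_back m4 m1.
  apply: (back H m1 hr rr); apply: (P1 _ _ (LT_comp (refl_LT m1) H)) => //=.
  - by rewrite h1 mf.
  - by rewrite h4 mf.
have P3 M0 M0' : LT M0 M0' -> M0 e4 = e4 ->
    exists f, hyp_isom f /\ represents f M0.
  move=> H h4; have [h3|h3] := EM (M0 e1 = e1); first exact: P2 H h3 h4.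
  have e31 : lf e1 e1 = 1 by rewrite /lf /e1 /c1 /c2 /c3 /c4 /=; ring.
  have [m [m1 m4 mm mf]] := stage H h4 e31 erefl h3.
  have [r [hr rr]] := plane_back m4 m1.
  apply: (back H m1 hr rr); apply: (P2 _ _ (LT_comp (refl_LT m1) H)) => //=.
  by rewrite h4 mf.
move=> H; have [h4|h4] := EM (M e4 = e4); first exact: P3 H h4.
have E4 : lf e4 e4 = -1 by rewrite /lf /e4 /c1 /c2 /c3 /c4 /=; ring.
have f4 : fut e4 by split; rewrite ?E4 ?oppr_le0 ?ler01 // /c4 /=; exact: ltr01.
have M1 : lf (M e4) (M e4) = lf e4 e4 by rewrite (LT_lf H).
have [_ t0] := LT_fut H f4.
have sq : c1 (M e4) ^+ 2 + c2 (M e4) ^+ 2 + c3 (M e4) ^+ 2 = c4 (M e4) ^+ 2 - 1.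
  by move: M1; rewrite E4 /lf !expr2; light_lra.
(* The only future vector of square -1 with time coordinate 1 is [e4]. The strict inequality makes
   the difference spacelike and gives its normal a positive time coordinate, so the reflection is a
   sphere inversion. *)
have t1 : 1 < c4 (M e4).
  have : 1 <= c4 (M e4) ^+ 2 by rewrite -subr_ge0 -sq !addr_ge0 ?sqr_ge0.
  rewrite le_eqVlt => /orP[/eqP e|]; last by rewrite -[X in X < _](expr1n _ 2) ltr_pXn2r ?nnegrE // ltW.
  have e' : c4 (M e4) = 1.
    by apply/eqP; rewrite -(eqrXn2 (n := 2)) // ?ltW // expr1n -e.
  have : c1 (M e4) ^+ 2 + c2 (M e4) ^+ 2 + c3 (M e4) ^+ 2 == 0 by rewrite sq -e subrr.
  rewrite !paddr_eq0 ?addr_ge0 ?sqr_ge0 // !sqrf_eq0 => /andP[/andP[/eqP a /eqP b] /eqP c].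
  by case: h4; apply: vext.
set d := lc 1 (M e4) (-1) e4.
have dE : lf d d = 2 * (c4 (M e4) - 1).
  rewrite lf_lcl !lf_lcr M1 E4 (lfC e4).
  have -> : lf (M e4) e4 = - c4 (M e4) by rewrite /lf /e4 /c1 /c2 /c3 /c4 /=; ring.
  ring.
have dp : 0 < lf d d by rewrite dE mulr_gt0 // subr_gt0.
have [n1 nm _] := refl_move M1 erefl dp.
set n := sc _ _ in n1 nm.
have n4 : 0 < c4 n.
  rewrite /n /sc /c4 /= -!/(c4 _) mulr_gt0 ?invr_gt0 ?sqrtr_gt0 //.
  by rewrite /lc /c4 /= -!/(c4 _); light_lra.
have [r [hr rr]] := sphere_back n4 n1.
apply: (back H n1 hr rr).
exact: (P3 _ _ (LT_comp (refl_LT n1) H)).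
Qed.

End Lorentz.

Local Notation edist := Defs.edist.

(** * Planar charts of Schottky sets *)

Section Plane.
Variable R : realType.
Implicit Types (u v w : vec R) (x y : pt R) (z : R * R) (k : R) (M : vec R -> vec R).

Definition n2 z : R := z.1 ^+ 2 + z.2 ^+ 2.
Definition d2 z z' : R := (z.1 - z'.1) ^+ 2 + (z.2 - z'.2) ^+ 2.
Definition pd z z' : R := Num.sqrt (d2 z z').

Lemma n2_ge0 z : 0 <= n2 z. Proof. by rewrite addr_ge0 ?sqr_ge0. Qed.
Lemma d2_ge0 z z' : 0 <= d2 z z'. Proof. by rewrite addr_ge0 ?sqr_ge0. Qed.
Lemma d2C z z' : d2 z z' = d2 z' z. Proof. rewrite /d2; ring. Qed.
Lemma pdC z z' : pd z z' = pd z' z. Proof. by rewrite /pd d2C. Qed.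
Lemma pd_ge0 z z' : 0 <= pd z z'. Proof. exact: sqrtr_ge0. Qed.
Lemma pd_sqr z z' : pd z z' ^+ 2 = d2 z z'. Proof. by rewrite sqr_sqrtr ?d2_ge0. Qed.
Lemma d2zz z : d2 z z = 0. Proof. rewrite /d2; ring. Qed.
Lemma pdzz z : pd z z = 0. Proof. by rewrite /pd d2zz sqrtr0. Qed.

Lemma d2_eq0 z z' : d2 z z' = 0 -> z = z'.
Proof.
move=> /eqP; rewrite paddr_eq0 ?sqr_ge0 // !sqrf_eq0 !subr_eq0 => /andP[/eqP a /eqP b].
by case: z a b => ? ?; case: z' => ? ? /= -> ->.
Qed.

Lemma ler_sqr_abs (a b : R) : 0 <= b -> a ^+ 2 <= b ^+ 2 -> a <= b.
Proof.
move=> b0 h; case: (leP a 0) => a0; first exact: le_trans a0 b0.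
by rewrite -(ler_pXn2r (n := 2)) // nnegrE ltW.
Qed.

Lemma ltr_sqr_abs (a b : R) : 0 <= b -> a ^+ 2 < b ^+ 2 -> a < b.
Proof.
move=> b0 h; case: (leP b a) => // ba; move: h; rewrite ltNge.
by rewrite ler_pXn2r ?ba // nnegrE (le_trans b0).
Qed.

Lemma minkowski3 (a1 a2 a3 b1 b2 b3 : R) :
  Num.sqrt ((a1 + b1) ^+ 2 + (a2 + b2) ^+ 2 + (a3 + b3) ^+ 2) <=
  Num.sqrt (a1 ^+ 2 + a2 ^+ 2 + a3 ^+ 2) + Num.sqrt (b1 ^+ 2 + b2 ^+ 2 + b3 ^+ 2).
Proof.
have C := cauchy3 a1 a2 a3 b1 b2 b3.
set A := a1 ^+ 2 + _ + _ in C *; set B := b1 ^+ 2 + _ + _ in C *.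
set P := _ + _ + _ in C.
have A0 : 0 <= A by rewrite !addr_ge0 ?sqr_ge0.
have B0 : 0 <= B by rewrite !addr_ge0 ?sqr_ge0.
have PP : P <= Num.sqrt A * Num.sqrt B.
  apply: ler_sqr_abs; first by rewrite mulr_ge0 ?sqrtr_ge0.
  by rewrite exprMn !sqr_sqrtr.
apply: ler_sqr_abs; first by rewrite addr_ge0 ?sqrtr_ge0.
rewrite sqr_sqrtr; last by rewrite !addr_ge0 ?sqr_ge0.
rewrite [X in _ <= X]sqrrD !sqr_sqrtr //.
have -> : (a1 + b1) ^+ 2 + (a2 + b2) ^+ 2 + (a3 + b3) ^+ 2 = A + P *+ 2 + B.
  rewrite /A /B /P; ring.
by rewrite lerD2r lerD2l lerMn2r PP orbT.
Qed.

Lemma pd_tri z z' z'' : pd z z'' <= pd z z' + pd z' z''.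
Proof.
have := minkowski3 (z.1 - z'.1) (z.2 - z'.2) 0 (z'.1 - z''.1) (z'.2 - z''.2) 0.
rewrite addr0 expr0n /= !addr0 /pd /d2.
rewrite (_ : z.1 - z'.1 + (z'.1 - z''.1) = z.1 - z''.1); last by ring.
by rewrite (_ : z.2 - z'.2 + (z'.2 - z''.2) = z.2 - z''.2); last by ring.
Qed.

Lemma edist_tri x y (t : pt R) : edist x t <= edist x y + edist y t.
Proof.
have := minkowski3 (px x - px y) (py x - py y) (pz x - pz y) (px y - px t) (py y - py t) (pz y - pz t).
have E (a b : pt R) : edist a b = Num.sqrt ((px a - px b) ^+ 2 + (py a - py b) ^+ 2 + (pz a - pz b) ^+ 2).
  by rewrite /Defs.edist /enorm dotE /px /py /pz !mxE !expr2.
rewrite !E.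
rewrite (_ : px x - px y + (px y - px t) = px x - px t); last by ring.
rewrite (_ : py x - py y + (py y - py t) = py x - py t); last by ring.
by rewrite (_ : pz x - pz y + (pz y - pz t) = pz x - pz t); last by ring.
Qed.

Lemma edist_ge0 x y : 0 <= edist x y. Proof. exact: sqrtr_ge0. Qed.

Lemma edist_sqr x y : edist x y ^+ 2 = (px x - px y) ^+ 2 + (py x - py y) ^+ 2 + (pz x - pz y) ^+ 2.
Proof.
have E : dot (x - y) (x - y) = (px x - px y) ^+ 2 + (py x - py y) ^+ 2 + (pz x - pz y) ^+ 2.
  by rewrite dotE /px /py /pz !mxE !expr2.
by rewrite /Defs.edist /enorm E sqr_sqrtr // !addr_ge0 ?sqr_ge0.
Qed.

Lemma edistC x y : edist x y = edist y x.
Proof.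
apply/eqP; rewrite -(eqrXn2 (n := 2)) ?edist_ge0 // !edist_sqr; apply/eqP; ring.
Qed.

Lemma edist_eq0 x y : edist x y = 0 -> x = y.
Proof.
move=> h; have := edist_sqr x y; rewrite h expr0n /= => /esym /eqP.
rewrite !paddr_eq0 ?addr_ge0 ?sqr_ge0 // !sqrf_eq0 !subr_eq0 => /andP[/andP[/eqP a /eqP b] /eqP c].
exact: pext.
Qed.

Lemma edist_xx x : edist x x = 0.
Proof. by apply/eqP; rewrite -sqrf_eq0 edist_sqr !subrr expr0n /= !addr0. Qed.

Lemma edist_gt0 x y : x <> y -> 0 < edist x y.
Proof.
by move=> h; rewrite lt_neqAle edist_ge0 andbT eq_sym; apply/eqP => /edist_eq0.
Qed.

Lemma edist_lf x y : sphere x -> sphere y -> edist x y ^+ 2 = - 2 * lf (X x) (X y).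
Proof.
rewrite /sphere /= => hx hy; rewrite edist_sqr lfXX !dotE in hx hy *.
by move: hx hy; rewrite !expr2; lra.
Qed.

Lemma edist_le2 x y : sphere x -> sphere y -> edist x y <= 2.
Proof.
move=> hx hy; apply: ler_sqr_abs => //.
have := cauchy3 (px x) (py x) (pz x) (px y) (py y) (pz y).
move: hx hy; rewrite /sphere /= edist_sqr !dotE -!expr2 => hx hy; rewrite hx hy.
move: hx hy; set P := (X in X ^+ 2 <= _) => hx hy hP.
have : - P <= 1 by apply: ler_sqr_abs => //; rewrite sqrrN expr1n (le_trans hP) // mulr1.
by move: hx hy; rewrite /P !expr2; lra.
Qed.

(** Stereographic coordinates in Lorentz space: [vz z] is the light-like vector over the planar
    point [z], scaled to [uc] = 1. The vector [nu] below stands for the point at infinity, and [uc]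
    is minus the product with it. *)
Definition vz z : vec R := (z.1, z.2, (n2 z - 1) / 2, (n2 z + 1) / 2).
Definition uc u : R := c4 u - c3 u.
Definition pl u : R * R := (c1 u / uc u, c2 u / uc u).
Definition nu : vec R := (0, 0, 1, 1).

Lemma lf_vz z z' : lf (vz z) (vz z') = - (d2 z z' / 2).
Proof. by rewrite /lf /vz /c1 /c2 /c3 /c4 /= /d2 /n2; field. Qed.

Lemma fut_vz z : fut (vz z).
Proof.
split; first by rewrite lf_vz d2zz mul0r oppr0.
by rewrite /vz /c4 /= divr_gt0 // ltr_wpDl ?n2_ge0.
Qed.

Lemma fut_nu : fut nu.
Proof. by split; rewrite /lf /nu /c1 /c2 /c3 /c4 /= ?ltr01 //; lra. Qed.

Lemma lf_nu u : lf nu u = - uc u.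
Proof. rewrite /lf /nu /uc /c1 /c2 /c3 /c4 /=; ring. Qed.

Lemma uc_vz z : uc (vz z) = 1.
Proof. by rewrite /uc /vz /c3 /c4 /=; field. Qed.

Lemma pl_vz z : pl (vz z) = z.
Proof. by rewrite /pl uc_vz /vz /c1 /c2 /= !divr1; case: z. Qed.

Lemma uc_sc k u : uc (sc k u) = k * uc u.
Proof. rewrite /uc /sc /c3 /c4 /=; ring. Qed.

Lemma pl_sc k u : k != 0 -> pl (sc k u) = pl u.
Proof. by move=> k0; rewrite /pl uc_sc /sc /c1 /c2 /= -!mulf_div divff // !mul1r. Qed.

Lemma plK u : lf u u = 0 -> uc u != 0 -> sc (uc u) (vz (pl u)) = u.
Proof.
move=> h u0.
have E : n2 (pl u) = (c4 u + c3 u) / uc u.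
  rewrite /n2 /pl /=.
  have -> : (c1 u / uc u) ^+ 2 + (c2 u / uc u) ^+ 2 = (c1 u ^+ 2 + c2 u ^+ 2) / uc u ^+ 2 by field.
  have -> : c1 u ^+ 2 + c2 u ^+ 2 = uc u * (c4 u + c3 u).
    by move: h; rewrite /lf /uc !expr2; lra.
  by field.
apply: vext; rewrite /sc /vz /c1 /c2 /c3 /c4 /= ?E -!/(c1 _) -!/(c2 _) -!/(c3 _) -!/(c4 _).
- by field.
- by field.
- by move: u0; rewrite /uc => u0; field.
- by move: u0; rewrite /uc => u0; field.
Qed.

(** Stereographic projection after the change of frame [M]; [ich] is its inverse. The pole of the
    chart is the point where [uc] vanishes. *)
Definition ch M x : R * R := pl (M (X x)).
Definition ich M' z : pt R := prj (M' (vz z)).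

Lemma lf_vz0 z : lf (vz z) (vz z) = 0.
Proof. by rewrite lf_vz d2zz mul0r oppr0. Qed.

Lemma transfer M M' a : LT M M' -> fut a -> lf a a = 0 -> exists2 k : R, 0 < k &
  sphere (prj (M' a)) /\ forall n, lf (X (prj (M' a))) n = k * lf a (M n).
Proof.
move=> H fa a0; have [_ h4] := LT_fut' H fa.
have h40 : c4 (M' a) != 0 by rewrite gt_eqF.
exists (c4 (M' a))^-1; first by rewrite invr_gt0.
split; first by apply: prj_sphere => //; rewrite (LT_lf (LT_sym H)).
move=> n; apply: (mulfI h40); rewrite mulrA divff // mul1r -lf_scl prjK //.
by rewrite (LT_adj _ _ (LT_sym H)).
Qed.

Lemma ich_sphere M M' z : LT M M' -> sphere (ich M' z).
Proof.
by move=> H; have [k _ [h _]] := transfer H (fut_vz z) (lf_vz0 z).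
Qed.

Lemma ich_lf M M' z : LT M M' -> exists2 k : R, 0 < k & forall n, lf (X (ich M' z)) n = k * lf (vz z) (M n).
Proof.
by move=> H; have [k k0 [h h']] := transfer H (fut_vz z) (lf_vz0 z); exists k.
Qed.

Lemma chK M M' x : LT M M' -> sphere x -> uc (M (X x)) != 0 -> ich M' (ch M x) = x.
Proof.
move=> H hx u0; rewrite /ich /ch -(prj_sc _ u0) -(LT_sc _ _ (LT_sym H)) plK //.
  by rewrite (LT_K H) prjX.
by rewrite (LT_lf H) lfXX0.
Qed.

Lemma ichK M M' z : LT M M' -> ch M (ich M' z) = z.
Proof.
move=> H; have [_ h4] := LT_fut' H (fut_vz z).
have h40 : c4 (M' (vz z)) != 0 by rewrite gt_eqF.
have E : sc (c4 (M' (vz z))) (M (X (ich M' z))) = vz z.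
  by rewrite -(LT_sc _ _ H) prjK // (LT_K' H).
by rewrite /ch -(pl_sc _ h40) E pl_vz.
Qed.

(** Both sides are -2 times the same Lorentz product, so [uc] acts as the conformal factor of the
    chart. *)
Lemma d2_ch M M' x y : LT M M' -> sphere x -> sphere y ->
  uc (M (X x)) != 0 -> uc (M (X y)) != 0 ->
  d2 (ch M x) (ch M y) * (uc (M (X x)) * uc (M (X y))) = edist x y ^+ 2.
Proof.
move=> H hx hy ux uy; rewrite edist_lf // -(LT_lf H).
have EX : sc (uc (M (X x))) (vz (pl (M (X x)))) = M (X x) by rewrite plK // (LT_lf H) lfXX0.
have EY : sc (uc (M (X y))) (vz (pl (M (X y)))) = M (X y) by rewrite plK // (LT_lf H) lfXX0.
rewrite -[in RHS]EX -[in RHS]EY.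
by rewrite lf_scl lf_scr lf_vz /ch; field.
Qed.

(** By [lf_disc] these are the radius and centre of the disc of the unit vector [n] in the chart. A
    negative radius means that the disc is the exterior of a circle. *)
Definition rad M n : R := (uc (M n))^-1.
Definition cen M n : R * R := pl (M n).

Lemma lf_disc m z : lf m m = 1 -> uc m != 0 ->
  lf (vz z) m = ((uc m)^-1 ^+ 2 - d2 z (pl m)) / (2 * (uc m)^-1).
Proof.
move=> m1 u0.
apply: (mulIf u0); rewrite (_ : _ / _ * uc m = (1 - uc m ^+ 2 * d2 z (pl m)) / 2); last by field.
have -> : uc m ^+ 2 * d2 z (pl m) = (uc m * z.1 - c1 m) ^+ 2 + (uc m * z.2 - c2 m) ^+ 2.
  by rewrite /d2 /pl /=; field.
by move: m1; rewrite /lf /vz /uc /n2 /c1 /c2 /c3 /c4 /=; lra.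
Qed.

(** The discs become the set [N] of their unit normals: the open disc of [n] is 0 < lf (X x) n, the
    closed disc is 0 <= lf (X x) n, and no index type remains. *)
Record SD (S : set (pt R)) (N : set (vec R)) : Prop := mkSD {
  sd_unit : forall n, N n -> lf n n = 1;
  sd_disj : forall n m x, N n -> N m -> n <> m -> sphere x ->
              0 <= lf (X x) n -> 0 <= lf (X x) m -> False;
  sd_S : forall x, S x <-> sphere x /\ forall n, N n -> lf (X x) n <= 0;
  sd_two : forall n, N n -> exists2 m, N m & m <> n;
  sd_ne : exists n, N n;
  sd_compact : compact S }.

(** (c, h) has Lorentz square 1 - h^2, whence the normalising factor. *)
Definition nvec (c : pt R) (h : R) : vec R :=
  sc (Num.sqrt (1 - h ^+ 2))^-1 (px c, py c, pz c, h).

Lemma lf_nvec x c h : lf (X x) (nvec c h) = (Num.sqrt (1 - h ^+ 2))^-1 * (dot x c - h).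
Proof. by rewrite /nvec lf_scr dotE /lf /X /c1 /c2 /c3 /c4 /= mul1r. Qed.

Lemma schottky_SD S : schottky_set S -> exists N, SD S N.
Proof.
case=> cS [Ssph [I [c [h [hc [[i [j [k [ij jk ik]]]] [disj cov]]]]]]].
have sp a : 0 < Num.sqrt (1 - h a ^+ 2).
  have [_ /andP[h1 h2]] := hc a; rewrite sqrtr_gt0 subr_gt0.
  by rewrite -[X in _ < X](expr1n _ 2); nra.
have lfn a x : 0 <= lf (X x) (nvec (c a) (h a)) <-> h a <= dot x (c a).
  by rewrite lf_nvec pmulr_rge0 ?invr_gt0 // subr_ge0.
have lfn' a x : 0 < lf (X x) (nvec (c a) (h a)) <-> h a < dot x (c a).
  by rewrite lf_nvec pmulr_rgt0 ?invr_gt0 // subr_gt0.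
have D a b x : sphere x -> 0 <= lf (X x) (nvec (c a) (h a)) ->
    0 <= lf (X x) (nvec (c b) (h b)) -> a = b.
  move=> hx /lfn ha /lfn hb; apply: contrapT => ab.
  have : (closed_cap (c a) (h a) `&` closed_cap (c b) (h b)) x by [].
  by rewrite disj.
have inj a b : nvec (c a) (h a) = nvec (c b) (h b) -> a = b.
  move=> e; have [ca /andP[/ltW h1 /ltW h2]] := hc a.
  have sc' : sphere (c a) by rewrite /sphere /= ca.
  have h0 : 0 <= lf (X (c a)) (nvec (c a) (h a)) by apply/lfn; rewrite ca.
  by apply: (D a b (c a)) => //; rewrite -e.
exists [set n | exists a, n = nvec (c a) (h a)]; split=> //.
- move=> _ [a ->]; have [ca _] := hc a.
  have -> : lf (nvec (c a) (h a)) (nvec (c a) (h a)) =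
      (Num.sqrt (1 - h a ^+ 2))^-1 ^+ 2 * (dot (c a) (c a) - h a ^+ 2).
    by rewrite /nvec lf_scr lf_scl dotE /lf /c1 /c2 /c3 /c4 /=; ring.
  rewrite ca -{2}(sqr_sqrtr (a := 1 - h a ^+ 2)).
    by rewrite -exprMn mulVf ?expr1n // gt_eqF.
  by rewrite ltW // -sqrtr_gt0.
- by move=> _ _ x [a ->] [b ->] ab hx ha hb; apply: ab; rewrite (D _ _ _ hx ha hb).
- move=> x; split.
    move=> Sx; split; first exact: Ssph.
    move=> _ [a ->]; rewrite leNgt; apply/negP => /lfn' ha.
    have : (\bigcup_i open_cap (c i) (h i)) x by exists a => //; split=> //; exact: Ssph.
    by rewrite -cov => -[].
  case=> hx hn; apply: contrapT => nS.
  have : (sphere (R:=R) `\` S) x by [].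
  rewrite cov => -[a _ [_ /lfn' ha]]; have := hn _ (ex_intro _ a erefl).
  by rewrite leNgt ha.
- move=> _ [a ->]; have [ai|ai] := EM (a = i).
    by exists (nvec (c j) (h j)); [exists j | move/inj => ja; apply: ij; rewrite -ai ja].
  by exists (nvec (c i) (h i)); [exists i | move/inj => ia; apply: ai].
- by exists (nvec (c i) (h i)); exists i.
Qed.

(** A state: a frame in which the disc [o] has normal [e3], so that in the chart it is the exterior
    of the unit circle. Then S lies in the closed unit disc and all other discs are bounded round
    discs inside it. *)
Record st (N : set (vec R)) M M' o : Prop := mkst {
  st_LT : LT M M'; st_o : N o; st_e : M o = e3 R }.

Section State.
Variables (S : set (pt R)) (N : set (vec R)) (M M' : vec R -> vec R) (o : vec R).
Hypotheses (sd : SD S N) (H : st N M M' o).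
Let L := st_LT H.

Lemma lf_e3 u : lf u (e3 R) = c3 u.
Proof. by rewrite /lf /e3 /c1 /c2 /c3 /c4 /=; ring. Qed.

Lemma lf_vz_e3 z : lf (vz z) (e3 R) = (n2 z - 1) / 2.
Proof. by rewrite lf_e3. Qed.

(** The point at infinity of the chart lies in the disc [o], hence outside the closed disc [n], and
    [uc] measures exactly this product. *)
Lemma st_uc n : N n -> n <> o -> 0 < uc (M n).
Proof.
move=> Nn no.
have [|k k0 [hs hk]] := transfer L fut_nu.
  by rewrite lf_nu /uc /nu /c3 /c4 /= subrr oppr0.
rewrite ltNge; apply/negP => h.
apply: (sd_disj sd Nn (st_o H) no hs); rewrite hk.
  by rewrite lf_nu mulr_ge0 ?oppr_ge0 // ltW.
rewrite (st_e H) lf_e3 /nu /c3 /= mulr1; exact: ltW.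
Qed.

Lemma st_rad n : N n -> n <> o -> 0 < rad M n.
Proof. by move=> Nn no; rewrite invr_gt0 st_uc. Qed.

Lemma st_lf n z : N n -> n <> o -> lf (vz z) (M n) = (rad M n ^+ 2 - d2 z (cen M n)) / (2 * rad M n).
Proof.
move=> Nn no; rewrite lf_disc ?(LT_lf L) ?(sd_unit sd) //.
by rewrite gt_eqF // st_uc.
Qed.

Lemma st_closed n z : N n -> n <> o -> 0 <= lf (X (ich M' z)) n <-> d2 z (cen M n) <= rad M n ^+ 2.
Proof.
move=> Nn no; have [k k0 ->] := ich_lf z L; have r0 := st_rad Nn no.
by rewrite pmulr_rge0 // st_lf // pmulr_lge0 ?subr_ge0 // invr_gt0 mulr_gt0.
Qed.

Lemma st_open n z : N n -> n <> o -> lf (X (ich M' z)) n <= 0 <-> rad M n ^+ 2 <= d2 z (cen M n).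
Proof.
move=> Nn no; have [k k0 ->] := ich_lf z L; have r0 := st_rad Nn no.
by rewrite pmulr_rle0 // st_lf // pmulr_lle0 ?subr_le0 // invr_gt0 mulr_gt0.
Qed.

Lemma st_ext z : lf (X (ich M' z)) o <= 0 <-> n2 z <= 1.
Proof.
have [k k0 ->] := ich_lf z L.
by rewrite pmulr_rle0 // (st_e H) lf_vz_e3 pmulr_lle0 ?subr_le0 // invr_gt0.
Qed.

Lemma st_ext' z : 0 <= lf (X (ich M' z)) o <-> 1 <= n2 z.
Proof.
have [k k0 ->] := ich_lf z L.
by rewrite pmulr_rge0 // (st_e H) lf_vz_e3 pmulr_lge0 ?subr_ge0 // invr_gt0.
Qed.

Lemma st_disj n m z : N n -> N m -> n <> o -> m <> o -> n <> m ->
  d2 z (cen M n) <= rad M n ^+ 2 -> d2 z (cen M m) <= rad M m ^+ 2 -> False.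
Proof.
move=> Nn Nm no mo nm /st_closed h1 /st_closed h2.
exact: (sd_disj sd Nn Nm nm (ich_sphere z L) (h1 Nn no) (h2 Nm mo)).
Qed.

Lemma st_in n z : N n -> n <> o -> d2 z (cen M n) <= rad M n ^+ 2 -> n2 z < 1.
Proof.
move=> Nn no /st_closed h1; rewrite ltNge; apply/negP => /st_ext' h2.
exact: (sd_disj sd Nn (st_o H) no (ich_sphere z L) (h1 Nn no) h2).
Qed.

Lemma st_S z : S (ich M' z) <-> n2 z <= 1 /\ forall n, N n -> n <> o -> rad M n ^+ 2 <= d2 z (cen M n).
Proof.
rewrite (sd_S sd); split.
  move=> [_ h]; split; first by apply/st_ext; apply: h; exact: st_o H.
  by move=> n Nn no; apply/st_open => //; apply: h.
move=> [h1 h2]; split; first exact: ich_sphere L.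
move=> n Nn; have [->|no] := EM (n = o); first exact/st_ext.
by apply/st_open => //; apply: h2.
Qed.

Lemma st_ucS x : S x -> 0 < uc (M (X x)).
Proof.
move=> /(sd_S sd) [hx h]; have := h _ (st_o H).
rewrite -(LT_lf L) (st_e H) lf_e3 => h3.
by rewrite /uc subr_gt0 (le_lt_trans h3) // (LT_c4 L).
Qed.

Lemma st_chK x : S x -> ich M' (ch M x) = x.
Proof.
move=> Sx; apply: (chK L); first by have [] := (sd_S sd x).1 Sx.
by rewrite gt_eqF // st_ucS.
Qed.

Lemma st_chS x : S x -> n2 (ch M x) <= 1 /\
  forall n, N n -> n <> o -> rad M n ^+ 2 <= d2 (ch M x) (cen M n).
Proof. by move=> Sx; apply/st_S; rewrite st_chK. Qed.

(** A boundary point of one disc lies in its closed disc, hence in no other closed disc. *)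
Lemma sd_circle n x : N n -> sphere x -> lf (X x) n = 0 -> S x.
Proof.
move=> Nn hx h; apply/(sd_S sd); split=> // m Nm.
have [->|mn] := EM (m = n); first by rewrite h.
rewrite leNgt; apply/negP => hm.
by apply: (sd_disj sd Nm Nn mn hx); rewrite ?h // ltW.
Qed.

Lemma st_circle n x : S x -> N n -> n <> o ->
  lf (X x) n = 0 <-> d2 (ch M x) (cen M n) = rad M n ^+ 2.
Proof.
move=> Sx Nn no; have [k k0] := ich_lf (ch M x) L; rewrite st_chK // => ->.
have r0 := st_rad Nn no; rewrite st_lf //; split.
  move=> /eqP; rewrite !mulf_eq0 invr_eq0 mulf_eq0 (gt_eqF k0) (gt_eqF r0) pnatr_eq0 /= !orbF.
  by rewrite subr_eq0 => /eqP.
by move=> ->; rewrite subrr mul0r mulr0.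
Qed.

Lemma st_circle_o x : S x -> lf (X x) o = 0 <-> n2 (ch M x) = 1.
Proof.
move=> Sx; have [k k0] := ich_lf (ch M x) L; rewrite st_chK // => ->.
rewrite (st_e H) lf_vz_e3; split.
  by move=> /eqP; rewrite !mulf_eq0 invr_eq0 pnatr_eq0 (gt_eqF k0) /= orbF subr_eq0 => /eqP.
by move=> ->; rewrite subrr mul0r mulr0.
Qed.

(* On S the chart is bi-Lipschitz: S stays away from the pole, which lies in the disc o. *)
Lemma st_bilip : exists2 C : R, 1 <= C & forall x y, S x -> S y ->
  pd (ch M x) (ch M y) <= C * edist x y /\ edist x y <= C * pd (ch M x) (ch M y).
Proof.
pose p := M' (e4 R).
have E4 : lf (e4 R) (e4 R) = -1 by rewrite /lf /e4 /c1 /c2 /c3 /c4 /=; ring.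
have [fp p0] : fut p.
  apply: (LT_fut' L); split; first by rewrite E4 oppr_le0 ler01.
  by rewrite /e4 /c4 /=; exact: ltr01.
have pp : c1 p ^+ 2 + c2 p ^+ 2 + c3 p ^+ 2 = c4 p ^+ 2 - 1.
  have : lf p p = -1 by rewrite (LT_lf (LT_sym L)) E4.
  by rewrite /lf !expr2; lra.
pose q : R := Num.sqrt (c4 p ^+ 2 - 1).
have q2 : q ^+ 2 = c4 p ^+ 2 - 1 by rewrite sqr_sqrtr // -pp !addr_ge0 ?sqr_ge0.
have q0 : 0 <= q by exact: sqrtr_ge0.
have qp : q < c4 p by apply: ltr_sqr_abs; rewrite ?ltW // q2; lra.
(* The time coordinate of M (X x) is c4 p minus an inner product of size at most [q]. On S the
   coordinate c3 is nonpositive and at most c4 in size, so [uc] lies between c4 and 2 c4. *)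
have B x : S x -> c4 p - q <= uc (M (X x)) <= 4 * c4 p.
  move=> Sx; have [hx hn] := (sd_S sd x).1 Sx.
  have c30 : c3 (M (X x)) <= 0 by rewrite -lf_e3 -(st_e H) (LT_lf L); apply: hn; exact: st_o H.
  have c4E : c4 (M (X x)) = c4 p - (px x * c1 p + py x * c2 p + pz x * c3 p).
    have -> : c4 (M (X x)) = - lf (M (X x)) (e4 R) by rewrite /lf /e4 /c1 /c2 /c3 /c4 /=; ring.
    rewrite (LT_adj _ _ L) -/p /lf /X /c1 /c2 /c3 /c4 /=; ring.
  have := cauchy3 (px x) (py x) (pz x) (c1 p) (c2 p) (c3 p).
  have x1 : px x ^+ 2 + py x ^+ 2 + pz x ^+ 2 = 1 by move: hx; rewrite /sphere /= dotE !expr2.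
  rewrite x1 pp mul1r -q2; set P := px x * _ + _ + _ in c4E * => hP.
  have P1 : P <= q by apply: ler_sqr_abs.
  have P2 : - P <= q by apply: ler_sqr_abs; rewrite ?sqrrN.
  have : lf (M (X x)) (M (X x)) = 0 by rewrite (LT_lf L) lfXX0.
  have t0 := LT_c4 L hx; rewrite /uc.
  set s := c3 _ in c30 *; set t := c4 (M _) in c4E t0 *.
  rewrite /lf -/s -/t => h.
  have st2 : - s <= t.
    apply: ler_sqr_abs; first exact: ltW.
    have := sqr_ge0 (c1 (M (X x))); have := sqr_ge0 (c2 (M (X x))).
    by move: h; rewrite sqrrN !expr2; lra.
  by apply/andP; split; lra.
pose a := c4 p - q; pose b := 4 * c4 p.
have a0 : 0 < a by rewrite subr_gt0.
have b0 : 0 < b by rewrite mulr_gt0.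
have ai : 0 < a^-1 by rewrite invr_gt0.
exists (1 + a^-1 + b); first by lra.
move=> x y Sx Sy.
have [hx _] := (sd_S sd x).1 Sx; have [hy _] := (sd_S sd y).1 Sy.
have ux := st_ucS Sx; have uy := st_ucS Sy.
have := d2_ch L hx hy (lt0r_neq0 ux) (lt0r_neq0 uy).
have /andP[ax bx] := B _ Sx; have /andP[ay by'] := B _ Sy.
rewrite -pd_sqr; set D := pd _ _; set ex := edist x y => E.
have D0 : 0 <= D by exact: pd_ge0.
have e0 : 0 <= ex by exact: edist_ge0.
have aD : a * D <= ex.
  apply: ler_sqr_abs => //; rewrite -E exprMn mulrC; apply: ler_wpM2l; first exact: sqr_ge0.
  by rewrite expr2 ler_pM // ltW.
have eD : ex <= b * D.
  apply: ler_sqr_abs; first by rewrite mulr_ge0 // ltW.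
  rewrite -E exprMn mulrC; apply: ler_wpM2r; first exact: sqr_ge0.
  by rewrite expr2 ler_pM // ltW.
split.
  have : D <= a^-1 * ex by rewrite ler_pdivlMl.
  have : 0 <= (1 + b) * ex by rewrite mulr_ge0 // addr_ge0 // ltW.
  by lra.
have : 0 <= (1 + a^-1) * D by rewrite mulr_ge0 // addr_ge0 // ltW.
by lra.
Qed.

End State.

End Plane.

(** * Existence of states, charts adapted to a smaller disc, symmetries of S *)

Section States.
Variable R : realType.
Implicit Types (u v w : vec R) (x y : pt R) (z : R * R) (r : R) (M : vec R -> vec R).

(** A reflection takes [o] to [e3] when their difference is spacelike, that is when c3 o < 1.
    Otherwise [o] is sent to minus [e3] and the reflection in [e3] follows. *)
Lemma st_exists (N : set (vec R)) o : N o -> lf o o = 1 -> exists M M', st N M M' o.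
Proof.
move=> No o1.
have E31 : lf (e3 R) (e3 R) = 1 by rewrite lf_e3.
have [h|h] := ltP (c3 o) 1.
  have hk : lf (lc 1 o (-1) (e3 R)) (lc 1 o (-1) (e3 R)) = 2 * (1 - c3 o).
    by rewrite lf_lcl !lf_lcr (lfC (e3 R) o) o1 E31 lf_e3; ring.
  have k0 : 0 < 2 * (1 - c3 o) by rewrite mulr_gt0 // subr_gt0.
  have [n1 nm _] := refl_move (etrans o1 (esym E31)) hk k0.
  by do 2 eexists; split; [exact: refl_LT n1 | | exact: nm].
pose e := sc (-1) (e3 R).
have Ee : lf e e = 1 by rewrite lf_scl lf_scr E31; ring.
have hk : lf (lc 1 o (-1) e) (lc 1 o (-1) e) = 2 * (1 + c3 o).
  by rewrite lf_lcl !lf_lcr (lfC e o) o1 Ee lf_scr lf_e3; ring.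
have k0 : 0 < 2 * (1 + c3 o) by rewrite mulr_gt0 //; lra.
have [n1 nm _] := refl_move (etrans o1 (esym Ee)) hk k0.
do 2 eexists; split; [exact: LT_comp (refl_LT E31) (refl_LT n1) | by [] |].
rewrite /= nm /refl /e lf_scl E31.
by apply: vext; rewrite /lc /sc /e3 /c1 /c2 /c3 /c4 /=; ring.
Qed.

(* The similarity z |-> (z - c) / r followed by the inversion in the unit circle. *)
Definition RR (c : R * R) r u : vec R :=
  let b := c4 u - c3 u in let w := c4 u + c3 u in
  let b' := (w - 2 * (c1 u * c.1 + c2 u * c.2) + b * n2 c) / r in let w' := r * b in
  (c1 u - b * c.1, c2 u - b * c.2, (w' - b') / 2, (w' + b') / 2).

Definition RR' (c : R * R) r u : vec R :=
  let b := (c4 u + c3 u) / r in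
  let a1 := c1 u + b * c.1 in let a2 := c2 u + b * c.2 in
  let w := r * (c4 u - c3 u) + 2 * (a1 * c.1 + a2 * c.2) - b * n2 c in
  (a1, a2, (w - b) / 2, (w + b) / 2).

Lemma fut_half u : lf u u <= 0 -> 0 <= c4 u -> 0 <= c4 u - c3 u /\ 0 <= c4 u + c3 u.
Proof.
move=> h h4; have : c3 u ^+ 2 <= c4 u ^+ 2.
  by move: (sqr_ge0 (c1 u)) (sqr_ge0 (c2 u)) h; rewrite /lf !expr2; lra.
move=> h2; have a := ler_sqr_abs h4 h2.
have b : - c3 u <= c4 u by apply: ler_sqr_abs; rewrite ?sqrrN.
by split; lra.
Qed.

Lemma RR_lf c r u v : 0 < r -> lf (RR c r u) (RR c r v) = lf u v.
Proof.
move=> r0; rewrite /lf /RR /n2 /c1 /c2 /c3 /c4 /=; field.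
by rewrite gt_eqF.
Qed.

Lemma fut0 u : lf u u <= 0 -> c4 u = 0 -> forall v, lf u v = 0.
Proof.
rewrite /lf => h h4 v; rewrite h4.
have : c1 u ^+ 2 + c2 u ^+ 2 + c3 u ^+ 2 == 0.
  rewrite eq_le !addr_ge0 ?sqr_ge0 // andbT.
  by move: h; rewrite h4 !expr2; lra.
rewrite !paddr_eq0 ?addr_ge0 ?sqr_ge0 // !sqrf_eq0 => /andP[/andP[/eqP -> /eqP ->] /eqP ->].
ring.
Qed.

(** The inverse preserves the future for free: if M' u pointed to the past, then M would send its
    negative, a future vector, to -u. *)
Lemma LT_intro M M' : (forall a u b v, M (lc a u b v) = lc a (M u) b (M v)) ->
  cancel M M' -> cancel M' M -> (forall u v, lf (M u) (M v) = lf u v) ->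
  (forall u, fut u -> fut (M u)) -> LT M M'.
Proof.
move=> l k k' f F; split=> //.
  by move=> a u b v; rewrite -{1}(k' u) -{1}(k' v) -l k.
move=> u [h h4]; have h' : lf (M' u) (M' u) <= 0 by rewrite -f !k'.
split=> //; rewrite ltNge le_eqVlt; apply/negP => /orP[/eqP e|e].
  have := fut0 h' e (M' (e4 R)); rewrite -f !k' /lf /e4 /c1 /c2 /c3 /c4 /= -!/(c4 _).
  by rewrite !mulr0 mulr1 !add0r => /eqP; rewrite oppr_eq0 gt_eqF.
have fm : fut (sc (-1) (M' u)).
  split; first by rewrite lf_scl lf_scr mulrA mulrNN !mul1r.
  by rewrite /sc /c4 /= -!/(c4 _) mulN1r oppr_gt0.
have [_] := F _ fm.
by rewrite sc_lc l k' /lc /c4 /= -!/(c4 _) mul0r addr0 mulN1r oppr_gt0 ltNge ltW.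
Qed.

Lemma RR_LT c r : 0 < r -> LT (RR c r) (RR' c r).
Proof.
move=> r0; have r00 : r != 0 by rewrite gt_eqF.
apply: LT_intro.
- by move=> *; apply: vext; rewrite /RR /lc /n2 /c1 /c2 /c3 /c4 /=; field.
- by move=> u; apply: vext; rewrite /RR /RR' /n2 /c1 /c2 /c3 /c4 /=; field.
- by move=> u; apply: vext; rewrite /RR /RR' /n2 /c1 /c2 /c3 /c4 /=; field.
- by move=> *; apply: RR_lf.
move=> u [h h4]; split; first by rewrite RR_lf.
have [b0 w0] := fut_half h (ltW h4).
rewrite /RR /= {1}/c4 /=; set b := c4 u - c3 u in b0 *; set w := c4 u + c3 u in w0 *.
have bw : 0 < b + w by rewrite /b /w; lra.
have hh : c1 u ^+ 2 + c2 u ^+ 2 <= b * w by move: h; rewrite /lf /b /w !expr2; lra.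
rewrite divr_gt0 //; move: b0; rewrite le_eqVlt => /orP[/eqP e|b1].
  have : c1 u ^+ 2 + c2 u ^+ 2 == 0.
    by rewrite eq_le addr_ge0 ?sqr_ge0 // andbT (le_trans hh) // -e mul0r.
  rewrite paddr_eq0 ?sqr_ge0 // !sqrf_eq0 => /andP[/eqP -> /eqP ->].
  rewrite -e !mul0r !mulr0 !addr0 add0r mulr0 subr0 divr_gt0 //.
  by rewrite -e add0r in bw.
rewrite ltr_pwDl ?mulr_gt0 // mulr_ge0 ?invr_ge0 ?(ltW r0) //.
rewrite -(pmulr_rge0 _ b1).
(* In the null coordinates b = c4 - c3 and w = c4 + c3 causality reads c1^2 + c2^2 <= b w;
   completing the square then shows the new null coordinate to be nonnegative. *)
have -> : b * (w - 2 * (c1 u * c.1 + c2 u * c.2) + b * n2 c) =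
  (b * w - (c1 u ^+ 2 + c2 u ^+ 2)) + (c1 u - b * c.1) ^+ 2 + (c2 u - b * c.2) ^+ 2.
  rewrite /n2; ring.
by rewrite addr_ge0 ?sqr_ge0 // addr_ge0 ?sqr_ge0 // subr_ge0.
Qed.

(** The inversion fixes its circle pointwise, so there only the similarity is visible. This is why
    the jumps seen from a smaller disc are rescaled jumps. *)
Lemma RR_vz c r z : 0 < r -> d2 z c = r ^+ 2 ->
  RR c r (vz z) = sc r (vz ((z.1 - c.1) / r, (z.2 - c.2) / r)).
Proof.
move=> r0 h; have r00 : r != 0 by rewrite gt_eqF.
have E : n2 ((z.1 - c.1) / r, (z.2 - c.2) / r) = 1.
  rewrite /n2 /= !exprMn -mulrDl; move: h; rewrite /d2 => ->.
  by rewrite -exprMn divff // expr1n.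
have E2 : n2 z = r ^+ 2 + 2 * (z.1 * c.1 + z.2 * c.2) - n2 c.
  by rewrite -h /d2 /n2; ring.
have w1 : (n2 z + 1) / 2 - (n2 z - 1) / 2 = 1 by field.
have w2 : (n2 z + 1) / 2 + (n2 z - 1) / 2 = n2 z by field.
apply: vext; rewrite /RR /sc {1}/vz /c1 /c2 /c3 /c4 /= ?w1 ?w2 ?mul1r ?E.
- by field.
- by field.
- by rewrite E2; field.
- by rewrite E2; field.
Qed.

(** A unit vector is determined by c1, c2 and [uc], because its square factors as c1^2 + c2^2 - (c4
    - c3)(c4 + c3). In chart terms, a disc is determined by its radius and centre. *)
Lemma unit_w u : lf u u = 1 -> uc u != 0 ->
  c3 u = ((c1 u ^+ 2 + c2 u ^+ 2 - 1) / uc u - uc u) / 2 /\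
  c4 u = ((c1 u ^+ 2 + c2 u ^+ 2 - 1) / uc u + uc u) / 2.
Proof.
move=> h u0; have E : c1 u ^+ 2 + c2 u ^+ 2 - 1 = (c4 u + c3 u) * uc u.
  by move: h; rewrite /lf /uc !expr2; lra.
by rewrite E mulfK // /uc; split; field.
Qed.

Lemma unit_ext u v : lf u u = 1 -> lf v v = 1 -> uc u != 0 -> uc u = uc v -> pl u = pl v -> u = v.
Proof.
move=> hu hv u0 e [p1 p2]; have v0 : uc v != 0 by rewrite -e.
have q1 : c1 u = c1 v by apply: (mulIf (invr_neq0 u0)); rewrite p1 e.
have q2 : c2 u = c2 v by apply: (mulIf (invr_neq0 u0)); rewrite p2 e.
have [a b] := unit_w hu u0; have [a' b'] := unit_w hv v0.
by apply: vext => //; [rewrite a a' q1 q2 e | rewrite b b' q1 q2 e].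
Qed.

Lemma direction z : exists e : R * R, n2 e = 1 /\ z = (Num.sqrt (n2 z) * e.1, Num.sqrt (n2 z) * e.2).
Proof.
have [h|h] := eqVneq (n2 z) 0.
  exists (1, 0); rewrite h sqrtr0 !mul0r; split; first by rewrite /n2 /= expr1n expr0n addr0.
  move/eqP: h; rewrite paddr_eq0 ?sqr_ge0 // !sqrf_eq0 => /andP[/eqP a /eqP b].
  by case: z a b => ? ? /= -> ->.
have s0 : Num.sqrt (n2 z) != 0 by rewrite sqrtr_eq0 -ltNge lt_neqAle eq_sym h n2_ge0.
exists (z.1 / Num.sqrt (n2 z), z.2 / Num.sqrt (n2 z)) => /=; split.
  rewrite /n2 /= !exprMn -mulrDl -/(n2 z) exprVn sqr_sqrtr ?n2_ge0 //.
  by rewrite divff.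
by rewrite mulrC divfK // mulrC divfK //; case: z h s0.
Qed.

Lemma uc_RR c r u : r != 0 ->
  uc (RR c r u) = (c4 u + c3 u - 2 * (c1 u * c.1 + c2 u * c.2) + uc u * n2 c) / r.
Proof. by move=> r0; case: u => [[[? ?] ?] ?]; rewrite /uc /RR /c1 /c2 /c3 /c4 /= /n2; field. Qed.

Section Child.
Variables (S : set (pt R)) (N : set (vec R)) (M M' : vec R -> vec R) (o n : vec R).
Hypotheses (sd : SD S N) (H : st N M M' o) (Nn : N n) (no : n <> o).

(** The frame of the child state: the disc [n] is blown up to the unit disc and turned inside out,
    so that [n] becomes the exterior disc. *)
Definition chM M n := RR (cen M n) (rad M n) \o M.
Definition chM' M M' n := M' \o RR' (cen M n) (rad M n).

Let r0 := st_rad sd H Nn no.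
Let u0 : uc (M n) != 0. Proof. by rewrite gt_eqF // (st_uc sd H). Qed.

Lemma child_st : st N (chM M n) (chM' M M' n) n.
Proof.
split=> //; first exact: LT_comp (RR_LT _ r0) (st_LT H).
have n1 : lf (M n) (M n) = 1 by rewrite (LT_lf (st_LT H)) (sd_unit sd).
have [e3' e4'] := unit_w n1 u0.
rewrite /chM /= /RR /cen /rad /pl /n2 /= -/(uc _).
have w : c4 (M n) + c3 (M n) = (c1 (M n) ^+ 2 + c2 (M n) ^+ 2 - 1) / uc (M n).
  by rewrite e3' e4'; field.
by rewrite w; apply: vext; rewrite /e3 /= /c1 /c2 /c3 /c4 /= -!/(c1 _) -!/(c2 _); field.
Qed.

(** The link between radii and Lorentz products: the inverse radius of [m] seen from [n] differs
    from r_n / r_m by twice their product. *)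
Lemma child_uc (m : vec R) : uc (chM M n m) = rad M n * uc (M m) - 2 * lf n m.
Proof.
have n1 : lf (M n) (M n) = 1 by rewrite (LT_lf (st_LT H)) (sd_unit sd).
have [e3' e4'] := unit_w n1 u0.
rewrite -(LT_lf (st_LT H)) /lf e3' e4' /chM /= uc_RR ?gt_eqF // /cen /rad /pl /n2 /=.
by rewrite [uc (M m)]/uc; field.
Qed.

Lemma child_ch x : S x -> lf (X x) n = 0 -> ch (chM M n) x =
  (((ch M x).1 - (cen M n).1) / rad M n, ((ch M x).2 - (cen M n).2) / rad M n).
Proof.
move=> Sx h; have ux := st_ucS sd H Sx; have ux0 := lt0r_neq0 ux.
have hc := (st_circle sd H Sx Nn no).1 h.
have E : sc (uc (M (X x))) (vz (ch M x)) = M (X x).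
  by rewrite plK // (LT_lf (st_LT H)) lfXX0 //; have [] := (sd_S sd x).1 Sx.
have -> : ch (chM M n) x = pl (RR (cen M n) (rad M n) (M (X x))) by [].
rewrite -E (LT_sc _ _ (RR_LT _ r0)) pl_sc // RR_vz // pl_sc ?gt_eqF //.
by rewrite pl_vz.
Qed.

End Child.

Definition symS (S : set (pt R)) (L L' : vec R -> vec R) :=
  LT L L' /\ forall x, sphere x -> (S x <-> S (act L x)).

Lemma symS_sym S L L' : symS S L L' -> symS S L' L.
Proof.
move=> [H h]; split; first exact: LT_sym.
move=> x hx; have := h _ (act_sphere (LT_sym H) hx); rewrite (actK (LT_sym H) hx).
by move=> [a b]; split.
Qed.

(* A cap of the complement of S bounded by a circle in S is one of the discs. *)
Lemma symS_N S N L L' n : SD S N -> symS S L L' -> N n -> N (L n).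
Proof.
move=> sd HL Nn; have [HLT hL] := HL; have [ o No] := sd_ne sd.
have [M [M' H]] := st_exists No (sd_unit sd No); have HM := st_LT H.
set m := M (L n).
have m1 : lf m m = 1 by rewrite (LT_lf HM) (LT_lf HLT) (sd_unit sd).
have pos z : 0 < lf (vz z) m -> ~ S (ich M' z).
  have [k k0 hk] := ich_lf z HM => h Sx; have hx := ich_sphere z HM.
  have : 0 < lf (X (ich M' z)) (L n) by rewrite hk mulr_gt0.
  have HL' := LT_sym HLT.
  rewrite (lf_act _ HL' hx) (LT_K HLT) pmulr_rgt0 ?(LT_c4 HL') // => h2.
  have /(sd_S sd) [_ h3] : S (act L' (ich M' z)).
    by apply/(hL _ (act_sphere HL' hx)); rewrite (actK HL').
  by have := h3 _ Nn; rewrite leNgt h2.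
have zero z : lf (vz z) m = 0 -> S (ich M' z).
  have [k k0 hk] := ich_lf z HM => h; have hx := ich_sphere z HM.
  have HL' := LT_sym HLT.
  have : lf (X (ich M' z)) (L n) = 0 by rewrite hk h mulr0.
  rewrite (lf_act _ HL' hx) (LT_K HLT) => /eqP; rewrite mulf_eq0 (gt_eqF (LT_c4 HL' hx)) /= => /eqP h2.
  have := sd_circle sd Nn (act_sphere HL' hx) h2.
  by move=> /(hL _ (act_sphere HL' hx)); rewrite (actK HL').
have in1 z : lf (vz z) m = 0 -> n2 z <= 1 by move=> /zero /(st_S sd H) [].
have [u0|u0] := eqVneq (uc m) 0.
  have c34 : c4 m = c3 m by move: u0; rewrite /uc => /eqP; rewrite subr_eq0 => /eqP.
  have a1 : c1 m ^+ 2 + c2 m ^+ 2 = 1 by move: m1; rewrite /lf c34 !expr2; lra.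
  (* The disc would be a half-plane bounded by the line with unit normal (c1 m, c2 m) at offset c3
     m. This point of the line has modulus at least 2, yet the boundary lies in S, inside the unit
     disc. *)
  pose z : R * R := (c3 m * c1 m - 2 * c2 m, c3 m * c2 m + 2 * c1 m).
  have nz : n2 z = c3 m ^+ 2 + 4.
    transitivity ((c3 m ^+ 2 + 4) * (c1 m ^+ 2 + c2 m ^+ 2)); first by rewrite /n2 /z /=; ring.
    by rewrite a1 mulr1.
  have : n2 z <= 1.
    apply: in1.
    transitivity (c3 m * (c1 m ^+ 2 + c2 m ^+ 2) - c3 m).
      rewrite /lf c34 /vz; move: nz; set q := n2 z => nz; by rewrite /z /c1 /c2 /c3 /c4 /=; field.
    by rewrite a1 mulr1 subrr.
  by rewrite nz; move: (sqr_ge0 (c3 m)); lra.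
set r := (uc m)^-1; set c := pl m.
have lfz z : lf (vz z) m = (r ^+ 2 - d2 z c) / (2 * r) by rewrite lf_disc.
have zer z : d2 z c = r ^+ 2 -> lf (vz z) m = 0 by move=> h; rewrite lfz h subrr mul0r.
have [up|un] := ltP 0 (uc m).
  have r0 : 0 < r by rewrite invr_gt0.
  have posd z : d2 z c < r ^+ 2 -> ~ S (ich M' z).
    by move=> h; apply: pos; rewrite lfz divr_gt0 ?subr_gt0 // mulr_gt0.
  have nc : ~ S (ich M' c) by apply: posd; rewrite d2zz exprn_gt0.
  have n2c : n2 c <= 1.
    have [e [e1' ec]] := direction c; set d := Num.sqrt (n2 c) in ec.
    have d0 : 0 <= d by exact: sqrtr_ge0.
    have nd : n2 c = d ^+ 2 by rewrite sqr_sqrtr ?n2_ge0.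
    pose z : R * R := (c.1 + r * e.1, c.2 + r * e.2).
    have z1 : d2 z c = r ^+ 2.
      by transitivity (r ^+ 2 * n2 e); [rewrite /d2 /n2 /z /=; ring | rewrite e1' mulr1].
    have nz : n2 z = (d + r) ^+ 2.
      transitivity ((d + r) ^+ 2 * n2 e); last by rewrite e1' mulr1.
      by rewrite /z ec /n2 /=; ring.
    have := in1 z (zer z z1); rewrite nz nd; apply: le_trans.
    by rewrite ler_pXn2r ?nnegrE ?addr_ge0 ?(ltW r0) // lerDl ltW.
  have [k [Nk ko hk]] : exists k, [/\ N k, k <> o & d2 c (cen M k) < rad M k ^+ 2].
    apply: contrapT => hn; apply: nc; apply/(st_S sd H); split=> // k Nk ko.
    by rewrite leNgt; apply/negP => hk; apply: hn; exists k.
  have rk := st_rad sd H Nk ko; set ck := cen M k in hk; set s := rad M k in hk rk.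
  have [e [e1' ec]] := direction (ck.1 - c.1, ck.2 - c.2).
  have dd : n2 (ck.1 - c.1, ck.2 - c.2) = d2 c ck by rewrite /n2 /d2 /=; ring.
  rewrite dd -/(pd c ck) in ec; set d := pd c ck in ec.
  have d0 : 0 <= d by exact: pd_ge0.
  have ds : d < s by apply: ltr_sqr_abs; rewrite ?(ltW rk) // /d pd_sqr.
  have [ec1 ec2] : ck.1 = c.1 + d * e.1 /\ ck.2 = c.2 + d * e.2.
    by move: (congr1 fst ec) (congr1 snd ec) => /= h1 h2; rewrite -h1 -h2 addrC subrK addrC subrK.
  (* [z] and the later [q] are points of the two circles on the line of centres, in the directions e
     and -e. Both lie in S, hence outside the other open disc, and these inequalities force the
     circles to coincide. *)
  pose z : R * R := (c.1 + r * e.1, c.2 + r * e.2).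
  have z1 : d2 z c = r ^+ 2.
    by transitivity (r ^+ 2 * n2 e); [rewrite /d2 /n2 /z /=; ring | rewrite e1' mulr1].
  have z2 : s ^+ 2 <= (r - d) ^+ 2.
    have -> : (r - d) ^+ 2 = d2 z ck.
      by transitivity ((r - d) ^+ 2 * n2 e); [rewrite e1' mulr1 | rewrite /d2 ec1 ec2 /n2 /z /=; ring].
    have /(st_S sd H) [_ h] := zero _ (zer _ z1); exact: h.
  pose q : R * R := (c.1 + (d - s) * e.1, c.2 + (d - s) * e.2).
  have q1 : d2 q ck = s ^+ 2.
    by transitivity (s ^+ 2 * n2 e); [rewrite /d2 ec1 ec2 /n2 /q /=; ring | rewrite e1' mulr1].
  have q2 : r ^+ 2 <= (s - d) ^+ 2.
    have -> : (s - d) ^+ 2 = d2 q c.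
      by transitivity ((s - d) ^+ 2 * n2 e); [rewrite e1' mulr1 | rewrite /d2 /n2 /q /=; ring].
    rewrite leNgt; apply/negP => /posd; apply.
    apply: (sd_circle sd Nk (ich_sphere q HM)).
    have [k1 _ ->] := ich_lf q HM.
    by rewrite (st_lf sd H) // -/s -/ck q1 subrr mul0r mulr0.
  have rs : r <= s - d by apply: ler_sqr_abs => //; rewrite subr_ge0 ltW.
  have [rd|rd] := leP d r.
    have : s <= r - d by apply: ler_sqr_abs => //; rewrite subr_ge0.
    move=> sr; have d00 : d = 0 by lra.
    have srE : s = r by lra.
    suff -> : L n = k by [].
    apply: (can_inj (LT_K HM)); rewrite -/m.
    apply: unit_ext => //; first by rewrite (LT_lf HM) (sd_unit sd).
      by apply: invr_inj; rewrite -/r -srE.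
    rewrite -/c -/(cen M k) -/ck; move: ec1 ec2; rewrite d00 !mul0r !addr0.
    by move=> a b; apply: d2_eq0; rewrite /d2 a b !subrr expr0n addr0.
  have : s <= d - r.
    by apply: ler_sqr_abs; [rewrite subr_ge0 ltW | rewrite -(sqrrN (d - r)) opprB].
  by lra.
have {un} un : uc m < 0 by rewrite lt_neqAle u0.
have rn : r < 0 by rewrite invr_lt0.
have [e [e1' ec]] := direction c; set d := Num.sqrt (n2 c) in ec.
have d0 : 0 <= d by exact: sqrtr_ge0.
(* With a negative radius the disc is an exterior. [z] lies on the unit circle opposite to the
   centre, and the later [q] is the point of the new circle farthest from the origin; they give 1 +
   d <= -r and d - r <= 1, so the disc is [o]. *)
pose z : R * R := (- e.1, - e.2).
have A : 1 + d <= - r.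
  apply: ler_sqr_abs; first by lra.
  rewrite sqrrN; have -> : (1 + d) ^+ 2 = d2 z c.
    transitivity ((1 + d) ^+ 2 * n2 e); first by rewrite e1' mulr1.
    by rewrite /d2 /z ec /n2 /=; ring.
  rewrite leNgt; apply/negP => h; have : S (ich M' z).
    have nz : n2 z = 1 by rewrite -e1' /n2 /z /= !sqrrN.
    apply: (sd_circle sd No (ich_sphere z HM)).
    have [k1 _ ->] := ich_lf z HM.
    by rewrite (st_e H) lf_vz_e3 nz subrr mul0r mulr0.
  by apply: pos; rewrite lfz nmulr_rgt0 ?invr_lt0 ?pmulr_rlt0 // subr_lt0.
pose q : R * R := (c.1 - r * e.1, c.2 - r * e.2).
have q1 : d2 q c = r ^+ 2.
  by transitivity (r ^+ 2 * n2 e); [rewrite /d2 /n2 /q /=; ring | rewrite e1' mulr1].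
have := in1 q (zer q q1).
have -> : n2 q = (d - r) ^+ 2.
  transitivity ((d - r) ^+ 2 * n2 e); last by rewrite e1' mulr1.
  by rewrite /n2 /q ec /=; ring.
move=> B; have B' : d - r <= 1 by apply: ler_sqr_abs; rewrite // expr1n.
have d00 : d = 0 by lra.
have r1 : r = -1 by lra.
suff -> : L n = o by [].
apply: (can_inj (LT_K HM)); rewrite -/m (st_e H).
have uE : uc (e3 R) = -1 by rewrite /uc /e3 /c3 /c4 /=; ring.
apply: unit_ext => //; first by rewrite lf_e3.
  by apply: invr_inj; rewrite -/r r1 uE invrN invr1.
rewrite -/c ec d00 !mul0r /pl /e3 /c1 /c2 /=.
by rewrite !mul0r.
Qed.

End States.

(** * Integrals and the packing of discs *)

Section Integral.
Variable R : realType.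
Implicit Types (f g : R -> R) (a b c r A : R).
Local Notation mu := (@lebesgue_measure R).

Lemma integral_ind a b : (\int[mu]_x (\1_(`[a, b]) x)%:E)%E = (if a < b then b - a else 0)%:E.
Proof.
rewrite integral_indic // setIT; etransitivity; first exact: (lebesgue_measure_itv `[a, b]).
by rewrite /= lte_fin; case: ifP.
Qed.

(** Bounded nonnegative measurable functions of bounded support. Their integrals are finite, so
    [Int] is real-valued and linear inequalities stay in R. *)
Definition adm g := [/\ measurable_fun [set: R] g, forall x, 0 <= g x &
  exists A, (forall x, g x <= A) /\ forall x, A < `|x| -> g x = 0].

Definition Int g : R := fine (\int[mu]_x (g x)%:E).

Lemma adm_fin g : adm g -> (\int[mu]_x (g x)%:E)%E \is a fin_num.
Proof.
move=> [mg g0 [A [gA gs]]].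
have A0 : 0 <= A by apply: le_trans (gA 0).
rewrite ge0_fin_numE; last by apply: integral_ge0 => x _; rewrite lee_fin.
apply: (@le_lt_trans _ _ (\int[mu]_x (A%:E * (\1_(`[- A, A]) x)%:E))%E).
  apply: ge0_le_integral => //.
  - by move=> x _; rewrite lee_fin.
  - exact/measurable_EFinP.
  - by apply/measurable_EFinP; apply: measurable_funM => //.
  - move=> x _; rewrite -EFinM lee_fin indicE.
    case: (leP `|x| A) => hx.
      by rewrite mem_set /= ?mulr1 // in_itv /= -ler_norml.
    by rewrite gs // mulr_ge0.
rewrite ge0_integralZl//.
- by rewrite integral_ind -EFinM ltry.
- exact/measurable_EFinP.
Qed.

Lemma Int_le f g : adm f -> adm g -> (forall x, f x <= g x) -> Int f <= Int g.
Proof.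
move=> af ag h; apply: fine_le; [exact: adm_fin | exact: adm_fin |].
have [mf f0 _] := af; have [mg g0 _] := ag.
apply: ge0_le_integral => //.
- by move=> x _; rewrite lee_fin.
- exact/measurable_EFinP.
- exact/measurable_EFinP.
- by move=> x _; rewrite lee_fin.
Qed.

Lemma adm0 : adm (fun=> 0).
Proof. by split=> //; exists 0. Qed.

Lemma Int0 : Int (fun=> 0) = 0.
Proof. by rewrite /Int integral0. Qed.

Lemma admD f g : adm f -> adm g -> adm (fun x => f x + g x).
Proof.
move=> [mf f0 [A [fA fs]]] [mg g0 [B [gB gs]]]; split.
- exact: measurable_funD.
- by move=> x; rewrite addr_ge0.
have A0 : 0 <= A by apply: le_trans (fA 0).
have B0 : 0 <= B by apply: le_trans (gB 0).
exists (A + B); split; first by move=> x; rewrite lerD.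
by move=> x hx; rewrite fs ?gs ?addr0 //; apply: le_lt_trans hx; rewrite ?lerDl ?lerDr.
Qed.

Lemma IntD f g : adm f -> adm g -> Int (fun x => f x + g x) = Int f + Int g.
Proof.
move=> af ag; rewrite /Int -fineD; [|exact: adm_fin..].
have [mf f0 _] := af; have [mg g0 _] := ag.
congr fine; rewrite -ge0_integralD //.
- by move=> x _; rewrite lee_fin.
- exact/measurable_EFinP.
- by move=> x _; rewrite lee_fin.
- exact/measurable_EFinP.
Qed.

Lemma admZ k g : 0 <= k -> adm g -> adm (fun x => k * g x).
Proof.
move=> k0 [mg g0 [A [gA gs]]]; split.
- by apply: measurable_funM => //.
- by move=> x; rewrite mulr_ge0.
have A0 : 0 <= A by apply: le_trans (gA 0).
exists ((k + 1) * A); split.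
  by move=> x; apply: le_trans (ler_wpM2l k0 (gA x)) _; rewrite ler_wpM2r // lerDl.
by move=> x hx; rewrite gs ?mulr0 //; apply: le_lt_trans hx; rewrite ler_peMl // lerDr.
Qed.

Lemma IntZ k g : 0 <= k -> adm g -> Int (fun x => k * g x) = k * Int g.
Proof.
move=> k0 ag; rewrite /Int -[k in RHS]/(fine k%:E) -fineM; [|by []|exact: adm_fin].
have [mg g0 _] := ag.
congr fine; rewrite -ge0_integralZl //.
- exact/measurable_EFinP.
- by move=> x _; rewrite lee_fin.
Qed.

Lemma adm_sum (T : Type) (s : seq T) (F : T -> R -> R) : (forall t, adm (F t)) ->
  adm (fun x => \sum_(t <- s) F t x).
Proof.
move=> h; elim: s => [|t s IH].
  by under [X in adm X]funext => x do rewrite big_nil; exact: adm0.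
by under [X in adm X]funext => x do rewrite big_cons; exact: admD.
Qed.

Lemma Int_sum (T : Type) (s : seq T) (F : T -> R -> R) : (forall t, adm (F t)) ->
  Int (fun x => \sum_(t <- s) F t x) = \sum_(t <- s) Int (F t).
Proof.
move=> h; elim: s => [|t s IH].
  by under [X in Int X]funext => x do rewrite big_nil; rewrite big_nil Int0.
under [X in Int X]funext => x do rewrite big_cons.
by rewrite big_cons IntD ?IH //; exact: adm_sum.
Qed.

Definition ind a b x : R := if (a <= x) && (x <= b) then 1 else 0.

Lemma ind_ge0 a b x : 0 <= ind a b x.
Proof. by rewrite /ind; case: ifP. Qed.

Lemma indE a b : ind a b = \1_(`[a, b]).
Proof.
apply/funext => x; rewrite /ind indicE; case: ifP => h.
  by rewrite mem_set //= in_itv.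
by rewrite memNset //= in_itv /= h.
Qed.

Lemma adm_ind a b : adm (ind a b).
Proof.
split; [by rewrite indE | exact: ind_ge0 |].
exists (1 + `|a| + `|b|); split.
  by move=> x; rewrite /ind; case: ifP => _; rewrite ?addr_ge0 // -addrA lerDl addr_ge0.
move=> x hx; rewrite /ind; case: ifP => // /andP[h1 h2]; exfalso; move: hx; apply/negP.
rewrite -leNgt ler_norml.
have := ler_norm b; have := ler_norm (- a); rewrite normrN.
have := normr_ge0 a; have := normr_ge0 b.
by move=> *; apply/andP; split; light_lra.
Qed.

Lemma Int_ind a b : a <= b -> Int (ind a b) = b - a.
Proof.
move=> ab; rewrite /Int indE integral_ind /=; case: ltP => //= ba; have -> : a = b by apply/eqP; rewrite eq_le ab.
by rewrite subrr.
Qed.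

Lemma adm_cont g A : continuous g -> (forall x, 0 <= g x) -> (forall x, g x <= A) ->
  (forall x, A < `|x| -> g x = 0) -> adm g.
Proof. by move=> cg g0 gA gs; split=> //; [exact: continuous_measurable_fun | exists A]. Qed.

(** The substitution that produces the source radius in the jump inequality. *)
Lemma Int_affine g A c r : 0 < r -> continuous g -> (forall x, 0 <= g x) -> (forall x, g x <= A) ->
  (forall x, A < `|x| -> g x = 0) ->
  adm (fun x => g ((x - c) / r)) /\ Int (fun x => g ((x - c) / r)) = r * Int g.
Proof.
move=> r0 cg g0 gA gs.
have r00 : r != 0 by rewrite gt_eqF.
have A0 : 0 <= A by apply: le_trans (gA 0).
have cF : continuous (fun x : R => (x - c) / r).
  move=> x; apply: cvgM; last exact: cvg_cst.
  by apply: cvgB; [exact: cvg_id | exact: cvg_cst].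
have cgF : continuous (fun x : R => g ((x - c) / r)).
  by move=> x; apply: (continuous_comp (f := fun x : R => (x - c) / r)); [exact: cF | exact: cg].
have ad : adm (fun x => g ((x - c) / r)).
  apply: (@adm_cont _ (A + r * A + `|c|)) => //.
    by move=> x; apply: (le_trans (gA _)); rewrite -addrA lerDl addr_ge0 // mulr_ge0 // ltW.
  move=> x hx; apply: gs; rewrite normrM normfV (gtr0_norm r0) ltr_pdivlMr // mulrC.
  have := lerB_dist x c; have : 0 <= A by []; light_lra.
split=> //.
pose F (x : R) := (x - c) / r.
have dF (x : R) : is_derive x 1 F r^-1.
  have -> : F = (r^-1 \*: (@id R)) - cst (c / r).
    by apply/funext => y /=; rewrite !fctE /= /F mulrBl [r^-1 *: y]mulrC.
  by apply: is_derive_eq; rewrite subr0 /GRing.scale /= mulr1.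
have F' : (F^`())%classic = fun=> r^-1.
  by apply/funext => x; rewrite derive1E; apply: derive_val.
have ag := adm_cont cg g0 gA gs.
have -> : Int (fun x => g ((x - c) / r)) = r * (r^-1 * Int (fun x => g ((x - c) / r))).
  by rewrite mulrA mulfV // mul1r.
congr (_ * _); rewrite -IntZ ?invr_ge0 ?(ltW r0) //.
rewrite /Int; congr fine.
rewrite (@increasing_ge0_integration_by_substitutionT _ F g) //.
- by apply: eq_integral => x _ /=; rewrite F' /F /= mulrC.
- by move=> x y xy; rewrite /F ltr_pM2r ?invr_gt0 // ltrD2r.
- by rewrite F'; exact: cst_continuous.
- by rewrite F'; apply: is_cvg_cst.
- by rewrite F'; apply: is_cvg_cst.
- apply/cvgrNyPle => B; near=> x.
  by rewrite /F ler_pdivrMr // lerBlDr; near: x; apply: nbhs_ninfty_le; exact: num_real.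
- apply/cvgryPge => B; near=> x.
  by rewrite /F ler_pdivlMr // lerBrDr; near: x; apply: nbhs_pinfty_ge; exact: num_real.
Unshelve. all: by end_near.
Qed.

End Integral.

(** * The area bound for disjoint discs, by horizontal slices *)

Section Packing.
Variable R : realType.

Lemma sqr_le_itv (a b : R) : - b <= a <= b -> a ^+ 2 <= b ^+ 2.
Proof. by move=> /andP[h1 h2]; rewrite -subr_ge0 subr_sqr mulr_ge0 //; lra. Qed.

Lemma sum_le1 (T : eqType) (s : seq T) (F : T -> R) (B : R) : uniq s -> 0 <= B ->
  (forall t, t \in s -> 0 <= F t <= B) ->
  (forall t t', t \in s -> t' \in s -> F t != 0 -> F t' != 0 -> t = t') ->
  \sum_(t <- s) F t <= B.
Proof.
elim: s => [|t s IH] /=; first by rewrite big_nil.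
move=> /andP[ts us] B0 hB hF; rewrite big_cons.
have [h|h] := eqVneq (F t) 0.
  rewrite h add0r; apply: IH => //.
    by move=> u hu; apply: hB; rewrite inE hu orbT.
  by move=> u u' hu hu'; apply: hF; rewrite inE ?hu ?hu' orbT.
rewrite big_seq big1 ?addr0; first by have /andP[] := hB t (mem_head _ _).
move=> u hu; apply/eqP; apply: contraT => hFu.
have e := hF t u (mem_head _ _) (@mem_behead _ (t :: s) u hu) h hFu.
by rewrite e hu in ts.
Qed.

(** The square root of a negative number is 0, so [chord] vanishes outside [-1, 1]. *)
Definition chord (y : R) : R := 2 * Num.sqrt (1 - y ^+ 2).

Lemma chord_ge0 y : 0 <= chord y.
Proof. by rewrite mulr_ge0 // sqrtr_ge0. Qed.

Lemma chord_le y : chord y <= 2.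
Proof.
rewrite -[X in _ <= X]mulr1 ler_wpM2l // -[X in _ <= X]sqrtr1 ler_wsqrtr //.
by rewrite lerBlDr lerDl sqr_ge0.
Qed.

Lemma chord_out y : 2 < `|y| -> chord y = 0.
Proof.
move=> h; rewrite /chord ler0_sqrtr ?mulr0 // subr_le0 -real_normK ?num_real //.
by rewrite expr_ge1 // (le_trans _ (ltW h)) // ler1n.
Qed.

Lemma chord_cont : continuous chord.
Proof.
move=> y; apply: cvgM; first exact: cvg_cst.
apply: (continuous_comp (f := fun y : R => 1 - y ^+ 2)); last exact: sqrt_continuous.
by apply: cvgB; [exact: cvg_cst | exact: exprn_continuous].
Qed.

Lemma adm_chord : adm chord.
Proof. exact: adm_cont chord_cont chord_ge0 chord_le chord_out. Qed.

(** The area of the unit disc; a positive lower bound is enough to cancel it in [packing]. *)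
Lemma Int_chord : 1 <= Int chord.
Proof.
have -> : 1 = Int (ind (- 2^-1) (2^-1 : R)) by rewrite Int_ind; lra.
apply: Int_le; [exact: adm_ind | exact: adm_chord |] => y.
rewrite /ind; case: ifP => [/andP[h1 h2]|_]; last exact: chord_ge0.
have : 2^-1 <= Num.sqrt (1 - y ^+ 2).
  apply: ler_sqr_abs; first exact: sqrtr_ge0.
  by rewrite sqr_sqrtr; nra.
by rewrite /chord; lra.
Qed.

Variables (S : set (pt R)) (N : set (vec R)) (M M' : vec R -> vec R) (o : vec R).
Hypotheses (sd : SD S N) (H : st N M M' o).

Definition proper n := N n /\ n <> o.

(** Cavalieri: on each horizontal line the chords of the discs are disjoint intervals inside the
    chord of the unit disc. Integration over the height multiplies both sides by the same area. *)
Lemma packing (s : seq (vec R)) : uniq s -> (forall n, n \in s -> proper n) ->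
  \sum_(n <- s) rad M n ^+ 2 <= 1.
Proof.
move=> us hs.
pose F n (y : R) := rad M n * chord ((y - (cen M n).2) / rad M n).
have rp n : n \in s -> 0 < rad M n by move=> /hs [Nn no]; exact: (st_rad sd H Nn no).
have FA n : n \in s -> adm (F n) /\ Int (F n) = rad M n ^+ 2 * Int chord.
  move=> hn; have r0 := rp _ hn.
  have [a i] := Int_affine (cen M n).2 r0 chord_cont chord_ge0 chord_le chord_out.
  split; first by apply: admZ => //; exact: ltW.
  by rewrite IntZ ?(ltW r0) // i mulrA expr2.
pose G n (y : R) := if n \in s then F n y else 0.
have GA n : adm (G n).
  rewrite /G; have [hn|hn] := boolP (n \in s); last exact: adm0.
  by have [] := FA _ hn.
have line y : \sum_(n <- s) G n y <= chord y.
  pose w n := rad M n * Num.sqrt (1 - ((y - (cen M n).2) / rad M n) ^+ 2).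
  pose W := Num.sqrt (1 - y ^+ 2).
  have in1 n t : n \in s -> 0 < w n -> (cen M n).1 - w n <= t <= (cen M n).1 + w n ->
      d2 (t, y) (cen M n) <= rad M n ^+ 2.
    move=> hn wn ht; have r0 := rp _ hn; have r00 := lt0r_neq0 r0.
    have q0 : 0 < 1 - ((y - (cen M n).2) / rad M n) ^+ 2.
      by rewrite -sqrtr_gt0 -(pmulr_rgt0 _ r0).
    have w2 : w n ^+ 2 = rad M n ^+ 2 - (y - (cen M n).2) ^+ 2.
      by rewrite exprMn sqr_sqrtr ?(ltW q0) //; field.
    have : (t - (cen M n).1) ^+ 2 <= w n ^+ 2.
      apply: sqr_le_itv.
      by move/andP: ht => [h1 h2]; apply/andP; split; lra.
    by rewrite w2 /d2 /=; lra.
  (* Lengths of chords are written as integrals of indicators, so that disjointness becomes a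
     pointwise bound on their sum. *)
  pose f n t := if (n \in s) && (0 < w n) then ind ((cen M n).1 - w n) ((cen M n).1 + w n) t else 0.
  have fA n : adm (f n) by rewrite /f; case: ((n \in s) && (0 < w n)); [exact: adm_ind | exact: adm0].
  have W0 : 0 <= W by exact: sqrtr_ge0.
  have : Int (fun t => \sum_(n <- s) f n t) <= Int (ind (- W) W).
    apply: Int_le; [exact: adm_sum | exact: adm_ind |] => t.
    apply: sum_le1 => //; first exact: ind_ge0.
      move=> n hn; rewrite /f hn /=; case: ifP => wn; last by rewrite lexx ind_ge0.
      rewrite ind_ge0 /= {1}/ind; case: ifP => ht; last exact: ind_ge0.
      have := in1 _ _ hn wn ht; have [Nn no] := hs _ hn => /(st_in sd H Nn no) h.
      suff -> : ind (- W) W t = 1 by [].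
      rewrite /ind -ler_norml ifT //.
      rewrite -(ler_pXn2r (n := 2)) ?nnegrE // real_normK ?num_real //.
      move: h; rewrite /n2 /= => h; rewrite sqr_sqrtr; first by lra.
      by move: (sqr_ge0 t); lra.
    move=> n m hn hm; rewrite /f hn hm /=.
    case: ifP => wn; last by rewrite eqxx.
    rewrite {1}/ind; case: ifP => ht; last by rewrite eqxx.
    move=> _; case: ifP => wm; last by rewrite eqxx.
    rewrite {1}/ind; case: ifP => ht'; last by rewrite eqxx.
    move=> _; apply: contrapT => nm.
    have [Nn no] := hs _ hn; have [Nm mo] := hs _ hm.
    exact: (st_disj sd H Nn Nm no mo nm (in1 _ _ hn wn ht) (in1 _ _ hm wm ht')).
  rewrite Int_sum // Int_ind; last by lra.
  have -> : W - - W = chord y by rewrite /chord -/W; ring.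
  apply: le_trans; rewrite big_seq [X in _ <= X]big_seq; apply: ler_sum => n hn.
  have r0 := rp _ hn.
  have -> : G n y = 2 * w n by rewrite /G hn /F /chord /w; ring.
  rewrite /f hn /=; case: ltP => wn; first by rewrite Int_ind; lra.
  by rewrite Int0; lra.
have : Int (fun y => \sum_(n <- s) G n y) <= Int chord.
  by apply: Int_le; [exact: adm_sum | exact: adm_chord | exact: line].
rewrite Int_sum //.
have -> : \sum_(n <- s) Int (G n) = (\sum_(n <- s) rad M n ^+ 2) * Int chord.
  rewrite mulr_suml big_seq [RHS]big_seq; apply: eq_bigr => n hn.
  by have [_ <-] := FA _ hn; congr Int; apply/funext => y; rewrite /G hn.
have K1 := Int_chord; have K0 : 0 < Int chord by lra.
by rewrite -[X in _ <= X]mul1r ler_pM2r.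
Qed.

End Packing.

(** * Limits along an ultrafilter *)

Section Ultra.

(** An ultrafilter containing all tails. Along it every bounded real sequence and every sequence in
    a compact set converges, and a sequence with finitely many values is constant. *)
Lemma ultra_nat : exists U : set_system nat, UltraFilter U /\ forall m, U [set n | (m <= n)%N].
Proof.
have [U [UU hU]] := ultraFilterLemma (F := \oo%classic : set_system nat) _.
by exists U; split=> // m; apply: hU; exists m.
Qed.

Definition UU : set_system nat := sval (cid ultra_nat).

#[global] Instance UU_ultra : UltraFilter UU.
Proof. by have [] := svalP (cid ultra_nat). Qed.

#[global] Instance UU_proper : ProperFilter UU.
Proof. exact: ultra_proper. Qed.

Lemma UU_ge m : UU [set n | (m <= n)%N].
Proof. by have [_ h] := svalP (cid ultra_nat); apply: h. Qed.

Lemma UU_imp (A B : set nat) : (forall n, A n -> B n) -> UU A -> UU B.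
Proof. by move=> h; apply: filterS. Qed.

Lemma UU_and (A B : set nat) : UU A -> UU B -> UU [set n | A n /\ B n].
Proof. exact: filterI. Qed.

Lemma UU_all (A : set nat) : (forall n, A n) -> UU A.
Proof. by move=> h; apply: UU_imp filterT. Qed.

Lemma UU_ex (A : set nat) : UU A -> exists n, A n.
Proof. exact: filter_ex. Qed.

Lemma UU_not (A : set nat) : ~ UU A -> UU [set n | ~ A n].
Proof. by case: (in_ultra_setVsetC A UU_ultra). Qed.

Lemma UU_const (T : eqType) (x : nat -> T) (s : seq T) :
  UU [set n | x n \in s] -> exists2 c, c \in s & UU [set n | x n = c].
Proof.
elim: s => [/UU_ex[n] //|c s IH] h.
have [h1|/UU_not h1] := EM (UU [set n | x n = c]); first by exists c; rewrite ?mem_head.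
have [|d ds hd] := IH; last by exists d; rewrite // inE ds orbT.
apply: UU_imp (UU_and h h1) => n /= []; rewrite inE => /orP[/eqP -> //|//].
Qed.

Lemma UU_compact (T : topologicalType) (K : set T) (x : nat -> T) : compact K ->
  UU [set n | K (x n)] -> exists2 y, K y & forall B, nbhs y B -> UU [set n | B (x n)].
Proof.
move=> cK hx; have [|y [Ky hy]] := cK (x @ UU) _; first exact: hx.
exists y => // B hB; apply: contrapT => /UU_not h.
by have [z [h1 h2]] := hy _ _ (h : (x @ UU) (~` B)) hB.
Qed.

Variable R : realType.
Implicit Types (u v : nat -> R) (a b l : R).

Definition ucv u l := forall e, 0 < e -> UU [set n | `|u n - l| < e].

Lemma ucvE u l : ucv u l <-> u @ UU --> l.
Proof.
split=> h.
  by apply/cvgrPdist_lt => e e0; apply: UU_imp (h e e0) => n /=; rewrite distrC.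
by move=> e e0; move/cvgrPdist_lt: h => /(_ e e0); apply: UU_imp => n /=; rewrite distrC.
Qed.

Lemma ucv_ex u a : UU [set n | `|u n| <= a] -> exists2 l, `|l| <= a & ucv u l.
Proof.
move=> h; have [||l hl hB] := @UU_compact R `[- a, a]%classic u.
- exact: segment_compact.
- by apply: UU_imp h => n /=; rewrite in_itv /= -ler_norml.
exists l; first by move: hl; rewrite /= in_itv /= -ler_norml.
move=> e e0; have := hB (ball l e) (nbhsx_ballx l e e0).
by apply: UU_imp => n /=; rewrite /ball /= distrC.
Qed.

Lemma ucv_cst a : ucv (fun=> a) a.
Proof. by apply/ucvE; apply: cvg_cst. Qed.

Lemma ucv_eq u v l : UU [set n | u n = v n] -> ucv u l -> ucv v l.
Proof. by move=> h hu e e0; apply: UU_imp (UU_and h (hu e e0)) => n /= [<-]. Qed.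

Lemma ucvD u v a b : ucv u a -> ucv v b -> ucv (fun n => u n + v n) (a + b).
Proof. by move=> /ucvE hu /ucvE hv; apply/ucvE; apply: cvgD. Qed.

Lemma ucvB u v a b : ucv u a -> ucv v b -> ucv (fun n => u n - v n) (a - b).
Proof. by move=> /ucvE hu /ucvE hv; apply/ucvE; apply: cvgB. Qed.

Lemma ucvM u v a b : ucv u a -> ucv v b -> ucv (fun n => u n * v n) (a * b).
Proof. by move=> /ucvE hu /ucvE hv; apply/ucvE; apply: cvgM. Qed.

Lemma ucvV u a : a != 0 -> ucv u a -> ucv (fun n => (u n)^-1) a^-1.
Proof. by move=> a0 /ucvE hu; apply/ucvE; apply: cvgV. Qed.

Lemma ucv_cont (g : R -> R) u a : {for a, continuous g} -> ucv u a -> ucv (fun n => g (u n)) (g a).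
Proof. by move=> hg /ucvE hu; apply/ucvE; exact: (cvg_comp _ _ hu hg). Qed.

Lemma ucv_sqrt u a : ucv u a -> ucv (fun n => Num.sqrt (u n)) (Num.sqrt a).
Proof. by apply: ucv_cont; exact: sqrt_continuous. Qed.

Lemma ucv_le u v a b : ucv u a -> ucv v b -> UU [set n | u n <= v n] -> a <= b.
Proof.
move=> hu hv h; rewrite leNgt; apply/negP => ba.
have e0 : 0 < (a - b) / 2 by rewrite divr_gt0 // subr_gt0.
have [n /= [[h1 h2] h3]] := UU_ex (UU_and (UU_and (hu _ e0) (hv _ e0)) h).
by move: h1 h2; rewrite !ltr_norml => /andP[? ?] /andP[? ?]; light_lra.
Qed.

Lemma ucv_uniq u a b : ucv u a -> ucv u b -> a = b.
Proof.
by move=> ha hb; apply/eqP; rewrite eq_le (ucv_le ha hb) ?(ucv_le hb ha) //; apply: UU_all => n /=.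
Qed.

Lemma ucv_lt u a b : ucv u a -> a < b -> UU [set n | u n < b].
Proof.
move=> hu ab; have e0 : 0 < b - a by rewrite subr_gt0.
by apply: UU_imp (hu _ e0) => n /=; rewrite ltr_norml => /andP[_]; rewrite ltrBlDr subrK.
Qed.

Lemma ucv_gt u a b : ucv u a -> b < a -> UU [set n | b < u n].
Proof.
move=> hu ab; have e0 : 0 < a - b by rewrite subr_gt0.
by apply: UU_imp (hu _ e0) => n /=; rewrite ltr_norml => /andP[h _]; move: h; light_lra.
Qed.

Lemma ucv_squeeze u v l : ucv v 0 -> UU [set n | `|u n - l| <= v n] -> ucv u l.
Proof.
move=> hv h e e0; apply: UU_imp (UU_and h (ucv_lt hv e0)) => n /= [h1 h2].
exact: le_lt_trans h1 h2.
Qed.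

Lemma ucv_inv_nat : ucv (fun n => n.+1%:R^-1) 0.
Proof.
move=> e e0; have [m hm] : exists m : nat, e^-1 < m%:R.
  by exists (Num.bound e^-1); apply: archi_boundP; rewrite invr_ge0 ltW.
apply: UU_imp (UU_ge m) => n /= mn; rewrite subr0 gtr0_norm ?invr_gt0 ?ltr0n //.
rewrite invf_plt ?posrE // ?ltr0n //; apply: lt_le_trans hm _.
by rewrite ler_nat (leq_trans mn).
Qed.

Lemma nbhs_edist (y : pt R) e : 0 < e -> nbhs y [set z | edist z y < e].
Proof.
(* Neighbourhoods come from the sup norm, and half the radius suffices because sqrt 3 < 2. *)
move=> e0; apply/nbhs_ballP; exists (e / 2) => /=; first by rewrite divr_gt0.
move=> z hz /=.
have e2 : 0 <= e / 2 by rewrite divr_ge0 // ltW.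
have cl i : (z ord0 i - y ord0 i) ^+ 2 <= (e / 2) ^+ 2.
  have [_ /(_ ord0 i) h] := hz.
  apply: sqr_le_itv; rewrite -ler_norml distrC; apply: ltW.
  by move: h; rewrite /ball /=.
apply: ltr_sqr_abs; first exact: ltW.
rewrite edist_sqr; have := cl (@Ordinal 3 0 isT); have := cl (@Ordinal 3 1 isT).
have := cl (@Ordinal 3 2 isT); rewrite -!/(px _) -!/(py _) -!/(pz _) => h1 h2 h3.
have : 0 < e ^+ 2 by rewrite exprn_gt0.
by move: h1 h2 h3; rewrite exprMn exprVn; light_lra.
Qed.

Definition ucvp (x : nat -> pt R) (y : pt R) := ucv (fun n => edist (x n) y) 0.

Lemma ucvp_ex (S : set (pt R)) (x : nat -> pt R) : compact S -> UU [set n | S (x n)] ->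
  exists2 y, S y & ucvp x y.
Proof.
move=> cS hx; have [y Sy hy] := UU_compact cS hx; exists y => // e e0.
apply: UU_imp (hy _ (nbhs_edist y e0)) => n /=.
by rewrite subr0 ger0_norm ?edist_ge0.
Qed.

End Ultra.

(** * The Jordan curve theorem *)

Section Crossing.

(** A discrete winding number: labels are coarse directions, and [inc] counts the signed quarter
    turns between labels that are not opposite. *)
Inductive dir := dE | dN | dW | dS.
Definition opp (a b : dir) : bool :=
  match a, b with dE, dW | dW, dE | dN, dS | dS, dN => true | _, _ => false end.
Definition inc (a b : dir) : int :=
  match a, b with
  | dE, dN | dN, dW | dW, dS | dS, dE => 1
  | dN, dE | dW, dN | dS, dW | dE, dS => -1
  | _, _ => 0 end.

(** Pairwise non-opposite labels take at most two adjacent values, and so cannot wind. *)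
Lemma inc_square a b c d : ~~ opp a b -> ~~ opp a c -> ~~ opp a d -> ~~ opp b c ->
  ~~ opp b d -> ~~ opp c d -> inc a b + inc b c = inc a d + inc d c.
Proof. by case: a; case: b; case: c; case: d. Qed.

(** On a side of the grid where one label never occurs the angle has a lift [pot], and the
    increments telescope. *)
Lemma inc_potential (pot : dir -> int) (l : nat -> dir) n :
  (forall i, (i < n)%N -> inc (l i) (l i.+1) = pot (l i.+1) - pot (l i)) ->
  \sum_(i < n) inc (l i) (l i.+1) = pot (l n) - pot (l 0%N).
Proof.
elim: n => [|n IH] h; first by rewrite big_ord0 subrr.
by rewrite big_ord_recr /= IH ?h // => [|i hi]; [rewrite addrC subrKA | apply: h; exact: leqW].
Qed.

(** Discrete Stokes: summing the relation over all cells leaves the two boundary paths between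
    opposite corners. *)
Lemma inc_grid (l : nat -> nat -> dir) n m :
  (forall i j, (i < n)%N -> (j < m)%N ->
     inc (l i j) (l i j.+1) + inc (l i j.+1) (l i.+1 j.+1) =
     inc (l i j) (l i.+1 j) + inc (l i.+1 j) (l i.+1 j.+1)) ->
  \sum_(j < m) inc (l 0%N j) (l 0%N j.+1) + \sum_(i < n) inc (l i m) (l i.+1 m) =
  \sum_(i < n) inc (l i 0%N) (l i.+1 0%N) + \sum_(j < m) inc (l n j) (l n j.+1).
Proof.
elim: n => [|n IH] h; first by rewrite !big_ord0 addr0 add0r.
have row : \sum_(j < m) inc (l n j) (l n j.+1) + inc (l n m) (l n.+1 m) =
    inc (l n 0%N) (l n.+1 0%N) + \sum_(j < m) inc (l n.+1 j) (l n.+1 j.+1).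
  have : forall j, (j < m)%N -> inc (l n j) (l n j.+1) + inc (l n j.+1) (l n.+1 j.+1) =
     inc (l n j) (l n.+1 j) + inc (l n.+1 j) (l n.+1 j.+1) by move=> j hj; apply: h.
  elim: (m) => [|k IHk] hk; first by rewrite !big_ord0 addr0 add0r.
  rewrite !big_ord_recr /= -addrA hk // addrA IHk ?addrA // => j hj.
  by apply: hk; exact: leqW.
rewrite !big_ord_recr /= addrA IH; last by move=> i j hi hj; apply: h => //; exact: leqW.
by rewrite -!addrA row.
Qed.

(** Lifts of the angle in quarter turns, one per side of the grid. [pot0], [potm], [pot00], [potn]
    serve sides without dS, dE, dW, dN respectively; their value at that label is a dummy. *)
Definition pot0 (d : dir) : int := match d with dN => 1 | dW => 2 | _ => 0 end.
Definition potm (d : dir) : int := match d with dE => 0 | dN => 1 | dW => 2 | dS => 3 end.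
Definition pot00 (d : dir) : int := match d with dN => 1 | dS => -1 | _ => 0 end.
Definition potn (d : dir) : int := match d with dE => 4 | dN => 0 | dW => 2 | dS => 3 end.

(* The labels would wind once around along the boundary of the grid. *)
Lemma winding (l : nat -> nat -> dir) n m :
  (forall i j i' j', (i <= i' <= i.+1)%N -> (i' <= n)%N ->
     (j <= j' <= j.+1)%N || (j' <= j <= j'.+1)%N -> (j <= m)%N -> (j' <= m)%N ->
     ~~ opp (l i j) (l i' j')) ->
  (forall j, (j <= m)%N -> l 0%N j <> dS) -> (forall j, (j <= m)%N -> l n j <> dN) ->
  (forall i, (i <= n)%N -> l i 0%N <> dW) -> (forall i, (i <= n)%N -> l i m <> dE) -> False.
Proof.
move=> ho h0 hn k0 km.
have hs i j : (i < n)%N -> (j < m)%N ->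
     inc (l i j) (l i j.+1) + inc (l i j.+1) (l i.+1 j.+1) =
     inc (l i j) (l i.+1 j) + inc (l i.+1 j) (l i.+1 j.+1).
  move=> hi hj; have hj' := ltnW hj; have hi' := ltnW hi.
  by apply: inc_square; apply: ho; rewrite ?leqnn ?leqnSn ?orbT.
have G := inc_grid hs.
have E1 : \sum_(j < m) inc (l 0%N j) (l 0%N j.+1) = pot0 (l 0%N m) - pot0 (l 0%N 0%N).
  apply: inc_potential => j hj.
  have : ~~ opp (l 0%N j) (l 0%N j.+1) by apply: ho; rewrite ?leqnn ?leqnSn // ltnW.
  by have := h0 j (ltnW hj); have := h0 j.+1 hj; case: (l 0%N j); case: (l 0%N j.+1).
have E2 : \sum_(i < n) inc (l i m) (l i.+1 m) = potm (l n m) - potm (l 0%N m).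
  apply: (@inc_potential potm (fun i => l i m)) => i hi.
  have : ~~ opp (l i m) (l i.+1 m) by apply: ho; rewrite ?leqnn ?leqnSn.
  by have := km i (ltnW hi); have := km i.+1 hi; case: (l i m); case: (l i.+1 m).
have E3 : \sum_(i < n) inc (l i 0%N) (l i.+1 0%N) = pot00 (l n 0%N) - pot00 (l 0%N 0%N).
  apply: (@inc_potential pot00 (fun i => l i 0%N)) => i hi.
  have : ~~ opp (l i 0%N) (l i.+1 0%N) by apply: ho; rewrite ?leqnn ?leqnSn.
  by have := k0 i (ltnW hi); have := k0 i.+1 hi; case: (l i 0%N); case: (l i.+1 0%N).
have E4 : \sum_(j < m) inc (l n j) (l n j.+1) = potn (l n m) - potn (l n 0%N).
  apply: inc_potential => j hj.
  have : ~~ opp (l n j) (l n j.+1) by apply: ho; rewrite ?leqnn ?leqnSn // ltnW.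
  by have := hn j (ltnW hj); have := hn j.+1 hj; case: (l n j); case: (l n j.+1).
move: G; rewrite E1 E2 E3 E4.
have := h0 0%N (leq0n _); have := h0 m (leqnn _); have := hn 0%N (leq0n _); have := hn m (leqnn _).
have := k0 0%N (leq0n _); have := k0 n (leqnn _); have := km 0%N (leq0n _); have := km n (leqnn _).
by case: (l 0%N 0%N); case: (l 0%N m); case: (l n 0%N); case: (l n m) => // *; congruence.
Qed.

Variable R : realType.
Implicit Types (a b z w : R * R) (e : R).

Definition close e a b := (`|a.1 - b.1| <= e) && (`|a.2 - b.2| <= e).

Lemma closeC e a b : close e a b = close e b a.
Proof. by rewrite /close distrC [X in _ && (X <= _)]distrC. Qed.

Lemma close_tri e e' a b c : close e a b -> close e' b c -> close (e + e') a c.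
Proof.
move=> /andP[h1 h2] /andP[h3 h4]; rewrite /close.
by rewrite (le_trans (ler_distD b.1 _ _) (lerD h1 h3)) (le_trans (ler_distD b.2 _ _) (lerD h2 h4)).
Qed.

Lemma close_le e e' a b : e <= e' -> close e a b -> close e' a b.
Proof. by move=> h /andP[h1 h2]; rewrite /close !(le_trans _ h). Qed.

Definition lab e a b : dir :=
  if e < a.1 - b.1 then dE else if a.1 - b.1 < - e then dW
  else if e < a.2 - b.2 then dN else dS.

Lemma labP e a b : (e < `|a.1 - b.1|) || (e < `|a.2 - b.2|) ->
  match lab e a b with
  | dE => e < a.1 - b.1 | dW => a.1 - b.1 < - e
  | dN => e < a.2 - b.2 | dS => a.2 - b.2 < - e end.
Proof.
rewrite /lab !ltr_normr; case: (ltP e (a.1 - b.1)) => // h1.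
case: (ltP (a.1 - b.1) (- e)) => // h2; case: (ltP e (a.2 - b.2)) => // h3 /=.
by rewrite ltrNr ltNge h2 /= ltrNr.
Qed.

(** If the chains stayed apart, the direction from b_j to a_i would label a grid. The extremal
    positions of the four ends exclude one label on each side, and [winding] gives the
    contradiction. *)
Lemma crossing_chains e (x y : R * R) (s t : seq (R * R)) :
  0 <= e -> path (close e) x s -> path (close e) y t ->
  (forall a, a \in x :: s -> y.1 <= a.1 <= (last y t).1) ->
  (forall b, b \in y :: t -> (last x s).2 <= b.2 <= x.2) ->
  exists a b, [/\ a \in x :: s, b \in y :: t & close e a b].
Proof.
move=> e0 ps pt ha hb; apply: contrapT => hn.
have far a b : a \in x :: s -> b \in y :: t -> (e < `|a.1 - b.1|) || (e < `|a.2 - b.2|).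
  move=> h1 h2; rewrite !ltNge -negb_and; apply/negP => h3; apply: hn; exists a, b; split=> //.
pose p i := nth x (x :: s) i; pose q j := nth y (y :: t) j.
have pin i : (i <= size s)%N -> p i \in x :: s by move=> h; apply: mem_nth.
have qin j : (j <= size t)%N -> q j \in y :: t by move=> h; apply: mem_nth.
have pl : p (size s) = last x s by rewrite /p -[size s]/(size (x :: s)).-1 nth_last.
have ql : q (size t) = last y t by rewrite /q -[size t]/(size (y :: t)).-1 nth_last.
have pst i : (i < size s)%N -> close e (p i) (p i.+1) by move=> h; exact: (pathP x ps).
have qst j : (j < size t)%N -> close e (q j) (q j.+1) by move=> h; exact: (pathP y pt).
have st0 a : close e a a by rewrite /close !subrr normr0 e0.
have step_p i i' : (i <= i' <= i.+1)%N -> (i' <= size s)%N -> close e (p i) (p i').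
  move=> /andP[h1 h2] h3; move: h1; rewrite leq_eqVlt => /orP[/eqP ->|h1]; first exact: st0.
  have e' : i' = i.+1 by apply/eqP; rewrite eqn_leq h2.
  by rewrite e'; apply: pst; rewrite -e'.
have step_q j j' : (j <= j' <= j.+1)%N -> (j' <= size t)%N -> close e (q j) (q j').
  move=> /andP[h1 h2] h3; move: h1; rewrite leq_eqVlt => /orP[/eqP ->|h1]; first exact: st0.
  have e' : j' = j.+1 by apply/eqP; rewrite eqn_leq h2.
  by rewrite e'; apply: qst; rewrite -e'.
apply: (@winding (fun i j => lab e (p i) (q j)) (size s) (size t)).
- move=> i j i' j' hi hi' hj hjt hjt'.
  have his : (i <= size s)%N by case/andP: hi => h _; exact: leq_trans h hi'.
  have cp := step_p _ _ hi hi'.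
  have cq : close e (q j) (q j') by case/orP: hj => h; [exact: step_q | rewrite closeC; exact: step_q].
  have f1 := far _ _ (pin _ his) (qin _ hjt); have f2 := far _ _ (pin _ hi') (qin _ hjt').
  (* Both points move by at most e, so a difference of coordinates changes by at most 2 e and cannot
     pass from above e to below -e. *)
  move: (labP f1) (labP f2) cp cq; rewrite /close !ler_norml.
  move=> g1 g2 /andP[/andP[? ?] /andP[? ?]] /andP[/andP[? ?] /andP[? ?]]; move: g1 g2.
  by case: (lab e (p i) (q j)) => //; case: (lab e (p i') (q j')) => // *; exfalso; light_lra.
- move=> j hj; have := labP (far _ _ (pin 0%N isT) (qin _ hj)); have := hb _ (qin _ hj).
  rewrite -[p 0%N]/x; case: (lab _ _ _) => // /andP[? ?] ? _; light_lra.
- move=> j hj; have := labP (far _ _ (pin _ (leqnn _)) (qin _ hj)); have := hb _ (qin _ hj).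
  rewrite -pl; case: (lab _ _ _) => // /andP[? ?] ? _; light_lra.
- move=> i hi; have := labP (far _ _ (pin _ hi) (qin 0%N isT)); have := ha _ (pin _ hi).
  rewrite -[q 0%N]/y; case: (lab _ _ _) => // /andP[? ?] ? _; light_lra.
- move=> i hi; have := labP (far _ _ (pin _ hi) (qin _ (leqnn _))); have := ha _ (pin _ hi).
  rewrite -ql; case: (lab _ _ _) => // /andP[? ?] ? _; light_lra.
Qed.

End Crossing.

(** * Chains, normalised arcs and escape from the box *)

Section Jordan.
Variable R : realType.
Implicit Types (a b z w x y : R * R) (e g : R -> R * R) (d r s t : R).

Lemma half_pos d : 0 < d -> 0 < d / 2.
Proof. by move=> h; rewrite divr_gt0. Qed.

(** Finite chains of step [d] play the role of paths; these are what [crossing_chains] can rule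
    out. *)
Definition conn (A : set (R * R)) d x y :=
  exists p : seq (R * R), [/\ path (close d) x p, last x p = y & forall z, z \in x :: p -> A z].

Lemma conn_refl A d x : A x -> conn A d x x.
Proof. by move=> h; exists [::]; split=> // z; rewrite inE => /eqP ->. Qed.

Lemma conn_trans A d x y z : conn A d x y -> conn A d y z -> conn A d x z.
Proof.
move=> [p [h1 h2 h3]] [q [k1 k2 k3]]; exists (p ++ q); split.
- by rewrite cat_path h1 h2.
- by rewrite last_cat h2.
- move=> w; rewrite -cat_cons mem_cat => /orP[/h3 //|hw]; apply: k3.
  by rewrite inE hw orbT.
Qed.

Lemma conn_step A d x y : A x -> A y -> close d x y -> conn A d x y.
Proof. by move=> hx hy h; exists [:: y]; split=> /=; rewrite ?h // => z; rewrite !inE => /orP[] /eqP ->. Qed.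

Lemma conn_sub (A B : set (R * R)) d x y : (forall z, A z -> B z) -> conn A d x y -> conn B d x y.
Proof. by move=> h [p [h1 h2 h3]]; exists p; split=> // z /h3 /h. Qed.

Lemma conn_sym A d x y : conn A d x y -> conn A d y x.
Proof.
move=> [p []]; elim: p x => [|u p IH] x /=; first by move=> _ <- h; apply: conn_refl; apply: h; rewrite mem_head.
move=> /andP[xu pu] l h; apply: (@conn_trans _ _ _ u).
  by apply: IH => // z hz; apply: h; rewrite inE hz orbT.
by apply: conn_step; [apply: h; rewrite !inE eqxx orbT | apply: h; rewrite mem_head | rewrite closeC].
Qed.

Definition ucont e := forall d, 0 < d -> exists2 r : R, 0 < r &
  forall s t, 0 <= s <= 1 -> 0 <= t <= 1 -> `|s - t| < r -> close d (e s) (e t).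

Lemma conn_path e d : ucont e -> 0 < d ->
  conn [set z | exists2 t : R, 0 <= t <= 1 & z = e t] d (e 0) (e 1).
Proof.
move=> he d0; have [r r0 hr] := he d d0.
pose m := Num.bound r^-1.
have hm : r^-1 < m%:R by apply: archi_boundP; rewrite invr_ge0 ltW.
have m0 : 0 < m%:R :> R by apply: lt_trans hm; rewrite invr_gt0.
have step k : (k <= m)%N -> conn [set z | exists2 t : R, 0 <= t <= 1 & z = e t] d (e 0) (e (k%:R / m%:R)).
  have I j : (j <= m)%N -> 0 <= (j%:R / m%:R : R) <= 1.
    move=> hj; rewrite divr_ge0 //= ?ler0n // ?(ltW m0) // ler_pdivrMr // mul1r ler_nat //.
  elim: k => [|k IH] hk.
    by rewrite mul0r; apply: conn_refl; exists 0; rewrite ?lexx ?ler01.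
  apply: (conn_trans (IH (ltnW hk))); apply: conn_step.
  - by exists (k%:R / m%:R) => //; apply: I; exact: ltnW.
  - by exists (k.+1%:R / m%:R) => //; apply: I.
  - apply: hr; [by apply: I; exact: ltnW | exact: I |].
    have -> : k%:R / m%:R - k.+1%:R / m%:R = - m%:R^-1 :> R.
      by rewrite -mulrBl -[k.+1]addn1 natrD opprD addrA subrr add0r mulN1r.
    by rewrite normrN gtr0_norm ?invr_gt0 // invf_plt ?posrE.
by have := step m (leqnn m); rewrite divff // gt_eqF.
Qed.

Definition seg a b t : R * R := (a.1 + t * (b.1 - a.1), a.2 + t * (b.2 - a.2)).

Lemma seg0 a b : seg a b 0 = a.
Proof. by rewrite /seg !mul0r !addr0; case: a. Qed.

Lemma seg1 a b : seg a b 1 = b.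
Proof. by rewrite /seg !mul1r; case: a; case: b => ? ? ? ? /=; congr (_, _); ring. Qed.

Lemma ucont_lip e C : 0 < C -> (forall s t, 0 <= s <= 1 -> 0 <= t <= 1 -> close (C * `|s - t|) (e s) (e t)) -> ucont e.
Proof.
move=> C0 h d d0; exists (d / C); first by rewrite divr_gt0.
move=> s t hs ht; rewrite ltr_pdivlMr // mulrC => hd.
by apply: close_le (h _ _ hs ht); exact: ltW.
Qed.

Lemma ucont_seg a b : ucont (seg a b).
Proof.
pose C : R := 1 + `|b.1 - a.1| + `|b.2 - a.2|.
have C0 : 0 < C by rewrite /C -addrA ltr_pwDl // addr_ge0.
apply: (ucont_lip C0) => s t _ _; rewrite /close /seg /=.
have -> : a.1 + s * (b.1 - a.1) - (a.1 + t * (b.1 - a.1)) = (b.1 - a.1) * (s - t) by ring.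
have -> : a.2 + s * (b.2 - a.2) - (a.2 + t * (b.2 - a.2)) = (b.2 - a.2) * (s - t) by ring.
have := normr_ge0 (b.1 - a.1); have := normr_ge0 (b.2 - a.2) => ? ?.
by rewrite !normrM !ler_wpM2r // /C; lra.
Qed.

Definition sub e s t r := e (s + r * (t - s)).

Lemma sub_in s t r : 0 <= s <= 1 -> 0 <= t <= 1 -> 0 <= r <= 1 -> 0 <= s + r * (t - s) <= 1.
Proof. by move=> /andP[? ?] /andP[? ?] /andP[? ?]; apply/andP; split; nra. Qed.

Lemma ucont_sub e s t : ucont e -> 0 <= s <= 1 -> 0 <= t <= 1 -> ucont (sub e s t).
Proof.
move=> he hs ht d d0; have [r r0 hr] := he d d0; exists r => // p q hp hq hpq.
apply: hr; [exact: sub_in | exact: sub_in |].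
have -> : s + p * (t - s) - (s + q * (t - s)) = (p - q) * (t - s) by ring.
rewrite normrM; apply: le_lt_trans hpq; rewrite ler_piMr // ler_norml.
by move: hs ht => /andP[? ?] /andP[? ?]; apply/andP; split; lra.
Qed.

Lemma ucont_ucv e (u : nat -> R) l : ucont e -> (forall n, 0 <= u n <= 1) -> 0 <= l <= 1 -> ucv u l ->
  ucv (fun n => (e (u n)).1) (e l).1 /\ ucv (fun n => (e (u n)).2) (e l).2.
Proof.
move=> he hu hl h; split=> d d0.
  have [r r0 hr] := he _ (half_pos d0).
  apply: UU_imp (h r r0) => n /= hn; have /andP[h1 _] := hr _ _ (hu n) hl hn.
  by apply: le_lt_trans h1 _; lra.
have [r r0 hr] := he _ (half_pos d0).
apply: UU_imp (h r r0) => n /= hn; have /andP[_ h1] := hr _ _ (hu n) hl hn.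
by apply: le_lt_trans h1 _; lra.
Qed.

Lemma ucv_unit (u : nat -> R) : (forall n, 0 <= u n <= 1) -> exists2 l : R, 0 <= l <= 1 & ucv u l.
Proof.
move=> hu; have [|l _ hl] := @ucv_ex R u 1.
  by apply: UU_all => n /=; rewrite ler_norml; have /andP[? ?] := hu n; apply/andP; split; lra.
exists l => //; apply/andP; split.
  by apply: (ucv_le (ucv_cst 0) hl); apply: UU_all => n /=; have /andP[] := hu n.
by apply: (ucv_le hl (ucv_cst 1)); apply: UU_all => n /=; have /andP[] := hu n.
Qed.

(** Compactness: parameters of closer and closer points converge along the ultrafilter to a common
    point of the two curves. *)
Lemma sep g e : ucont g -> ucont e ->
  (forall s t, 0 <= s <= 1 -> 0 <= t <= 1 -> g s <> e t) ->
  exists2 d : R, 0 < d & forall s t, 0 <= s <= 1 -> 0 <= t <= 1 -> ~~ close d (g s) (e t).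
Proof.
move=> hg he hne; apply: contrapT => hn.
have H n : exists st : R * R, [/\ 0 <= st.1 <= 1, 0 <= st.2 <= 1 & close n.+1%:R^-1 (g st.1) (e st.2)].
  apply: contrapT => h; apply: hn; exists n.+1%:R^-1; first by rewrite invr_gt0 ltr0n.
  by move=> s t hs ht; apply/negP => hc; apply: h; exists (s, t).
have [u hu] := choice H.
have hu1 n : 0 <= (u n).1 <= 1 by have [] := hu n.
have hu2 n : 0 <= (u n).2 <= 1 by have [] := hu n.
have [s hs cs] := ucv_unit hu1.
have [t ht ct] := ucv_unit hu2.
have [g1 g2] := ucont_ucv hg hu1 hs cs.
have [e1' e2'] := ucont_ucv he hu2 ht ct.
apply: (hne s t hs ht); rewrite [g s]surjective_pairing [e t]surjective_pairing.
congr (_, _).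
  apply/eqP; rewrite -subr_eq0; apply/eqP; apply: (ucv_uniq (ucvB g1 e1')).
  apply: (ucv_squeeze (@ucv_inv_nat R)); apply: UU_all => n /=; rewrite subr0.
  by have [_ _ /andP[]] := hu n.
apply/eqP; rewrite -subr_eq0; apply/eqP; apply: (ucv_uniq (ucvB g2 e2')).
apply: (ucv_squeeze (@ucv_inv_nat R)); apply: UU_all => n /=; rewrite subr0.
by have [_ _ /andP[]] := hu n.
Qed.

(** An extremal point of the curve subject to a closed condition [P]; [sg] = 1 gives the highest and
    [sg] = -1 the lowest. *)
Lemma top_point e (P : R -> R -> Prop) (sg B : R) t0 : ucont e ->
  (forall t, 0 <= t <= 1 -> sg * (e t).2 <= B) ->
  (forall (u v : nat -> R) (a b : R), ucv u a -> ucv v b -> (forall n, P (u n) (v n)) -> P a b) ->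
  0 <= t0 <= 1 -> P (e t0).1 (e t0).2 ->
  exists t, [/\ 0 <= t <= 1, P (e t).1 (e t).2 &
    forall s, 0 <= s <= 1 -> P (e s).1 (e s).2 -> sg * (e s).2 <= sg * (e t).2].
Proof.
move=> he hB hP ht0 Pt0.
pose E := [set y | exists2 t : R, 0 <= t <= 1 & P (e t).1 (e t).2 /\ y = sg * (e t).2].
have hE : has_sup E.
  split; first by exists (sg * (e t0).2), t0.
  by exists B => _ [t ht [_ ->]]; apply: hB.
have H n : exists t, 0 <= t <= 1 /\ P (e t).1 (e t).2 /\ sup E - n.+1%:R^-1 <= sg * (e t).2.
  have n0 : 0 < n.+1%:R^-1 :> R by rewrite invr_gt0 ltr0n.
  have [_ [t ht [Pt ->]] hlt] := sup_adherent n0 hE.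
  by exists t; split=> //; split=> //; exact: ltW.
have [u hu] := choice H.
have hu1 n : 0 <= u n <= 1 by have [] := hu n.
have [t ht ct] := ucv_unit hu1.
have [c1' c2'] := ucont_ucv he hu1 ht ct.
have Pt : P (e t).1 (e t).2 by apply: hP c1' c2' _ => n; have [_ []] := hu n.
exists t; split=> // s hs Ps.
have h1 : sg * (e s).2 <= sup E by apply: sup_ubound => //; [case: hE | exists s].
apply: le_trans h1 _; rewrite -[sup E]subr0.
apply: (ucv_le (ucvB (ucv_cst (sup E)) (@ucv_inv_nat R)) (ucvM (ucv_cst sg) c2')).
by apply: UU_all => n /=; have [_ []] := hu n.
Qed.

Lemma eps_continuous (f : R -> R) :
  (forall (x : R) d, 0 < d -> exists2 r : R, 0 < r & forall y : R, `|x - y| < r -> `|f x - f y| < d) -> continuous f.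
Proof.
move=> h x; apply/cvgrPdist_lt => d d0; have [r r0 hr] := h x d d0.
near=> y; apply: hr; near: y; apply/nbhs_ballP; exists r => // y.
Unshelve. all: by end_near.
Qed.

(** The 1-Lipschitz retraction onto [a, b]. It turns a function on an interval into a continuous
    function on R. *)
Definition clamp (a b t : R) : R := if t <= a then a else if t <= b then t else b.

Lemma clamp_in (a b t : R) : a <= b -> a <= clamp a b t <= b.
Proof.
move=> ab; rewrite /clamp; case: (leP t a) => h1; first by rewrite lexx.
by case: (leP t b) => h2; rewrite ?lexx ?ab ?h2 ?ltW.
Qed.

Lemma clamp_id (a b t : R) : a <= t <= b -> clamp a b t = t.
Proof.
move=> /andP[h1 h2]; rewrite /clamp h2; case: (leP t a) => // h; apply/eqP.
by rewrite eq_le h1 h.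
Qed.

Lemma clamp_lip (a b s t : R) : a <= b -> `|clamp a b s - clamp a b t| <= `|s - t|.
Proof.
move=> ab; rewrite /clamp; case: (leP s a) => h1; case: (leP t a) => h2; rewrite ?subrr ?normr0 //;
  try (case: (leP s b) => h3); try (case: (leP t b) => h4); rewrite ?subrr ?normr0 //;
  rewrite ler_norml; apply/andP; split;
  move: (ler_norm (s - t)) (ler_norm (- (s - t))); rewrite normrN; lra.
Qed.

Lemma cross0 e : ucont e -> (e 0).1 = -1 -> (e 1).1 = 1 -> exists2 t : R, 0 <= t <= 1 & (e t).1 = 0.
Proof.
move=> he h0 h1; pose f t := (e (clamp 0 1 t)).1.
have cf : continuous f.
  apply: eps_continuous => x d d0; have [r r0 hr] := he _ (half_pos d0).
  exists r => // y hy; have /andP[h _] := hr _ _ (clamp_in x ler01) (clamp_in y ler01) (le_lt_trans (clamp_lip x y ler01) hy).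
  by apply: le_lt_trans h _; lra.
have c0 : clamp 0 1 (0 : R) = 0 by rewrite clamp_id // lexx ler01.
have c1' : clamp 0 1 (1 : R) = 1 by rewrite clamp_id // lexx ler01.
have [||t] := @IVT R f 0 1 0 ler01.
- by apply: continuous_subspaceT.
- have le11 : (-1 : R) <= 1 by lra.
  by rewrite /f c0 c1' h0 h1 (min_l le11) (max_r le11); apply/andP; split; lra.
rewrite in_itv /= => ht; rewrite /f clamp_id // => ft; by exists t.
Qed.

Definition avoid e d := [set z | -1 <= z.1 <= 1 /\ forall t, 0 <= t <= 1 -> ~~ close d z (e t)].

Lemma avoid_le e d d' z : d <= d' -> avoid e d' z -> avoid e d z.
Proof. by move=> h [h1 h2]; split=> // t ht; apply: contra (h2 t ht); exact: close_le. Qed.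

(** The curve [e], cut into a chain of step [d], crosses the strip from left to right, so no chain
    of step [d] can descend through the strip at distance more than [d] from it. *)
Lemma block e d x y : ucont e -> e 0 = (-1, 0) -> e 1 = (1, 0) ->
  (forall t, 0 <= t <= 1 -> -2 <= (e t).2 <= 2) -> 0 < d ->
  conn (avoid e d) d x y -> 2 <= x.2 -> y.2 <= -2 -> False.
Proof.
move=> he h0 h1 hy d0 [p [pp lp hp]] hx2 hy2.
have [q [pq lq hq]] := conn_path he d0.
have [||a [b [ha hb hab]]] := crossing_chains (ltW d0) pp pq.
- move=> a /hp [ha _]; rewrite lq h0 h1 //.
- move=> b /hq [t ht ->]; rewrite lp; have /andP[k1 k2] := hy t ht.
  by rewrite (le_trans hy2 k1) (le_trans k2 hx2).
have [_ ha2] := hp _ ha; have [t ht hbt] := hq _ hb.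
by move: (ha2 t ht); rewrite -hbt hab.
Qed.

(** The clearance is fixed before the step. Connections can then be concatenated, and [block]
    applies with the step equal to the clearance. *)
Definition good e x y := exists2 d0 : R, 0 < d0 & forall d, 0 < d -> conn (avoid e d0) d x y.

Lemma good_path e g : ucont e -> ucont g -> (forall s, 0 <= s <= 1 -> -1 <= (g s).1 <= 1) ->
  (forall s t, 0 <= s <= 1 -> 0 <= t <= 1 -> g s <> e t) -> good e (g 0) (g 1).
Proof.
move=> he hg hin hne; have [d0 d00 hd] := sep hg he hne; exists d0 => // d dp.
apply: conn_sub (conn_path hg dp) => z [s hs ->]; split; first exact: hin.
by move=> t ht; apply: hd.
Qed.

Lemma good_trans e x y z : good e x y -> good e y z -> good e x z.
Proof.
move=> [d1 d10 h1] [d2' d20 h2]; exists (Num.min d1 d2'); first by rewrite lt_min d10.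
move=> d dp; apply: (@conn_trans _ _ _ y).
  by apply: conn_sub (h1 d dp) => w; apply: avoid_le; rewrite ge_min lexx.
by apply: conn_sub (h2 d dp) => w; apply: avoid_le; rewrite ge_min lexx orbT.
Qed.

Lemma good_block e x y : ucont e -> e 0 = (-1, 0) -> e 1 = (1, 0) ->
  (forall t, 0 <= t <= 1 -> -2 <= (e t).2 <= 2) -> good e x y -> 2 <= x.2 -> y.2 <= -2 -> False.
Proof. by move=> he h0 h1 hy [d d0 h]; apply: (block he h0 h1 hy d0 (h d d0)). Qed.

Definition out z := (1 < `|z.1|) || (2 < `|z.2|).

(* An arc of the Jordan curve inside the box, normalised to join (-1, 0) to (1, 0). *)
Record arc e : Prop := mkarc {
  arc_u : ucont e; arc0 : e 0 = (-1, 0); arc1 : e 1 = (1, 0);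
  arc_x : forall t, 0 < t < 1 -> -1 < (e t).1 < 1;
  arc_y : forall t, 0 <= t <= 1 -> `|(e t).2| < 2 }.

Lemma arc_x' e t : arc e -> 0 <= t <= 1 -> -1 <= (e t).1 <= 1.
Proof.
move=> H /andP[t0 t1]; move: t0; rewrite le_eqVlt => /orP[/eqP <-|t0].
  by rewrite (arc0 H) /=; apply/andP; split; lra.
move: t1; rewrite le_eqVlt => /orP[/eqP ->|t1]; first by rewrite (arc1 H) /=; apply/andP; split; lra.
by have /andP[h1 h2] := arc_x H (introT andP (conj t0 t1)); rewrite !ltW.
Qed.

Lemma arc_y' e t : arc e -> 0 <= t <= 1 -> -2 <= (e t).2 <= 2.
Proof. by move=> H ht; rewrite -ler_norml ltW // (arc_y H). Qed.

(** The arc meets the vertical sides of the box only at its ends, at height 0, and never meets the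
    horizontal sides; compactness makes both facts quantitative. *)
Lemma arc_edge e (D : R) : arc e -> 0 < D -> exists2 k : R, 0 < k & forall t, 0 <= t <= 1 ->
  (1 - k <= `|(e t).1| -> `|(e t).2| <= D) /\ `|(e t).2| <= 2 - k.
Proof.
move=> H D0; apply: contrapT => hn.
have Hn n : exists t, 0 <= t <= 1 /\ ((1 - n.+1%:R^-1 <= `|(e t).1| /\ D <= `|(e t).2|) \/
    2 - n.+1%:R^-1 <= `|(e t).2|).
  apply: contrapT => h; apply: hn; exists n.+1%:R^-1; first by rewrite invr_gt0 ltr0n.
  move=> t ht; split=> [h1|]; rewrite leNgt; apply/negP => h2; apply: h; exists t; split=> //.
    by left; split=> //; exact: ltW.
  by right; exact: ltW.
have [u hu] := choice Hn.
have hu1 n : 0 <= u n <= 1 by have [] := hu n.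
have [t ht ct] := ucv_unit hu1.
have [c1' c2'] := ucont_ucv (arc_u H) hu1 ht ct.
have nc : continuous (fun x : R => `|x|) by move=> x; apply: norm_continuous.
have n1 := ucv_cont (nc _) c1'; have n2 := ucv_cont (nc _) c2'.
have inv := @ucv_inv_nat R.
have [hA|/UU_not hA] := EM (UU [set n | 2 - n.+1%:R^-1 <= `|(e (u n)).2|]).
  have := ucv_le (ucvB (ucv_cst 2) inv) n2 hA; rewrite subr0 leNgt.
  by rewrite (arc_y H ht).
have hB : UU [set n | 1 - n.+1%:R^-1 <= `|(e (u n)).1| /\ D <= `|(e (u n)).2|].
  by apply: UU_imp hA => n /= h; have [_ [//|]] := hu n.
have := ucv_le (ucvB (ucv_cst 1) inv) n1 (UU_imp (fun n h => proj1 h) hB).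
have := ucv_le (ucv_cst D) n2 (UU_imp (fun n h => proj2 h) hB).
rewrite subr0; move: (ht) => /andP[]; rewrite le_eqVlt => /orP[/eqP <- _|t0].
  by rewrite (arc0 H) /= normr0 => /(lt_le_trans D0); rewrite ltxx.
rewrite le_eqVlt => /orP[/eqP ->|t1].
  by rewrite (arc1 H) /= normr0 => /(lt_le_trans D0); rewrite ltxx.
have /andP[k1 k2] := arc_x H (introT andP (conj t0 t1)).
by move=> _; rewrite leNgt ltr_norml k1 k2.
Qed.

Section TwoArcs.
Variables (f1 f2 : R -> R * R).
Hypotheses (A1 : arc f1) (A2 : arc f2).
Hypothesis dj : forall s t, 0 < s < 1 -> 0 < t < 1 -> f1 s <> f2 t.

Definition onJ z := exists2 t : R, 0 <= t <= 1 & z = f1 t \/ z = f2 t.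
Definition clear d := [set z | forall w, onJ w -> ~~ close d z w].

Lemma clear_le d d' z : d <= d' -> clear d' z -> clear d z.
Proof. by move=> h h2 w hw; apply: contra (h2 w hw); exact: close_le. Qed.

Definition nearout d w := exists2 w', out w' & close d w w'.

(** Stop the chain just before it first leaves the box. *)
Lemma cut d D z y : conn (clear D) d z y -> out y -> ~~ out z ->
  exists w, [/\ ~~ out w, nearout d w & conn (fun u => clear D u /\ ~~ out u) d z w].
Proof.
move=> [p []]; elim: p z => [|u p IH] z /=; first by move=> _ -> _ ->.
move=> /andP[zu pu] l h oy nz.
have cz : clear D z by apply: h; rewrite mem_head.
have [ou|nu] := boolP (out u).
  by exists z; split=> //; [exists u | apply: conn_refl].
have hu a : a \in u :: p -> clear D a by move=> ha; apply: h; rewrite inE ha orbT.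
have [w [h1 h2 h3]] := IH u pu l hu oy nu.
exists w; split=> //; apply: conn_trans h3; apply: conn_step => //.
by split=> //; apply: hu; rewrite mem_head.
Qed.

Lemma onJ_edge (D : R) : 0 < D -> exists2 k : R, 0 < k & forall z, onJ z ->
  (1 - k <= `|z.1| -> `|z.2| <= D) /\ `|z.2| <= 2 - k.
Proof.
move=> D0; have [k1 k10 h1] := arc_edge A1 D0; have [k2 k20 h2] := arc_edge A2 D0.
have m1 : Num.min k1 k2 <= k1 by rewrite ge_min lexx.
have m2 : Num.min k1 k2 <= k2 by rewrite ge_min lexx orbT.
exists (Num.min k1 k2); first by rewrite lt_min k10.
move: m1 m2; set k := Num.min k1 k2 => m1 m2.
move=> z [t ht [->|->]].
  have [a b] := h1 t ht; split; last by lra.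
  by move=> hh; apply: a; lra.
have [a b] := h2 t ht; split; last by lra.
by move=> hh; apply: a; lra.
Qed.

End TwoArcs.

(** Near a vertical side the curve hugs height 0, and near the top and the bottom it is absent. A
    point close to the boundary of the box and clear of the curve can therefore leave along its
    vertical line, away from height 0. *)
Lemma vertical_exit f1 f2 (D sg : R) : arc f1 -> arc f2 -> 0 < D -> sg = 1 \/ sg = -1 -> exists2 k : R, 0 < k &
  forall w, ~~ out w -> clear f1 f2 D w -> nearout k w -> sg * w.2 <= 0 ->
  forall d, 0 < d -> conn (fun u => clear f1 f2 k u /\ ~~ out u) d w (w.1, - (2 * sg)).
Proof.
move=> A1 A2 D0 hsg; have [k0 k00 hk] := onJ_edge A1 A2 (half_pos D0).
(* [k0] is the width within which the curve has height at most D / 2 near a vertical side. A clear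
   point near (1, 0) or (-1, 0) in abscissa has height above D in absolute value, and the margins k0
   / 4 and D / 8 absorb the errors of closeness. *)
pose k := Num.min (k0 / 4) (D / 8).
have k1 : k <= k0 / 4 by rewrite /k ge_min lexx.
have k2 : k <= D / 8 by rewrite /k ge_min lexx orbT.
have kp : 0 < k by rewrite /k lt_min !divr_gt0.
exists k => // w nw cw [w' ow' cw'] sw d dp.
pose g := seg w (w.1, - (2 * sg)).
have nw12 : -1 <= w.1 <= 1 /\ -2 <= w.2 <= 2.
  by move: nw; rewrite /out negb_or -!leNgt !ler_norml => /andP[].
have [/andP[w11 w12] /andP[w21 w22]] := nw12.
have -> : (w.1, - (2 * sg)) = g 1 by rewrite /g seg1.
have -> : conn (fun u => clear f1 f2 k u /\ ~~ out u) d w (g 1) = conn (fun u => clear f1 f2 k u /\ ~~ out u) d (g 0) (g 1).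
  by rewrite /g seg0.
apply: conn_sub (conn_path (ucont_seg _ _) dp) => _ [t /andP[t0 t1] ->].
have g1E : (seg w (w.1, - (2 * sg)) t).1 = w.1 by rewrite /seg /= subrr mulr0 addr0.
have g2E : -2 <= (seg w (w.1, - (2 * sg)) t).2 <= 2 /\ sg * (seg w (w.1, - (2 * sg)) t).2 <= sg * w.2.
  by rewrite /seg /=; clear - hsg sw w21 w22 t0 t1; case: hsg sw => -> sw; split; [apply/andP; split| |apply/andP; split|]; nra.
set u := seg _ _ _ in g1E g2E *.
have [/andP[u21 u22] su] := g2E.
split; last by rewrite /out negb_or -!leNgt g1E !ler_norml w11 w12 u21 u22.
move=> z Jz; apply/negP; rewrite /close !ler_norml g1E => /andP[/andP[z1 z2] /andP[z3 z4]].
have [za zb] := hk z Jz.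
have [/andP[zb1 zb2]] : - (2 - k0) <= z.2 <= 2 - k0 /\ True by rewrite -ler_norml.
move=> _.
move: cw'; rewrite /close !ler_norml => /andP[/andP[c1' c2'] /andP[c3' c4']].
have Ja : onJ f1 f2 (-1, 0) by exists 0; [rewrite lexx ler01 | left; rewrite (arc0 A1)].
have Jb : onJ f1 f2 (1, 0) by exists 1; [rewrite lexx ler01 | left; rewrite (arc1 A1)].
have side (s : R) : onJ f1 f2 (s, 0) -> - k <= w.1 - s <= k -> (1 - k0 <= `|z.1|) -> False.
  move=> Js /andP[ws1 ws2] hz; have := za hz; rewrite ler_norml => /andP[zz1 zz2].
  have := cw _ Js; rewrite /close /= negb_and => /orP[/negP|]; first by apply; rewrite ler_norml; apply/andP; split; lra_from ws1 ws2 k1 k2 k00 D0 kp.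
  rewrite subr0 ler_norml negb_and -!ltNge => /orP[] h; case: hsg sw su => -> sw su.
  - lra_from h sw su zz1 zz2 z3 z4 k1 k2 D0.
  - lra_from h sw su zz1 zz2 z3 z4 k1 k2 D0.
  - lra_from h sw su zz1 zz2 z3 z4 k1 k2 D0.
  - lra_from h sw su zz1 zz2 z3 z4 k1 k2 D0.
move: ow'; rewrite /out !ltr_normr => /orP[/orP[h|h]|/orP[h|h]].
- have z1k : 1 - k0 <= z.1 by lra_from h z1 z2 c1' c2' k1 kp.
  apply: (side 1) => //; last by apply: le_trans z1k (ler_norm _).
  by apply/andP; split; lra_from h w11 w12 c1' c2' kp.
- have z1k : 1 - k0 <= - z.1 by lra_from h z1 z2 c1' c2' k1 kp.
  apply: (side (-1)) => //; last by rewrite -normrN; apply: le_trans z1k (ler_norm _).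
  by apply/andP; split; lra_from h w11 w12 c1' c2' kp.
- by case: hsg sw su => -> sw su; lra_from h sw su c3' c4' u21 u22 z3 z4 zb1 zb2 k1 k2 kp k00.
- by case: hsg sw su => -> sw su; lra_from h sw su c3' c4' u21 u22 z3 z4 zb1 zb2 k1 k2 kp k00.
Qed.

End Jordan.

(** * A point that cannot escape, and the separation theorem *)

Section JordanPoint.
Variable R : realType.
Implicit Types (z w x y : R * R) (d s t : R).

Definition reach (f1 f2 : R -> R * R) z := exists2 D : R, 0 < D & forall d, 0 < d ->
  exists2 y, out y & conn (clear f1 f2 D) d z y.

Lemma arc_mid (f : R -> R * R) t : arc f -> 0 <= t <= 1 -> (f t).1 = 0 -> 0 < t < 1.
Proof.
move=> A /andP[t0 t1] h; rewrite lt_neqAle t0 andbT lt_neqAle t1 andbT.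
apply/andP; split; apply/eqP => e.
  by move: h; rewrite -e (arc0 A) /=; light_lra.
by move: h; rewrite e (arc1 A) /=; light_lra.
Qed.

Lemma pair_eq (z w : R * R) : z.1 = w.1 -> z.2 = w.2 -> z = w.
Proof. by case: z; case: w => ? ? ? ? /= -> ->. Qed.

Lemma clear_avoid (f1 f2 f : R -> R * R) D d z : (forall t, 0 <= t <= 1 -> onJ f1 f2 (f t)) -> d <= D ->
  clear f1 f2 D z /\ ~~ out z -> avoid f d z.
Proof.
move=> hf dD [cz]; rewrite /out negb_or -!leNgt ler_norml => /andP[hz _]; split=> // t ht.
by apply: contra (cz _ (hf t ht)); exact: close_le.
Qed.

Lemma conn_seg (A : set (R * R)) d x y : 0 < d -> (forall t, 0 <= t <= 1 -> A (seg x y t)) -> conn A d x y.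
Proof.
move=> d0 h; have := conn_path (ucont_seg x y) d0; rewrite seg0 seg1.
by apply: conn_sub => z [t ht ->]; apply: h.
Qed.

Lemma good_seg (e : R -> R * R) x y : ucont e -> (forall s, 0 <= s <= 1 -> -1 <= (seg x y s).1 <= 1) ->
  (forall s t, 0 <= s <= 1 -> 0 <= t <= 1 -> seg x y s <> e t) -> good e x y.
Proof. by move=> he h1 h2; have := good_path he (ucont_seg x y) h1 h2; rewrite seg0 seg1. Qed.

(** Maehara's point: descend the vertical axis to the top of f1, follow f1 to its lowest axis point,
    and stop halfway to the next axis point of f2 below. From there each way out, joined to the
    axis, would bypass f2 or f1. *)
Lemma jordan_point (f1 f2 : R -> R * R) (tl : R) : arc f1 -> arc f2 ->
  (forall s t, 0 < s < 1 -> 0 < t < 1 -> f1 s <> f2 t) ->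
  0 <= tl <= 1 -> (f1 tl).1 = 0 ->
  (forall t, 0 <= t <= 1 -> (f2 t).1 = 0 -> (f2 t).2 <= (f1 tl).2) ->
  exists z0, [/\ ~ onJ f1 f2 z0, ~~ out z0 & ~ reach f1 f2 z0].
Proof.
move=> A1 A2 dj htl ltl top2.
have I01 : 0 <= (0 : R) <= 1 by rewrite lexx ler01.
have I11 : 0 <= (1 : R) <= 1 by rewrite lexx ler01.
have tl' := arc_mid A1 htl ltl.
have ne t s : 0 < t < 1 -> 0 <= s <= 1 -> f1 t <> f2 s.
  move=> ht /andP[]; rewrite le_eqVlt => /orP[/eqP <- _ e|s0].
    by have /andP[] := arc_x A1 ht; rewrite e (arc0 A2) /= ltxx.
  rewrite le_eqVlt => /orP[/eqP -> e|s1]; last by apply: dj; rewrite ?s0.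
  by have /andP[_] := arc_x A1 ht; rewrite e (arc1 A2) /= ltxx.
have cP (u v : nat -> R) (a b : R) : ucv u a -> ucv v b -> (forall n, u n = 0) -> a = 0.
  move=> hu _ h; apply: (ucv_uniq hu); apply: (ucv_eq _ (ucv_cst 0)); exact: UU_all.
have [tm [htm xm lowm]] := @top_point R f1 (fun a _ => a = 0) (-1) 2 tl (arc_u A1)
  (fun t ht => let h := arc_y' A1 ht in ltac:(move: h => /andP[? ?]; light_lra)) cP htl ltl.
have tm' := arc_mid A1 htm xm.
have low1 t : 0 <= t <= 1 -> (f1 t).1 = 0 -> (f1 tm).2 <= (f1 t).2.
  by move=> ht h; have := lowm t ht h; light_lra.
have vseg (a b : R) s : 0 <= s <= 1 -> (seg (0, a) (0, b) s).1 = 0 /\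
    ((seg (0, a) (0, b) s).2 <= Num.max a b /\ Num.min a b <= (seg (0, a) (0, b) s).2).
  move=> /andP[s0 s1]; rewrite /seg /= subrr mulr0 addr0; split=> //.
  by case: (leP a b) => ab; split; nra.
have E f t : (f t).1 = 0 -> f t = (0, (f t).2) :> R * R by move=> <-; rewrite -surjective_pairing.
have g_tl : good f2 (0, 2) (f1 tl).
  rewrite (E _ _ ltl); apply: good_seg; [exact: arc_u A2 | |].
    by move=> s hs; have [-> _] := vseg 2 (f1 tl).2 s hs; apply/andP; split; light_lra.
  move=> s t hs ht e; have [h1 [h2 h3]] := vseg 2 (f1 tl).2 s hs; rewrite e in h1 h2 h3.
  have /andP[_ y2] := arc_y' A1 htl; rewrite (min_r y2) in h3.
  apply: (ne tl t tl' ht); apply: pair_eq; rewrite ?h1 //.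
  by apply/eqP; rewrite eq_le h3 top2.
have g_arc : good f2 (f1 tl) (f1 tm).
  have <- : sub f1 tl tm 0 = f1 tl by rewrite /sub mul0r addr0.
  have <- : sub f1 tl tm 1 = f1 tm by rewrite /sub mul1r addrC subrK.
  apply: good_path; [exact: arc_u A2 | exact: ucont_sub (arc_u A1) htl htm | |].
    by move=> s hs; apply: (arc_x' A1); apply: sub_in.
  move=> s t /andP[s0 s1] ht; apply: ne => //.
  have s1' : 0 <= 1 - s by light_lra.
  move: tl' tm' => /andP[? ?] /andP[? ?]; apply/andP.
  case: (leP tl tm) => ll.
    have ll' : 0 <= tm - tl by light_lra.
    by have := mulr_ge0 s0 ll'; have := mulr_ge0 s1' ll'; split; light_lra.
  have ll' : 0 <= tl - tm by light_lra.
  by have := mulr_ge0 s0 ll'; have := mulr_ge0 s1' ll'; split; light_lra.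
have g_m (y0 : R) : -2 <= y0 -> (forall t, 0 <= t <= 1 -> (f2 t).1 = 0 -> y0 <= (f2 t).2 -> (f1 tm).2 < (f2 t).2) ->
    y0 <= (f1 tm).2 -> good f2 (f1 tm) (0, y0).
  move=> yy hy ym; rewrite (E _ _ xm).
  apply: good_seg; [exact: arc_u A2 | |].
    by move=> s hs; have [-> _] := vseg (f1 tm).2 y0 s hs; apply/andP; split; light_lra.
  move=> s t hs ht e; have [h1 [h2 h3]] := vseg (f1 tm).2 y0 s hs; rewrite e in h1 h2 h3.
  rewrite (min_r ym) in h3; rewrite (max_l ym) in h2.
  by have := hy t ht h1 h3; light_lra.
(* If f2 had no axis point below, then the axis down to f1, the piece of f1 and the rest of the axis
   would cross the box from top to bottom without meeting f2. *)
have [s0 [hs0 xs0 ys0]] : exists s0, [/\ 0 <= s0 <= 1, (f2 s0).1 = 0 & (f2 s0).2 <= (f1 tm).2].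
  apply: contrapT => hn.
  have /andP[ym1 _] := arc_y' A1 htm.
  have g3 : good f2 (f1 tm) (0, -2).
    apply: g_m => // t ht h1 h2; rewrite ltNge; apply/negP => h3.
    by apply: hn; exists t.
  have := good_block (arc_u A2) (arc0 A2) (arc1 A2) (fun t ht => arc_y' A2 ht)
    (good_trans (good_trans g_tl g_arc) g3).
  by apply.
have cP2 (u v : nat -> R) (a b : R) : ucv u a -> ucv v b ->
    (forall n, u n = 0 /\ v n <= (f1 tm).2) -> a = 0 /\ b <= (f1 tm).2.
  move=> hu hv h; split; first by apply: (cP u v a b hu hv) => n; have [] := h n.
  by apply: (ucv_le hv (ucv_cst _)); apply: UU_all => n /=; have [] := h n.
have [tp [htp [xp yp] highp]] := @top_point R f2 (fun a b => a = 0 /\ b <= (f1 tm).2) 1 2 s0 (arc_u A2)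
  (fun t ht => let h := arc_y' A2 ht in ltac:(move: h => /andP[? ?]; light_lra)) cP2 hs0 (conj xs0 ys0).
have high2 t : 0 <= t <= 1 -> (f2 t).1 = 0 -> (f2 t).2 <= (f1 tm).2 -> (f2 t).2 <= (f2 tp).2.
  by move=> ht h1 h2; have := highp t ht (conj h1 h2); rewrite !mul1r.
have pm : (f2 tp).2 < (f1 tm).2.
  rewrite lt_neqAle yp andbT; apply/eqP => e; apply: (ne tm tp tm' htp).
  by apply: pair_eq; rewrite ?xm ?xp.
have /andP[p1 p2] := arc_y' A2 htp; have /andP[m1 m2] := arc_y' A1 htm.
set my := (f1 tm).2 in low1 g_m ys0 cP2 yp highp high2 pm m1 m2; set py := (f2 tp).2 in yp high2 pm p1 p2.
(* Strictly between consecutive axis points of f1 and f2: all axis points of f1 are above it, and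
   those of f2 are either below it or above [my]. *)
pose y0 : R := (my + py) / 2.
have y0m : y0 < my by rewrite /y0; light_lra.
have y0p : py < y0 by rewrite /y0; light_lra.
have no1 t : 0 <= t <= 1 -> (f1 t).1 = 0 -> y0 < (f1 t).2.
  by move=> ht h; apply: lt_le_trans y0m (low1 t ht h).
have no2 t : 0 <= t <= 1 -> (f2 t).1 = 0 -> y0 <= (f2 t).2 -> my < (f2 t).2.
  move=> ht h h2; rewrite ltNge; apply/negP => h3.
  by have := high2 t ht h h3; light_lra.
have nz : ~~ out (0, y0).
  rewrite /out /= normr0 negb_or -!leNgt ler01 ler_norml; clear - y0m y0p p1 p2 m1 m2.
  by apply/andP; split=> //; apply/andP; split; lra.
exists (0, y0); split.
- move=> [t ht [e|e]]; first by have := no1 t ht; rewrite -e /= ltxx => /(_ erefl).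
  by have := no2 t ht; rewrite -e /= lexx => /(_ erefl isT); light_lra.
- exact: nz.
move=> [D D0 hD].
have [k1 k10 v1] := vertical_exit A1 A2 D0 (or_introl erefl : (1 : R) = 1 \/ (1 : R) = -1).
have [k2 k20 v2] := vertical_exit A1 A2 D0 (or_intror erefl : (-1 : R) = 1 \/ (-1 : R) = -1).
have [d1 d10 G1] : good f2 (0, 2) (0, y0).
  apply: good_trans (good_trans g_tl g_arc) _.
  by apply: g_m; [light_lra | exact: no2 | exact: ltW].
have [d2 d20 G2] : good f1 (0, y0) (0, -2).
  apply: good_seg; [exact: arc_u A1 | |].
    by move=> s hs; have [-> _] := vseg y0 (-2) s hs; apply/andP; split; light_lra.
  move=> s t hs ht e; have [h1 [h2 h3]] := vseg y0 (-2) s hs; rewrite e in h1 h2 h3.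
  have l0 : -2 <= y0 by light_lra.
  by rewrite (max_l l0) in h2; have := no1 t ht h1; light_lra.
pose d := Num.min (Num.min k1 k2) (Num.min D (Num.min d1 d2)).
have dk1 : d <= k1 by rewrite /d !ge_min lexx.
have dk2 : d <= k2 by rewrite /d !ge_min lexx orbT.
have dD : d <= D by rewrite /d !ge_min lexx !orbT.
have dd1 : d <= d1 by rewrite /d !ge_min lexx !orbT.
have dd2 : d <= d2 by rewrite /d !ge_min lexx !orbT.
have d0 : 0 < d by rewrite /d !lt_min k10 k20 D0 d10 d20.
have [y oy cy] := hD d d0.
have [w [nw ow cw]] := cut cy oy nz.
have J1 t : 0 <= t <= 1 -> onJ f1 f2 (f1 t) by move=> ht; exists t => //; left.
have J2 t : 0 <= t <= 1 -> onJ f1 f2 (f2 t) by move=> ht; exists t => //; right.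
have clw : clear f1 f2 D w.
  have [p [_ lp hp]] := cw; have hw : w \in (0, y0) :: p by rewrite -lp mem_last.
  by have [] := hp _ hw.
have now k : d <= k -> nearout k w.
  by move=> dk; have [w' h1 h2] := ow; exists w' => //; apply: close_le h2.
(* An exit through the bottom completes the upper connection to a descent avoiding f2; an exit
   through the top completes the lower segment to a descent avoiding f1. *)
have [wy|wy] := leP w.2 0.
  have c3 := v1 w nw clw (now _ dk1); rewrite !mul1r mulr1 in c3.
  have {}c3 := c3 wy d d0.
  apply: (block (arc_u A2) (arc0 A2) (arc1 A2) (fun t ht => arc_y' A2 ht) d0 (x := (0, 2)) (y := (w.1, -2))) => //.
  apply: (conn_trans (y := (0, y0))).
    by apply: conn_sub (G1 d d0) => z; exact: avoid_le.
  apply: (conn_trans (y := w)).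
    by apply: conn_sub cw => z; apply: clear_avoid.
  by apply: conn_sub c3 => z; apply: clear_avoid.
have c3 := v2 w nw clw (now _ dk2).
have wy' : -1 * w.2 <= 0 by lra_from wy.
have {}c3 := c3 wy' d d0; rewrite mulrN1 opprK in c3.
apply: (block (arc_u A1) (arc0 A1) (arc1 A1) (fun t ht => arc_y' A1 ht) d0 (x := (w.1, 2)) (y := (0, -2))) => //.
apply: (conn_trans (y := w)).
  by apply: conn_sym; apply: conn_sub c3 => z; apply: clear_avoid.
apply: (conn_trans (y := (0, y0))).
  by apply: conn_sym; apply: conn_sub cw => z; apply: clear_avoid.
by apply: conn_sub (G2 d d0) => z; exact: avoid_le.
Qed.

Lemma onJ_sym (f1 f2 : R -> R * R) z : onJ f1 f2 z -> onJ f2 f1 z.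
Proof. by move=> [t ht [h|h]]; exists t => //; [right | left]. Qed.

Lemma reach_sym (f1 f2 : R -> R * R) z : reach f1 f2 z -> reach f2 f1 z.
Proof.
move=> [D D0 h]; exists D => // d d0; have [y oy c] := h d d0; exists y => //.
by apply: conn_sub c => u hu w /onJ_sym /hu.
Qed.

Lemma onJ_closed (f1 f2 : R -> R * R) z : ucont f1 -> ucont f2 -> ~ onJ f1 f2 z ->
  exists2 d : R, 0 < d & clear f1 f2 d z.
Proof.
move=> h1 h2 hz.
have uz : ucont (fun=> z) by move=> d d0; exists 1 => // s t _ _ _; rewrite /close !subrr normr0 ltW.
have [s t _ ht e|d1 d10 k1] := sep uz h1; first by apply: hz; exists t => //; left.
have [s t _ ht e|d2 d20 k2] := sep uz h2; first by apply: hz; exists t => //; right.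
exists (Num.min d1 d2); first by rewrite lt_min d10.
have I01 : 0 <= (0 : R) <= 1 by rewrite lexx ler01.
move=> w [t ht [->|->]].
  by apply: contra (k1 0 t I01 ht); apply: close_le; rewrite ge_min lexx.
by apply: contra (k2 0 t I01 ht); apply: close_le; rewrite ge_min lexx orbT.
Qed.

(** V consists of the points from which chains of every step leave the box with a common clearance,
    and V' is the rest of the complement. Openness holds because a small move costs only part of the
    clearance. *)
Lemma jordan_separation (f1 f2 : R -> R * R) : arc f1 -> arc f2 ->
  (forall s t, 0 < s < 1 -> 0 < t < 1 -> f1 s <> f2 t) ->
  exists V V' : set (R * R),
  [/\ forall z, onJ f1 f2 z \/ V z \/ V' z,
      forall z, V z -> ~ V' z /\ ~ onJ f1 f2 z,
      (forall z, V z -> exists2 d : R, 0 < d & forall w, close d z w -> V w) /\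
      (forall z, V' z -> ~ onJ f1 f2 z /\ exists2 d : R, 0 < d & forall w, close d z w -> V' w),
      exists z, V' z & forall z, out z -> V z].
Proof.
move=> A1 A2 dj.
have near_clear (d : R) z w : 0 < d -> clear f1 f2 d z -> close (d / 2) z w -> clear f1 f2 (d / 2) w.
  move=> d0 cz zw v Jv; apply: contra (cz v Jv) => h.
  by have := close_tri zw h; rewrite -splitr.
have segc (d : R) z w e : 0 < d -> 0 < e -> clear f1 f2 d z -> close (d / 2) z w -> conn (clear f1 f2 (d / 2)) e w z.
  move=> d0 e0 cz zw.
  apply: conn_seg => // t /andP[t0 t1].
  apply: near_clear d0 cz _; move: zw; rewrite /close /seg /= !ler_norml.
  by move=> /andP[/andP[? ?] /andP[? ?]]; apply/andP; split; apply/andP; split; nra.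
exists (reach f1 f2), [set z | ~ onJ f1 f2 z /\ ~ reach f1 f2 z]; split.
- move=> z; have [|h1] := EM (onJ f1 f2 z); first by left.
  by have [|h2] := EM (reach f1 f2 z); right; [left | right].
- move=> z hz; split=> [[_]|]; first by [].
  move=> [t ht hJ]; have [D D0 h] := hz; have [y _ [p [_ _ hp]]] := h 1 ltr01.
  have := hp z (mem_head _ _) z; rewrite /close !subrr normr0 (ltW D0) /=.
  by move=> /(_ (ex_intro2 _ _ t ht hJ)).
- split.
  move=> z [D D0 h]; exists (D / 2); first exact: half_pos.
    move=> w zw; exists (D / 2); first exact: half_pos.
    move=> d d0; have [y oy c] := h d d0; exists y => //.
    have cz : clear f1 f2 D z by have [p [_ _ hp]] := c; apply: hp; rewrite mem_head.
    apply: (conn_trans (y := z)); first exact: segc.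
    by apply: conn_sub c => u; apply: clear_le; light_lra.
  move=> z [nJ nr]; split=> //; have [d d0 cz] := onJ_closed (arc_u A1) (arc_u A2) nJ.
  exists (d / 2); first exact: half_pos.
  move=> w zw; have cw := near_clear _ _ _ d0 cz zw; split.
    by move=> Jw; have := cw w Jw; rewrite /close !subrr normr0 (ltW (half_pos d0)).
  move=> [D D0 h]; apply: nr; exists (Num.min D (d / 2)); first by rewrite lt_min D0 half_pos.
  move=> e e0; have [y oy c] := h e e0; exists y => //.
  apply: (conn_trans (y := w)).
    apply: conn_sym; apply: conn_sub (segc d z w e d0 e0 cz zw) => u; apply: clear_le.
    by rewrite ge_min lexx orbT.
  by apply: conn_sub c => u; apply: clear_le; rewrite ge_min lexx.
- have cP (u v : nat -> R) (a b : R) : ucv u a -> ucv v b -> (forall n, u n = 0) -> a = 0.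
    move=> hu _ h; apply: (ucv_uniq hu); apply: (ucv_eq _ (ucv_cst 0)); exact: UU_all.
  have tp f : arc f -> exists t, [/\ 0 <= t <= 1, (f t).1 = 0 &
      forall s, 0 <= s <= 1 -> (f s).1 = 0 -> 1 * (f s).2 <= 1 * (f t).2].
    move=> A; have [||t0 ht0 xt0] := cross0 (arc_u A); rewrite ?(arc0 A) ?(arc1 A) //.
    apply: (@top_point R f (fun a _ => a = 0) 1 2 t0 (arc_u A)) => // t ht.
    by have /andP[] := arc_y' A ht; light_lra.
  have [t1 [ht1 x1 m1]] := tp _ A1; have [t2 [ht2 x2 m2]] := tp _ A2.
  have [h|h] := leP (f2 t2).2 (f1 t1).2.
    have [t ht xt|z [z1 _ z2]] := jordan_point A1 A2 dj ht1 x1; last by exists z.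
    by have := m2 t ht xt; light_lra.
  have [s t hs ht e|t ht xt|z [z1 _ z2]] := jordan_point A2 A1 _ ht2 x2.
  - by apply: (dj t s ht hs).
  - by have := m1 t ht xt; light_lra.
  - by exists z; split=> [/onJ_sym //|/reach_sym].
- move=> z oz; have nJ : ~ onJ f1 f2 z.
    move=> [t ht hz]; move: oz; rewrite /out; suff : `|z.1| <= 1 /\ `|z.2| < 2.
      by move=> [h1 h2]; rewrite ltNge h1 /= ltNge ltW.
    case: hz => ->; split; rewrite ?(arc_y A1) ?(arc_y A2) // ler_norml.
      exact: (arc_x' A1).
    exact: (arc_x' A2).
  have [d d0 cz] := onJ_closed (arc_u A1) (arc_u A2) nJ.
  by exists d => // e e0; exists z => //; apply: conn_refl.
Qed.

End JordanPoint.

(** * Paths along segments and circles, and connectedness of an interval *)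

Section Paths.
Variable R : realType.
Implicit Types (z w p q c : R * R) (d s t r : R).

Definition ucv2 (u : nat -> R * R) z := ucv (fun n => (u n).1) z.1 /\ ucv (fun n => (u n).2) z.2.
Definition cont01 (e : R -> R * R) := forall (u : nat -> R) l,
  (forall n, 0 <= u n <= 1) -> 0 <= l <= 1 -> ucv u l -> ucv2 (fun n => e (u n)) (e l).

Lemma ucv2_cst z : ucv2 (fun=> z) z. Proof. by split; exact: ucv_cst. Qed.

(** Pairs of parameters that violate uniform continuity converge along the ultrafilter to a single
    parameter. *)
Lemma ucont_cont e : cont01 e -> ucont e.
Proof.
move=> he d d0; apply: contrapT => hn.
have H n : exists st : R * R, [/\ 0 <= st.1 <= 1, 0 <= st.2 <= 1, `|st.1 - st.2| <= n.+1%:R^-1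
    & ~~ close d (e st.1) (e st.2)].
  apply: contrapT => h; apply: hn; exists n.+1%:R^-1; first by rewrite invr_gt0 ltr0n.
  by move=> s t hs ht st; apply/negP => /negP hc; apply: h; exists (s, t); split=> //; exact: ltW.
have [u hu] := choice H.
have hu2 n : 0 <= (u n).2 <= 1 by have [] := hu n.
have hu1 n : 0 <= (u n).1 <= 1 by have [] := hu n.
have [s hs cs] := ucv_unit hu1.
have ct : ucv (fun n => (u n).2) s.
  have d1 : ucv (fun n => (u n).1 - (u n).2) 0.
    by apply: (ucv_squeeze (@ucv_inv_nat R)); apply: UU_all => n /=; rewrite subr0; have [] := hu n.
  rewrite -(subr0 s); apply: ucv_eq (ucvB cs d1); apply: UU_all => n /=; ring.
have [g1 g2] := he _ _ hu1 hs cs.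
have [k1 k2] := he _ _ hu2 hs ct.
have [n /= [a1 a2]] := UU_ex (UU_and (ucvB g1 k1 d0) (ucvB g2 k2 d0)).
have [_ _ _ /negP] := hu n; apply; move: a1 a2; rewrite !subrr !subr0 => a1 a2.
by apply/andP; split; exact: ltW.
Qed.

Lemma cont01_seg a b : cont01 (seg a b).
Proof.
move=> u l _ _ h; split; rewrite /seg /=.
  by apply: ucvD; [exact: ucv_cst | apply: ucvM => //; exact: ucv_cst].
by apply: ucvD; [exact: ucv_cst | apply: ucvM => //; exact: ucv_cst].
Qed.

Lemma seg_d2 a b s t : d2 (seg a b s) (seg a b t) = (s - t) ^+ 2 * d2 a b.
Proof. by rewrite /d2 /seg /=; ring. Qed.

Lemma ivt01 (f : R -> R) (v : R) : (forall (u : nat -> R) l,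
  (forall n, 0 <= u n <= 1) -> 0 <= l <= 1 -> ucv u l -> ucv (fun n => f (u n)) (f l)) ->
  f 0 <= v <= f 1 -> exists2 t : R, 0 <= t <= 1 & f t = v.
Proof.
move=> hf hv.
have he : ucont (fun t => (f t, 0)).
  by apply: ucont_cont => u l h1 h2 h3; split=> /=; [exact: hf | exact: ucv_cst].
pose g t := f (clamp 0 1 t).
have cg : continuous g.
  apply: eps_continuous => x d d0; have [r r0 hr] := he _ (half_pos d0).
  exists r => // y hy; have /andP[h _] := hr _ _ (clamp_in x ler01) (clamp_in y ler01) (le_lt_trans (clamp_lip x y ler01) hy).
  by apply: le_lt_trans h _; light_lra.
have c0 : clamp 0 1 (0 : R) = 0 by rewrite clamp_id // lexx ler01.
have c1' : clamp 0 1 (1 : R) = 1 by rewrite clamp_id // lexx ler01.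
have [||t] := @IVT R g 0 1 v ler01.
- by apply: continuous_subspaceT.
- move/andP: hv => [v0 v1]; have le01 := le_trans v0 v1.
  by rewrite /g c0 c1' (min_l le01) (max_r le01) v0.
rewrite in_itv /= => ht; rewrite /g clamp_id // => ft; by exists t.
Qed.

(** Connectedness of [0, 1] for predicates: the indicator of a locally constant predicate is
    continuous and cannot take the value 1/2. *)
Lemma loc_const (C : R -> Prop) : (forall (u : nat -> R) l,
  (forall n, 0 <= u n <= 1) -> 0 <= l <= 1 -> ucv u l -> UU [set n | C (u n) <-> C l]) ->
  C 0 -> C 1.
Proof.
move=> hC h0; apply: contrapT => h1.
pose f t : R := if `[< C t >] then 0 else 1.
have f0 : f 0 = 0 by rewrite /f; case: asboolP.
have f1 : f 1 = 1 by rewrite /f; case: asboolP.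
have [||t ht] := @ivt01 f (2^-1).
- move=> u l hu hl ul; apply: ucv_eq (ucv_cst (f l)); apply: UU_imp (hC _ _ hu hl ul) => n /= e.
  by rewrite /f; congr (if _ then _ else _); apply: asbool_equiv_eq; split=> /e.
- rewrite f0 f1; apply/andP; split; light_lra.
by rewrite /f; case: asboolP => _ hh; exfalso; light_lra.
Qed.

Lemma ucv_d2 (u v : nat -> R * R) z w : ucv2 u z -> ucv2 v w -> ucv (fun n => d2 (u n) (v n)) (d2 z w).
Proof.
move=> [h1 h2] [k1 k2]; rewrite /d2; apply: ucvD; rewrite expr2.
  have := ucvB h1 k1 => h; apply: ucv_eq (ucvM h h); apply: UU_all => n /=; ring.
have := ucvB h2 k2 => h; apply: ucv_eq (ucvM h h); apply: UU_all => n /=; ring.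
Qed.

Lemma d2_ucv (u : nat -> R * R) z : ucv (fun n => d2 (u n) z) 0 -> ucv2 u z.
Proof.
move=> h; have := ucv_sqrt h; rewrite sqrtr0 => {}h.
have A n : `|(u n).1 - z.1| <= Num.sqrt (d2 (u n) z) /\ `|(u n).2 - z.2| <= Num.sqrt (d2 (u n) z).
  by split; rewrite -sqrtr_sqr; apply: ler_wsqrtr; rewrite /d2 ?lerDl ?lerDr sqr_ge0.
by split; apply: (ucv_squeeze h); apply: UU_all => n /=; have [] := A n.
Qed.

Lemma d20 (z w : R * R) : 0 < d2 z w \/ z = w.
Proof.
have := d2_ge0 z w; rewrite le_eqVlt => /orP[/eqP e|]; last by left.
by right; apply: d2_eq0.
Qed.

Lemma seg_cross z z' c (r : R) : r ^+ 2 <= d2 z c -> d2 z' c <= r ^+ 2 ->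
  exists2 t : R, 0 <= t <= 1 & d2 (seg z z' t) c = r ^+ 2.
Proof.
move=> h h'.
have [||t ht e] := @ivt01 (fun t => - d2 (seg z z' t) c) (- r ^+ 2).
- move=> u l hu hl ul.
  have := ucvB (ucv_cst 0) (ucv_d2 (cont01_seg z z' hu hl ul) (ucv2_cst c)).
  by rewrite sub0r; apply: ucv_eq; apply: UU_all => n /=; rewrite sub0r.
- by rewrite seg0 seg1 !lerN2 h h'.
by exists t => //; light_lra.
Qed.

(* [circ] is the squaring map w |-> w^2/|w|^2 in complex notation. *)
Definition circ w : R * R := ((w.1 ^+ 2 - w.2 ^+ 2) / n2 w, 2 * w.1 * w.2 / n2 w).
Definition det w z : R := w.1 * z.2 - w.2 * z.1.

Lemma circ1 w : n2 w != 0 -> n2 (circ w) = 1.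
Proof. by rewrite /circ /n2 /= => h; field. Qed.

(** Doubling the angle forgets only the sign and the length, so equal images come from parallel
    vectors. *)
Lemma circ_det w z : n2 w != 0 -> n2 z != 0 -> circ w = circ z -> det w z = 0.
Proof.
move=> hw hz [e1 e2].
have a1 : (w.1 ^+ 2 - w.2 ^+ 2) * n2 z - (z.1 ^+ 2 - z.2 ^+ 2) * n2 w = 0.
  by apply/eqP; rewrite subr_eq0 -eqr_div // e1.
have a2 : 2 * w.1 * w.2 * n2 z - 2 * z.1 * z.2 * n2 w = 0.
  by apply/eqP; rewrite subr_eq0 -eqr_div // e2.
have : 4 * n2 w * n2 z * det w z ^+ 2 = 0.
  by rewrite (_ : 0 = 0 ^+ 2 + 0 ^+ 2); [rewrite -{1}a1 -{1}a2 /n2 /det; ring | ring].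
move/eqP; rewrite 3!mulf_eq0 (negbTE hw) (negbTE hz) pnatr_eq0 /= sqrf_eq0.
by move/eqP.
Qed.

Lemma circ_sur z : n2 z = 1 -> exists2 w, n2 w != 0 & circ w = z.
Proof.
case: z => a b; rewrite /n2 /= => h.
have [e|e] := eqVneq (1 + a) 0.
  have ae : a = -1 by light_lra.
  have be : b = 0 by apply/eqP; rewrite -sqrf_eq0; apply/eqP; rewrite ae in h; move: h; rewrite sqrrN expr1n; light_lra.
  exists (0, 1); rewrite /circ /n2 /= expr1n expr0n /= add0r ?oner_neq0 //.
  by rewrite ae be add0r !divr1 mulr0 mul0r.
have E : (1 + a) ^+ 2 + b ^+ 2 = 2 * (1 + a) by rewrite !expr2 in h *; light_lra.
have nz : 2 * (1 + a) != 0 by rewrite mulf_neq0 ?pnatr_eq0.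
exists (1 + a, b); rewrite /circ /n2 /= E //; congr (_, _); apply/eqP.
  have -> : (1 + a) ^+ 2 - b ^+ 2 = a * (2 * (1 + a)) by rewrite !expr2 in h *; light_lra.
  by rewrite mulfK.
by rewrite mulrAC divff // mul1r.
Qed.

Lemma circN w : circ (- w.1, - w.2) = circ w.
Proof. by rewrite /circ /n2 /= !sqrrN; congr (_, _ / _); ring. Qed.

Lemma circZ (k : R) w : k != 0 -> circ (k * w.1, k * w.2) = circ w.
Proof.
move=> k0; rewrite /circ /n2 /= !exprMn -!mulrDr -!mulrBr.
have k2 : k ^+ 2 != 0 by rewrite expf_neq0.
congr (_, _); first by rewrite invfM mulrACA divff // mul1r.
rewrite (_ : 2 * (k * w.1) * (k * w.2) = k ^+ 2 * (2 * w.1 * w.2)); last by ring.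
by rewrite invfM mulrACA divff // mul1r.
Qed.

Lemma cont01_circ a b : (forall t, 0 <= t <= 1 -> n2 (seg a b t) != 0) -> cont01 (fun t => circ (seg a b t)).
Proof.
move=> h u l hu hl ul; have [c1' c2'] := cont01_seg a b hu hl ul.
have s1 := ucvM c1' c1'; have s2 := ucvM c2' c2'.
have iv := ucvV (h _ hl) (ucvD s1 s2).
split; rewrite /circ /=.
  exact: (ucvM (ucvB s1 s2) iv).
exact: (ucvM (ucvM (ucvM (ucv_cst 2) c1') c2') iv).
Qed.

Lemma cont01_affine (e : R -> R * R) c r : cont01 e -> cont01 (fun t => (c.1 + r * (e t).1, c.2 + r * (e t).2)).
Proof.
move=> h u l hu hl ul; have [c1' c2'] := h _ _ hu hl ul.
by split=> /=; (apply: ucvD; [exact: ucv_cst | apply: ucvM => //; exact: ucv_cst]).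
Qed.

(** The arc is the [circ] image of a segment, without trigonometry. The sign of the second
    representative is chosen so that the inner product is nonnegative, which keeps the segment away
    from 0. *)
Lemma circle_path c r p q : 0 < r -> d2 p c = r ^+ 2 -> d2 q c = r ^+ 2 -> exists e,
  [/\ cont01 e, e 0 = p, e 1 = q & forall t, 0 <= t <= 1 -> d2 (e t) c = r ^+ 2].
Proof.
move=> r0 hp hq; have rn : r != 0 by rewrite gt_eqF.
pose nm (p : R * R) := ((p.1 - c.1) / r, (p.2 - c.2) / r).
have nm1 p0 : d2 p0 c = r ^+ 2 -> n2 (nm p0) = 1.
  by rewrite /d2 /n2 /nm /= !expr_div_n -mulrDl => ->; rewrite divff // expf_neq0.
have nmK p0 : p0 = (c.1 + r * (nm p0).1, c.2 + r * (nm p0).2).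
  by case: p0 => a b; rewrite /nm /=; congr (_, _); field.
have [w1 n1 e1] := circ_sur (nm1 _ hp).
have [w2 [n2' e2 dt]] : exists w2, [/\ n2 w2 != 0, circ w2 = nm q & 0 <= w1.1 * w2.1 + w1.2 * w2.2].
  have [w2 n2' e2] := circ_sur (nm1 _ hq).
  have [h|h] := leP 0 (w1.1 * w2.1 + w1.2 * w2.2); first by exists w2.
  exists (- w2.1, - w2.2); rewrite circN /n2 /= !sqrrN; split=> //; light_lra.
have nz t : 0 <= t <= 1 -> n2 (seg w1 w2 t) != 0.
  move=> /andP[t0 t1].
  have -> : n2 (seg w1 w2 t) = (1 - t) ^+ 2 * n2 w1 + t ^+ 2 * n2 w2 +
     2 * (t * (1 - t)) * (w1.1 * w2.1 + w1.2 * w2.2) by rewrite /seg /n2 /=; ring.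
  have p1 : 0 < n2 w1 by rewrite lt_def n1 n2_ge0.
  have p2 : 0 < n2 w2 by rewrite lt_def n2' n2_ge0.
  have tt : 0 <= t * (1 - t) by rewrite mulr_ge0 // subr_ge0.
  rewrite lt0r_neq0 //; apply: ltr_wpDr; first by rewrite mulr_ge0 // mulr_ge0.
  have [->|tn] := eqVneq t 0; first by rewrite subr0 expr1n mul1r ltr_pwDl // mulr_ge0 ?sqr_ge0 ?n2_ge0.
  apply: ltr_wpDl; first by rewrite mulr_ge0 ?sqr_ge0 ?n2_ge0.
  by rewrite mulr_gt0 // exprn_gt0 // lt_def tn.
exists (fun t => (c.1 + r * (circ (seg w1 w2 t)).1, c.2 + r * (circ (seg w1 w2 t)).2)); split.
- by apply: cont01_affine; exact: cont01_circ.
- by rewrite seg0 e1 -nmK.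
- by rewrite seg1 e2 -nmK.
- move=> t /nz /circ1; move: (circ _) => k h; rewrite /d2 /= -[RHS]mulr1 -h /n2; ring.
Qed.

End Paths.

(** * Homeomorphisms match complementary discs *)

Section Connected.
Variable R : realType.
Implicit Types (z w p q : R * R).
Variables (S : set (pt R)) (N : set (vec R)) (M M' : vec R -> vec R) (o : vec R).
Hypotheses (sd : SD S N) (H : st N M M' o).

Lemma disc_pt z w c (r : R) : 0 < r -> d2 z c < r ^+ 2 -> d2 w c = r ^+ 2 ->
  forall t, 0 <= t < 1 -> d2 (seg z w t) c < r ^+ 2.
Proof.
move=> r0 hz hw t /andP[t0 t1].
have -> : d2 (seg z w t) c = (1 - t) * d2 z c + t * d2 w c - t * (1 - t) * d2 z w.
  by rewrite /d2 /seg /=; ring.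
rewrite hw; apply: (@le_lt_trans _ _ ((1 - t) * d2 z c + t * r ^+ 2)).
  by rewrite gerBl mulr_ge0 ?d2_ge0 // mulr_ge0 // subr_ge0 ltW.
rewrite -ltrBrDr (_ : r ^+ 2 - t * r ^+ 2 = (1 - t) * r ^+ 2); last by ring.
by rewrite ltr_pM2l // subr_gt0.
Qed.

Lemma disc_seg z w (r : R) t : n2 z < r -> n2 w < r -> 0 <= t <= 1 -> n2 (seg z w t) < r.
Proof.
move=> hz hw /andP[t0 t1].
have -> : n2 (seg z w t) = (1 - t) * n2 z + t * n2 w - t * (1 - t) * d2 z w.
  by rewrite /d2 /n2 /seg /=; ring.
have t1' : 0 <= 1 - t by rewrite subr_ge0.
apply: (@le_lt_trans _ _ ((1 - t) * n2 z + t * n2 w)).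
  by rewrite gerBl mulr_ge0 ?d2_ge0 // mulr_ge0.
have [->|tn] := eqVneq t 0; first by rewrite subr0 mul1r mul0r addr0.
have -> : r = (1 - t) * r + t * r by ring.
apply: ler_ltD; first by rewrite ler_wpM2l // ltW.
by rewrite ltr_pM2l // lt_def tn.
Qed.

(** S in the chart without the circle of the exterior disc. *)
Definition inP z := S (ich M' z) /\ n2 z < 1.

Lemma inPP z : inP z <-> n2 z < 1 /\ forall n, proper N o n -> rad M n ^+ 2 <= d2 z (cen M n).
Proof.
rewrite /inP (st_S sd H); split; first by move=> [[h1 h2] h3]; split=> // n [a b]; exact: h2.
by move=> [h1 h2]; split=> //; split=> [|n a b]; [exact: ltW | apply: h2].
Qed.

Lemma not_inP z : n2 z < 1 -> ~ inP z -> exists2 n, proper N o n & d2 z (cen M n) < rad M n ^+ 2.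
Proof.
move=> z1 /inPP h; apply: contrapT => hn; apply: h; split=> // n pn.
by rewrite leNgt; apply/negP => hh; apply: hn; exists n.
Qed.

Lemma circ_inP n z : proper N o n -> d2 z (cen M n) = rad M n ^+ 2 -> inP z.
Proof.
move=> [a b] e; apply/inPP; split; first by apply: (st_in sd H a b); rewrite e.
move=> m [a' b']; have [->|nm] := EM (m = n); first by rewrite e.
rewrite leNgt; apply/negP => hh.
have e' : d2 z (cen M n) <= rad M n ^+ 2 by rewrite e.
exact: (st_disj sd H a' a b' b nm (ltW hh) e').
Qed.

Lemma proper_uniq n m z : proper N o n -> proper N o m -> d2 z (cen M n) <= rad M n ^+ 2 ->
  d2 z (cen M m) <= rad M m ^+ 2 -> n = m.
Proof. by move=> [a b] [a' b'] h h'; apply: contrapT => nm; exact: (st_disj sd H a a' b b' nm h h'). Qed.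

(** Connectedness of S off one of its circles, stated for locally constant predicates: follow a
    straight segment and replace each passage through a disc by the constant value on its circle. *)
Lemma interior_connected (W : R * R -> Prop) :
  (forall u z, (forall n, inP (u n)) -> inP z -> ucv2 u z -> UU [set n | W (u n) <-> W z]) ->
  forall z w, inP z -> inP w -> W z -> W w.
Proof.
move=> hW z0 w0 pz pw.
have cW n p q : proper N o n -> d2 p (cen M n) = rad M n ^+ 2 -> d2 q (cen M n) = rad M n ^+ 2 -> W p -> W q.
  move=> pn hp hq; have r0 : 0 < rad M n by have [a b] := pn; exact: (st_rad sd H a b).
  have [e [ce <- <- he]] := circle_path r0 hp hq.
  apply: (loc_const (C := fun t => W (e t))) => u l hu hl ul; apply: hW; last exact: ce.
    by move=> k; exact: (circ_inP pn (he _ (hu k))).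
  exact: (circ_inP pn (he _ hl)).
(* [W] extended to the whole open unit disc; a complementary disc takes the common value on its
   circle. *)
pose col z := (inP z /\ W z) \/ exists n, [/\ proper N o n, d2 z (cen M n) < rad M n ^+ 2 &
  forall p, d2 p (cen M n) = rad M n ^+ 2 -> W p].
have colP z : inP z -> (col z <-> W z).
  move=> hz; split; last by left.
  case=> [[]//|[n [pn h _]]]; have /inPP[_ k] := hz.
  by have := k _ pn; rewrite leNgt h.
have colD n z p : proper N o n -> d2 z (cen M n) < rad M n ^+ 2 -> d2 p (cen M n) = rad M n ^+ 2 -> (col z <-> W p).
  move=> pn h hp; split.
    case=> [[/inPP[_ k] _]|[m [pm hm k]]]; first by have := k _ pn; rewrite leNgt h.
    by apply: k; rewrite (proper_uniq pm pn (ltW hm) (ltW h)).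
  by move=> Wp; right; exists n; split=> // q hq; exact: (cW n p q).
have circ_ex n : proper N o n -> exists p, d2 p (cen M n) = rad M n ^+ 2.
  by move=> _; exists ((cen M n).1 + rad M n, (cen M n).2); rewrite /d2 /=; ring.
move=> Wz; apply/(colP _ pw).
rewrite -(seg1 z0 w0).
have : col (seg z0 w0 0) by rewrite seg0; apply/colP.
apply: (loc_const (C := fun t => col (seg z0 w0 t))) => u l hu hl ul.
have z1 t : 0 <= t <= 1 -> n2 (seg z0 w0 t) < 1.
  by move=> ht; apply: disc_seg => //; [have [] := pz | have [] := pw].
have cu := cont01_seg z0 w0 hu hl ul.
have [hl1|hl1] := EM (inP (seg z0 w0 l)).
  (* A point of the segment inside a disc is replaced by a point of the circle of that disc, on the
     way to the limit point. The replacement is no farther from the limit, so convergence is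
     kept. *)
  have Q n : exists p, [/\ inP p, (col (seg z0 w0 (u n)) <-> W p) &
      d2 p (seg z0 w0 l) <= d2 (seg z0 w0 (u n)) (seg z0 w0 l)].
    have [h|/(not_inP (z1 _ (hu n)))[m pm hm]] := EM (inP (seg z0 w0 (u n))).
      by exists (seg z0 w0 (u n)); split=> //; exact: colP.
    have /inPP[_ k] := hl1.
    have [t /andP[t0 t1] e] := seg_cross (k _ pm) (ltW hm).
    exists (seg (seg z0 w0 l) (seg z0 w0 (u n)) t); split.
    - exact: circ_inP e.
    - exact: colD e.
    - rewrite -{2}(seg0 (seg z0 w0 l) (seg z0 w0 (u n))) seg_d2 subr0 d2C ler_piMl ?d2_ge0 //.
      by rewrite expr_le1.
  have [p hp] := choice Q.
  have : UU [set n | W (p n) <-> W (seg z0 w0 l)].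
    apply: hW => // [n|]; first by have [] := hp n.
    apply: d2_ucv; have := ucv_d2 cu (ucv2_cst (seg z0 w0 l)); rewrite d2zz => h.
    apply: (ucv_squeeze h); apply: UU_all => n /=; rewrite subr0 ger0_norm ?d2_ge0 //.
    by have [] := hp n.
  apply: UU_imp => n /= e; have [_ -> _] := hp n; rewrite e; apply: iff_sym; exact: colP.
have [m pm hm] := not_inP (z1 _ hl) hl1.
have [p hp] := circ_ex _ pm.
have := ucv_lt (ucv_d2 cu (ucv2_cst (cen M m))) hm.
apply: UU_imp => n /= hn; rewrite (colD _ _ _ pm hn hp); apply: iff_sym; exact: (colD _ _ _ pm hm hp).
Qed.

End Connected.

(** * Homeomorphisms between the two sets, and charts along limits *)

Section Homeo.
Variable R : realType.
Implicit Types (z w p q : R * R) (x y : pt R).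

Record HM (S S' : set (pt R)) (f g : pt R -> pt R) : Prop := mkHM {
  hm_f : forall x, S x -> S' (f x);
  hm_g : forall y, S' y -> S (g y);
  hm_fK : forall x, S x -> g (f x) = x;
  hm_gK : forall y, S' y -> f (g y) = y;
  hm_cf : forall (x : nat -> pt R) y, (forall n, S (x n)) -> S y -> ucvp x y -> ucvp (fun n => f (x n)) (f y);
  hm_cg : forall (x : nat -> pt R) y, (forall n, S' (x n)) -> S' y -> ucvp x y -> ucvp (fun n => g (x n)) (g y) }.

Lemma HM_sym S S' f g : HM S S' f g -> HM S' S g f.
Proof. by case. Qed.

Lemma ucvp_uniq (x : nat -> pt R) (y z : pt R) : ucvp x y -> ucvp x z -> y = z.
Proof.
move=> h k; apply: edist_eq0; apply/eqP; rewrite eq_le edist_ge0 andbT.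
have := ucvD h k; rewrite addr0 => hk.
apply: (ucv_le (ucv_cst _) hk); apply: UU_all => n /=; rewrite (edistC (x n) y); exact: edist_tri.
Qed.

Lemma HM_intro (S S' : set (pt R)) f g : compact S -> (forall x, S x -> S' (f x)) -> (forall y, S' y -> S (g y)) ->
  (forall x, S x -> g (f x) = x) -> (forall y, S' y -> f (g y) = y) ->
  (forall (x : nat -> pt R) y, (forall n, S (x n)) -> S y -> ucvp x y -> ucvp (fun n => f (x n)) (f y)) ->
  HM S S' f g.
Proof.
move=> cS hf hg fK gK cf; split=> // x y hx hy xy.
have [w Sw cw] := ucvp_ex cS (UU_all (fun n => hg _ (hx n))).
have k := cf _ _ (fun n => hg _ (hx n)) Sw cw.
suff -> : y = f w by rewrite fK.
apply: (ucvp_uniq xy); apply: ucv_eq k; by apply: UU_all => n /=; rewrite gK.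
Qed.

End Homeo.

Section ChartConvergence.
Variable R : realType.
Implicit Types (z w p q : R * R) (x y : pt R).
Variables (S : set (pt R)) (N : set (vec R)) (M M' : vec R -> vec R) (o : vec R).
Hypotheses (sd : SD S N) (H : st N M M' o).

Lemma ucv2_pd (u : nat -> R * R) z : ucv2 u z <-> ucv (fun n => pd (u n) z) 0.
Proof.
split=> [h|h]; first by have := ucv_sqrt (ucv_d2 h (ucv2_cst z)); rewrite d2zz sqrtr0.
apply: d2_ucv; have := ucvM h h; rewrite mulr0; apply: ucv_eq; apply: UU_all => n /=.
by rewrite -expr2 pd_sqr.
Qed.

Lemma ch_ucv (x : nat -> pt R) y : (forall n, S (x n)) -> S y -> ucvp x y -> ucv2 (fun n => ch M (x n)) (ch M y).
Proof.
move=> hx hy h; apply/ucv2_pd; have [C C1 hC] := st_bilip sd H.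
have := ucvM (ucv_cst C) h; rewrite mulr0 => k; apply: (ucv_squeeze k); apply: UU_all => n /=.
by rewrite subr0 ger0_norm ?pd_ge0 //; have [] := hC _ _ (hx n) hy.
Qed.

Lemma ich_ucv (u : nat -> R * R) z : (forall n, S (ich M' (u n))) -> S (ich M' z) -> ucv2 u z ->
  ucvp (fun n => ich M' (u n)) (ich M' z).
Proof.
move=> hx hy /ucv2_pd h; have [C C1 hC] := st_bilip sd H.
have := ucvM (ucv_cst C) h; rewrite mulr0 => k; apply: (ucv_squeeze k); apply: UU_all => n /=.
rewrite subr0 ger0_norm ?edist_ge0 //; have [_] := hC _ _ (hx n) hy.
by rewrite !(ichK _ (st_LT H)).
Qed.

End ChartConvergence.

(** * The similarity that puts a curve into the box *)

Section Normalise.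
Variable R : realType.
Implicit Types (z w p q : R * R).
Variables A B : R * R.
Hypothesis AB : 0 < d2 A B.
Hypothesis AB4 : d2 A B <= 4.
Let v1 := B.1 - A.1.
Let v2 := B.2 - A.2.
Let m1 := (A.1 + B.1) / 2.
Let m2 := (A.2 + B.2) / 2.
Let D := v1 ^+ 2 + v2 ^+ 2.
Let DE : D = d2 A B. Proof. by rewrite /D /d2 /v1 /v2; ring. Qed.
Let D0 : D != 0. Proof. by rewrite DE gt_eqF. Qed.

(* The similarity z |-> 2 (z - (A + B)/2) / (B - A), taking A, B to -1, 1. *)
Definition nrm z : R * R := (2 * (v1 * (z.1 - m1) + v2 * (z.2 - m2)) / D,
  2 * (v1 * (z.2 - m2) - v2 * (z.1 - m1)) / D).
Definition nrm' w : R * R := (m1 + (v1 * w.1 - v2 * w.2) / 2, m2 + (v2 * w.1 + v1 * w.2) / 2).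

Lemma nrmK z : nrm' (nrm z) = z.
Proof.
case: z => a b; rewrite /nrm' /nrm /=; congr (_, _).
  rewrite (_ : v1 * _ - _ = 2 * (a - m1)); first by field.
  by have h := D0; rewrite /D in h *; field.
rewrite (_ : v2 * _ + _ = 2 * (b - m2)); first by field.
by have h := D0; rewrite /D in h *; field.
Qed.

Lemma nrmK' w : nrm (nrm' w) = w.
Proof.
case: w => a b; rewrite /nrm' /nrm /=; congr (_, _); rewrite !(addrC m1) !(addrC m2) !addrK.
  by have h := D0; rewrite /D in h *; field.
by have h := D0; rewrite /D in h *; field.
Qed.

Lemma nrm_A : nrm A = (-1, 0).
Proof.
rewrite /nrm; congr (_, _); last by rewrite /m1 /m2 /v1 /v2 (_ : _ * _ = 0) ?mul0r //; field.
by rewrite (_ : 2 * _ = - D) ?mulNr ?divff // /D /m1 /m2 /v1 /v2; field.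
Qed.

Lemma nrm_B : nrm B = (1, 0).
Proof.
rewrite /nrm; congr (_, _); last by rewrite /m1 /m2 /v1 /v2 (_ : _ * _ = 0) ?mul0r //; field.
by rewrite (_ : 2 * _ = D) ?divff // /D /m1 /m2 /v1 /v2; field.
Qed.

Lemma nrm_dA z : ((nrm z).1 + 1) ^+ 2 + (nrm z).2 ^+ 2 = 4 * d2 z A / D.
Proof. by have h := D0; rewrite /nrm /= /D /v1 /v2 /m1 /m2 /d2 in h *; field. Qed.

Lemma nrm_dB z : ((nrm z).1 - 1) ^+ 2 + (nrm z).2 ^+ 2 = 4 * d2 z B / D.
Proof. by have h := D0; rewrite /nrm /= /D /v1 /v2 /m1 /m2 /d2 in h *; field. Qed.

Lemma nrm_n2 z : n2 (nrm z) = 4 * d2 z (m1, m2) / D.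
Proof. by have h := D0; rewrite /n2 /nrm /= /D /v1 /v2 /m1 /m2 /d2 /= in h *; field. Qed.

Lemma ucv_nrm (u : nat -> R * R) z : ucv2 u z -> ucv2 (fun n => nrm (u n)) (nrm z).
Proof.
move=> [h1 h2]; have k1 := ucvB h1 (ucv_cst m1); have k2 := ucvB h2 (ucv_cst m2).
have C a : @ucv R (fun=> a) a := ucv_cst a.
split; rewrite /nrm /=.
  exact: (ucvM (ucvM (C 2) (ucvD (ucvM (C v1) k1) (ucvM (C v2) k2))) (C D^-1)).
exact: (ucvM (ucvM (C 2) (ucvB (ucvM (C v1) k2) (ucvM (C v2) k1))) (C D^-1)).
Qed.

(** Points no farther from A and from B than |A - B| form a lens. Its normalised height is at most
    sqrt 3, and it touches the vertical sides only at the two ends. *)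
Lemma nrm_box z : d2 z A <= d2 A B -> d2 z B <= d2 A B ->
  [/\ -1 <= (nrm z).1 <= 1, `|(nrm z).2| < 2, (nrm z).1 = -1 -> z = A & (nrm z).1 = 1 -> z = B].
Proof.
move=> hA hB; have Dp : 0 < D by rewrite DE.
have a1 : 4 * d2 z A / D <= 4 by rewrite ler_pdivrMr // ler_pM2l // DE.
have a2 : 4 * d2 z B / D <= 4 by rewrite ler_pdivrMr // ler_pM2l // DE.
rewrite -nrm_dA in a1; rewrite -nrm_dB in a2.
have y0 := sqr_ge0 (nrm z).2.
set x := (nrm z).1 in a1 a2 *; set y := (nrm z).2 in a1 a2 y0 *.
have x0 := sqr_ge0 x.
have x1 : -1 <= x.
  have : 1 - x <= 2 by apply: ler_sqr_abs => //; rewrite !expr2 in a1 a2 y0 *; lra.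
  lra.
have x2 : x <= 1.
  have : x + 1 <= 2 by apply: ler_sqr_abs => //; rewrite !expr2 in a1 a2 y0 *; lra.
  lra.
split.
- by rewrite x1.
- apply: ltr_sqr_abs => //; rewrite real_normK ?num_real // !expr2 in a1 a2 x0 *; lra.
- move=> e; have ye : y = 0.
    by apply/eqP; rewrite -sqrf_eq0 eq_le y0 andbT; move: a2; rewrite e !expr2; lra.
  by rewrite -(nrmK z) -(nrmK A) nrm_A [nrm z]surjective_pairing -/x -/y e ye.
- move=> e; have ye : y = 0.
    by apply/eqP; rewrite -sqrf_eq0 eq_le y0 andbT; move: a1; rewrite e !expr2; lra.
  by rewrite -(nrmK z) -(nrmK B) nrm_B [nrm z]surjective_pairing -/x -/y e ye.
Qed.

(** A point of modulus at least 10 is at distance at least 9 from the midpoint of A and B. Since |A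
    - B| <= 2, [nrm] does not shrink distances, while the box lies within sqrt 5 of the origin. *)
Lemma nrm_far z : n2 A <= 1 -> n2 B <= 1 -> 1 <= n2 z -> out (nrm (10 * z.1, 10 * z.2)).
Proof.
move=> hA hB hz; have Dp : 0 < D by rewrite DE.
rewrite /out; apply: contraT; rewrite negb_or -!leNgt => /andP[h1 h2].
have : n2 (nrm (10 * z.1, 10 * z.2)) <= 5.
  rewrite /n2 -[(_).1 ^+ 2]real_normK ?num_real // -[(_).2 ^+ 2]real_normK ?num_real //.
  have -> : 5 = 1 ^+ 2 + 2 ^+ 2 :> R by ring.
  by apply: lerD; rewrite ler_sqr ?nnegrE.
rewrite nrm_n2 ler_pdivrMr // => h.
have q1 := sqr_ge0 (z.1 - m1); have q2 := sqr_ge0 (z.2 - m2).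
have r1 := sqr_ge0 (A.1 - B.1); have r2 := sqr_ge0 (A.2 - B.2).
have mm : m1 ^+ 2 + m2 ^+ 2 <= 1.
  by move: hA hB; rewrite /n2 /m1 /m2 !expr2 in r1 r2 *; lra.
have : D <= 4 by rewrite DE.
move: h hz; rewrite /d2 /n2 /=; rewrite !expr2 in q1 q2 mm *; lra.
Qed.

End Normalise.

(** * The image of a boundary circle contains a boundary circle *)

Section CircleInto.
Variable R : realType.
Implicit Types (z w p q : R * R) (x y : pt R).
Variables (S : set (pt R)) (N : set (vec R)) (M M' : vec R -> vec R) (o : vec R).
Variables (S1 : set (pt R)) (N1 : set (vec R)) (M1 M1' : vec R -> vec R) (o1 : vec R).
Hypotheses (sd : SD S N) (H : st N M M' o) (sd1 : SD S1 N1) (H1 : st N1 M1 M1' o1).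
Variables f g : pt R -> pt R.
Hypothesis hm : HM S S1 f g.

Let h z := ch M1 (f (ich M' z)).

Lemma circle_S z : n2 z = 1 -> S (ich M' z) /\ lf (X (ich M' z)) o = 0.
Proof.
move=> z1; have e : lf (X (ich M' z)) o = 0.
  apply/eqP; rewrite eq_le; apply/andP; split; first by apply/(st_ext H); rewrite z1.
  by apply/(st_ext' H); rewrite z1.
by split=> //; apply: (sd_circle sd (st_o H) _ e); exact: ich_sphere (st_LT H).
Qed.

Let h_inj z w : S (ich M' z) -> S (ich M' w) -> h z = h w -> z = w.
Proof.
move=> hz hw e.
have k z0 : S (ich M' z0) -> ich M1' (h z0) = f (ich M' z0) by move=> /(hm_f hm) k; rewrite /h (st_chK sd1 H1 k).
have := congr1 g (congr1 (ich M1') e); rewrite !k // !(hm_fK hm) // => /(congr1 (ch M)).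
by rewrite !(ichK _ (st_LT H)).
Qed.

Let h_ucv (u : nat -> R * R) z : (forall n, S (ich M' (u n))) -> S (ich M' z) -> ucv2 u z ->
  ucv2 (fun n => h (u n)) (h z).
Proof.
move=> hu hz uz; apply: (ch_ucv sd1 H1).
- by move=> n; exact: hm_f hm _ (hu n).
- exact: hm_f hm _ hz.
- by apply: (hm_cf hm) => //; exact: (ich_ucv sd H).
Qed.

Lemma n2_ucv (u : nat -> R * R) z : ucv2 u z -> ucv (fun n => n2 (u n)) (n2 z).
Proof. by move=> [a b]; rewrite /n2 !expr2; apply: ucv_eq (ucvD (ucvM a a) (ucvM b b)); apply: UU_all => n /=; rewrite !expr2. Qed.

Lemma unit_ucv (u : nat -> R * R) : (forall n, n2 (u n) = 1) -> exists2 z, n2 z = 1 & ucv2 u z.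
Proof.
move=> hu.
have b n : `|(u n).1| <= 1 /\ `|(u n).2| <= 1.
  have := hu n; rewrite /n2 => e.
  have q1 := sqr_ge0 (u n).1; have q2 := sqr_ge0 (u n).2.
  by split; apply: ler_sqr_abs => //; rewrite real_normK ?num_real // expr1n; lra.
have [a _ ua] := ucv_ex (UU_all (fun n => (b n).1)).
have [c _ uc] := ucv_ex (UU_all (fun n => (b n).2)).
have k : ucv2 u (a, c) by [].
exists (a, c) => //; apply: (ucv_uniq (n2_ucv k)).
by apply: ucv_eq (ucv_cst 1); apply: UU_all => n /=; rewrite hu.
Qed.

(** A farthest pair on the image of the circle; with these ends the two arcs satisfy the box
    conditions of [arc]. *)
Let diam : exists a b, [/\ n2 a = 1, n2 b = 1, a <> b &
  forall p q, n2 p = 1 -> n2 q = 1 -> d2 (h p) (h q) <= d2 (h a) (h b)].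
Proof.
pose E := [set t : R | exists p q, [/\ n2 p = 1, n2 q = 1 & t = d2 (h p) (h q)]].
have ii : n2 (1, 0) = 1 :> R by rewrite /n2 /= expr1n expr0n addr0.
have jj : n2 (-1, 0) = 1 :> R by rewrite /n2 /= sqrrN expr1n expr0n addr0.
have hE : has_sup E.
  split; first by exists (d2 (h (1, 0)) (h (1, 0))), (1, 0), (1, 0).
  exists 4 => _ [p [q [hp hq ->]]].
  have [a _] := st_chS sd1 H1 (hm_f hm (circle_S hp).1).
  have [b _] := st_chS sd1 H1 (hm_f hm (circle_S hq).1).
  move: a b; rewrite -!/(h _) /n2 /d2.
  set x1 := (h p).1; set x2 := (h p).2; set y1 := (h q).1; set y2 := (h q).2 => a b.
  have := sqr_ge0 (x1 + y1); have := sqr_ge0 (x2 + y2); rewrite !expr2 in a b *; lra.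
have Q n : exists pq : (R * R) * (R * R), [/\ n2 pq.1 = 1, n2 pq.2 = 1 &
    sup E - n.+1%:R^-1 < d2 (h pq.1) (h pq.2)].
  have n0 : 0 < (n.+1%:R : R)^-1 by rewrite invr_gt0 ltr0n.
  by have [_ [p [q [hp hq ->]]] hlt] := sup_adherent n0 hE; exists (p, q).
have [u hu] := choice Q.
have u1 n : n2 (u n).1 = 1 by have [] := hu n.
have u2 n : n2 (u n).2 = 1 by have [] := hu n.
have [a a1 ua] := unit_ucv u1; have [b b1 ub] := unit_ucv u2.
have ca := h_ucv (fun n => (circle_S (u1 n)).1) (circle_S a1).1 ua.
have cb := h_ucv (fun n => (circle_S (u2 n)).1) (circle_S b1).1 ub.
have mx p q : n2 p = 1 -> n2 q = 1 -> d2 (h p) (h q) <= d2 (h a) (h b).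
  move=> hp hq; apply: (@le_trans _ _ (sup E)).
    by apply: ub_le_sup; [case: hE | exists p, q].
  have k := ucvB (ucv_cst (sup E)) (@ucv_inv_nat R); rewrite subr0 in k.
  apply: (ucv_le k (ucv_d2 ca cb)); apply: UU_all => n /=; apply: ltW.
  by have [] := hu n.
exists a, b; split=> // e.
have := mx _ _ ii jj; rewrite e d2zz => k.
have k0 : d2 (h (1, 0)) (h (-1, 0)) = 0 by apply/eqP; rewrite eq_le k d2_ge0.
have [] := h_inj (circle_S ii).1 (circle_S jj).1 (d2_eq0 k0); lra.
Qed.

(** The image of the unit circle is a Jordan curve. The rest of S1 is connected, so one side of the
    curve is free of S1, and the disc found on that side has its whole circle on the curve. *)
Lemma circle_into : exists2 m, N1 m & forall y, sphere y -> lf (X y) m = 0 -> lf (X (g y)) o = 0.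
Proof.
have [al [be [al1 be1 ab mx]]] := diam.
have hS c : n2 c = 1 -> S (ich M' c) by move=> /circle_S[].
have hin c : S (ich M' c) -> n2 (h c) <= 1 by move=> /(hm_f hm) k; have [] := st_chS sd1 H1 k.
have AB0 : 0 < d2 (h al) (h be).
  case: (d20 (h al) (h be)) => // e; exfalso; apply: ab; exact: h_inj (hS _ al1) (hS _ be1) e.
have AB4 : d2 (h al) (h be) <= 4.
  have := hin _ (hS _ al1); have := hin _ (hS _ be1); rewrite /n2 /d2.
  set x1 := (h al).1; set x2 := (h al).2; set y1 := (h be).1; set y2 := (h be).2 => a b.
  have := sqr_ge0 (x1 + y1); have := sqr_ge0 (x2 + y2); rewrite !expr2 in a b *; lra.
pose T := nrm (h al) (h be); pose T' := nrm' (h al) (h be).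
have TK z : T' (T z) = z by exact: nrmK.
have TK' z : T (T' z) = z by exact: nrmK'.
have T_inj z w : T z = T w -> z = w by move=> e; rewrite -(TK z) e TK.
(* The arcs between the farthest points are the [circ] images of the segments from [wa] to [wb] and
   from [wa] to [-wb]. *)
have [wa na ea] := circ_sur al1; have [wb nb eb] := circ_sur be1.
have dw : det wa wb != 0.
  apply/eqP => e; apply: ab; rewrite -ea -eb.
  have [k [k0 ek]] : exists k : R, k != 0 /\ wb = (k * wa.1, k * wa.2).
    pose k := (wa.1 * wb.1 + wa.2 * wb.2) / n2 wa.
    have e1' : wb.1 = k * wa.1.
      apply: (mulfI na); rewrite /k mulrA mulrCA divff // mulr1 /n2.
      have : wa.2 * det wa wb = 0 by rewrite e mulr0.
      by rewrite /det !expr2; lra.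
    have e2' : wb.2 = k * wa.2.
      apply: (mulfI na); rewrite /k mulrA mulrCA divff // mulr1 /n2.
      have : wa.1 * det wa wb = 0 by rewrite e mulr0.
      by rewrite /det !expr2; lra.
    exists k; split; last by rewrite -e1' -e2' -surjective_pairing.
    by apply: contra nb => /eqP k0; rewrite /n2 e1' e2' k0 !mul0r expr0n addr0.
  by rewrite ek circZ.
have dwN : det wa (- wb.1, - wb.2) != 0 by rewrite (_ : det _ _ = - det wa wb) ?oppr_eq0 // /det /=; ring.
have segn v t : det wa v != 0 -> n2 (seg wa v t) != 0.
  move=> dv; apply/eqP => /eqP; rewrite /n2 paddr_eq0 ?sqr_ge0 // !sqrf_eq0 => /andP[/eqP s1 /eqP s2].
  have E : (1 - t) * det wa v = 0.
    rewrite (_ : _ * _ = (seg wa v t).1 * v.2 - (seg wa v t).2 * v.1); last by rewrite /det /seg /=; ring.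
    by rewrite s1 s2 !mul0r subr0.
  have E2 : t * det wa v = 0.
    rewrite (_ : _ * _ = (seg wa v t).2 * wa.1 - (seg wa v t).1 * wa.2); last by rewrite /det /seg /=; ring.
    by rewrite s1 s2 !mul0r subr0.
  have : det wa v = 0 by rewrite -[LHS]mul1r -(subrK t 1) mulrDl E E2 addr0.
  by move/eqP; rewrite (negbTE dv).
pose F v t := T (h (circ (seg wa v t))).
have arcF v : det wa v != 0 -> circ v = be -> arc (F v).
  move=> dv ev.
  have Fu t : n2 (circ (seg wa v t)) = 1 by apply: circ1; exact: segn.
  have bx c : n2 c = 1 -> d2 (h c) (h al) <= d2 (h al) (h be) /\ d2 (h c) (h be) <= d2 (h al) (h be).
    by move=> c1; split; apply: mx.
  split.
  - apply: ucont_cont => u l hu hl ul; apply: ucv_nrm; apply: h_ucv.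
    + by move=> n; apply: hS.
    + exact: hS.
    + by apply: cont01_circ => // t _; exact: segn.
  - by rewrite /F seg0 ea /T nrm_A.
  - by rewrite /F seg1 ev /T nrm_B.
  - move=> t /andP[t0 t1]; have [b1' b2'] := bx _ (Fu t).
    have [/andP[x1 x2] _ xa xb] := nrm_box AB0 b1' b2'.
    rewrite !lt_def x1 x2 !andbT; apply/andP; split; apply/eqP => e.
      have k := h_inj (hS _ (Fu t)) (hS _ al1) (xa e); rewrite -ea in k.
      have := circ_det (segn _ _ dv) na k.
      rewrite (_ : det _ _ = - t * det wa v); last by rewrite /det /seg /=; ring.
      by move/eqP; rewrite mulf_eq0 (negbTE dv) orbF oppr_eq0 gt_eqF.
    have k := h_inj (hS _ (Fu t)) (hS _ be1) (xb (esym e)); rewrite -ev in k.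
    have nv : n2 v != 0 by have := segn v 1 dv; rewrite seg1.
    have := circ_det (segn _ _ dv) nv k.
    rewrite (_ : det _ _ = (1 - t) * det wa v); last by rewrite /det /seg /=; ring.
    by move/eqP; rewrite mulf_eq0 (negbTE dv) orbF subr_eq0 gt_eqF.
  - by move=> t _; have [b1' b2'] := bx _ (Fu t); have [] := nrm_box AB0 b1' b2'.
pose wb' := (- wb.1, - wb.2).
have A1 : arc (F wb) by apply: arcF.
have A2 : arc (F wb') by apply: arcF => //; rewrite circN.
have dj s t : 0 < s < 1 -> 0 < t < 1 -> F wb s <> F wb' t.
  move=> /andP[s0 s1] /andP[t0 t1] /T_inj e.
  have k := h_inj (hS _ (circ1 (segn _ s dw))) (hS _ (circ1 (segn _ t dwN))) e.
  have := circ_det (segn _ _ dw) (segn _ _ dwN) k.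
  rewrite (_ : det _ _ = - ((1 - s) * t + s * (1 - t)) * det wa wb); last by rewrite /det /seg /=; ring.
  move/eqP; rewrite mulf_eq0 (negbTE dw) orbF oppr_eq0 gt_eqF //.
  by rewrite addr_gt0 // mulr_gt0 // subr_gt0.
have [V [V' [cov VV' [Vo Vo'] [z0 Vz0] Vout]]] := jordan_separation A1 A2 dj.
pose J := onJ (F wb) (F wb').
have J1 z : J z -> exists2 c, n2 c = 1 & z = T (h c).
  by move=> [t ht [->|->]]; [exists (circ (seg wa wb t)) | exists (circ (seg wa wb' t))] => //; apply: circ1; apply: segn.
(* Write a square root of [c] in the basis [wa], [wb]. Up to a global sign the first coefficient is
   nonnegative, and the sign of the second chooses the arc. *)
have J2 c : n2 c = 1 -> J (T (h c)).
  move=> c1; have [w nw ew] := circ_sur c1.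
  pose p := det w wb / det wa wb; pose q := det wa w / det wa wb.
  have ew' : w = (p * wa.1 + q * wb.1, p * wa.2 + q * wb.2).
    case: (w) @p @q => w1 w2 p q; congr (_, _); rewrite /p /q /det /=; rewrite /det in dw; by field.
  have pq0 : p != 0 \/ q != 0.
    have [p0|] := eqVneq p 0; last by left.
    have [q0|] := eqVneq q 0; last by right.
    by move: nw; rewrite ew' p0 q0 /n2 /= !mul0r addr0 expr0n addr0 eqxx.
  have key (p0 q0 : R) (v : R * R) : 0 <= p0 -> 0 <= q0 -> 0 < p0 + q0 -> det wa v != 0 ->
      exists2 t : R, 0 <= t <= 1 & circ (p0 * wa.1 + q0 * v.1, p0 * wa.2 + q0 * v.2) = circ (seg wa v t).
    move=> hp hq pq dv; have pqn : p0 + q0 != 0 by rewrite gt_eqF.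
    exists (q0 / (p0 + q0)).
      by rewrite divr_ge0 ?(ltW pq) //= ler_pdivrMr // mul1r lerDr.
    rewrite -[RHS](circZ _ pqn); congr circ; congr (_, _); rewrite /seg /=; by field.
  have fin (p0 q0 : R) : 0 <= p0 -> p0 != 0 \/ q0 != 0 -> circ (p0 * wa.1 + q0 * wb.1, p0 * wa.2 + q0 * wb.2) = c -> J (T (h c)).
    move=> hp pq <-; have [hq|hq] := leP 0 q0.
      have s0 : 0 < p0 + q0.
        rewrite lt_def addr_ge0 // andbT paddr_eq0 // negb_and.
        by case: pq => ->; rewrite ?orbT.
      by have [t ht ->] := key p0 q0 wb hp hq s0 dw; exists t => //; left.
    have hq' : 0 <= - q0 by lra.
    have s0 : 0 < p0 + - q0 by lra.
    have [t ht e] := key p0 (- q0) wb' hp hq' s0 dwN.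
    by move: e; rewrite /= !mulrNN => ->; exists t => //; right.
  have [hp|hp] := leP 0 p; first by apply: (fin p q hp pq0); rewrite -ew' ew.
  apply: (fin (- p) (- q)); first by lra.
    by rewrite !oppr_eq0.
  rewrite -ew -[RHS]circN; congr circ; congr (_, _); rewrite [in RHS]ew' /=; ring.
have colV u z : ~ J z -> ucv2 u z -> UU [set n | V (u n) <-> V z].
  move=> nJ [u1 u2].
  have cl d : 0 < d -> UU [set n | close d z (u n)].
    move=> d0; apply: UU_imp (UU_and (u1 d d0) (u2 d d0)) => n /= [a b].
    by rewrite /close distrC (ltW a) distrC (ltW b).
  have [//|[Vz|V'z]] := cov z.
    by have [d d0 hd] := Vo z Vz; apply: UU_imp (cl d d0) => n /= /hd hn; split.
  have [_ [d d0 hd]] := Vo' z V'z; apply: UU_imp (cl d d0) => n /= /hd hn.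
  by split=> k; [have [/(_ hn)] := VV' _ k | have [/(_ V'z)] := VV' _ k].
have Jin z : J (T z) -> exists2 x, S1 x & z = ch M1 x.
  move=> /J1[c c1 /T_inj ->]; exists (f (ich M' c)) => //; exact: (hm_f hm (hS _ c1)).
have Jlf y : S1 y -> lf (X (g y)) o <> 0 -> ~ J (T (ch M1 y)) /\
    inP S M' (ch M (g y)) /\ h (ch M (g y)) = ch M1 y.
  move=> Sy ne; have Sg := hm_g hm Sy.
  have hz : h (ch M (g y)) = ch M1 y by rewrite /h (st_chK sd H Sg) (hm_gK hm).
  have n1 : n2 (ch M (g y)) < 1.
    rewrite lt_neqAle; have [-> _] := st_chS sd H Sg; rewrite andbT.
    by apply/eqP => e; apply: ne; apply/(st_circle_o sd H Sg).
  have iP : inP S M' (ch M (g y)) by split=> //; rewrite (st_chK sd H Sg).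
  split=> //; move=> /J1[c c1 /T_inj]; rewrite -hz => e.
  have := h_inj iP.1 (hS _ c1) e => e2; by move: n1; rewrite e2 c1 ltxx.
have eqJ y : S1 y -> lf (X (g y)) o = 0 -> J (T (ch M1 y)).
  move=> Sy e; have Sg := hm_g hm Sy.
  have <- : h (ch M (g y)) = ch M1 y by rewrite /h (st_chK sd H Sg) (hm_gK hm).
  by apply: J2; apply/(st_circle_o sd H Sg).
(* A point of S1 on either side would come from two interior points of S, between which the
   predicate V (T (h z)) is locally constant. *)
have dich : (forall y, S1 y -> ~ V' (T (ch M1 y))) \/ (forall y, S1 y -> ~ V (T (ch M1 y))).
  have [ha|ha] := EM (forall y, S1 y -> ~ V' (T (ch M1 y))); [by left | right => y Sy Vy].
  apply: ha => y' Sy' V'y.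
  have ne : lf (X (g y)) o <> 0 by move=> e; have [_] := VV' _ Vy; apply; exact: eqJ.
  have ne' : lf (X (g y')) o <> 0 by move=> e; have [+ _] := Vo' _ V'y; apply; exact: eqJ.
  have [nJ [iz ez]] := Jlf _ Sy ne; have [nJ' [iz' ez']] := Jlf _ Sy' ne'.
  have : V (T (h (ch M (g y')))).
    apply: (interior_connected sd H (W := fun z => V (T (h z))) _ iz iz'); last by rewrite ez.
    move=> u z hu hz uz; apply: colV; last by apply: ucv_nrm; apply: h_ucv => //; [move=> n; have [] := hu n | have [] := hz].
    move=> /J1[c c1 /T_inj e]; have e2 := h_inj hz.1 (hS _ c1) e.
    by have [_] := hz; rewrite e2 c1 ltxx.
  by rewrite ez' => /VV'[].
have pathV p q : (forall t, 0 <= t <= 1 -> ~ J (T (seg p q t))) -> V (T q) -> V (T p).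
  move=> hJ Vq; apply: contrapT => nV.
  have : ~ V (T (seg p q 1)).
    apply: (loc_const (C := fun t => ~ V (T (seg p q t)))) => [u l hu hl ul|]; last by rewrite seg0.
    have := colV _ _ (hJ l hl) (ucv_nrm (h al) (h be) (cont01_seg p q hu hl ul)).
    by apply: UU_imp => n /= ->.
  by rewrite seg1.
(* Move radially out to 10 p: beyond [p] this ray has left the closed unit disc, hence S1 and the
   curve. *)
have exterior p : 1 <= n2 p -> ~ J (T p) -> V (T p).
  move=> p1 nJ.
  apply: (pathV p (10 * p.1, 10 * p.2)); last first.
    by apply: Vout; apply: nrm_far => //; apply: hin; exact: hS.
  move=> t /andP[t0 t1].
  have [->|tn] := eqVneq t 0; first by rewrite seg0.
  have tp : 0 < t by rewrite lt_def tn.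
  move=> /Jin[x Sx e]; have [+ _] := st_chS sd1 H1 Sx; rewrite -e.
  have -> : n2 (seg p (10 * p.1, 10 * p.2) t) = (1 + 9 * t) ^+ 2 * n2 p by rewrite /n2 /seg /=; ring.
  apply/negP; rewrite -ltNge.
  apply: (lt_le_trans (y := (1 + 9 * t) ^+ 2)); first by rewrite exprn_egt1 // ltrDl mulr_gt0.
  by rewrite ler_peMr // exprn_ge0 // addr_ge0 // mulr_ge0.
(* If S1 avoids the outer side, the exterior disc serves. Otherwise a point of V' lies in some disc
   [m], and segments inside [m] keep every point of its circle off V. *)
case: dich => ha; last first.
  exists o1; first exact: st_o H1.
  move=> y sy y0; have Sy := sd_circle sd1 (st_o H1) sy y0.
  apply: contrapT => ne; have [nJ _] := Jlf _ Sy ne.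
  apply: (ha _ Sy); apply: exterior => //.
  by have /(st_circle_o sd1 H1 Sy) -> := y0.
pose ze := T' z0.
have Vze : V' (T ze) by rewrite TK'.
have ze1 : n2 ze < 1.
  rewrite ltNge; apply/negP => k; have [nJ _] := Vo' _ Vze.
  by have [/(_ Vze)] := VV' _ (exterior _ k nJ).
have nS : ~ inP S1 M1' ze.
  by move=> [Sz _]; apply: (ha _ Sz); rewrite (ichK _ (st_LT H1)).
have [m pm hm'] := not_inP sd1 H1 ze1 nS.
have [Nm mo] := pm; have r0 := st_rad sd1 H1 Nm mo.
exists m => // y sy y0; have Sy := sd_circle sd1 Nm sy y0.
have dy := (st_circle sd1 H1 Sy Nm mo).1 y0.
apply: contrapT => ne; have [nJ _] := Jlf _ Sy ne.
have Vy : V (T (ch M1 y)) by have [//|[//|/(ha _ Sy)]] := cov (T (ch M1 y)).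
suff : V (T ze) by move=> /VV'[/(_ Vze)].
apply: pathV Vy => t /andP[t0 t1].
have [->|tn] := eqVneq t 1; first by rewrite seg1.
have t1' : t < 1 by rewrite lt_neqAle tn.
have t01 : 0 <= t < 1 by rewrite t0.
have hd := disc_pt r0 hm' dy t01.
move=> /Jin[x Sx e]; have [_ k] := st_chS sd1 H1 Sx.
by have := k _ Nm mo; rewrite -e leNgt hd.
Qed.

End CircleInto.

(** * The bijection between discs *)

Section Matching.
Variable R : realType.
Implicit Types (x y : pt R) (n m : vec R).

Lemma circle_ne (S : set (pt R)) N n : SD S N -> N n -> exists2 x, S x & lf (X x) n = 0.
Proof.
move=> sd Nn; have [M [M' H]] := st_exists Nn (sd_unit sd Nn).
have ii : n2 (1, 0) = 1 :> R by rewrite /n2 /= expr1n expr0n addr0.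
by have [a b] := circle_S sd H ii; exists (ich M' (1, 0)).
Qed.

Record match_discs (S : set (pt R)) (N N1 : set (vec R)) (f : pt R -> pt R) (phi psi : vec R -> vec R) : Prop := mkmatch {
  md_phi : forall n, N n -> N1 (phi n);
  md_psi : forall m, N1 m -> N (psi m);
  md_K : forall n, N n -> psi (phi n) = n;
  md_K' : forall m, N1 m -> phi (psi m) = m;
  md_circle : forall n x, N n -> S x -> lf (X x) n = 0 <-> lf (X (f x)) (phi n) = 0 }.

(** [circle_into] gives one inclusion of circles in each direction. Composing them places a circle
    inside another circle of the same set, so the two maps are mutually inverse and the inclusions
    are equalities. *)
Lemma matching (S S1 : set (pt R)) N N1 f g : SD S N -> SD S1 N1 -> HM S S1 f g ->
  exists phi psi, match_discs S N N1 f phi psi.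
Proof.
move=> sd sd1 hm.
have into (S0 S2 : set (pt R)) N0 N2 f0 g0 : SD S0 N0 -> SD S2 N2 -> HM S0 S2 f0 g0 -> forall n, exists m, N0 n ->
    N2 m /\ forall y, sphere y -> lf (X y) m = 0 -> lf (X (g0 y)) n = 0.
  move=> d0 d2 hm0 n; have [Nn|nn] := EM (N0 n); last by exists n.
  have [M [M' H]] := st_exists Nn (sd_unit d0 Nn).
  have [m2 Nm2] := sd_ne d2; have [M2 [M2' H2]] := st_exists Nm2 (sd_unit d2 Nm2).
  by have [m Nm hm'] := circle_into d0 H d2 H2 hm0; exists m.
have same (S0 : set (pt R)) N0 n m : SD S0 N0 -> N0 n -> N0 m ->
   (forall x, S0 x -> lf (X x) n = 0 -> lf (X x) m = 0) -> n = m.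
  move=> d0 Nn Nm k; apply: contrapT => nm; have [x Sx e] := circle_ne d0 Nn.
  have sx := ((sd_S d0 x).1 Sx).1.
  by apply: (sd_disj d0 Nn Nm nm sx); rewrite ?e // k.
have [phi hphi] := choice (into _ _ _ _ _ _ sd sd1 hm).
have [psi hpsi] := choice (into _ _ _ _ _ _ sd1 sd (HM_sym hm)).
have K n : N n -> psi (phi n) = n.
  move=> Nn; have [Np hp] := hphi _ Nn; have [Nq hq] := hpsi _ Np.
  apply: (same _ _ _ _ sd Nq Nn) => x Sx e.
  rewrite -(hm_fK hm Sx); apply: hp; last by apply: hq => //; exact: ((sd_S sd x).1 Sx).1.
  exact: ((sd_S sd1 _).1 (hm_f hm Sx)).1.
have K' m : N1 m -> phi (psi m) = m.
  move=> Nn; have [Np hp] := hpsi _ Nn; have [Nq hq] := hphi _ Np.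
  apply: (same _ _ _ _ sd1 Nq Nn) => x Sx e.
  rewrite -(hm_gK hm Sx); apply: hp; last by apply: hq => //; exact: ((sd_S sd1 x).1 Sx).1.
  exact: ((sd_S sd _).1 (hm_g hm Sx)).1.
exists phi, psi; split=> // [n /hphi[]//|m /hpsi[]//|n x Nn Sx].
have [Np hp] := hphi _ Nn; have [_ hq] := hpsi _ Np; split=> e.
  by apply: hq; [exact: ((sd_S sd x).1 Sx).1 | rewrite K].
rewrite -(hm_fK hm Sx); apply: hp => //; exact: ((sd_S sd1 _).1 (hm_f hm Sx)).1.
Qed.

End Matching.

(** * Cocompact groups and discs at every scale *)

Section Conformal.
Variable R : realType.
Implicit Types (x y z : pt R) (L : vec R -> vec R).

Lemma act_dist L L' x y : LT L L' -> sphere x -> sphere y ->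
  edist (act L x) (act L y) ^+ 2 * (c4 (L (X x)) * c4 (L (X y))) = edist x y ^+ 2.
Proof.
move=> H hx hy; have sx := act_sphere H hx; have sy := act_sphere H hy.
have -> : edist x y ^+ 2 = - 2 * (c4 (L (X x)) * (c4 (L (X y)) * lf (X (act L x)) (X (act L y)))).
  by rewrite (edist_lf hx hy) -(LT_lf H) {1}(actE H hx) {1}(actE H hy) lf_scl lf_scr.
rewrite (edist_lf sx sy); ring.
Qed.

(* The conformal factor of a Moebius transformation is governed by one pole. *)
Lemma pole L L' : LT L L' -> exists (t : R) u, [/\ 1 <= t, sphere u,
  forall y, sphere y -> t * (edist y u ^+ 2 / 4) <= c4 (L (X y)) <= 2 * t &
  forall y, sphere y -> c4 (L (X y)) <= 1 + t * (edist y u ^+ 2 / 2)].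
Proof.
move=> H; pose a := L' (e4 R).
have E4 : lf (e4 R) (e4 R) = -1 by rewrite /lf /e4 /c1 /c2 /c3 /c4 /=; ring.
have f4 : fut (e4 R) by split; rewrite ?E4 ?oppr_le0 ?ler01 // /c4 /=; exact: ltr01.
have [_ t0] := LT_fut' H f4; rewrite -/a in t0.
have a1 : lf a a = -1 by rewrite (LT_lf (LT_sym H)) E4.
pose b2 := c1 a ^+ 2 + c2 a ^+ 2 + c3 a ^+ 2.
have b2E : b2 = c4 a ^+ 2 - 1 by move: a1; rewrite /lf /b2 !expr2; light_lra.
have b20 : 0 <= b2 by rewrite /b2 !addr_ge0 ?sqr_ge0.
have t1 : 1 <= c4 a by apply: ler_sqr_abs; [exact: ltW | rewrite expr1n; light_lra].
pose b := Num.sqrt b2.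
have bb : b ^+ 2 = b2 by rewrite sqr_sqrtr.
have b0 : 0 <= b by exact: sqrtr_ge0.
have bt : b <= c4 a by apply: ler_sqr_abs; [exact: ltW | rewrite bb; light_lra].
have [u [u1 ua ub uc']] : exists u, [/\ sphere u, c1 a = b * px u, c2 a = b * py u & c3 a = b * pz u].
  have [e|e] := eqVneq b 0.
    exists (mkpt 1 0 0); rewrite e !mul0r; split.
    - by rewrite /sphere /= dotE px_mk py_mk pz_mk; ring.
    - apply/eqP; rewrite -sqrf_eq0; have := sqr_ge0 (c2 a); have := sqr_ge0 (c3 a); have := sqr_ge0 (c1 a).
      by rewrite eq_le => -> x2 x3; rewrite andbT; move: bb; rewrite /b2 e expr0n /=; light_lra.
    - apply/eqP; rewrite -sqrf_eq0; have := sqr_ge0 (c1 a); have := sqr_ge0 (c3 a); have := sqr_ge0 (c2 a).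
      by rewrite eq_le => -> x2 x3; rewrite andbT; move: bb; rewrite /b2 e expr0n /=; light_lra.
    - apply/eqP; rewrite -sqrf_eq0; have := sqr_ge0 (c1 a); have := sqr_ge0 (c2 a); have := sqr_ge0 (c3 a).
      by rewrite eq_le => -> x2 x3; rewrite andbT; move: bb; rewrite /b2 e expr0n /=; light_lra.
  exists (mkpt (c1 a / b) (c2 a / b) (c3 a / b)); rewrite /sphere /= dotE !px_mk !py_mk !pz_mk.
  split; try (by rewrite mulrCA divff // mulr1).
  rewrite -!expr2 !exprMn -!mulrDl -/b2 -bb -exprMn divff // expr1n; ring.
suff main y : sphere y -> c4 a * (edist y u ^+ 2 / 4) <= c4 (L (X y)) <= 2 * c4 a /\
    c4 (L (X y)) <= 1 + c4 a * (edist y u ^+ 2 / 2).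
  by exists (c4 a), u; split=> // y sy; have [] := main y sy.
move=> sy.
have ly : c4 (L (X y)) = c4 a - b * (px u * px y + py u * py y + pz u * pz y).
  have -> : c4 (L (X y)) = - lf (L (X y)) (e4 R) by rewrite /lf /e4 /c1 /c2 /c3 /c4 /=; ring.
  rewrite (LT_adj _ _ H) -/a /lf ua ub uc' /X /c1 /c2 /c3 /c4 /=; ring.
have ey := edist_lf sy u1; rewrite lfXX dotE in ey.
have e0 := sqr_ge0 (edist y u).
have e4' : edist y u ^+ 2 <= 4.
  rewrite (_ : 4 = 2 ^+ 2); last by ring.
  by rewrite ler_sqr ?nnegrE ?edist_ge0 //; exact: edist_le2.
set k := px u * px y + py u * py y + pz u * pz y in ly.
have kE : edist y u ^+ 2 = 2 - 2 * k by rewrite ey /k; ring.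
rewrite ly kE; rewrite kE in e0 e4'.
have k1 : k <= 1 by light_lra.
have k2 : -1 <= k by light_lra.
split; last first.
  have cb : (c4 a - b) * (c4 a + b) = 1 by rewrite -subr_sqr bb b2E; ring.
  have cb0 : 0 <= c4 a - b by rewrite subr_ge0.
  have cb1 : c4 a - b <= 1 by rewrite -[leRHS]cb ler_peMr //; light_lra.
  have := ler_wpM2l cb0 k1; light_lra.
apply/andP; split; last by have := ler_wpM2l b0 k2; light_lra.
have [kp|kn] := leP 0 k.
  have := ler_wpM2r kp bt; have : c4 a * k <= c4 a by rewrite ler_piMr ?(ltW t0).
  light_lra.
have := mulr_ge0 b0 (ltW (_ : 0 < - k)); rewrite oppr_gt0 => /(_ kn).
have : - k * c4 a <= c4 a by rewrite ler_piMl ?(ltW t0) //; light_lra.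
light_lra.
Qed.

End Conformal.

(** * Cocompactness on triples in metric form *)

Section Cocompact.
Variable R : realType.
Implicit Types (x y z : pt R) (L : vec R -> vec R).

Lemma compact_sep (T : topologicalType) (K : set T) (p q : T -> pt R) : compact K ->
  continuous p -> continuous q -> (forall t, K t -> p t <> q t) ->
  exists2 d : R, 0 < d & forall t, K t -> d <= edist (p t) (q t).
Proof.
move=> cK cp cq ne; apply: contrapT => hn.
have Q n : exists t, K t /\ edist (p t) (q t) < n.+1%:R^-1.
  apply: contrapT => h; apply: hn; exists n.+1%:R^-1; first by rewrite invr_gt0 ltr0n.
  by move=> t Kt; rewrite leNgt; apply/negP => hh; apply: h; exists t.
have [t ht] := choice Q.
have [y Ky hy] := UU_compact cK (UU_all (fun n => (ht n).1)).
apply: (ne y Ky).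
have up : ucvp (fun n => p (t n)) (p y).
  move=> e e0; have := hy _ (cp y _ (nbhs_edist (p y) e0)).
  by apply: UU_imp => n /=; rewrite subr0 ger0_norm ?edist_ge0.
have uq : ucvp (fun n => q (t n)) (q y).
  move=> e e0; have := hy _ (cq y _ (nbhs_edist (q y) e0)).
  by apply: UU_imp => n /=; rewrite subr0 ger0_norm ?edist_ge0.
apply: (ucvp_uniq up).
have := ucvD uq (@ucv_inv_nat R); rewrite addr0 => k.
apply: (ucv_squeeze k); apply: UU_all => n /=; rewrite subr0 ger0_norm ?edist_ge0 //.
apply: le_trans (edist_tri _ (q (t n)) _) _; rewrite addrC lerD2l.
exact: ltW (ht n).2.
Qed.

(** Triples are spread out by Lorentz symmetries of S, so that from here on the argument speaks of S
    and no longer of the group. *)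
Definition cocompact (S : set (pt R)) (d : R) := forall x y z, S x -> S y -> S z ->
  x <> y -> y <> z -> x <> z -> exists L L', symS S L L' /\
  [/\ d <= edist (act L x) (act L y), d <= edist (act L y) (act L z) & d <= edist (act L x) (act L z)].

(** A compact set of triples of distinct points is uniformly separated, and the inverse of the group
    element given by the covering moves the triple into it. *)
Lemma group_cocompact (G : set (pt R -> pt R)) (S : set (pt R)) : kleinian G -> S `<=` sphere (R := R) ->
  uniform_convergence_action G S -> exists2 d : R, 0 < d & cocompact S d.
Proof.
move=> [Gm Gid Gc Gi _] Ss [GS [_ [K [KT cK eT]]]].
have c1' : continuous (fun t : pt R * pt R * pt R => t.1.1) by move=> t; apply: continuous_comp; exact: cvg_fst.
have c2' : continuous (fun t : pt R * pt R * pt R => t.1.2) by move=> t; apply: continuous_comp; [exact: cvg_fst | exact: cvg_snd].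
have c3' : continuous (fun t : pt R * pt R * pt R => t.2) by move=> t; exact: cvg_snd.
have [d1 d10 h1] := compact_sep cK c1' c2' (fun t Kt => let: conj _ (And3 a _ _) := KT t Kt in a).
have [d2 d20 h2] := compact_sep cK c2' c3' (fun t Kt => let: conj _ (And3 _ a _) := KT t Kt in a).
have [d3 d30 h3] := compact_sep cK c1' c3' (fun t Kt => let: conj _ (And3 _ _ a) := KT t Kt in a).
exists (Num.min d1 (Num.min d2 d3)); first by rewrite !lt_min d10 d20.
move=> x y z Sx Sy Sz xy yz xz.
have : triples S (x, y, z) by [].
rewrite eqEsubset in eT; case: eT => + _ => /(_ _).
move=> /[apply] -[g Gg [k Kk [ex ey ez]]].
have [h Gh hg] := Gi g Gg.
have hgk w : h (g w) = w by rewrite -[h (g w)]/((h \o g) w) hg.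
have [L [L' [H rep]]] := mobius_LT (Gm _ Gh).
have aL w : S w -> act L w = h w by move=> /Ss sw; have [_] := rep _ sw.
exists L, L'; split.
  split=> // w sw; split=> [Sw|Sw].
    by rewrite aL // -(GS _ Gh); exists w.
  have : (h @` S) (act L w) by rewrite (GS _ Gh).
  move=> [s Ss' e]; have : act L s = act L w by rewrite aL.
  by move=> /(congr1 (act L')); rewrite (actK H (Ss _ Ss')) (actK H sw) => <-.
rewrite !aL // -ex -ey -ez !hgk !ge_min; split.
- by rewrite h1.
- by rewrite h2 // orbT.
- by rewrite h3 // !orbT.
Qed.

End Cocompact.

Section Scale.
Variable R : realType.
Implicit Types (z w p q : R * R) (x y : pt R).

Lemma pd_gt0 z w : z <> w -> 0 < pd z w.
Proof. by move=> zw; rewrite sqrtr_gt0; case: (d20 z w) => // /zw. Qed.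

Lemma pd_le_sqr z w (d : R) : 0 <= d -> (pd z w <= d) = (d2 z w <= d ^+ 2).
Proof. by move=> d0; rewrite -(ler_pXn2r (ltn0Sn 1)) ?nnegrE ?pd_ge0 // pd_sqr. Qed.

Lemma pd_sqrE z w (d : R) : 0 <= d -> d2 z w = d ^+ 2 -> pd z w = d.
Proof. by move=> d0 e; rewrite /pd e sqrtr_sqr ger0_norm. Qed.

Section InState.
Variables (S : set (pt R)) (N : set (vec R)) (M M' : vec R -> vec R) (o : vec R).
Hypotheses (sd : SD S N) (H : st N M M' o).

(** Uniform perfectness. On the outer circle one rotates; elsewhere, if no point lay at distance
    exactly [d], the points closer than [d] would split the connected interior. *)
Lemma scale_pts : exists2 d1 : R, 0 < d1 & forall (x : R * R) d, S (ich M' x) -> 0 < d <= d1 ->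
  exists2 y, S (ich M' y) & pd x y = d.
Proof.
have [n Nn no] := sd_two sd (st_o H); have r0 := st_rad sd H Nn no.
have pn : proper N o n by [].
exists (Num.min (rad M n / 2) 1); first by rewrite lt_min divr_gt0 //= ltr01.
move=> x d Sx /andP[d0]; rewrite le_min => /andP[dr d1].
have [x1 hx] := (st_S sd H x).1 Sx.
have [x1'|x1'] := eqVneq (n2 x) 1.
  (* Cosine and sine of the angle whose chord in the unit circle is [d]. *)
  pose c := 1 - d ^+ 2 / 2; pose s := Num.sqrt (1 - c ^+ 2).
  have d2' : d ^+ 2 <= 1 by rewrite expr_le1 // ltW.
  have d0' := sqr_ge0 d.
  have s2 : s ^+ 2 = 1 - c ^+ 2.
    by rewrite sqr_sqrtr // subr_ge0 expr_le1 // /c; lra.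
  have E : n2 (x.1 * c - x.2 * s, x.1 * s + x.2 * c) = 1.
    rewrite -x1' /n2 /= (_ : _ + _ = (x.1 ^+ 2 + x.2 ^+ 2) * (c ^+ 2 + s ^+ 2)); last by ring.
    by rewrite s2 (addrC (c ^+ 2)) subrK mulr1.
  exists (x.1 * c - x.2 * s, x.1 * s + x.2 * c).
    by have [] := circle_S sd H E.
  apply: pd_sqrE; first exact: ltW.
  rewrite /d2 /= (_ : _ + _ = n2 x * (1 - 2 * c + c ^+ 2 + s ^+ 2)); last by rewrite /n2; ring.
  by rewrite x1' s2 /c; field.
have xP : inP S M' x by split; rewrite // lt_neqAle x1'.
pose p1 := ((cen M n).1 + rad M n, (cen M n).2); pose p2 := ((cen M n).1 - rad M n, (cen M n).2).
have P1 : inP S M' p1 by apply: (circ_inP sd H pn); rewrite /d2 /p1 /=; ring.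
have P2 : inP S M' p2 by apply: (circ_inP sd H pn); rewrite /d2 /p2 /=; ring.
have [p pP hp] : exists2 p, inP S M' p & d < pd x p.
  have pp : pd p1 p2 = 2 * rad M n.
    by apply: pd_sqrE; [rewrite mulr_ge0 // ltW | rewrite /d2 /p1 /p2 /=; ring].
  have := pd_tri p1 x p2; rewrite pp (pdC p1 x) => tri.
  have [h1|h1] := ltP d (pd x p1); first by exists p1.
  exists p2 => //; lra.
apply: contrapT => hn.
have : pd x p < d.
  apply: (interior_connected sd H (W := fun w => pd x w < d) _ xP pP); last by rewrite pdzz.
  move=> u w hu hw uw; have cu := ucv_sqrt (ucv_d2 (ucv2_cst x) uw).
  have [h|h|h] := ltgtP (pd x w) d.
  - by apply: UU_imp (ucv_lt cu h) => k /= hk; split.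
  - apply: UU_imp (ucv_gt cu h) => k /= hk; split=> // hk'.
    by have := lt_trans hk hk'; rewrite ltxx.
  - by exfalso; apply: hn; exists w => //; have [] := hw.
by move=> h; have := lt_trans hp h; rewrite ltxx.
Qed.

End InState.

(** Distances d and 3 d from [x] keep the two further points at least 2 d apart; the chart constant
    is then absorbed in [C]. *)
Lemma triple_at (S : set (pt R)) N : SD S N -> exists C d1 : R, [/\ 1 <= C, 0 < d1 & forall x d, S x -> 0 < d <= d1 ->
  exists y z : pt R, [/\ S y, S z & [/\ d / C <= edist x y <= C * d, d / C <= edist y z <= C * d & d / C <= edist x z <= C * d]]].
Proof.
move=> sd; have [ o No] := sd_ne sd; have [M [M' H]] := st_exists No (sd_unit sd No).
have [d1 d10 hd] := scale_pts sd H; have [C C1 hC] := st_bilip sd H.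
have C0 : 0 < C by apply: lt_le_trans C1.
exists (4 * C), (d1 / 3); split; [lra | by rewrite divr_gt0 |].
move=> x d Sx /andP[d0 dd1].
have Sx' : S (ich M' (ch M x)) by rewrite (st_chK sd H).
have [|y Sy xy] := hd _ d Sx'; first by rewrite d0; lra.
have [|z Sz xz] := hd _ (3 * d) Sx'; first by rewrite mulr_gt0 //=; lra.
have yz1 : 2 * d <= pd y z by have := pd_tri (ch M x) y z; rewrite xy xz; lra.
have yz2 : pd y z <= 4 * d by have := pd_tri y (ch M x) z; rewrite pdC in xy; rewrite xy xz; lra.
have key (u w : R * R) : S (ich M' u) -> S (ich M' w) -> d <= pd u w <= 4 * d ->
    d / (4 * C) <= edist (ich M' u) (ich M' w) <= 4 * C * d.
  move=> Su Sw /andP[l1 l2]; have [] := hC _ _ Su Sw; rewrite !(ichK _ (st_LT H)) => a b.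
  apply/andP; split.
    rewrite ler_pdivrMr ?mulr_gt0 // (le_trans l1) // (le_trans a) // mulrC mulrCA.
    rewrite ler_peMl //; first by rewrite mulr_ge0 ?edist_ge0 // ltW.
    lra.
  by have := ler_wpM2l (ltW C0) l2; lra.
have kx (u : R * R) : S (ich M' u) -> d <= pd (ch M x) u <= 4 * d -> d / (4 * C) <= edist x (ich M' u) <= 4 * C * d.
  by move=> Su h; have := key _ _ Sx' Su h; rewrite (st_chK sd H).
exists (ich M' y), (ich M' z); split=> //; split.
- by apply: kx => //; rewrite xy lexx /=; lra.
- by apply: key => //; rewrite yz2 andbT; lra.
- by apply: kx => //; rewrite xz; apply/andP; split; lra.
Qed.

End Scale.

(** * A disc at every point and scale *)

Section DiscAt.
Variable R : realType.
Implicit Types (x y z u : pt R) (n m : vec R) (d : R) (L : vec R -> vec R).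

Lemma coord_le x y : [/\ `|px x - px y| <= edist x y, `|py x - py y| <= edist x y & `|pz x - pz y| <= edist x y].
Proof.
have k1 := sqr_ge0 (px x - px y); have k2 := sqr_ge0 (py x - py y); have k3 := sqr_ge0 (pz x - pz y).
have e := edist_sqr x y.
by split; apply: ler_sqr_abs; rewrite ?edist_ge0 // real_normK ?num_real // e; light_lra.
Qed.

Lemma ucv_coord (x : nat -> pt R) y : ucvp x y ->
  [/\ ucv (fun i => px (x i)) (px y), ucv (fun i => py (x i)) (py y) & ucv (fun i => pz (x i)) (pz y)].
Proof. by move=> h; split; apply: (ucv_squeeze h); apply: UU_all => n /=; have [] := coord_le (x n) y. Qed.

Lemma ucv_lfX (x : nat -> pt R) y n : ucvp x y -> ucv (fun i => lf (X (x i)) n) (lf (X y) n).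
Proof.
move=> /ucv_coord[h1 h2 h3]; have C a : @ucv R (fun=> a) a := ucv_cst a.
exact: (ucvB (ucvD (ucvD (ucvM h1 (C (c1 n))) (ucvM h2 (C (c2 n)))) (ucvM h3 (C (c3 n)))) (ucvM (C 1) (C (c4 n)))).
Qed.

(** Two disjoint compact circles are a positive distance apart, so the pole of a symmetry is far
    from at least one of them. *)
Lemma two_circles (S : set (pt R)) N n m : SD S N -> N n -> N m -> n <> m -> exists2 d, 0 < d & forall u,
  (forall y, sphere y -> lf (X y) n = 0 -> d <= edist y u) \/ (forall y, sphere y -> lf (X y) m = 0 -> d <= edist y u).
Proof.
move=> sd Nn Nm nm; apply: contrapT => hn.
have Q i : exists yz : pt R * pt R, [/\ S yz.1, S yz.2, lf (X yz.1) n = 0, lf (X yz.2) m = 0 & edist yz.1 yz.2 <= 2 * i.+1%:R^-1].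
  apply: contrapT => h; apply: hn; exists i.+1%:R^-1; first by rewrite invr_gt0 ltr0n.
  move=> u; have [k|k] := EM (forall y, sphere y -> lf (X y) n = 0 -> i.+1%:R^-1 <= edist y u); first by left.
  right => z sz ez; rewrite leNgt; apply/negP => hz; apply: k => y sy ey.
  rewrite leNgt; apply/negP => hy; apply: h; exists (y, z); split=> //=.
  - exact: (sd_circle sd Nn).
  - exact: (sd_circle sd Nm).
  - by apply: le_trans (edist_tri y u z) _; rewrite (edistC u) mulr_natl mulr2n lerD // ltW.
have [t ht] := choice Q.
have S1 i : S (t i).1 by have [] := ht i.
have [y Sy cy] := ucvp_ex (sd_compact sd) (UU_all S1).
have cz : ucvp (fun i => (t i).2) y.
  have := ucvD cy (ucvM (ucv_cst 2) (@ucv_inv_nat R)); rewrite mulr0 addr0 => k.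
  apply: (ucv_squeeze k); apply: UU_all => i /=; rewrite subr0 ger0_norm ?edist_ge0 //.
  apply: le_trans (edist_tri _ (t i).1 _) _; rewrite addrC lerD2l edistC; by have [] := ht i.
have e1 : lf (X y) n = 0.
  apply: (ucv_uniq (ucv_lfX n cy)); apply: ucv_eq (ucv_cst 0); apply: UU_all => i /=; by have [] := ht i.
have e2 : lf (X y) m = 0.
  apply: (ucv_uniq (ucv_lfX m cz)); apply: ucv_eq (ucv_cst 0); apply: UU_all => i /=; by have [] := ht i.
by apply: (sd_disj sd Nn Nm nm ((sd_S sd y).1 Sy).1); rewrite ?e1 ?e2.
Qed.

Lemma circle_diam (S : set (pt R)) N n : SD S N -> N n -> exists y z, [/\ S y, S z, y <> z, lf (X y) n = 0 & lf (X z) n = 0].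
Proof.
move=> sd Nn; have [M [M' H]] := st_exists Nn (sd_unit sd Nn).
have ii : n2 (1, 0) = 1 :> R by rewrite /n2 /= expr1n expr0n addr0.
have jj : n2 (-1, 0) = 1 :> R by rewrite /n2 /= sqrrN expr1n expr0n addr0.
have [a b] := circle_S sd H ii; have [a' b'] := circle_S sd H jj.
exists (ich M' (1, 0)), (ich M' (-1, 0)); split=> // /(congr1 (ch M)); rewrite !(ichK _ (st_LT H)) => -[]; light_lra.
Qed.

(* Away from u, [L'] scales distances by about 1 / t. *)
Lemma spread (S : set (pt R)) N d0 L L' u t C d x1 x2 x3 : SD S N -> LT L L' -> 0 < d0 -> 1 <= C -> 0 < d ->
  S x1 -> S x2 -> S x3 -> 1 <= t -> sphere u ->
  (forall y, sphere y -> t * (edist y u ^+ 2 / 4) <= c4 (L' (X y)) <= 2 * t) ->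
  [/\ d / C <= edist x1 x2 <= C * d, d / C <= edist x2 x3 <= C * d & d / C <= edist x1 x3 <= C * d] ->
  [/\ d0 <= edist (act L x1) (act L x2), d0 <= edist (act L x2) (act L x3) & d0 <= edist (act L x1) (act L x3)] ->
  [/\ d0 / (2 * C) <= t * d, t * d <= 32 * C / d0 ^+ 2 &
      exists2 x, S x /\ edist x x1 <= C * d & d0 / 2 <= edist (act L x) u].
Proof.
move=> sd H d00 C1 dp S1 S2 S3 t1 su hu [e12 e23 e13] [f12 f23 f13].
have Ss x : S x -> sphere x by move=> Sx; exact: ((sd_S sd x).1 Sx).1.
have C0 : 0 < C by apply: lt_le_trans C1.
have t0 : 0 < t by apply: lt_le_trans t1.
have key x y : S x -> S y -> d / C <= edist x y <= C * d -> d0 <= edist (act L x) (act L y) ->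
    d0 / (2 * C) <= t * d /\ (d0 / 2 <= edist (act L x) u -> d0 / 2 <= edist (act L y) u -> t * d <= 32 * C / d0 ^+ 2).
  move=> Sx Sy /andP[b1 b2] b3.
  have sx := act_sphere H (Ss _ Sx); have sy := act_sphere H (Ss _ Sy).
  have E := act_dist (LT_sym H) sx sy; rewrite !(actK H (Ss _ _)) // in E.
  have /andP[lx ux] := hu _ sx; have /andP[ly uy] := hu _ sy.
  have px0 := LT_c4 (LT_sym H) sx; have py0 := LT_c4 (LT_sym H) sy.
  set A := c4 (L' (X (act L x))) in E lx ux px0; set B := c4 (L' (X (act L y))) in E ly uy py0.
  have AB : A * B <= (2 * t) ^+ 2 by rewrite expr2; apply: ler_pM => //; exact: ltW.
  have C2 : 0 < 2 * C by rewrite mulr_gt0.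
  split.
    have : d0 <= C * d * (2 * t).
      apply: ler_sqr_abs; first by rewrite !mulr_ge0 // ltW.
      apply: (@le_trans _ _ (edist (act L x) (act L y) ^+ 2)).
        by rewrite ler_sqr ?nnegrE ?edist_ge0 // ltW.
      rewrite -E exprMn; apply: ler_pM => //; first exact: sqr_ge0.
      - by rewrite mulr_ge0 ?ltW.
      - by rewrite ler_sqr ?nnegrE ?edist_ge0 // mulr_ge0 // ltW.
    rewrite ler_pdivrMr //; clear; lra.
  move=> kx ky.
  have d4 : 0 <= d0 / 2 by rewrite divr_ge0 // ltW.
  have lb a c : d0 / 2 <= a -> t * (a ^+ 2 / 4) <= c -> t * (d0 ^+ 2 / 16) <= c.
    move=> ha; apply: le_trans; rewrite ler_pM2l //.
    have : (d0 / 2) ^+ 2 <= a ^+ 2 by rewrite ler_sqr ?nnegrE // (le_trans d4).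
    by rewrite expr_div_n; clear; lra.
  have la := lb _ _ kx lx; have lb' := lb _ _ ky ly.
  have g0 : 0 <= t * (d0 ^+ 2 / 16) by rewrite mulr_ge0 ?(ltW t0) // divr_ge0 ?sqr_ge0.
  have AB' : (t * (d0 ^+ 2 / 16)) ^+ 2 <= A * B by rewrite expr2; apply: ler_pM.
  have : d / C * (t * (d0 ^+ 2 / 16)) <= 2.
    apply: ler_sqr_abs => //; apply: (@le_trans _ _ (edist (act L x) (act L y) ^+ 2)).
      rewrite -E exprMn; apply: ler_pM => //; try exact: sqr_ge0.
      by rewrite ler_sqr ?nnegrE ?edist_ge0 // divr_ge0 // ltW.
    rewrite ler_sqr ?nnegrE ?edist_ge0 //; exact: edist_le2.
  have d2p : 0 < d0 ^+ 2 by rewrite exprn_gt0.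
  rewrite ler_pdivlMr // => h.
  have := ler_wpM2l (ltW C0) h.
  rewrite (_ : C * (d / C * (t * (d0 ^+ 2 / 16))) = t * d * d0 ^+ 2 / 16); last by field; rewrite gt_eqF.
  clear; lra.
have [h12 k12] := key _ _ S1 S2 e12 f12.
have [h23 k23] := key _ _ S2 S3 e23 f23.
have [h13 k13] := key _ _ S1 S3 e13 f13.
(* Among three points at mutual distance at least [d0], at most one is within d0 / 2 of the pole. *)
have two a b : d0 <= edist a b -> d0 / 2 <= edist a u \/ d0 / 2 <= edist b u.
  move=> h; have := edist_tri a u b; rewrite (edistC u b) => tri.
  have [k|k] := leP (d0 / 2) (edist a u); [by left | right; lra_from h tri k].
have self : edist x1 x1 <= C * d by rewrite edist_xx mulr_ge0 // ltW.
have [/andP[_ m12] /andP[_ m13]] := (e12, e13); rewrite edistC in m12; rewrite edistC in m13.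
have [a1|a1] := leP (d0 / 2) (edist (act L x1) u).
  have [a2|a2] := leP (d0 / 2) (edist (act L x2) u).
    by split=> //; [exact: k12 | exists x1].
  have [a3|a3] := two _ _ f23; first by have := le_lt_trans a3 a2; rewrite ltxx.
  by split=> //; [exact: k13 | exists x1].
have [a2|a2] := two _ _ f12; first by have := le_lt_trans a2 a1; rewrite ltxx.
have [a3|a3] := two _ _ f13; first by have := le_lt_trans a3 a1; rewrite ltxx.
by split=> //; [exact: k23 | exists x2].
Qed.

(** A symmetry spreads a triple of size [d] at [x]. Of two fixed discs, one whose circle avoids the
    pole is pulled back; there the inverse symmetry contracts by a factor comparable to [d]. *)
Lemma disc_at (S : set (pt R)) N d0 : SD S N -> 0 < d0 -> cocompact S d0 ->
  exists C d1 : R, [/\ 1 <= C, 0 < d1 & forall x d, S x -> 0 < d <= d1 -> exists n, [/\ N n,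
    forall z, sphere z -> lf (X z) n = 0 -> edist z x <= C * d &
    exists y z, [/\ S y, S z, lf (X y) n = 0, lf (X z) n = 0 & d / C <= edist y z]]].
Proof.
move=> sd d00 hc; have [C [d1 [C1 d10 htr]]] := triple_at sd.
have [n1 Nn1] := sd_ne sd; have [m Nm /nesym n12] := sd_two sd Nn1.
have [dc dc0 hdc] := two_circles sd Nn1 Nm n12.
have [y1 [z1 [Sy1 Sz1 /edist_gt0 yz1 ly1 lz1]]] := circle_diam sd Nn1.
have [y2 [z2 [Sy2 Sz2 /edist_gt0 yz2 ly2 lz2]]] := circle_diam sd Nm.
pose rho := Num.min (edist y1 z1) (edist y2 z2).
have rho0 : 0 < rho by rewrite lt_min yz1.
have C0 : 0 < C by apply: lt_le_trans C1.
(* [Ka] comes from the lower bounds of the conformal factor at the circle and at a point of the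
   triple; [Kb] comes from the upper bound 2 t together with the bound on t d in [spread]. *)
pose Ka := 64 * C / (dc * d0 ^+ 2).
pose Kb := 64 * C / (d0 ^+ 2 * rho).
have Ka0 : 0 < Ka by rewrite divr_gt0 ?mulr_gt0 // exprn_gt0.
have Kb0 : 0 < Kb by rewrite divr_gt0 ?mulr_gt0 // exprn_gt0.
exists (1 + C + Ka + Kb), d1; split=> //; first by lra_from C0 Ka0 Kb0.
move=> x d Sx hd; have /andP[dp _] := hd.
have [x2 [x3 [Sx2 Sx3 hx]]] := htr x d Sx hd.
have [a1 a2 a3] := hx.
have ne a b : d / C <= edist a b <= C * d -> a <> b.
  by move=> /andP[h _] e; move: h; rewrite e edist_xx leNgt divr_gt0.
have [L [L' [sy hL]]] := hc _ _ _ Sx Sx2 Sx3 (ne _ _ a1) (ne _ _ a2) (ne _ _ a3).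
have [H Hs] := sy.
have [t [u [t1 su hu _]]] := pole (LT_sym H).
have [td1 td2 [x0 [Sx0 x0x] x0u]] := spread sd H d00 C1 dp Sx Sx2 Sx3 t1 su hu hx hL.
have t0 : 0 < t by apply: lt_le_trans t1.
have Ss w : S w -> sphere w by move=> Sw; exact: ((sd_S sd w).1 Sw).1.
have H' := LT_sym H.
suff [n [Nn [nu [y [z [Sy Sz ly lz yz]]]]]] : exists n, N n /\ (forall y, sphere y -> lf (X y) n = 0 -> dc <= edist y u) /\
    exists y z, [/\ S y, S z, lf (X y) n = 0, lf (X z) n = 0 & rho <= edist y z].
  have circ w : sphere w -> lf (X w) n = 0 -> lf (X (act L' w)) (L' n) = 0.
    move=> sw; rewrite (lf_act n H' sw) => /eqP; rewrite mulf_eq0 gt_eqF ?(LT_c4 H') //=.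
    by move/eqP.
  have symS' := (symS_sym sy).2.
  exists (L' n); split.
  - exact: symS_N sd (symS_sym sy) Nn.
  - move=> w sw; rewrite -(actK H sw) => lw; have swl := act_sphere H sw.
    have lw' : lf (X (act L w)) n = 0.
      by rewrite (lf_act n H' swl) lw mulr0.
    have kw := nu _ swl lw'.
    have s0 := act_sphere H (Ss _ Sx0).
    have /andP[b1 _] := hu _ swl; have /andP[b2 _] := hu _ s0.
    have E := act_dist H' swl s0.
    rewrite (actK H (Ss _ Sx0)) in E.
    have : edist (act L' (act L w)) x0 <= Ka * d; last first.
      move=> h; apply: le_trans (edist_tri _ x0 _) _.
      apply: (le_trans (lerD h x0x)); rewrite -mulrDl ler_pM2r //; lra_from Kb0.
    apply: ler_sqr_abs; first by rewrite mulr_ge0 // ltW.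
    have p1 : 0 < t * dc by rewrite mulr_gt0.
    have p2 : 0 < t * d0 by rewrite mulr_gt0.
    have P : 0 < (t * (dc ^+ 2 / 4)) * (t * (d0 ^+ 2 / 16)) by rewrite !mulr_gt0 // ?exprn_gt0.
    have AB : (t * (dc ^+ 2 / 4)) * (t * (d0 ^+ 2 / 16)) <= c4 (L' (X (act L w))) * c4 (L' (X (act L x0))).
      apply: ler_pM; try by rewrite mulr_ge0 ?(ltW t0) // divr_ge0 ?sqr_ge0.
        by apply: le_trans b1; rewrite ler_pM2l // ler_pM2r // ler_sqr ?nnegrE ?edist_ge0 // ltW.
      apply: le_trans b2; rewrite ler_pM2l //.
      have : (d0 / 2) ^+ 2 <= edist (act L x0) u ^+ 2 by rewrite ler_sqr ?nnegrE ?edist_ge0 // divr_ge0 // ltW.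
      by rewrite expr_div_n; clear; lra.
    have e4 : edist (act L w) (act L x0) ^+ 2 <= 4.
      rewrite (_ : 4 = 2 ^+ 2); last by ring.
      by rewrite ler_sqr ?nnegrE ?edist_ge0 //; exact: edist_le2.
    rewrite -(ler_pM2r P); apply: (@le_trans _ _ 4).
      apply: le_trans e4; rewrite -E; apply: ler_wpM2l => //; exact: sqr_ge0.
    have -> : (Ka * d) ^+ 2 * ((t * (dc ^+ 2 / 4)) * (t * (d0 ^+ 2 / 16))) = (8 * C * (t * d) / d0) ^+ 2.
      by rewrite /Ka; field; rewrite !gt_eqF.
    rewrite (_ : 4 = 2 ^+ 2); last by ring.
    have pos : 0 <= 8 * C * (t * d) / d0 by rewrite divr_ge0 ?(ltW d00) // !mulr_ge0 // ltW.
    rewrite ler_sqr ?nnegrE // ler_pdivlMr //.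
    have := ler_wpM2l (ltW C0) td1.
    rewrite (_ : C * (d0 / (2 * C)) = d0 / 2); last by field; rewrite gt_eqF.
    lra_from d00.
  - have sy' := Ss _ Sy; have sz' := Ss _ Sz.
    exists (act L' y), (act L' z); split; try exact: circ.
    + by apply/(symS' y sy').
    + by apply/(symS' z sz').
    have E := act_dist H' sy' sz'.
    have /andP[_ b1] := hu _ sy'; have /andP[_ b2] := hu _ sz'.
    have p1 := LT_c4 H' sy'; have p2 := LT_c4 H' sz'.
    have AB : c4 (L' (X y)) * c4 (L' (X z)) <= (2 * t) ^+ 2 by rewrite expr2; apply: ler_pM => //; exact: ltW.
    have P : rho <= edist (act L' y) (act L' z) * (2 * t).
      apply: ler_sqr_abs; first by rewrite mulr_ge0 ?edist_ge0 // mulr_ge0 // ltW.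
      apply: (@le_trans _ _ (edist y z ^+ 2)); first by rewrite ler_sqr ?nnegrE ?edist_ge0 // ltW.
      rewrite -E exprMn; apply: ler_wpM2l => //; exact: sqr_ge0.
    have K0 : 0 < 1 + C + Ka + Kb by lra_from C0 Ka0 Kb0.
    rewrite ler_pdivrMr //.
    have e0 := edist_ge0 (act L' y) (act L' z).
    set ed := edist _ _ in P e0 *.
    apply: (@le_trans _ _ (ed * Kb)); last by rewrite ler_wpM2l //; lra_from C0 Ka0.
    have h1 : rho * d <= ed * 2 * (t * d) by have := ler_wpM2r (ltW dp) P; clear; lra.
    have h2 : ed * 2 * (t * d) <= ed * 2 * (32 * C / d0 ^+ 2) by rewrite ler_wpM2l // mulr_ge0.
    have := le_trans h1 h2; rewrite -ler_pdivlMl // => h3; apply: le_trans h3 _.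
    by rewrite le_eqVlt; apply/orP; left; apply/eqP; rewrite /Kb; field; rewrite !gt_eqF.
have [h|h] := hdc u.
  exists n1; split=> //; split=> //; exists y1, z1; split=> //; by rewrite ge_min lexx.
exists m; split=> //; split=> //; exists y2, z2; split=> //; by rewrite ge_min lexx orbT.
Qed.

End DiscAt.

(** * Weak tangents as Schottky sets minus a point *)

Section TangentLimit.
Variable R : realType.
Implicit Types (x y s t q u v : pt R) (d : R).

Definition eps (i : nat) : R := i.+1%:R^-1.
Lemma eps_gt0 i : 0 < eps i. Proof. by rewrite invr_gt0 ltr0n. Qed.
Lemma eps_ucv : ucv eps 0. Proof. exact: ucv_inv_nat. Qed.

(* [E k] is an almost bilipschitz, almost surjective chart of a weak tangent by S minus q. *)
Record tangent_limit (S : set (pt R)) (Z : Type) (dZ : Z -> Z -> R) (z : Z) (E : nat -> pt R -> Z) q : Prop := mkTL {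
  tl_q : S q;
  tl_bilip : forall d, 0 < d -> exists2 C : R, 0 < C & UU [set k | forall s t, S s -> S t ->
    d <= edist s q -> d <= edist t q ->
    [/\ edist s t <= C * (dZ (E k s) (E k t) + eps k), dZ (E k s) (E k t) <= C * edist s t + eps k
      & dZ z (E k s) <= C]];
  tl_dense : forall D : R, exists2 d, 0 < d & UU [set k | forall w, dZ z w <= D ->
    exists2 s, S s /\ d <= edist s q & dZ w (E k s) <= eps k] }.

(** One blow-up at scale [Lam] around [P]: [G] is the approximate map to the tangent, [L] spreads a
    triple of size [Lam] at [P], and [t], [u] come from [pole] applied to the inverse of [L]. The
    bounds [a], [b] say that t is comparable to 1 / Lam. The point [v] has a preimage far from [P]
    and will tend to the pole. *)
Record step (S : set (pt R)) (Z : Type) (dZ : Z -> Z -> R) (z : Z) (k : nat) (c a b d0 C : R)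
  (Lam : R) (G : pt R -> Z) (L L' : vec R -> vec R) (t : R) (P u y0 v : pt R) : Prop := mkstep {
  sp_sym : symS S L L';
  sp_u : sphere u; sp_t : 0 < t;
  sp_lo : forall y, sphere y -> t * (edist y u ^+ 2 / 4) <= c4 (L' (X y));
  sp_hi : forall y, sphere y -> c4 (L' (X y)) <= 2 * t;
  sp_hi' : forall y, sphere y -> c4 (L' (X y)) <= 1 + t * (edist y u ^+ 2 / 2);
  sp_a : a <= t * Lam; sp_b : t * Lam <= b;
  sp_L0 : 0 < Lam; sp_L1 : Lam <= eps k;
  sp_y0 : S y0; sp_y0u : d0 <= edist y0 u;
  sp_P : edist (act L' y0) P <= C * Lam;
  sp_v : S v; sp_vP : c <= edist (act L' v) P;
  sp_z : dZ z (G P) = 0; sp_SP : S P;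
  sp_G : forall x y, S x -> S y -> edist x P < k.+1%:R * Lam -> edist y P < k.+1%:R * Lam ->
     `|edist x y / Lam - dZ (G x) (G y)| <= eps k;
  sp_D : forall w, dZ z w < k.+1%:R - eps k -> exists2 x, S x /\ edist x P < k.+1%:R * Lam & dZ w (G x) <= eps k }.

Lemma step_ex (S : set (pt R)) N (Z : Type) (dZ : Z -> Z -> R) z p d0 : SD S N -> 0 < d0 -> cocompact S d0 ->
  is_metric dZ -> weak_tangent S p dZ z -> exists (c a b d C : R), [/\ 0 < c, 0 < a, 0 < d, 1 <= C & forall k,
    exists Lam G L L' (t : R), exists P u y0 v : pt R, step S dZ z k c a b d C Lam G L L' t P u y0 v].
Proof.
move=> sd d00 hc [_ dz0 _ _] [lam [pn [lam0 clam Sp _ hw]]].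
have [C [d1 [C1 d10 htr]]] := triple_at sd.
have [n1 Nn1] := sd_ne sd; have [y1 [z1 [Sy1 Sz1 yz1 _ _]]] := circle_diam sd Nn1.
have e0 := edist_gt0 yz1.
exists (edist y1 z1 / 2), (d0 / (2 * C)), (32 * C / d0 ^+ 2), (d0 / 2), C.
have C0 : 0 < C by apply: lt_le_trans C1.
split=> //; try by rewrite divr_gt0 // mulr_gt0.
move=> k.
have [n0 hn0] := hw k.+1%:R (eps k) (ltr0Sn _ k) (eps_gt0 k).
have [n [nn0 ln]] : exists n, (n0 <= n)%N /\ lam n <= Num.min d1 (eps k).
  have m0 : 0 < Num.min d1 (eps k) by rewrite lt_min d10 eps_gt0.
  have /cvgrPdist_le/(_ _ m0)[n2 _ hn2] := clam.
  exists (maxn n0 n2); split; first exact: leq_maxl.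
  have := hn2 (maxn n0 n2) (leq_maxr _ _); rewrite sub0r normrN gtr0_norm //.
have [G [G1 [dl dle G2] G3]] := hn0 n nn0.
have l0 := lam0 n; move: ln; rewrite le_min => /andP[ld1 lek].
set P := pn n in G1 G2 G3 *; set Lam := lam n in l0 ld1 lek G2 G3 *.
have hL : 0 < Lam <= d1 by rewrite l0.
have [x2 [x3 [Sx2 Sx3 hx]]] := htr P Lam (Sp n) hL.
have [a1 a2 a3] := hx.
have ne a b : Lam / C <= edist a b <= C * Lam -> a <> b.
  by move=> /andP[h _] e; move: h; rewrite e edist_xx leNgt divr_gt0.
have [L [L' [sy hL2]]] := hc _ _ _ (Sp n) Sx2 Sx3 (ne _ _ a1) (ne _ _ a2) (ne _ _ a3).
have [H Hs] := sy.
have [t [u [t1 su hu hu']]] := pole (LT_sym H).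
have [td1 td2 [x0 [Sx0 x0x] x0u]] := spread sd H d00 C1 l0 (Sp n) Sx2 Sx3 t1 su hu hx hL2.
have Ss w : S w -> sphere w by move=> Sw; exact: ((sd_S sd w).1 Sw).1.
(* Of two fixed points of S, one is at least half their distance away from [P]; its image will be
   [v]. *)
have [w Sw hw'] : exists2 w, S w & edist y1 z1 / 2 <= edist w P.
  have := edist_tri y1 P z1; rewrite (edistC P) => tri.
  have [h|h] := leP (edist y1 z1 / 2) (edist y1 P); [by exists y1 | exists z1 => //; light_lra].
have inB x : edist x P < k.+1%:R * Lam -> edist x P / Lam < k.+1%:R by rewrite ltr_pdivrMr.
exists Lam, G, L, L', t, P, u, (act L x0), (act L w); split=> //.
- by apply: lt_le_trans t1.
- by move=> y sy'; have /andP[] := hu y sy'.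
- by move=> y sy'; have /andP[] := hu y sy'.
- by apply/(Hs _ (Ss _ Sx0)).
- by rewrite (actK H (Ss _ Sx0)).
- by apply/(Hs _ (Ss _ Sw)).
- by rewrite (actK H (Ss _ Sw)).
- by apply/dz0.
- exact: Sp.
- by move=> x y Sx Sy hx' hy; apply: le_trans (ltW dle); apply: G2; split=> //; exact: inB.
- move=> w' /G3[x [Sx hx'] hG]; exists x; last exact: ltW.
  by split=> //; rewrite -ltr_pdivrMr.
Qed.

End TangentLimit.

Section TangentLimitExists.
Variable R : realType.
Implicit Types (x y s t q u v : pt R) (d : R).

Lemma sqr_mono (a b : R) : 0 <= a -> a <= b -> a ^+ 2 <= b ^+ 2.
Proof. by move=> a0 ab; rewrite ler_sqr ?nnegrE // (le_trans a0). Qed.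

Lemma nat_ucv_inf (A : R) : UU [set k | A < k.+1%:R].
Proof.
have : UU [set k | (Num.truncn `|A| <= k)%N] by exact: UU_ge.
apply: UU_imp => k /= hk; apply: le_lt_trans (ler_norm A) _.
by have /andP[_ h] := truncn_itv (normr_ge0 A); apply: lt_le_trans h _; rewrite ler_nat.
Qed.

(** Chart number [k] sends [s] to G k (act (L' k) s), and [q] is the limit of the poles. Distances
    are controlled by the rescaled conformal factor, which is bounded above and is bounded below
    away from the pole. *)
Lemma tangent_limit_ex (S : set (pt R)) N (Z : Type) (dZ : Z -> Z -> R) z p d0 : SD S N -> 0 < d0 -> cocompact S d0 ->
  is_metric dZ -> weak_tangent S p dZ z -> exists E q, tangent_limit S dZ z E q.
Proof.
move=> sd d00 hc mZ wt.
have [c [a [b [d [C [c0 a0 dp C1 hst]]]]]] := step_ex sd d00 hc mZ wt.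
have [dz1 dz0 dzC dzt] := mZ.
have [Lam hst1] := choice hst; have [G hst2] := choice hst1; have [L hst3] := choice hst2.
have [L' hst4] := choice hst3; have [t hst5] := choice hst4; have [P hst6] := choice hst5.
have [u hst7] := choice hst6; have [y0 hst8] := choice hst7; have [v h] := choice hst8.
move=> {hst hst1 hst2 hst3 hst4 hst5 hst6 hst7 hst8}.
have C0 : 0 < C by apply: lt_le_trans C1.
have b0 : 0 < b by have := sp_a (h 0%N); have := sp_b (h 0%N); light_lra.
have Ss s : S s -> sphere s by move=> hs; exact: ((sd_S sd s).1 hs).1.
have HL k : LT (L' k) (L k) by have [H _] := sp_sym (h k); exact: LT_sym.
have SL' k s : S s -> S (act (L' k) s) by move=> hs; have [_ hh] := symS_sym (sp_sym (h k)); apply/(hh s (Ss _ hs)).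
(* The conformal factor in units of the blow-up: it lies between a |s - u|^2 / 4 and 2 b, and is
   also at most eps k + b |s - u|^2 / 2. *)
pose l k s := Lam k * c4 (L' k (X s)).
have l0 k s : S s -> 0 < l k s by move=> hs; rewrite mulr_gt0 ?(sp_L0 (h k)) // (LT_c4 (HL k)) //; exact: Ss.
have dist k s s' : S s -> S s' ->
    (edist (act (L' k) s) (act (L' k) s') / Lam k) ^+ 2 * (l k s * l k s') = edist s s' ^+ 2.
  move=> hs hs'; rewrite -(act_dist (HL k) (Ss _ hs) (Ss _ hs')) /l; field.
  by rewrite gt_eqF // (sp_L0 (h k)).
have lhi k s : S s -> l k s <= 2 * b.
  move=> hs; have := ler_wpM2l (ltW (sp_L0 (h k))) (sp_hi (h k) (Ss _ hs)); have := sp_b (h k); rewrite /l; clear; lra.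
have tL k (y : R) : Lam k * (t k * y) = t k * Lam k * y by ring.
have llo k s : S s -> a * (edist s (u k) ^+ 2 / 4) <= l k s.
  move=> hs; have h1 := ler_wpM2l (ltW (sp_L0 (h k))) (sp_lo (h k) (Ss _ hs)).
  apply: le_trans h1; rewrite tL; apply: ler_wpM2r; last exact: sp_a (h k).
  by rewrite divr_ge0 // sqr_ge0.
have lhi' k s : S s -> l k s <= eps R k + b * (edist s (u k) ^+ 2 / 2).
  move=> hs; have h1 := ler_wpM2l (ltW (sp_L0 (h k))) (sp_hi' (h k) (Ss _ hs)).
  apply: le_trans h1 _; rewrite mulrDr mulr1 tL; apply: lerD; first exact: sp_L1 (h k).
  by apply: ler_wpM2r; [rewrite divr_ge0 // sqr_ge0 | exact: sp_b (h k)].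
have ly0 k : a * (d ^+ 2 / 4) <= l k (y0 k).
  apply: le_trans (llo k _ (sp_y0 (h k))); rewrite ler_pM2l // ler_pM2r //.
  by apply: sqr_mono; [exact: ltW | exact: sp_y0u (h k)].
have [q Sq vq] := ucvp_ex (sd_compact sd) (UU_all (fun k => sp_v (h k))).
have ad0 : 0 < a * (d ^+ 2 / 4) by rewrite mulr_gt0 // divr_gt0 // exprn_gt0.
(* The preimages of [v k] and [y0 k] are at rescaled distance at least c / (2 Lam k), while the
   points themselves are within 2. This forces the factor at [v k] to 0, hence [v k] towards
   [u k]. *)
have uq : ucvp u q.
  have cl : ucv (fun k => edist (v k) (u k)) 0.
    have K0 : 0 < 64 / (c ^+ 2 * (a * (d ^+ 2 / 4))) / a by rewrite !divr_gt0 // mulr_gt0 // exprn_gt0.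
    set K := 64 / _ / a in K0.
    have e1' : ucv (fun k => K * (eps R k * eps R k)) 0.
      by have := ucvM (ucv_cst K) (ucvM (@eps_ucv R) (@eps_ucv R)); rewrite !mulr0.
    have e2' : UU [set k | C * Lam k <= c / 2].
      have : 0 < c / 2 / C by rewrite !divr_gt0.
      move=> /(ucv_lt (@eps_ucv R)); apply: UU_imp => k /= hk.
      by rewrite mulrC -ler_pdivlMr //; apply: le_trans (sp_L1 (h k)) (ltW hk).
    have e3' : ucv (fun k => edist (v k) (u k) ^+ 2) 0.
      apply: (ucv_squeeze e1'); apply: UU_imp e2' => k /= hk.
      rewrite subr0 ger0_norm ?sqr_ge0 //.
      have Lk := sp_L0 (h k).
      have far : c / 2 / Lam k <= edist (act (L' k) (v k)) (act (L' k) (y0 k)) / Lam k.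
        rewrite ler_pM2r ?invr_gt0 //.
        have := edist_tri (act (L' k) (v k)) (act (L' k) (y0 k)) (P k).
        have := sp_vP (h k); have := sp_P (h k); lra_from hk.
      have E := dist k _ _ (sp_v (h k)) (sp_y0 (h k)).
      have e4' : edist (v k) (y0 k) ^+ 2 <= 4.
        rewrite (_ : 4 = 2 ^+ 2); last by ring.
        by rewrite ler_sqr ?nnegrE ?edist_ge0 //; apply: edist_le2; apply: Ss; [exact: sp_v (h k) | exact: sp_y0 (h k)].
      have lb : (c / 2 / Lam k) ^+ 2 * (l k (v k) * (a * (d ^+ 2 / 4))) <= 4.
        apply: le_trans e4'; rewrite -E; apply: ler_pM.
        - exact: sqr_ge0.
        - by rewrite mulr_ge0 ?(ltW ad0) // ltW // l0 //; exact: sp_v (h k).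
        - by apply: sqr_mono => //; rewrite !divr_ge0 // ltW.
        - by rewrite ler_pM2l ?ly0 // l0 //; exact: sp_v (h k).
      have lv := llo k _ (sp_v (h k)).
      have cc : 0 < (c / 2 / Lam k) ^+ 2 * (a * (d ^+ 2 / 4)) by rewrite mulr_gt0 // exprn_gt0 // !divr_gt0.
      have : (c / 2 / Lam k) ^+ 2 * (a * (d ^+ 2 / 4)) * (a * (edist (v k) (u k) ^+ 2 / 4)) <= 4.
        have h' := ler_wpM2l (ltW cc) lv; apply: (le_trans h'); apply: le_trans lb.
        by rewrite le_eqVlt; apply/orP; left; apply/eqP; ring.
      rewrite mulrA -ler_pdivlMl; last by rewrite mulr_gt0.
      move=> lb2.
      have : edist (v k) (u k) ^+ 2 <= K * (Lam k * Lam k).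
        rewrite (_ : K * (Lam k * Lam k) = 4 * (((c / 2 / Lam k) ^+ 2 * (a * (d ^+ 2 / 4)) * a)^-1 * 4)).
          by rewrite -ler_pdivrMl // [X in X <= _]mulrC.
        by rewrite /K; field; rewrite !gt_eqF.
      move=> lb3; apply: le_trans lb3 _; rewrite ler_pM2l //.
      apply: ler_pM; rewrite ?(ltW Lk) //; exact: sp_L1 (h k).
    have := ucv_sqrt e3'; rewrite sqrtr0; apply: ucv_eq; apply: UU_all => k /=.
    by rewrite sqrtr_sqr ger0_norm ?edist_ge0.
  have := ucvD cl vq; rewrite addr0 => cc.
  apply: (ucv_squeeze cc); apply: UU_all => k /=; rewrite subr0 ger0_norm ?edist_ge0 //.
  by rewrite (edistC (v k) (u k)); exact: edist_tri.
pose E k s := G k (act (L' k) s).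
exists E, q; split=> //.
- move=> tau tau0.
  have tt : 0 < tau / 2 by rewrite divr_gt0.
  pose m := a * ((tau / 2) ^+ 2 / 4).
  have m0 : 0 < m by rewrite mulr_gt0 // divr_gt0 // exprn_gt0.
  pose K1 := 1 / m.
  pose K2 := 2 / Num.sqrt (m * (a * (d ^+ 2 / 4))).
  have K10 : 0 < K1 by rewrite divr_gt0.
  have K20 : 0 < K2 by rewrite divr_gt0 // sqrtr_gt0 mulr_gt0.
  (* 2 b bounds the factor above, [K1] inverts its lower bound [m] at distance tau / 2 from the
     pole, and K2 + C bounds the rescaled distance to [P]. *)
  pose K := 2 * b + K1 + K2 + C + 1.
  have Kb : 2 * b + 1 <= K by rewrite /K; lra_from K10 K20 C0.
  have KC : K2 + C + 1 <= K by rewrite /K; lra_from K10 b0.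
  have K1K : K1 <= K by rewrite /K; lra_from K20 C0 b0.
  exists K; first by lra_from Kb b0.
  apply: UU_imp (UU_and (ucv_lt uq tt) (nat_ucv_inf K)) => k /= [uk kK] s s' hs hs' qs qs'.
  have Lk := sp_L0 (h k).
  have eps1 : eps R k <= 1 by rewrite invf_le1 // ler1n.
  have su x : tau <= edist x q -> tau / 2 <= edist x (u k).
    by move=> hx; have := edist_tri x (u k) q; lra_from hx uk.
  have lm x : S x -> tau <= edist x q -> m <= l k x.
    move=> hx qx; apply: le_trans (llo k _ hx); rewrite ler_pM2l // ler_pM2r //.
    by apply: sqr_mono; [exact: ltW | exact: su].
  have inB x : S x -> tau <= edist x q -> edist (act (L' k) x) (P k) <= (K2 + C) * Lam k.
    move=> hx qx; apply: le_trans (edist_tri _ (act (L' k) (y0 k)) _) _.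
    rewrite mulrDl; apply: lerD; last exact: sp_P (h k).
    rewrite -ler_pdivrMr //.
    have sq0 : 0 < Num.sqrt (m * (a * (d ^+ 2 / 4))) by rewrite sqrtr_gt0 mulr_gt0.
    rewrite /K2 ler_pdivlMr //; apply: ler_sqr_abs => //.
    rewrite exprMn sqr_sqrtr; last by apply: mulr_ge0; exact: ltW.
    apply: (@le_trans _ _ (edist x (y0 k) ^+ 2)).
      rewrite -(dist k _ _ hx (sp_y0 (h k))); apply: ler_wpM2l; first exact: sqr_ge0.
      by apply: ler_pM; [exact: ltW m0 | exact: ltW ad0 | exact: lm | exact: ly0].
    rewrite ler_sqr ?nnegrE ?edist_ge0 //; apply: edist_le2; apply: Ss => //; exact: sp_y0 (h k).
  have inB' x : S x -> tau <= edist x q -> edist (act (L' k) x) (P k) < k.+1%:R * Lam k.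
    move=> hx qx; apply: le_lt_trans (inB x hx qx) _; rewrite ltr_pM2r //.
    apply: le_lt_trans kK; lra_from KC.
  have SP := sp_SP (h k).
  have PP : edist (P k) (P k) < k.+1%:R * Lam k by rewrite edist_xx mulr_gt0 // ltr0n.
  have := sp_G (h k) (SL' k _ hs) (SL' k _ hs') (inB' _ hs qs) (inB' _ hs' qs').
  rewrite -/(E k s) -/(E k s'); set D := edist _ _ / _ => hD.
  have D0 : 0 <= D by rewrite divr_ge0 ?edist_ge0 // ltW.
  have ED := dist k _ _ hs hs'; rewrite -/D in ED.
  have n1 := ler_norm (D - dZ (E k s) (E k s')).
  have n2 := ler_norm (- (D - dZ (E k s) (E k s'))); rewrite normrN in n2.
  have ll := le_trans n1 hD; have lr := le_trans n2 hD.
  have dd := dz1 (E k s) (E k s').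
  have ss0 := edist_ge0 s s'.
  have ee := @eps_gt0 R k.
  split.
  + apply: (@le_trans _ _ ((2 * b) * D)).
      apply: ler_sqr_abs; first by rewrite mulr_ge0 // mulr_ge0 // ltW.
      rewrite exprMn [leRHS]mulrC -ED; apply: ler_wpM2l; first exact: sqr_ge0.
      by rewrite expr2; apply: ler_pM; rewrite ?lhi // ltW ?l0.
    apply: ler_pM => //; [by rewrite mulr_ge0 // ltW | lra_from Kb | lra_from ll eps1 ee].
  + have D1 : D <= K1 * edist s s'.
      rewrite /K1 div1r ler_pdivlMl //.
      apply: ler_sqr_abs => //; rewrite exprMn mulrC -ED; apply: ler_wpM2l; first exact: sqr_ge0.
      by rewrite expr2; apply: ler_pM; try exact: (ltW m0); exact: lm.
    have : K1 * edist s s' <= K * edist s s' by rewrite ler_wpM2r.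
    lra_from lr D1.
  + have h1 := sp_G (h k) SP (SL' k _ hs) PP (inB' _ hs qs).
    have h2 := ler_norm (- (edist (P k) (act (L' k) s) / Lam k - dZ (G k (P k)) (G k (act (L' k) s)))).
    rewrite normrN in h2.
    have h3 : edist (P k) (act (L' k) s) / Lam k <= K2 + C by rewrite ler_pdivrMr // edistC; exact: inB.
    have h4 := dzt z (G k (P k)) (E k s); rewrite (sp_z (h k)) add0r -/(E k s) in h4 h1 h2 *.
    by have := le_trans h2 h1; lra_from h3 h4 KC eps1.
- move=> D.
  (* A point of the tangent within [D] of the base point comes from a point within rescaled distance
     [D'] of the preimage of [y0]. This bounds the factor below by [m], so the upper bound in |s -
     u|^2 keeps the point away from the pole. *)
  pose D' := `|D| + 2 + C.
  have D'0 : 0 < D' by rewrite /D'; have := normr_ge0 D; light_lra.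
  pose m := (d / 2) ^+ 2 / (D' ^+ 2 * (2 * b)).
  have m0 : 0 < m by rewrite divr_gt0 ?mulr_gt0 ?exprn_gt0 ?mulr_gt0 // divr_gt0.
  pose tau0 := Num.min (d / 2) (Num.sqrt (m / b)).
  have tau00 : 0 < tau0 by rewrite lt_min divr_gt0 //= sqrtr_gt0 divr_gt0.
  exists (tau0 / 2); first by rewrite divr_gt0.
  have tt : 0 < tau0 / 2 by rewrite divr_gt0.
  have m2 : 0 < m / 2 by rewrite divr_gt0.
  apply: UU_imp (UU_and (ucv_lt uq tt) (UU_and (ucv_lt (@eps_ucv R) m2) (nat_ucv_inf (D + 1)))) => k /= [uk [ek kD]] w hw.
  have Lk := sp_L0 (h k).
  have eps1 : eps R k <= 1 by rewrite invf_le1 // ler1n.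
  have [|x [Sx xP] xw] := sp_D (h k) (w := w); first by lra_from hw kD eps1.
  have [H Hs] := sp_sym (h k).
  have xK : act (L' k) (act (L k) x) = x by rewrite (actK H (Ss _ Sx)).
  have Sl : S (act (L k) x) by apply/(Hs x (Ss _ Sx)).
  exists (act (L k) x); last by rewrite /E xK.
  split=> //.
  have PP : edist (P k) (P k) < k.+1%:R * Lam k by rewrite edist_xx mulr_gt0 // ltr0n.
  have h1 := sp_G (h k) (sp_SP (h k)) Sx PP xP.
  have h2 := ler_norm (edist (P k) x / Lam k - dZ (G k (P k)) (G k x)).
  have h3 := dzt (G k (P k)) z (G k x); rewrite (dzC _ z) (sp_z (h k)) add0r in h3.
  have h4 := dzt z w (G k x).
  have h5 : edist (P k) x / Lam k <= `|D| + 2 by have := ler_norm D; lra_from h1 h2 h3 h4 hw xw eps1.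
  have h6 : edist x (act (L' k) (y0 k)) / Lam k <= D'.
    rewrite ler_pdivrMr //; move: h5; rewrite ler_pdivrMr // => h5.
    have := edist_tri x (P k) (act (L' k) (y0 k)); have := sp_P (h k).
    rewrite (edistC (act _ _) (P k)) (edistC x (P k)) /D'; lra_from h5.
  suff : tau0 <= edist (act (L k) x) (u k).
    have := edist_tri (act (L k) x) q (u k); rewrite (edistC q); lra_from uk.
  rewrite leNgt; apply/negP; rewrite lt_min => /andP[k1 k2].
  have E1 := dist k _ _ Sl (sp_y0 (h k)); rewrite xK in E1.
  have far : d / 2 <= edist (act (L k) x) (y0 k).
    have := edist_tri (y0 k) (act (L k) x) (u k); have := sp_y0u (h k); rewrite (edistC (y0 k) (act _ _)); lra_from k1.
  have lm : m <= l k (act (L k) x).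
    rewrite /m ler_pdivrMr ?mulr_gt0 ?exprn_gt0 //.
    apply: (@le_trans _ _ (edist (act (L k) x) (y0 k) ^+ 2)).
      by rewrite ler_sqr ?nnegrE ?edist_ge0 // divr_ge0 // ltW.
    rewrite -E1 mulrCA; apply: ler_wpM2l; first by rewrite ltW // l0.
    apply: ler_pM.
    - exact: sqr_ge0.
    - by rewrite ltW // l0 //; exact: sp_y0 (h k).
    - by apply: sqr_mono => //; rewrite divr_ge0 ?edist_ge0 // ltW.
    - by rewrite lhi //; exact: sp_y0 (h k).
  have := lhi' k _ Sl.
  have k3 : edist (act (L k) x) (u k) ^+ 2 < m / b.
    have mb : 0 <= m / b by rewrite divr_ge0 // ltW.
    by rewrite -(sqr_sqrtr mb) ltr_sqr ?nnegrE ?edist_ge0 ?sqrtr_ge0.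
  have := ltr_pM2l b0 (edist (act (L k) x) (u k) ^+ 2) (m / b); rewrite k3 => k4.
  rewrite (_ : b * (m / b) = m) in k4; last by field; rewrite gt_eqF.
  lra_from k4 lm ek.
Qed.

End TangentLimitExists.

(** * Consequences of quasisymmetry on bounded sets *)

Section QuasiSymmetry.
Variable R : realType.
Variables (Z Z' : Type) (dZ : Z -> Z -> R) (dZ' : Z' -> Z' -> R) (F : Z -> Z').
Hypotheses (mZ : is_metric dZ) (mZ' : is_metric dZ') (qs : quasisymmetric dZ dZ' F).

Let d_ge0 x y : 0 <= dZ x y. Proof. by have [] := mZ. Qed.
Let d_xx x : dZ x x = 0. Proof. by have [_ h _ _] := mZ; apply/h. Qed.
Let d_gt0 x y : x <> y -> 0 < dZ x y.
Proof. by have [_ h _ _] := mZ => xy; rewrite lt_def d_ge0 andbT; apply/eqP => /h. Qed.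
Let dC x y : dZ x y = dZ y x. Proof. by have [] := mZ. Qed.
Let dtri x y w : dZ x w <= dZ x y + dZ y w. Proof. by have [_ _ _ h] := mZ. Qed.
Let d'_ge0 x y : 0 <= dZ' x y. Proof. by have [] := mZ'. Qed.
Let d'C x y : dZ' x y = dZ' y x. Proof. by have [] := mZ'. Qed.
Let d'tri x y w : dZ' x w <= dZ' x y + dZ' y w. Proof. by have [_ _ _ h] := mZ'. Qed.
Let F_inj x y : F x = F y -> x = y.
Proof. by have [[g [K _ _ _]] _] := qs => e; rewrite -(K x) e K. Qed.
Let d'_gt0 x y : x <> y -> 0 < dZ' (F x) (F y).
Proof. by have [_ h _ _] := mZ' => xy; rewrite lt_def d'_ge0 andbT; apply/eqP => /h /F_inj. Qed.

Lemma qs_control : exists eta : R -> R, [/\ forall t, 0 <= t -> 0 <= eta t,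
  forall s t, 0 <= s -> s <= t -> eta s <= eta t,
  forall e : R, 0 < e -> exists2 d : R, 0 < d & forall t, 0 <= t -> t < d -> eta t < e
  & forall x y w, x <> w -> dZ' (F x) (F y) <= eta (dZ x y / dZ x w) * dZ' (F x) (F w)].
Proof.
have [_ [eta [e0 em ec _ eq]]] := qs.
have mono s t : 0 <= s -> s <= t -> eta s <= eta t.
  by move=> s0; rewrite le_eqVlt => /orP[/eqP -> //|st]; apply: ltW; exact: em.
have pos t : 0 <= t -> 0 <= eta t by move=> t0; rewrite -e0; exact: mono.
exists eta; split=> //.
  move=> e ep; have [d d0 hd] := ec 0 e (lexx 0) ep; exists d => // t t0 td.
  by have := hd t t0; rewrite subr0 ger0_norm // e0 subr0 ger0_norm ?pos // => /(_ td).
by move=> x y w xw; rewrite -ler_pdivrMr ?d'_gt0 //; exact: eq.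
Qed.

Variables (z z1 : Z) (z' : Z').
Hypothesis z1z : z <> z1.

Lemma qs_bounded (D : R) : exists D' : R, forall x, dZ z x <= D -> dZ' z' (F x) <= D'.
Proof.
have [eta [ep em _ eq]] := qs_control.
exists (dZ' z' (F z) + eta (`|D| / dZ z z1) * dZ' (F z) (F z1)) => x hx.
apply: le_trans (d'tri _ (F z) _) _; rewrite lerD2l.
apply: le_trans (eq z x z1 z1z) _; apply: ler_wpM2r => //.
apply: em; first by rewrite divr_ge0.
by rewrite ler_pM2r ?invr_gt0 ?d_gt0 // (le_trans hx) // ler_norm.
Qed.

(** If [x] were very far, the ratio dZ z z1 / dZ z x would be small, so the fixed image distance of
    z and z1 would be too small compared with that of z and x. *)
Lemma qs_bounded_inv (D' : R) : exists D : R, forall x, dZ' z' (F x) <= D' -> dZ z x <= D.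
Proof.
have [eta [ep em e0 eq]] := qs_control.
pose K := `|D'| + dZ' z' (F z) + 1.
have K0 : 0 < K by rewrite ltr_wpDl // addr_ge0.
have p1 : 0 < dZ' (F z) (F z1) / K by rewrite divr_gt0 // d'_gt0.
have [d dp hd] := e0 _ p1.
exists (dZ z z1 / d) => x hx.
have [->|xz] := EM (z = x); first by rewrite d_xx divr_ge0 // ltW.
rewrite ler_pdivlMr // leNgt; apply/negP => h.
have t0 : 0 <= dZ z z1 / dZ z x by rewrite divr_ge0.
have hlt : dZ z z1 / dZ z x < d by rewrite ltr_pdivrMr ?d_gt0 // mulrC.
have := eq z z1 x xz; have := hd _ t0 hlt; rewrite ltr_pdivlMr // => k1 k2.
have k3 : dZ' (F z) (F x) <= K.
  have := d'tri (F z) z' (F x); rewrite (d'C (F z) z'); have := ler_norm D'; rewrite /K; lra.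
have := ler_wpM2l (ep _ t0) k3; lra.
Qed.

(** The three-point inequality needs a third point at definite distance; z or z1 always serves. *)
Lemma qs_uniform (D e : R) : 0 < e -> exists2 d : R, 0 < d & forall x y, dZ z x <= D -> dZ x y <= d -> dZ' (F x) (F y) <= e.
Proof.
move=> ep; have [eta [epos em e0 eq]] := qs_control.
pose z2 := F z; have [D' hD'] : exists D' : R, forall x, dZ z x <= D -> dZ' (F z) (F x) <= D'.
  exists (eta (`|D| / dZ z z1) * dZ' (F z) (F z1)) => x hx.
  apply: le_trans (eq z x z1 z1z) _; apply: ler_wpM2r => //.
  apply: em; first by rewrite divr_ge0.
  by rewrite ler_pM2r ?invr_gt0 ?d_gt0 // (le_trans hx) // ler_norm.
have c0 := d_gt0 z1z; pose c := dZ z z1 / 2.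
have cp : 0 < c by rewrite divr_gt0.
pose K := `|D'| + dZ' (F z) (F z1) + 1.
have K0 : 0 < K by rewrite ltr_wpDl // addr_ge0.
have eK : 0 < e / K by rewrite divr_gt0.
have [d dp hd] := e0 _ eK.
exists (d * c / 2); first by rewrite divr_gt0 // mulr_gt0.
move=> x y hx xy.
(* [c] is half the distance of z and z1, so at least one of them is at distance [c] or more from
   [x]. *)
have [w [xw wK]] : exists w, c <= dZ x w /\ dZ' (F x) (F w) <= K.
  have n1 := ler_norm D'; have n2 := hD' _ hx.
  have := dtri z x z1; rewrite (dC z x) => tri.
  have [h|h] := leP c (dZ x z).
    by exists z; split=> //; rewrite d'C /K; have := d'_ge0 (F z) (F z1); lra.
  exists z1; split; first by rewrite /c in h *; lra.
  by have := d'tri (F x) (F z) (F z1); rewrite (d'C (F x) (F z)) /K; lra.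
have xw' : x <> w by move=> e1; move: xw; rewrite e1 d_xx leNgt cp.
apply: le_trans (eq x y w xw') _.
have t0 : 0 <= dZ x y / dZ x w by rewrite divr_ge0.
have : eta (dZ x y / dZ x w) < e / K.
  apply: hd => //; rewrite ltr_pdivrMr ?d_gt0 //.
  apply: le_lt_trans xy _; apply: lt_le_trans (ler_wpM2l (ltW dp) xw).
  by rewrite ltr_pdivrMr // ltr_pMr ?mulr_gt0 // ltr1n.
rewrite ltr_pdivlMr // => k1.
have := ler_wpM2l (epos _ t0) wK; lra.
Qed.

End QuasiSymmetry.

(** * The homeomorphism between the two Schottky sets *)

Section LimitMap.
Variable R : realType.
Implicit Types (x y s t a b q : pt R).

(** Weak quasisymmetry away from [q], with a constant depending on the distance to [q]. *)
Definition lqs (S : set (pt R)) (f : pt R -> pt R) q := forall d A : R, 0 < d -> exists2 B : R, 0 < B &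
  forall x y t, S x -> S y -> S t -> d <= edist x q -> d <= edist y q -> d <= edist t q ->
  edist x t <= A * edist x y -> edist (f x) (f t) <= B * edist (f x) (f y).

Lemma far_two (S : set (pt R)) N q : SD S N -> S q -> exists s t, [/\ S s, S t & [/\ s <> q, t <> q & s <> t]].
Proof.
move=> sd Sq; have [C [d1 [C1 d10 h]]] := triple_at sd.
have hd : 0 < d1 <= d1 by rewrite d10 /=.
have [y [z [Sy Sz [a1 a2 a3]]]] := h q d1 Sq hd.
have C0 : 0 < C by apply: lt_le_trans C1.
have ne a b : d1 / C <= edist a b <= C * d1 -> a <> b.
  by move=> /andP[k _] e; move: k; rewrite e edist_xx leNgt divr_gt0.
by exists y, z; split=> //; split; [exact/nesym/(ne _ _ a1) | exact/nesym/(ne _ _ a3) | exact: ne a2].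
Qed.

Lemma ucvp_edist (x y : nat -> pt R) (a b : pt R) : ucvp x a -> ucvp y b -> ucv (fun n => edist (x n) (y n)) (edist a b).
Proof.
move=> h k; have := ucvD h k; rewrite addr0 => c; apply: (ucv_squeeze c); apply: UU_all => n /=.
rewrite ler_norml; apply/andP; split.
  have := edist_tri a (x n) b; have := edist_tri (x n) (y n) b; rewrite (edistC a (x n)); lra.
have := edist_tri (x n) a (y n); have := edist_tri a b (y n); rewrite (edistC b (y n)); lra.
Qed.

Lemma ucvp_cst (a : pt R) : ucvp (fun=> a) a.
Proof. by move=> e e0; apply: UU_all => n; rewrite edist_xx subrr normr0. Qed.

Variables (S S1 : set (pt R)) (N N1 : set (vec R)) (Z Z' : Type) (dZ : Z -> Z -> R) (dZ' : Z' -> Z' -> R).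
Variables (z : Z) (z' : Z') (E : nat -> pt R -> Z) (E' : nat -> pt R -> Z') (q q' : pt R) (F : Z -> Z').
Hypotheses (sd : SD S N) (sd1 : SD S1 N1) (mZ : is_metric dZ) (mZ' : is_metric dZ').
Hypotheses (tl : tangent_limit S dZ z E q) (tl' : tangent_limit S1 dZ' z' E' q') (qs : quasisymmetric dZ dZ' F).

Let d_ge0 (x y : Z) : 0 <= dZ x y. Proof. by have [] := mZ. Qed.
Let dC (x y : Z) : dZ x y = dZ y x. Proof. by have [] := mZ. Qed.
Let dtri (x y w : Z) : dZ x w <= dZ x y + dZ y w. Proof. by have [_ _ _ h] := mZ. Qed.
Let d'_ge0 (x y : Z') : 0 <= dZ' x y. Proof. by have [] := mZ'. Qed.
Let d'C (x y : Z') : dZ' x y = dZ' y x. Proof. by have [] := mZ'. Qed.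
Let d'tri (x y w : Z') : dZ' x w <= dZ' x y + dZ' y w. Proof. by have [_ _ _ h] := mZ'. Qed.

Let z1_ex : exists z1, z <> z1.
Proof.
have [s [t [Ss St [sq tq st]]]] := far_two sd (tl_q tl).
pose d := Num.min (edist s q) (edist t q).
have d0 : 0 < d by rewrite lt_min !edist_gt0.
have [C C0 hC] := tl_bilip tl d0.
have p : 0 < edist s t / C by rewrite divr_gt0 // edist_gt0.
have [k /= [h ek]] := UU_ex (UU_and hC (ucv_lt (@eps_ucv R) p)).
have [] := h s t Ss St; rewrite ?ge_min ?lexx ?orbT // => k1 _ _.
have [e|] := EM (z = E k s); last by exists (E k s).
exists (E k t) => e2; move: k1; rewrite -e -e2.
have [_ zz _ _] := mZ; rewrite (_ : dZ z z = 0); last by apply/zz.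
by rewrite add0r mulrC -ler_pdivrMr // leNgt ek.
Qed.

(** The graph of the limit map. A relation is convenient because the approximate charts have no
    inverses. *)
Definition limrel s a := ucv (fun k => dZ' (F (E k s)) (E' k a)) 0.

Lemma limrel_ex (d : R) : 0 < d -> exists2 d' : R, 0 < d' & forall s, S s -> d <= edist s q ->
  exists a, [/\ S1 a, d' <= edist a q' & limrel s a].
Proof.
move=> d0; have [z1 hz1] := z1_ex; have [C C0 hC] := tl_bilip tl d0.
have [D hD] := qs_bounded mZ mZ' qs z' hz1 C.
have [d' d'0 hd'] := tl_dense tl' D.
exists d' => // s Ss qs'.
have : UU [set k | exists a, [/\ S1 a, d' <= edist a q' & dZ' (F (E k s)) (E' k a) <= eps R k]].
  apply: UU_imp (UU_and hC hd') => k /= [h1 h2].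
  have [_ _ /hD hk] := h1 s s Ss Ss qs' qs'.
  by have [a [Sa qa] ha] := h2 _ hk; exists a.
(* Points exist for almost every index only; elsewhere [q'] is a default value. *)
move=> U; have Q k : exists a, [/\ S1 a, d' <= edist a q' & dZ' (F (E k s)) (E' k a) <= eps R k] \/ S1 a /\
   ~ exists a, [/\ S1 a, d' <= edist a q' & dZ' (F (E k s)) (E' k a) <= eps R k].
  have [[a ha]|n] := EM (exists a, [/\ S1 a, d' <= edist a q' & dZ' (F (E k s)) (E' k a) <= eps R k]).
    by exists a; left.
  by exists q'; right; split=> //; exact: tl_q tl'.
have [a ha] := choice Q.
have Ua : UU [set k | [/\ S1 (a k), d' <= edist (a k) q' & dZ' (F (E k s)) (E' k (a k)) <= eps R k]].
  by apply: UU_imp U => k /= hk; have [//|[_ /(_ hk)]] := ha k.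
have Sa k : S1 (a k) by have [[]|[]] := ha k.
have [b Sb ab] := ucvp_ex (sd_compact sd1) (UU_all Sa).
have qb : d' <= edist b q'.
  apply: (ucv_le (ucv_cst d') (ucvp_edist ab (ucvp_cst q'))).
  by apply: UU_imp Ua => k /= [].
exists b; split=> //.
have [C' C'0 hC'] := tl_bilip tl' d'0.
have lim := ucvD (@eps_ucv R) (ucvD (ucvM (ucv_cst C') ab) (@eps_ucv R)).
rewrite mulr0 !addr0 in lim.
apply: (ucv_squeeze lim); apply: UU_imp (UU_and Ua hC') => k /= [[Sk qk dk] hk].
rewrite subr0 ger0_norm //; apply: le_trans (d'tri _ (E' k (a k)) _) _.
have [_ h2 _] := hk _ _ Sk Sb qk qb; exact: lerD.
Qed.

Lemma limrel_sur (d' : R) : 0 < d' -> exists2 d : R, 0 < d & forall a, S1 a -> d' <= edist a q' ->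
  exists s, [/\ S s, d <= edist s q & limrel s a].
Proof.
move=> d'0; have [z1 hz1] := z1_ex; have [C C0 hC] := tl_bilip tl' d'0.
have [[Fi [FK FK' _ _]] _] := qs.
have [D hD] := qs_bounded_inv mZ mZ' qs z' hz1 C.
have [d d0 hd] := tl_dense tl D.
exists d => // a Sa qa.
pose y k := Fi (E' k a).
pose P k s := [/\ S s, d <= edist s q & dZ (y k) (E k s) <= eps R k].
have U : UU [set k | dZ z (y k) <= D /\ exists s, P k s].
  apply: UU_imp (UU_and hC hd) => k /= [h1 h2].
  have [_ _ h3] := h1 a a Sa Sa qa qa.
  have yD : dZ z (y k) <= D by apply: hD; rewrite /y FK'.
  by split=> //; have [s [Ss qs'] hs] := h2 _ yD; exists s.
have Q k : exists s, P k s \/ S s /\ ~ exists s, P k s.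
  have [[s hs]|n] := EM (exists s, P k s); first by exists s; left.
  by exists q; right; split=> //; exact: tl_q tl.
have [s hs] := choice Q.
have Us : UU [set k | dZ z (y k) <= D /\ P k (s k)].
  by apply: UU_imp U => k /= [hz hk]; split=> //; have [//|[_ /(_ hk)]] := hs k.
have Ss k : S (s k) by have [[]|[]] := hs k.
have [b Sb ab] := ucvp_ex (sd_compact sd) (UU_all Ss).
have qb : d <= edist b q.
  apply: (ucv_le (ucv_cst d) (ucvp_edist ab (ucvp_cst q))).
  by apply: UU_imp Us => k /= [_ []].
exists b; split=> //.
have [C' C'0 hC'] := tl_bilip tl d0.
have lim := ucvD (@eps_ucv R) (ucvD (ucvM (ucv_cst C') ab) (@eps_ucv R)).
rewrite mulr0 !addr0 in lim.
have lim2 : ucv (fun k => dZ (y k) (E k b)) 0.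
  apply: (ucv_squeeze lim); apply: UU_imp (UU_and Us hC') => k /= [[_ [Sk qk dk]] hk].
  rewrite subr0 ger0_norm //; apply: le_trans (dtri _ (E k (s k)) _) _.
  have [_ h2 _] := hk _ _ Sk Sb qk qb; exact: lerD.
move=> e e0; have e20 : 0 < e / 2 by rewrite divr_gt0.
have [r r0 hr] := qs_uniform mZ mZ' qs hz1 D e20.
apply: UU_imp (UU_and Us (ucv_lt lim2 r0)) => k /= [[yD _] /ltW yr].
rewrite subr0 ger0_norm // d'C; have := hr _ _ yD yr; rewrite /y FK' => k1.
by apply: le_lt_trans k1 _; rewrite ltr_pdivrMr // ltr_pMr // ltr1n.
Qed.

Let limrel_dist (d' : R) : 0 < d' -> exists2 C : R, 0 < C & forall s t a b, S1 a -> S1 b -> limrel s a -> limrel t b ->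
  d' <= edist a q' -> d' <= edist b q' -> exists2 u : nat -> R, ucv u 0 &
  UU [set k | edist a b <= C * (dZ' (F (E k s)) (F (E k t)) + u k) /\ dZ' (F (E k s)) (F (E k t)) <= C * edist a b + u k].
Proof.
move=> d'0; have [C C0 hC] := tl_bilip tl' d'0; exists C => // s t a b Sa Sb ra rb qa qb.
exists (fun k => dZ' (F (E k s)) (E' k a) + dZ' (F (E k t)) (E' k b) + eps R k).
  by have := ucvD (ucvD ra rb) (@eps_ucv R); rewrite !addr0.
apply: UU_imp hC => k /= h; have [h1 h2 _] := h a b Sa Sb qa qb.
have t1 := d'tri (E' k a) (F (E k s)) (E' k b); rewrite (d'C (E' k a) (F (E k s))) in t1.
have t2 := d'tri (F (E k s)) (F (E k t)) (E' k b).
have t3 := d'tri (F (E k s)) (E' k a) (F (E k t)).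
have t4 := d'tri (E' k a) (E' k b) (F (E k t)); rewrite (d'C (E' k b) (F (E k t))) in t4.
split; last by lra.
apply: le_trans h1 _; rewrite ler_pM2l //; lra.
Qed.

Lemma limrel_uniq s a b : S1 a -> S1 b -> a <> q' -> b <> q' -> limrel s a -> limrel s b -> a = b.
Proof.
move=> Sa Sb aq bq ra rb.
pose d' := Num.min (edist a q') (edist b q').
have d'0 : 0 < d' by rewrite lt_min !edist_gt0.
have [C C0 hC] := limrel_dist d'0.
have [||u u0 hu] := hC _ _ _ _ Sa Sb ra rb; try by rewrite /d' ge_min lexx ?orbT.
apply: edist_eq0; apply/eqP; rewrite eq_le edist_ge0 andbT.
have := ucvM (ucv_cst C) u0; rewrite mulr0 => lim.
apply: (ucv_le (ucv_cst _) lim); apply: UU_imp hu => k /= [h _].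
by move: h; have [_ hh _ _] := mZ'; rewrite (_ : dZ' (F (E k s)) (F (E k s)) = 0) ?add0r //; apply/hh.
Qed.

(** The modulus of [F] passes to the limit relation: charts distort distances by bounded factors at
    distance [d] from [q], and their additive errors vanish along the ultrafilter. *)
Lemma limrel_qs : exists2 eta : R -> R,
  (forall e : R, 0 < e -> exists2 r : R, 0 < r & forall t : R, 0 <= t -> t < r -> eta t < e) /\
  (forall s t : R, 0 <= s -> s <= t -> eta s <= eta t) &
  forall d : R, 0 < d -> exists C1 C2 : R, [/\ 0 < C1, 0 < C2 & forall x y t a b c, S x -> S y -> S t ->
    d <= edist x q -> d <= edist y q -> d <= edist t q -> S1 a -> S1 b -> S1 c -> a <> q' -> b <> q' -> c <> q' ->
    limrel x a -> limrel y b -> limrel t c -> x <> y ->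
    edist a c <= C2 * eta (C1 * (edist x t / edist x y)) * edist a b].
Proof.
have [eta [ep em e0 eq]] := qs_control mZ' qs.
exists eta => // d d0.
have [C C0 hC] := tl_bilip tl d0.
have [d' d'0 hd'] := limrel_ex d0.
have [C' C'0 hC'] := limrel_dist d'0.
(* Each source distance costs a factor C for the chart and a factor 2 to absorb the additive error;
   each target distance costs C'. *)
exists (4 * C * C), (C' * C'); split; [by rewrite !mulr_gt0 | by rewrite mulr_gt0 |].
move=> x y t a b c Sx Sy St qx qy qt Sa Sb Sc aq bq cq ra rb rc xy.
have far s w : S s -> d <= edist s q -> S1 w -> w <> q' -> limrel s w -> d' <= edist w q'.
  move=> Ss qs' Sw wq rw; have [w' [Sw' qw rw']] := hd' s Ss qs'.
  rewrite (limrel_uniq Sw Sw' wq _ rw rw') // => e; move: qw.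
  by rewrite e edist_xx leNgt d'0.
have fa := far _ _ Sx qx Sa aq ra; have fb := far _ _ Sy qy Sb bq rb; have fc := far _ _ St qt Sc cq rc.
have xy0 := edist_gt0 xy.
have K0 : 0 <= 4 * C * C * (edist x t / edist x y).
  by apply: mulr_ge0; [rewrite !mulr_ge0 // ltW | rewrite divr_ge0 ?edist_ge0].
have [xt|xt] := EM (x = t).
  rewrite -xt in rc; rewrite (limrel_uniq Sa Sc aq cq ra rc) edist_xx mulr_ge0 ?edist_ge0 //.
  by rewrite mulr_ge0 ?ep // mulr_ge0 // ltW.
have xt0 := edist_gt0 xt.
have [u u0 hu] := hC' _ _ _ _ Sa Sc ra rc fa fc.
have [v v0 hv] := hC' _ _ _ _ Sa Sb ra rb fa fb.
set K := 4 * C * C * _ in K0 *.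
have lim := ucvM (ucv_cst C') (ucvD (ucvM (ucv_cst (eta K)) (ucvD (ucv_cst (C' * edist a b)) v0)) u0).
rewrite !addr0 in lim.
have p1 : 0 < C * edist x t by rewrite mulr_gt0.
have p2 : 0 < edist x y / (2 * C) by rewrite divr_gt0 // mulr_gt0.
have -> : C' * C' * eta K * edist a b = C' * (eta K * (C' * edist a b)) by ring.
apply: (ucv_le (ucv_cst _) lim).
apply: UU_imp (UU_and hC (UU_and (UU_and (ucv_lt (@eps_ucv R) p1) (ucv_lt (@eps_ucv R) p2)) (UU_and hu hv))) => k /= [hk [[e1 e2] [[h1 _] [_ h2]]]].
have [_ b1 _] := hk _ _ Sx St qx qt; have [b2 _ _] := hk _ _ Sx Sy qx qy.
apply: le_trans h1 _; rewrite ler_pM2l // lerD2r.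
have b3 : edist x y / (2 * C) <= dZ (E k x) (E k y).
  have : edist x y / C <= dZ (E k x) (E k y) + eps R k by rewrite ler_pdivrMr // mulrC.
  have -> : edist x y / C = edist x y / (2 * C) + edist x y / (2 * C) by field; rewrite gt_eqF.
  lra.
have Exy : E k x <> E k y.
  move=> e; have := lt_le_trans p2 b3; rewrite e; have [_ hh _ _] := mZ.
  by rewrite (_ : dZ (E k y) (E k y) = 0) ?ltxx //; apply/hh.
apply: le_trans (eq _ (E k t) _ Exy) _.
apply: (@le_trans _ _ (eta K * dZ' (F (E k x)) (F (E k y)))); last by apply: ler_wpM2l => //; exact: ep.
apply: ler_wpM2r => //; apply: em; first by rewrite divr_ge0.
have D0 : 0 < dZ (E k x) (E k y) by apply: lt_le_trans b3.
rewrite ler_pdivrMr //.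
apply: (@le_trans _ _ (2 * (C * edist x t))); first by lra.
have := ler_wpM2l K0 b3; apply: le_trans; rewrite /K.
by rewrite le_eqVlt; apply/orP; left; apply/eqP; field; rewrite !gt_eqF.
Qed.

(** The limit relation is a bijection off q and q', completed by sending q to q'. *)
Lemma limit_map : exists f g, [/\ HM S S1 f g, f q = q' & lqs S f q].
Proof.
have [eta [e0 em] hqs] := limrel_qs.
have nd : edist q q' < edist q q' + 1 by rewrite ltrDl.
have rel_f s : S s -> s <> q -> exists a, [/\ S1 a, a <> q' & limrel s a].
  move=> Ss /edist_gt0 sq; have [d' d'0 hd'] := limrel_ex sq.
  have [a [Sa qa ra]] := hd' s Ss (lexx _); exists a; split=> // e.
  by move: qa; rewrite e edist_xx leNgt d'0.
have rel_g a : S1 a -> a <> q' -> exists s, [/\ S s, s <> q & limrel s a].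
  move=> Ss /edist_gt0 sq; have [d' d'0 hd'] := limrel_sur sq.
  have [s [Sa qa ra]] := hd' a Ss (lexx _); exists s; split=> // e.
  by move: qa; rewrite e edist_xx leNgt d'0.
have inj s t a : S s -> S t -> s <> q -> t <> q -> S1 a -> a <> q' -> limrel s a -> limrel t a -> s = t.
  move=> Ss St sq tq Sa aq rs rt; apply: contrapT => st.
  (* With two preimages of [a], the right side of the three-point inequality is 0, so every point of
     S1 other than q' would equal [a]. *)
  have all c : S1 c -> c <> q' -> c = a.
    move=> Sc cq; have [w [Sw wq rw]] := rel_g c Sc cq.
    pose d := Num.min (edist s q) (Num.min (edist t q) (edist w q)).
    have d0 : 0 < d by rewrite !lt_min !edist_gt0.
    have [C1 [C2 [C10 C20 h]]] := hqs d d0.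
    have := h s t w a a c Ss St Sw; rewrite /d !ge_min !lexx !orbT => /(_ erefl erefl erefl Sa Sa Sc aq aq cq rs rt rw st).
    rewrite edist_xx mulr0 => k; apply/esym/edist_eq0/eqP; by rewrite eq_le k edist_ge0.
  have [c1 [c2 [Sc1 Sc2 [n1 n2 n12]]]] := far_two sd1 (tl_q tl').
  by apply: n12; rewrite (all c1) // (all c2).
have Qf s : exists a, (S s -> s <> q -> [/\ S1 a, a <> q' & limrel s a]) /\ (s = q -> a = q').
  have [->|sq] := EM (s = q); first by exists q'.
  have [Ss|nS] := EM (S s); last by exists q'; split.
  by have [a ha] := rel_f s Ss sq; exists a; split.
have Qg a : exists s, (S1 a -> a <> q' -> [/\ S s, s <> q & limrel s a]) /\ (a = q' -> s = q).
  have [->|sq] := EM (a = q'); first by exists q.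
  have [Ss|nS] := EM (S1 a); last by exists q; split.
  by have [s hs] := rel_g a Ss sq; exists s; split.
have [f hf] := choice Qf; have [g hg] := choice Qg.
have fq : f q = q' by apply: (hf q).2.
have gq : g q' = q by apply: (hg q').2.
have Sq := tl_q tl; have Sq' := tl_q tl'.
have Sf s : S s -> S1 (f s).
  by move=> Ss; have [->|sq] := EM (s = q); [rewrite fq | have [] := (hf s).1 Ss sq].
have Sg a : S1 a -> S (g a).
  by move=> Ss; have [->|sq] := EM (a = q'); [rewrite gq | have [] := (hg a).1 Ss sq].
have gK s : S s -> g (f s) = s.
  move=> Ss; have [->|sq] := EM (s = q); first by rewrite fq gq.
  have [Sa aq ra] := (hf s).1 Ss sq; have [St tq rt] := (hg (f s)).1 Sa aq.
  exact: inj Sa aq rt ra.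
have fK a : S1 a -> f (g a) = a.
  move=> Sa; have [->|sq] := EM (a = q'); first by rewrite gq fq.
  have [Ss aq ra] := (hg a).1 Sa sq; have [St tq rt] := (hf (g a)).1 Ss aq.
  exact: limrel_uniq rt ra.
have cont (x : nat -> pt R) s : (forall n, S (x n)) -> S s -> ucvp x s -> ucvp (fun n => f (x n)) (f s).
  (* At q: if the images tended to a point other than q', [limrel_sur] would keep their preimages
     away from q. Elsewhere the modulus of [limrel_qs] gives continuity. *)
  move=> Sx Ss xs; have [sq|sq] := EM (s = q).
    rewrite sq fq; rewrite sq in xs.
    have [b Sb xb] := ucvp_ex (sd_compact sd1) (UU_all (fun n => Sf _ (Sx n))).
    have [<-//|/edist_gt0 bq] := EM (b = q').
    have bq2 : 0 < edist b q' / 2 by rewrite divr_gt0.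
    have [d d0 hd] := limrel_sur bq2; exfalso.
    have lb := ucvp_edist xb (ucvp_cst q').
    have hlt : edist b q' / 2 < edist b q' by rewrite ltr_pdivrMr // ltr_pMr // ltr1n.
    have [n /= [h1 h2]] := UU_ex (UU_and (ucv_gt lb hlt) (ucv_lt xs d0)).
    have [t [St tq rt]] := hd _ (Sf _ (Sx n)) (ltW h1).
    have fnq : f (x n) <> q' by move=> e; move: h1; rewrite e edist_xx ltNge ltW.
    have xq : x n <> q by move=> e; apply: fnq; rewrite e.
    have tq' : t <> q by move=> e; move: tq; rewrite e edist_xx leNgt d0.
    have [Sa aq ra] := (hf (x n)).1 (Sx n) xq.
    have e := inj _ _ _ (Sx n) St xq tq' Sa aq ra rt.
    by move: h2; rewrite e ltNge tq.
  have [y1 [y2 [Sy1 Sy2 [y1q y2q y12]]]] := far_two sd Sq.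
  have [y [Sy yq sy]] : exists y, [/\ S y, y <> q & s <> y].
    by have [e|ne] := EM (s = y1); [exists y2; rewrite e | exists y1].
  pose d := Num.min (edist s q / 2) (edist y q).
  have sq0 := edist_gt0 sq.
  have d0 : 0 < d by rewrite lt_min edist_gt0 // divr_gt0.
  have [C1 [C2 [C10 C20 h]]] := hqs d d0.
  have [Sa aq ra] := (hf s).1 Ss sq; have [Sb bq rb] := (hf y).1 Sy yq.
  move=> e ep; have K0 : 0 < C2 * (edist (f s) (f y) + 1) by rewrite mulr_gt0 // ltr_wpDl ?edist_ge0.
  have eK : 0 < e / (C2 * (edist (f s) (f y) + 1)) by rewrite divr_gt0.
  have [r r0 hr] := e0 _ eK.
  have sy0 := edist_gt0 sy.
  have r1 : 0 < Num.min (r / C1 * edist s y) (edist s q / 2) by rewrite lt_min mulr_gt0 ?divr_gt0.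
  apply: UU_imp (ucv_lt xs r1) => n /=; rewrite lt_min => /andP[h1 h2].
  have h3 := edist_tri s (x n) q; rewrite (edistC s (x n)) in h3.
  have xq : edist s q / 2 <= edist (x n) q by lra.
  have xq' : x n <> q by move=> e'; move: xq; rewrite e' edist_xx leNgt divr_gt0.
  have [Sc cq rc] := (hf (x n)).1 (Sx n) xq'.
  rewrite subr0 ger0_norm ?edist_ge0 // edistC.
  have dx : d <= edist (x n) q by rewrite /d ge_min xq.
  have ds : d <= edist s q by rewrite /d ge_min; apply/orP; left; lra.
  have dy : d <= edist y q by rewrite /d ge_min lexx orbT.
  have := h s y (x n) _ _ _ Ss Sy (Sx n) ds dy dx Sa Sb Sc aq bq cq ra rb rc sy.
  have t0 : 0 <= C1 * (edist s (x n) / edist s y) by rewrite mulr_ge0 ?divr_ge0 ?edist_ge0 // ltW.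
  have tr : C1 * (edist s (x n) / edist s y) < r.
    by rewrite mulrC -ltr_pdivlMr // ltr_pdivrMr // edistC.
  have := hr _ t0 tr; rewrite ltr_pdivlMr // => h4 h5; apply: le_lt_trans h5 _.
  have fab := edist_ge0 (f s) (f y).
  have [ng|ng] := leP 0 (eta (C1 * (edist s (x n) / edist s y))).
    apply: le_lt_trans h4; rewrite (mulrC C2) -mulrA; apply: ler_wpM2l => //; apply: ler_wpM2l; first exact: ltW.
    by rewrite lerDl.
  by apply: le_lt_trans ep; rewrite mulr_le0_ge0 // mulr_ge0_le0 // ltW.
exists f, g; split=> //; first by apply: HM_intro => //; exact: sd_compact sd.
move=> d A d0; have [C1 [C2 [C10 C20 h]]] := hqs d d0.
pose B := C2 * eta (C1 * `|A|).
exists (`|B| + 1); first by rewrite ltr_wpDl.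
move=> x y t Sx Sy St qx qy qt hA.
have nq s : d <= edist s q -> s <> q by move=> hs e; move: hs; rewrite e edist_xx leNgt d0.
have [Sa aq ra] := (hf x).1 Sx (nq _ qx); have [Sb bq rb] := (hf y).1 Sy (nq _ qy).
have [Sc cq rc] := (hf t).1 St (nq _ qt).
have [xy|xy] := EM (x = y).
  have xt : x = t.
    apply: edist_eq0; apply/eqP; rewrite eq_le edist_ge0 andbT; move: hA.
    by rewrite xy edist_xx mulr0.
  by rewrite -xt edist_xx mulr_ge0 ?edist_ge0 // addr_ge0.
apply: le_trans (h x y t _ _ _ Sx Sy St qx qy qt Sa Sb Sc aq bq cq ra rb rc xy) _.
apply: ler_wpM2r; first exact: edist_ge0.
apply: (@le_trans _ _ B); last by have := ler_norm B; lra.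
rewrite /B ler_pM2l //; apply: em; first by rewrite mulr_ge0 ?divr_ge0 ?edist_ge0 // ltW.
rewrite ler_pM2l // ler_pdivrMr ?edist_gt0 //; apply: le_trans hA _.
by rewrite ler_wpM2r ?edist_ge0 // ler_norm.
Qed.

End LimitMap.

(** * The jump inequality *)

Section DiscTools.
Variable R : realType.
Implicit Types (z w : R * R) (s : seq (vec R)) (t u d : R).

Lemma closed_max (T : R -> Prop) t0 (B : R) : T t0 -> (forall t, T t -> t <= B) ->
  (forall (u : nat -> R) l, (forall n, T (u n)) -> ucv u l -> T l) -> exists2 t, T t & forall t', T t' -> t' <= t.
Proof.
move=> T0 TB cl; have hT : has_sup [set t | T t] by split; [exists t0 | exists B].
have Q n : exists t, T t /\ sup [set t | T t] - n.+1%:R^-1 < t.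
  have n0 : 0 < (n.+1%:R : R)^-1 by rewrite invr_gt0 ltr0n.
  by have [t Tt ht] := sup_adherent n0 hT; exists t.
have [u hu] := choice Q.
exists (sup [set t | T t]); last by move=> t Tt; apply: ub_le_sup => //; case: hT.
apply: (cl u); first by move=> n; have [] := hu n.
apply: (ucv_squeeze (@ucv_inv_nat R)); apply: UU_all => n /=; have [h1 h2] := hu n.
have h3 : u n <= sup [set t | T t] by apply: ub_le_sup => //; case: hT.
by rewrite distrC ger0_norm ?subr_ge0 // lerBlDr -lerBlDl ltW.
Qed.

Lemma closed_min (T : R -> Prop) t0 (B : R) : T t0 -> (forall t, T t -> B <= t) ->
  (forall (u : nat -> R) l, (forall n, T (u n)) -> ucv u l -> T l) -> exists2 t, T t & forall t', T t' -> t <= t'.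
Proof.
move=> T0 TB cl.
have [||u l hu hl|t Tt ht] := @closed_max (fun t => T (- t)) (- t0) (- B).
- by rewrite opprK.
- by move=> t /TB; lra.
- apply: (cl (fun n => - u n)) => //; have := ucvB (ucv_cst 0) hl; rewrite sub0r.
  by apply: ucv_eq; apply: UU_all => n /=; rewrite sub0r.
by exists (- t) => // t' Tt'; have := ht (- t'); rewrite opprK => /(_ Tt'); lra.
Qed.

(** Each counted integer contributes a full unit step of a clamped counter whose range has length 2
    A + 1. *)
Lemma count_near (x A : R) (K : nat) : 0 <= A ->
  \sum_(i < K) (if `|i%:R - x| <= A then 1 else 0) <= 2 * A + 1.
Proof.
move=> A0.
have ab : x - A <= x + A + 1 by lra.
pose c (i : nat) : R := clamp (x - A) (x + A + 1) i%:R.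
have step i : (if `|i%:R - x| <= A then 1 else 0) <= c i.+1 - c i.
  case: (boolP (_ <= A)) => h.
    move: h; rewrite ler_norml => /andP[h1 h2].
    rewrite /c !clamp_id -?natr1; first by lra.
    - by apply/andP; split; lra.
    - by apply/andP; split; lra.
  rewrite subr_ge0 /c -natr1 /clamp; set y := i%:R.
  by case: (leP y (x - A)) => h1; case: (leP (y + 1) (x - A)) => h2;
     case: (leP (y + 1) (x + A + 1)) => h3; case: (leP y (x + A + 1)) => h4; lra.
have : \sum_(i < K) (if `|i%:R - x| <= A then 1 else 0) <= c K - c 0%N.
  elim: K => [|K IH]; first by rewrite big_ord0 subrr.
  by rewrite big_ord_recr; apply: le_trans (lerD IH (step K)) _; rewrite addrC subrKA.
have /andP[_ h1] := clamp_in K%:R ab; have /andP[h2 _] := clamp_in 0%:R ab.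
by rewrite /c; lra.
Qed.

Section InState.
Variables (S : set (pt R)) (N : set (vec R)) (M M' : vec R -> vec R) (o : vec R).
Hypotheses (sd : SD S N) (H : st N M M' o).

Lemma proper_rad n : proper N o n -> 0 < rad M n.
Proof. by case=> a b; exact: (st_rad sd H a b). Qed.

(** More than r^-2 discs of radius at least r would violate [packing]. *)
Lemma finite_discs (r : R) : 0 < r -> exists s, uniq s /\ forall n, n \in s <-> proper N o n /\ r <= rad M n.
Proof.
move=> r0; apply: contrapT => hn.
have ext k : exists s, [/\ uniq s, size s = k & forall n, n \in s -> proper N o n /\ r <= rad M n].
  elim: k => [|k [s [us sk hs]]]; first by exists [::].
  apply: contrapT => h; apply: hn; exists s; split=> // n; split=> [/hs //|pn].
  apply: contrapT => ns; apply: h; exists (n :: s); split=> /=.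
  - by rewrite us andbT; apply/negP.
  - by rewrite sk.
  - by move=> m; rewrite inE => /orP[/eqP -> //|/hs].
have r2 : 0 < r ^+ 2 by rewrite exprn_gt0.
have [s [us sk hs]] := ext (Num.truncn (r ^+ 2)^-1).+1.
have := packing sd H us (fun n hn => (hs n hn).1).
apply/negP; rewrite -ltNge; apply: (@lt_le_trans _ _ (\sum_(n <- s) r ^+ 2)).
  have -> : \sum_(n <- s) r ^+ 2 = (size s)%:R * r ^+ 2.
    by rewrite big_const_seq count_predT iter_addr_0 mulr_natl.
  rewrite sk -ltr_pdivrMr // div1r.
  have ir : 0 <= (r ^+ 2)^-1 by rewrite invr_ge0 ltW.
  by have /andP[_ h] := truncn_itv ir.
rewrite big_seq [X in _ <= X]big_seq; apply: ler_sum => n /hs[pn rn]; apply: sqr_mono => //; exact: ltW.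
Qed.

Lemma P_closed (u : nat -> R * R) z : (forall n, S (ich M' (u n))) -> ucv2 u z -> S (ich M' z).
Proof.
move=> hu uz; apply/(st_S sd H); split.
  apply: (ucv_le (n2_ucv uz) (ucv_cst 1)); apply: UU_all => n /=.
  by have [] := (st_S sd H (u n)).1 (hu n).
move=> n Nn no; apply: (ucv_le (ucv_cst _) (ucv_d2 uz (ucv2_cst (cen M n)))).
apply: UU_all => k /=; have [_] := (st_S sd H (u k)).1 (hu k); exact.
Qed.

Lemma ucv2_line (v : nat -> R) l (y : R) : ucv v l -> ucv2 (fun n => (v n, y)) (l, y).
Proof. by move=> h; split => //=; exact: ucv_cst. Qed.

(** The midpoint of a gap of S on a horizontal line lies in a disc. Its circle belongs to S and
    meets the line between the midpoint and each end, hence at the ends. *)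
Lemma gap t u y : t < u -> S (ich M' (t, y)) -> S (ich M' (u, y)) ->
  (forall v, t < v < u -> ~ S (ich M' (v, y))) ->
  exists n, [/\ proper N o n, d2 (t, y) (cen M n) = rad M n ^+ 2 & d2 (u, y) (cen M n) = rad M n ^+ 2].
Proof.
move=> tu St Su hg; pose m := (t + u) / 2.
have tm : t < m < u by rewrite /m; apply/andP; split; lra.
have [nt ht] := (st_S sd H _).1 St; have [nu hu] := (st_S sd H _).1 Su.
have nm : n2 (m, y) < 1.
  have -> : n2 (m, y) = n2 (t, y) / 2 + n2 (u, y) / 2 - (u - t) ^+ 2 / 4 by rewrite /n2 /m /=; field.
  have : 0 < (u - t) ^+ 2 by rewrite exprn_gt0 // subr_gt0.
  lra.
have [|n pn hn] := not_inP sd H nm; first by case=> k _; exact: (hg m).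
exists n; split=> //.
  have [s /andP[s0 s1] e] := seg_cross (ht n pn.1 pn.2) (ltW hn).
  have Ss := (circ_inP sd H pn e).1.
  move: e Ss; rewrite /seg /= subrr mulr0 addr0; set v := t + _ => e Ss.
  have [vt|vt] := eqVneq v t; first by rewrite -vt.
  exfalso; apply: (hg v) => //; apply/andP; split.
    rewrite lt_def vt /v lerDl mulr_ge0 // subr_ge0; lra.
  by apply: (@le_lt_trans _ _ m); [rewrite /v -lerBrDl ler_piMl //; lra | lra].
have [s /andP[s0 s1] e] := seg_cross (hu n pn.1 pn.2) (ltW hn).
have Ss := (circ_inP sd H pn e).1.
move: e Ss; rewrite /seg /= subrr mulr0 addr0; set v := u + _ => e Ss.
have [vt|vt] := eqVneq v u; first by rewrite -vt.
exfalso; apply: (hg v) => //; apply/andP; split.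
  apply: (@lt_le_trans _ _ m); first by lra.
  rewrite /v -lerBlDl -[X in X <= _]mul1r; apply: ler_wnM2r => //; lra.
by rewrite lt_neqAle vt /v gerDl mulr_ge0_le0 // subr_le0; lra.
Qed.

End InState.
End DiscTools.

(** * Jumps across chords and their scaling *)

Section Jumps.
Variable R : realType.
Implicit Types (z w : R * R) (x : pt R) (t y r d : R).
Variables (S : set (pt R)) (N : set (vec R)) (S1 : set (pt R)) (N1 : set (vec R)).
Variables (f g : pt R -> pt R) (phi psi : vec R -> vec R).
Hypotheses (sd : SD S N) (sd1 : SD S1 N1) (hm : HM S S1 f g) (md : match_discs S N N1 f phi psi).

(** The map f read in the two charts. *)
Definition hmap (M' M1 : vec R -> vec R) z := ch M1 (f (ich M' z)).
Definition upt y : R * R := (Num.sqrt (1 - y ^+ 2), y).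
Definition lpt y : R * R := (- Num.sqrt (1 - y ^+ 2), y).
(* The oscillation of f across the chord of the unit circle at height y. *)
Definition jump (M' M1 : vec R -> vec R) y := pd (hmap M' M1 (upt (clamp (-1) 1 y))) (hmap M' M1 (lpt (clamp (-1) 1 y))).

Lemma clamp1 y : -1 <= clamp (-1) 1 y <= 1. Proof. by apply: clamp_in; lra. Qed.

Lemma sqr_le1 y : -1 <= y <= 1 -> 0 <= 1 - y ^+ 2.
Proof. by move=> h; rewrite subr_ge0 -[leRHS](expr1n _ 2); exact: sqr_le_itv. Qed.

Lemma upt1 y : -1 <= y <= 1 -> n2 (upt y) = 1.
Proof. by move=> /sqr_le1 h; rewrite /n2 /upt /= sqr_sqrtr // subrK. Qed.
Lemma lpt1 y : -1 <= y <= 1 -> n2 (lpt y) = 1.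
Proof. by move=> /sqr_le1 h; rewrite /n2 /lpt /= sqrrN sqr_sqrtr // subrK. Qed.

Lemma phi_proper o n : N o -> proper N o n -> proper N1 (phi o) (phi n).
Proof.
move=> No [Nn no]; split; first exact: (md_phi md Nn).
by move=> e; apply: no; rewrite -(md_K md Nn) e (md_K md No).
Qed.

Section InState.
Variables (M M' M1 M1' : vec R -> vec R) (o : vec R).
Hypotheses (H : st N M M' o) (H1 : st N1 M1 M1' (phi o)).
Let h := hmap M' M1.

Lemma hmap_in z : S (ich M' z) -> n2 (h z) <= 1.
Proof. by move=> /(hm_f hm) k; have [] := st_chS sd1 H1 k. Qed.

Lemma pd_le2 z w : n2 z <= 1 -> n2 w <= 1 -> pd z w <= 2.
Proof.
move=> hz hw; rewrite pd_le_sqr //; have e1 := sqr_ge0 (z.1 + w.1); have e2 := sqr_ge0 (z.2 + w.2).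
by move: hz hw; rewrite /n2 /d2 !expr2 in e1 e2 *; lra.
Qed.

Lemma upt_S y : -1 <= y <= 1 -> S (ich M' (upt y)).
Proof. by move=> /upt1 /(circle_S sd H)[]. Qed.
Lemma lpt_S y : -1 <= y <= 1 -> S (ich M' (lpt y)).
Proof. by move=> /lpt1 /(circle_S sd H)[]. Qed.

Lemma jump_ge0 y : 0 <= jump M' M1 y. Proof. exact: pd_ge0. Qed.
Lemma jump_le2 y : jump M' M1 y <= 2.
Proof. by apply: pd_le2; apply: hmap_in; [apply: upt_S | apply: lpt_S]; exact: clamp1. Qed.

Lemma jump_out y : 1 < `|y| -> jump M' M1 y = 0.
Proof.
move=> hy; have -> : jump M' M1 y = pd (h (upt (clamp (-1) 1 y))) (h (lpt (clamp (-1) 1 y))) by [].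
suff [->|->] : clamp (-1) 1 y = 1 \/ clamp (-1) 1 y = -1.
- by rewrite /upt /lpt expr1n subrr sqrtr0 oppr0 pdzz.
- by rewrite /upt /lpt sqrrN expr1n subrr sqrtr0 oppr0 pdzz.
rewrite /clamp; case: (leP y (-1)) => h1; first by right.
case: (leP y 1) => h2; last by left.
by exfalso; move: hy; apply/negP; rewrite -leNgt ler_norml h2 ltW.
Qed.

Lemma hmap_ucv (u : nat -> R * R) z : (forall n, S (ich M' (u n))) -> S (ich M' z) -> ucv2 u z ->
  ucv2 (fun n => h (u n)) (h z).
Proof.
move=> hu hz uz; apply: (ch_ucv sd1 H1).
- by move=> n; exact: hm_f hm _ (hu n).
- exact: hm_f hm _ hz.
- by apply: (hm_cf hm) => //; exact: (ich_ucv sd H).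
Qed.

Lemma jump_cont : continuous (jump M' M1).
Proof.
pose J t : R * R := (jump M' M1 (2 * t - 1), 0).
have cJ : ucont J.
  apply: ucont_cont => u l hu hl ul; split; last exact: ucv_cst.
  rewrite /J /= /jump.
  have r t : 0 <= t <= 1 -> -1 <= 2 * t - 1 <= 1 by move=> /andP[t0 t1]; apply/andP; split; lra.
  have ul' := ucvB (ucvM (ucv_cst 2) ul) (ucv_cst 1).
  have us : ucv (fun n => Num.sqrt (1 - (2 * u n - 1) ^+ 2)) (Num.sqrt (1 - (2 * l - 1) ^+ 2)).
    by apply: ucv_sqrt; apply: ucvB; [exact: ucv_cst | exact: (ucvM ul' ul')].
  have c n : clamp (-1) 1 (2 * u n - 1) = 2 * u n - 1 by apply: clamp_id; apply: r.
  have c' : clamp (-1) 1 (2 * l - 1) = 2 * l - 1 by apply: clamp_id; apply: r.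
  have U : ucv2 (fun n => h (upt (2 * u n - 1))) (h (upt (2 * l - 1))).
    by apply: hmap_ucv => [n||]; [apply: upt_S; exact: r | apply: upt_S; exact: r | split].
  have L : ucv2 (fun n => h (lpt (2 * u n - 1))) (h (lpt (2 * l - 1))).
    apply: hmap_ucv => [n||]; [apply: lpt_S; exact: r | apply: lpt_S; exact: r | split => //=].
    by have := ucvB (ucv_cst 0) us; rewrite sub0r; apply: ucv_eq; apply: UU_all => n /=; rewrite sub0r.
  rewrite c'; have := ucv_sqrt (ucv_d2 U L); apply: ucv_eq; apply: UU_all => n /=.
  by rewrite c.
apply: eps_continuous => x d d0; have [r r0 hr] := cJ _ (half_pos d0).
exists (2 * r); first by rewrite mulr_gt0.
move=> y hy; pose t (y : R) := (clamp (-1) 1 y + 1) / 2.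
have t01 y0 : 0 <= t y0 <= 1 by rewrite /t; have /andP[a b] := clamp1 y0; apply/andP; split; lra.
have jt y0 : jump M' M1 y0 = (J (t y0)).1.
  rewrite /J /= /jump (_ : 2 * t y0 - 1 = clamp (-1) 1 y0); last by rewrite /t; field.
  by rewrite (clamp_id (clamp1 y0)).
rewrite !jt; have lip : `|t x - t y| < r.
  rewrite /t -mulrBl opprD addrACA subrr addr0 normrM [`|_^-1|]ger0_norm // ltr_pdivrMr // mulrC.
  by apply: le_lt_trans (clamp_lip x y _) hy; lra.
have /andP[h1 _] := hr _ _ (t01 x) (t01 y) lip; apply: le_lt_trans h1 _; lra.
Qed.

Lemma adm_jump : adm (jump M' M1).
Proof.
apply: (adm_cont (A := 2)); [exact: jump_cont | exact: jump_ge0 | exact: jump_le2 |].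
by move=> y hy; apply: jump_out; lra.
Qed.

Lemma Int_jump_le : Int (jump M' M1) <= 4.
Proof.
have -> : 4 = Int (fun y => 2 * ind (-1) 1 y).
  by rewrite IntZ //; [rewrite Int_ind; lra | exact: adm_ind].
apply: Int_le; [exact: adm_jump | apply: admZ => //; exact: adm_ind |] => y.
have [hy|hy] := leP `|y| 1.
  by rewrite /ind -ler_norml hy mulr1 jump_le2.
by rewrite jump_out // mulr_ge0 // ind_ge0.
Qed.

(** At height 0 the ends of the chord differ, f is injective, and the jump is continuous. Positivity
    allows division by the supremum later. *)
Lemma Int_jump_gt0 : 0 < Int (jump M' M1).
Proof.
have i0 : -1 <= (0 : R) <= 1 by apply/andP; split; lra.
have j0 : 0 < jump M' M1 0.
  rewrite /jump clamp_id //; apply: pd_gt0 => e.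
  have k z : S (ich M' z) -> ich M1' (h z) = f (ich M' z) by move=> /(hm_f hm) k; rewrite /h /hmap (st_chK sd1 H1 k).
  have := congr1 g (congr1 (ich M1') e); rewrite !k ?(hm_fK hm) //; try by [apply: upt_S | apply: lpt_S].
  move=> /(congr1 (ch M)); rewrite !(ichK _ (st_LT H)) /upt /lpt expr0n subr0 sqrtr1 => -[]; lra.
have cj := jump_cont; have /cvgrPdist_lt/(_ _ (half_pos j0)) := cj (0 : R).
move=> /nbhs_ballP[r /= r0 hr].
have r20 : 0 < r / 2 by rewrite divr_gt0.
apply: (@lt_le_trans _ _ (Int (fun y => (jump M' M1 0 / 2) * ind (- (r / 2)) (r / 2) y))).
  rewrite IntZ ?(ltW (half_pos j0)) //; last exact: adm_ind.
  rewrite mulr_gt0 ?half_pos // Int_ind; lra.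
apply: Int_le; [by apply: admZ; [exact: ltW (half_pos j0) | exact: adm_ind] | exact: adm_jump |] => y.
rewrite /ind -ler_norml; case: (leP `|y| (r / 2)) => hy; last by rewrite mulr0 jump_ge0.
rewrite mulr1; have : ball 0 r y by rewrite /ball /= sub0r normrN; lra.
by move=> /hr /=; rewrite ltr_norml => /andP[_]; lra.
Qed.

Lemma pd_scale z w c r : 0 < r -> pd z w =
  r * pd ((z.1 - c.1) / r, (z.2 - c.2) / r) ((w.1 - c.1) / r, (w.2 - c.2) / r).
Proof.
move=> r0; apply: pd_sqrE; first by rewrite mulr_ge0 ?pd_ge0 // ltW.
by rewrite exprMn pd_sqr /d2 /=; field; rewrite gt_eqF.
Qed.

(** On the circle of [n] the child charts are similarities of the parent charts, in the source and
    in the target, so the jump scales by the target radius. *)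
Lemma child_jump n y : proper N o n -> -1 <= y <= 1 ->
  pd (h ((cen M n).1 + rad M n * (upt y).1, (cen M n).2 + rad M n * (upt y).2))
     (h ((cen M n).1 + rad M n * (lpt y).1, (cen M n).2 + rad M n * (lpt y).2)) =
  rad M1 (phi n) * jump (chM' M M' n) (chM M1 (phi n)) y.
Proof.
move=> pn hy; have [Nn no] := pn; have [Np po] := phi_proper (st_o H) pn.
have r0 := st_rad sd H Nn no; have r1 := st_rad sd1 H1 Np po.
have cs := child_st sd H Nn no.
have key w : n2 w = 1 -> exists x, [/\ S x, lf (X x) n = 0, ich (chM' M M' n) w = x &
    ich M' ((cen M n).1 + rad M n * w.1, (cen M n).2 + rad M n * w.2) = x].
  have gen (a c : R * R) (v : R * R) : v = ((a.1 - c.1) / rad M n, (a.2 - c.2) / rad M n) ->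
      (c.1 + rad M n * v.1, c.2 + rad M n * v.2) = a.
    by move=> ->; rewrite [RHS]surjective_pairing /=; congr (_, _); field; rewrite gt_eqF.
  move=> w1; have [Sx lx] := circle_S sd cs w1.
  exists (ich (chM' M M' n) w); split=> //.
  have e := child_ch sd H Nn no Sx lx; rewrite (ichK _ (st_LT cs)) in e.
  rewrite -[RHS](st_chK sd H Sx); congr ich; exact: gen e.
have val w : n2 w = 1 -> hmap (chM' M M' n) (chM M1 (phi n)) w =
    (((h ((cen M n).1 + rad M n * w.1, (cen M n).2 + rad M n * w.2)).1 - (cen M1 (phi n)).1) / rad M1 (phi n),
     ((h ((cen M n).1 + rad M n * w.1, (cen M n).2 + rad M n * w.2)).2 - (cen M1 (phi n)).2) / rad M1 (phi n)).
  move=> /key[x [Sx lx ex ex2]]; rewrite /h /hmap ex ex2.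
  apply: (child_ch sd1 H1 Np po); first exact: (hm_f hm Sx).
  by apply/(md_circle md Nn Sx).
rewrite /jump clamp_id // (val _ (upt1 hy)) (val _ (lpt1 hy)).
exact: (pd_scale _ _ (cen M1 (phi n)) r1).
Qed.

End InState.
End Jumps.

Section DiscScale.
Variable R : realType.
Implicit Types (z w t : R * R) (x : pt R) (d : R).

Lemma coord_pd z w : `|z.1 - w.1| <= pd z w /\ `|z.2 - w.2| <= pd z w.
Proof. by split; rewrite -sqrtr_sqr; apply: ler_wsqrtr; rewrite /d2 ?lerDl ?lerDr sqr_ge0. Qed.

End DiscScale.

(** [disc_at] read in the chart, with the variation of f bounded by the matched radius: [lqs]
    compares it with the image distance of two points on the circle of [n], which is controlled by
    the diameter of the matched circle. *)
Lemma disc_scale (R : realType) (S : set (pt R)) N S1 N1 (f g : pt R -> pt R) phi psi q (d0 : R) M M' M1 M1' o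
    (tau : R) : SD S N -> SD S1 N1 -> HM S S1 f g -> match_discs S N N1 f phi psi ->
  S q -> lqs S f q -> 0 < d0 -> cocompact S d0 -> st N M M' o -> st N1 M1 M1' (phi o) ->
  0 < tau -> exists C d1 : R, [/\ 1 <= C, 0 < d1 &
  forall z d, S (ich M' z) -> tau <= pd z (ch M q) -> 0 < d <= d1 -> exists n,
  [/\ proper N o n, d / C <= rad M n <= C * d,
      `|(cen M n).1 - z.1| <= C * d /\ `|(cen M n).2 - z.2| <= C * d &
      forall t, S (ich M' t) -> pd t z <= 3 * d -> pd (hmap f M' M1 t) (hmap f M' M1 z) <= C * rad M1 (phi n)]].
Proof.
move=> sd sd1 hm md Sq lq d00 co H H1 tau0; have [C [dd [C1 dd0 hC]]] := disc_at sd d00 co.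
have [Cb Cb1 hb] := st_bilip sd H; have [Ce Ce1 he] := st_bilip sd1 H1.
have C0 : 0 < C by apply: lt_le_trans C1.
have Cb0 : 0 < Cb by apply: lt_le_trans Cb1.
have Ce0 : 0 < Ce by apply: lt_le_trans Ce1.
have t2 : 0 < tau / (2 * Cb) by rewrite divr_gt0 // mulr_gt0.
pose A := C * (C + 3 * Cb).
have [B B0 hB] := lq _ A t2.
pose K := 2 * C * Cb + 4 * Ce ^+ 2 * B.
have Be0 : 0 <= 4 * Ce ^+ 2 * B by rewrite mulr_ge0 ?(ltW B0) // mulr_ge0 // sqr_ge0.
have Cc0 : 0 <= 2 * C * Cb by rewrite mulr_ge0 ?(ltW Cb0) // mulr_ge0 // ltW.
have K1 : 1 <= K.
  have h1 : 1 <= C * Cb by rewrite -[1]mulr1; apply: ler_pM.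
  have h2 : 0 <= 4 * Ce ^+ 2 * B by rewrite !mulr_ge0 ?sqr_ge0 // ltW.
  rewrite /K; lra_from h1 h2 Cc0.
(* The three extra bounds keep the circle within 1/2 of [z], so that n <> o, and keep all points
   compared at distance at least tau / (2 Cb) from q. *)
pose d1 := Num.min dd (Num.min (1 / (2 * C * Cb)) (Num.min (tau / (2 * Cb * C)) (tau / (6 * Cb ^+ 2)))).
exists K, d1; split=> //.
  by rewrite /d1 !lt_min dd0 !divr_gt0 ?mulr_gt0 ?exprn_gt0.
move=> z d Sz zq /andP[dp]; rewrite /d1 !le_min => /andP[dk /andP[dk1 /andP[dk2 dk3]]].
pose x := ich M' z.
have cx : ch M x = z by rewrite /x (ichK _ (st_LT H)).
have xq : tau / Cb <= edist x q.
  by rewrite ler_pdivrMr // mulrC; apply: le_trans zq _; rewrite -cx; have [] := hb _ _ Sz Sq.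
have dkk : 0 < d <= dd by rewrite dp.
have [n [Nn nx [y [y' [Sy Sy' ly ly' yy]]]]] := hC x d Sz dkk.
have tt : tau / (2 * Cb) + tau / (2 * Cb) = tau / Cb by field; rewrite gt_eqF.
have Cd : C * d <= tau / (2 * Cb).
  move: dk2; rewrite !ler_pdivlMr ?mulr_gt0 //; clear; lra.
have Cd3 : 3 * Cb * d <= tau / (2 * Cb).
  move: dk3; rewrite !ler_pdivlMr ?mulr_gt0 ?exprn_gt0 // expr2; clear; lra.
have Cd1 : C * Cb * d <= 1 / 2.
  move: dk1; rewrite !ler_pdivlMr ?mulr_gt0 //; clear; lra.
have circ p : S p -> lf (X p) n = 0 -> pd (ch M p) z <= Cb * C * d.
  move=> Sp lp; have := nx p ((sd_S sd p).1 Sp).1 lp => h1.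
  have [h2 _] := hb _ _ Sp Sz; rewrite cx in h2; apply: le_trans h2 _.
  by rewrite -mulrA ler_pM2l.
have no : n <> o.
  move=> e; have ii : n2 (1, 0) = 1 :> R by rewrite /n2 /= expr1n expr0n addr0.
  have jj : n2 (-1, 0) = 1 :> R by rewrite /n2 /= sqrrN expr1n expr0n addr0.
  have [a1 a2] := circle_S sd H ii; have [b1 b2] := circle_S sd H jj.
  rewrite -e in a2 b2; have := circ _ a1 a2; have := circ _ b1 b2.
  rewrite !(ichK _ (st_LT H)) => k1 k2.
  have := pd_tri (1, 0) z (-1, 0); rewrite (pdC z).
  have -> : pd (1, 0) (-1, 0) = 2 :> R by apply: pd_sqrE => //; rewrite /d2 /=; ring.
  lra_from k1 k2 Cd1.
have pn : proper N o n by [].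
have r0 := proper_rad sd H pn.
have [Np po] := phi_proper md (st_o H) pn.
have r1 := st_rad sd1 H1 Np po.
have rC : rad M n <= C * Cb * d /\ `|(cen M n).1 - z.1| <= C * Cb * d /\ `|(cen M n).2 - z.2| <= C * Cb * d.
  pose p1 := ((cen M n).1 + rad M n, (cen M n).2); pose p2 := ((cen M n).1 - rad M n, (cen M n).2).
  have key p : d2 p (cen M n) = rad M n ^+ 2 -> pd p z <= Cb * C * d.
    move=> e; have Sp := (circ_inP sd H pn e).1.
    have := circ _ Sp; rewrite (ichK _ (st_LT H)); apply.
    by apply/(st_circle sd H Sp Nn no); rewrite (ichK _ (st_LT H)).
  have k1 : pd p1 z <= Cb * C * d by apply: key; rewrite /d2 /p1 /=; ring.
  have k2 : pd p2 z <= Cb * C * d by apply: key; rewrite /d2 /p2 /=; ring.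
  have [a1 a2] := coord_pd p1 z; have [b1 b2] := coord_pd p2 z.
  move: (le_trans a1 k1) (le_trans a2 k1) (le_trans b1 k2) (le_trans b2 k2).
  rewrite /p1 /p2 /= !ler_norml => /andP[u1 u2] /andP[u3 u4] /andP[u5 u6] /andP[u7 u8].
  clear - u1 u2 u3 u4 u5 u6 u7 u8; split; [lra|]; split; apply/andP; split; lra.
have [rC1 [rC2 rC3]] := rC.
have KK : C * Cb * d <= K * d.
  have h2 : 0 <= 4 * Ce ^+ 2 * B by rewrite !mulr_ge0 ?sqr_ge0 // ltW.
  have h3 : 0 <= C * Cb by rewrite mulr_ge0 // ltW.
  rewrite ler_pM2r // /K; lra_from h2 h3.
have rad2 p p' : S p -> S p' -> lf (X p) n = 0 -> lf (X p') n = 0 -> pd (ch M p) (ch M p') <= 2 * rad M n.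
  move=> Sp Sp' /(st_circle sd H Sp Nn no) e /(st_circle sd H Sp' Nn no) e'.
  apply: le_trans (pd_tri _ (cen M n) _) _; rewrite (pdC (cen M n)).
  by rewrite (pd_sqrE (ltW r0) e) (pd_sqrE (ltW r0) e') mulr_natl mulr2n.
have rad2' p p' : S p -> S p' -> lf (X p) n = 0 -> lf (X p') n = 0 -> pd (ch M1 (f p)) (ch M1 (f p')) <= 2 * rad M1 (phi n).
  move=> Sp Sp' /(md_circle md Nn Sp) e /(md_circle md Nn Sp') e'.
  move: e => /(st_circle sd1 H1 (hm_f hm Sp) Np po) e; move: e' => /(st_circle sd1 H1 (hm_f hm Sp') Np po) e'.
  apply: le_trans (pd_tri _ (cen M1 (phi n)) _) _; rewrite (pdC (cen M1 (phi n))).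
  by rewrite (pd_sqrE (ltW r1) e) (pd_sqrE (ltW r1) e') mulr_natl mulr2n.
exists n; split=> //.
- apply/andP; split; last by apply: le_trans rC1 KK.
  have k1 := rad2 _ _ Sy Sy' ly ly'; have [_ k2] := hb _ _ Sy Sy'.
  have k3 : d <= C * (Cb * (2 * rad M n)).
    move: yy; rewrite ler_pdivrMr // => k4; apply: le_trans k4 _; rewrite mulrC ler_pM2l //.
    by apply: le_trans k2 _; rewrite ler_pM2l.
  rewrite ler_pdivrMr; last by apply: lt_le_trans K1.
  apply: le_trans k3 _.
  have -> : C * (Cb * (2 * rad M n)) = rad M n * (2 * C * Cb) by ring.
  by rewrite ler_pM2l // /K lerDl.
- by split; apply: le_trans KK.
- move=> t St tz; pose s := ich M' t.
  have ct : ch M s = t by rewrite /s (ichK _ (st_LT H)).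
  have sx : edist s x <= 3 * Cb * d.
    have [_ k] := hb _ _ St Sz; rewrite ct cx in k; apply: le_trans k _.
    by rewrite -mulrA mulrCA ler_pM2l.
  have yx := nx y ((sd_S sd y).1 Sy).1 ly; have y'x := nx y' ((sd_S sd y').1 Sy').1 ly'.
  have far p : edist p x <= tau / (2 * Cb) -> tau / (2 * Cb) <= edist p q.
    by move=> k; have := edist_tri x p q; rewrite (edistC x p); lra_from k tt xq.
  have yd : d <= C * edist y y' by move: yy; rewrite ler_pdivrMr // mulrC.
  have Ay p : edist p x <= 3 * Cb * d -> edist y p <= A * edist y y'.
    move=> k; apply: le_trans (edist_tri y x p) _; rewrite (edistC x p).
    apply: (@le_trans _ _ ((C + 3 * Cb) * d)); first by lra_from yx k.
    have := ler_wpM2l (_ : 0 <= C + 3 * Cb) yd; rewrite /A => k2.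
    apply: le_trans (k2 _) _; first by lra_from C0 Cb0.
    by rewrite le_eqVlt; apply/orP; left; apply/eqP; ring.
  have fy : tau / (2 * Cb) <= edist y q by apply: far; apply: le_trans yx _.
  have fy' : tau / (2 * Cb) <= edist y' q by apply: far; apply: le_trans y'x _.
  have Bs p : S p -> edist p x <= 3 * Cb * d -> edist (f y) (f p) <= B * edist (f y) (f y').
    move=> Sp k; apply: hB => //; last exact: Ay.
    by apply: far; apply: le_trans k _.
  have k1 := Bs _ St sx.
  have k2 : edist (f y) (f x) <= B * edist (f y) (f y').
    by apply: Bs => //; rewrite edist_xx mulr_ge0 ?(ltW dp) // mulr_ge0 // ltW.
  have [k3 _] := he _ _ (hm_f hm St) (hm_f hm Sz).
  have [_ k4] := he _ _ (hm_f hm Sy) (hm_f hm Sy').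
  have k5 := rad2' _ _ Sy Sy' ly ly'.
  have k6 : edist (f y) (f y') <= Ce * (2 * rad M1 (phi n)) by apply: le_trans k4 _; rewrite ler_pM2l.
  have k7 : edist (f s) (f x) <= 2 * B * (Ce * (2 * rad M1 (phi n))).
    apply: le_trans (edist_tri _ (f y) _) _; rewrite (edistC (f s)).
    have := ler_wpM2l (ltW B0) k6; lra_from k1 k2.
  apply: le_trans k3 _.
  apply: (@le_trans _ _ (Ce * (2 * B * (Ce * (2 * rad M1 (phi n)))))); first by rewrite ler_pM2l.
  have -> : Ce * (2 * B * (Ce * (2 * rad M1 (phi n)))) = 4 * Ce ^+ 2 * B * rad M1 (phi n) by ring.
  by rewrite ler_pM2r // /K lerDr.
Qed.

(** * The bound on one horizontal line *)

Section LineBound.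
Variable R : realType.
Implicit Types (z w : R * R) (x : pt R) (d t u y : R).
Lemma sum_seq1 (T : eqType) (s : seq T) (F : T -> R) n : n \in s -> (forall m, m \in s -> 0 <= F m) -> F n <= \sum_(m <- s) F m.
Proof.
move=> ns F0; rewrite (big_rem n) //= lerDl big_seq; apply: sumr_ge0 => m /mem_rem; exact: F0.
Qed.

Definition child_term (f : pt R -> pt R) (phi M M' M1 : vec R -> vec R) n y := rad M1 (phi n) * jump f (chM' M M' n) (chM M1 (phi n)) ((y - (cen M n).2) / rad M n).

Lemma child_term_ge0 (S : set (pt R)) N S1 N1 f phi psi M M' M1 M1' o n y : SD S N -> SD S1 N1 ->
  match_discs S N N1 f phi psi -> st N M M' o -> st N1 M1 M1' (phi o) -> proper N o n -> 0 <= child_term f phi M M' M1 n y.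
Proof.
by move=> sd sd1 md H H1 pn; rewrite mulr_ge0 ?pd_ge0 // ltW // (proper_rad sd1 H1) //; exact: (phi_proper md (st_o H) pn).
Qed.

(* C times the scale d bounds the discs used on small cells, whose contribution is the second sum. *)
Lemma line_bound (S : set (pt R)) N S1 N1 f g phi psi q M M' M1 M1' o (C d tau y : R) (s s' : seq (vec R)) :
  SD S N -> SD S1 N1 -> HM S S1 f g -> match_discs S N N1 f phi psi -> st N M M' o -> st N1 M1 M1' (phi o) -> 1 <= C -> 0 < d -> -1 <= y <= 1 -> tau <= `|y - (ch M q).2| ->
  (forall z, S (ich M' z) -> tau <= pd z (ch M q) -> exists n,
    [/\ proper N o n, d / C <= rad M n <= C * d, `|(cen M n).1 - z.1| <= C * d /\ `|(cen M n).2 - z.2| <= C * d &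
      forall t : R * R, S (ich M' t) -> pd t z <= 3 * d -> pd (hmap f M' M1 t) (hmap f M' M1 z) <= C * rad M1 (phi n)]) ->
  (forall n, n \in s <-> proper N o n /\ d / 2 <= rad M n) ->
  (forall n, n \in s' <-> proper N o n /\ d / C <= rad M n <= C * d) ->
  jump f M' M1 y <= \sum_(n <- s) child_term f phi M M' M1 n y +
    2 * C * (2 * (C + 1) + 1) * \sum_(n <- s') rad M1 (phi n) * ind ((cen M n).2 - C * d) ((cen M n).2 + C * d) y.
Proof.
move=> sd sd1 hm md H H1 C1 d0 hy ty hD hs hs'; pose h := hmap f M' M1.
have C0 : 0 < C by apply: lt_le_trans C1.
pose T t := S (ich M' (t, y)).
pose b := Num.sqrt (1 - y ^+ 2).
have y2 := sqr_le1 hy.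
have b2 : b ^+ 2 = 1 - y ^+ 2 by rewrite sqr_sqrtr.
have b0 : 0 <= b by exact: sqrtr_ge0.
have Ta : T (- b) by exact: (lpt_S sd H hy).
have Tb : T b by exact: (upt_S sd H hy).
have b1 : b <= 1 by apply: ler_sqr_abs => //; rewrite b2 expr1n gerBl sqr_ge0.
have Tr t : T t -> - b <= t <= b.
  move=> /(st_S sd H)[+ _]; rewrite /n2 /= => k; rewrite -ler_norml.
  by apply: ler_sqr_abs => //; rewrite real_normK ?num_real // b2; light_lra.
have Tc (v : nat -> R) l : (forall n, T (v n)) -> ucv v l -> T l.
  by move=> hv vl; apply: (P_closed sd H (u := fun n => (v n, y))) => //; exact: ucv2_line.
have Tq t : tau <= pd (t, y) (ch M q).
  by apply: le_trans ty _; have [_] := coord_pd (t, y) (ch M q).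
(* The line is cut into cells of length [d], starting at -1. Cells that meet S are charged to a disc
   of size about [d]. *)
pose J i t := i%:R * d - 1 <= t <= i.+1%:R * d - 1.
pose ne i := exists t, T t /\ J i t.
have JJ i t u : J i t -> J i u -> `|t - u| <= d.
  rewrite /J -natr1 => /andP[a1 a2] /andP[a3 a4]; rewrite ler_norml; clear - a1 a2 a3 a4; apply/andP; split; lra.
have Q i : exists n, ne i -> [/\ n \in s', `|(cen M n).2 - y| <= C * d, `|i%:R - ((cen M n).1 + 1) / d| <= C + 1 &
    forall t u, T t -> J i t -> T u -> `|t - u| <= 2 * d -> pd (h (t, y)) (h (u, y)) <= 2 * C * rad M1 (phi n)].
  have [[t0 [Tt0 Jt0]]|nn] := EM (ne i); last by exists o.
  have [n [pn rn [c1' c2'] hn]] := hD _ Tt0 (Tq t0); exists n => _; split.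
  - by apply/hs'.
  - by [].
  - rewrite -(ler_pM2r d0) -[X in _ * X](gtr0_norm d0) -normrM mulrBl divfK ?gt_eqF //.
    move: c1' Jt0; rewrite /= /J -natr1 !ler_norml => /andP[k1 k2] /andP[k3 k4]; clear - k1 k2 k3 k4; apply/andP; split; lra.
  - have pdl (t u : R) : pd (t, y) (u, y) = `|t - u|.
      by rewrite /pd /d2 /= subrr expr0n addr0 sqrtr_sqr.
    move=> t u Tt Jt Tu tu; have k1 : `|t - t0| <= d := JJ _ _ _ Jt Jt0.
    have k2 : `|u - t0| <= 3 * d.
      rewrite (_ : u - t0 = - (t - u) + (t - t0)); last by ring.
      by apply: le_trans (ler_normD _ _) _; rewrite normrN; lra_from tu k1.
    have k3 : pd (t, y) (t0, y) <= 3 * d by rewrite pdl; lra_from k1 d0.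
    have k4 : pd (u, y) (t0, y) <= 3 * d by rewrite pdl.
    have := hn _ Tt k3; have := hn _ Tu k4; have := pd_tri (h (t, y)) (h (t0, y)) (h (u, y)).
    rewrite (pdC (h (t0, y))); clear; lra.
have [nd hnd] := choice Q.
have r10 n : n \in s' -> 0 < rad M1 (phi n).
  by move=> /hs'[pn _]; apply: (proper_rad sd1 H1); exact: (phi_proper md (st_o H) pn).
pose E i : R := if `[< ne i >] then 2 * C * rad M1 (phi (nd i)) else 0.
have E0 i : 0 <= E i.
  rewrite /E; case: asboolP => // /hnd[k _ _ _]; by rewrite !mulr_ge0 ?(ltW C0) // ltW // r10.
have EJ i t u : T t -> J i t -> T u -> `|t - u| <= 2 * d -> pd (h (t, y)) (h (u, y)) <= E i.
  move=> Tt Jt Tu tu; rewrite /E; case: asboolP => [/hnd[_ _ _ k]|[]]; first exact: k.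
  by exists t.
pose re n := (cen M n).1 + Num.sqrt (rad M n ^+ 2 - (y - (cen M n).2) ^+ 2).
(* The jumps of the large discs whose chords end at or before [t]. *)
pose G t := \sum_(n <- s) (if re n <= t then child_term f phi M M' M1 n y else 0).
have gt0 n : n \in s -> 0 <= child_term f phi M M' M1 n y by move=> /hs[pn _]; exact: (child_term_ge0 _ sd sd1 md H H1).
have Gm t u : t <= u -> G t <= G u.
  move=> tu; rewrite /G big_seq [leRHS]big_seq; apply: ler_sum => n ns.
  case: (leP (re n) t) => k1; first by rewrite (le_trans k1 tu).
  by case: ifP => // _; exact: gt0.
have G0 t : 0 <= G t.
  by rewrite /G big_seq; apply: sumr_ge0 => n ns; case: ifP => // _; exact: gt0.
(* Walk to the right from cell to cell: jumps over long gaps are paid by [G], all other variation by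
   the costs [E]. *)
have claim k : forall t, T t -> t <= k%:R * d - 1 -> pd (h (- b, y)) (h (t, y)) <= G t + \sum_(i < k) E i.
  elim: k => [|k IH] t Tt tk.
    rewrite mul0r sub0r in tk; have /andP[t1 _] := Tr t Tt.
    have -> : t = - b by lra_from tk t1 b1.
    by rewrite pdzz addr_ge0 ?G0 // big_ord0.
  rewrite big_ord_recr /=.
  have [tk'|tk'] := leP t (k%:R * d - 1).
    by have := IH t Tt tk'; have := E0 k; clear; lra.
  have Jt : J k t by rewrite /J tk ltW.
  have Ek0 := E0 k; have S0 : 0 <= \sum_(i < k) E i by apply: sumr_ge0 => i _; exact: E0.
  have [ak|ak] := ltP (k%:R * d - 1) (- b).
    have Ja : J k (- b) by rewrite /J ltW //=; have /andP[t1 _] := Tr t Tt; lra_from t1 tk.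
    have dd2 : d <= 2 * d by lra_from d0.
    have := EJ k _ _ Ta Ja Tt (le_trans (JJ _ _ _ Ja Jt) dd2); have := G0 t; lra_from S0.
  (* The last point of S up to the cell boundary and, below, the first point of S from it on. *)
  have [t1 [Tt1 t1k] mt1] : exists2 t', T t' /\ t' <= k%:R * d - 1 & forall t'', T t'' /\ t'' <= k%:R * d - 1 -> t'' <= t'.
    apply: (closed_max (t0 := - b) (B := k%:R * d - 1)) => //; first by move=> ? [].
    move=> v l hv vl; split; first by apply: Tc vl => n; have [] := hv n.
    by apply: (ucv_le vl (ucv_cst _)); apply: UU_all => n /=; have [] := hv n.
  have [u [Tu uk] mu] : exists2 t', T t' /\ k%:R * d - 1 <= t' & forall t'', T t'' /\ k%:R * d - 1 <= t'' -> t' <= t''.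
    apply: (closed_min (t0 := t) (B := k%:R * d - 1)) => //; [by split=> //; exact: ltW | by move=> ? [] |].
    move=> v l hv vl; split; first by apply: Tc vl => n; have [] := hv n.
    by apply: (ucv_le (ucv_cst _) vl); apply: UU_all => n /=; have [] := hv n.
  have ut : u <= t by apply: mu; split=> //; exact: ltW.
  have IH1 := IH _ Tt1 t1k.
  have Ju : J k u by rewrite /J uk (le_trans ut).
  have ttri := pd_tri (h (- b, y)) (h (t1, y)) (h (t, y)).
  have t1t : t1 <= t by apply: le_trans ut; apply: le_trans uk.
  (* A gap of length at most [d] is covered by the cost of the cell. A longer one is the chord of a
     single disc of radius at least d / 2, which belongs to [s] and is counted in [G] from [u]
     on. *)
  have [short|long] := leP (u - t1) d.
    have near : `|t - t1| <= 2 * d.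
      have := JJ _ _ _ Jt Ju; rewrite ger0_norm ?subr_ge0 // => k1.
      by rewrite ger0_norm ?subr_ge0 //; lra_from k1 short.
    have := EJ k _ _ Tt Jt Tt1 near; rewrite pdC; have := Gm _ _ t1t; lra_from ttri IH1.
  have t1u : t1 < u by lra_from long d0.
  have [n [pn e1' e2']] : exists n, [/\ proper N o n, d2 (t1, y) (cen M n) = rad M n ^+ 2 & d2 (u, y) (cen M n) = rad M n ^+ 2].
    apply: (gap sd H t1u Tt1 Tu) => v /andP[v1 v2] Tv.
    have [vk|vk] := leP v (k%:R * d - 1).
      by have := mt1 v (conj Tv vk); lra_from v1.
    by have := mu v (conj Tv (ltW vk)); lra_from v2.
  have r0 := proper_rad sd H pn.
  pose m := u - (cen M n).1.
  have {}e1' : (t1 - (cen M n).1) ^+ 2 + (y - (cen M n).2) ^+ 2 = rad M n ^+ 2 := e1'.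
  have {}e2' : (u - (cen M n).1) ^+ 2 + (y - (cen M n).2) ^+ 2 = rad M n ^+ 2 := e2'.
  have e12 : (t1 - (cen M n).1) ^+ 2 = m ^+ 2 by rewrite /m; lra_from e1' e2'.
  have tm : t1 = (cen M n).1 - m.
    move/eqP: e12; rewrite eqf_sqr => /orP[/eqP|/eqP]; rewrite /m; last by clear; lra.
    lra_from t1u.
  have um : u = (cen M n).1 + m by rewrite /m addrC subrK.
  have m0 : 0 < m by lra_from tm um t1u.
  have mE : rad M n ^+ 2 - (y - (cen M n).2) ^+ 2 = m ^+ 2 by rewrite /m -e2' addrK.
  have mr : m <= rad M n by apply: ler_sqr_abs; [exact: ltW | rewrite -mE gerBl sqr_ge0].
  have ns : n \in s by apply/hs; split=> //; lra_from tm um long mr.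
  have reu : re n = u by rewrite /re mE sqrtr_sqr gtr0_norm // /m addrC subrK.
  have y' : -1 <= (y - (cen M n).2) / rad M n <= 1.
    rewrite -ler_norml normrM normfV (gtr0_norm r0) ler_pdivrMr // mul1r.
    apply: ler_sqr_abs; first exact: ltW.
    rewrite real_normK ?num_real //; have := sqr_ge0 m; rewrite -mE; clear; lra.
  have mm : Num.sqrt (1 - ((y - (cen M n).2) / rad M n) ^+ 2) = m / rad M n.
    have -> : 1 - ((y - (cen M n).2) / rad M n) ^+ 2 = (m / rad M n) ^+ 2.
      by rewrite !expr_div_n -mE mulrBl divff // expf_neq0 // gt_eqF.
    by rewrite sqrtr_sqr ger0_norm // divr_ge0 // ltW.
  have jump_n : pd (h (t1, y)) (h (u, y)) = child_term f phi M M' M1 n y.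
    rewrite /child_term -(child_jump sd sd1 hm md H H1 pn y') pdC -/h /upt /lpt /= mm mulrN.
    have -> : rad M n * (m / rad M n) = m by rewrite mulrC divfK // gt_eqF.
    have -> : rad M n * ((y - (cen M n).2) / rad M n) = y - (cen M n).2 by rewrite mulrC divfK // gt_eqF.
    by rewrite -tm (_ : (cen M n).1 + m = u); [rewrite (addrC (cen M n).2) subrK | rewrite /m addrC subrK].
  have GG : G t1 + child_term f phi M M' M1 n y <= G t.
    have z1 : (if re n <= t1 then child_term f phi M M' M1 n y else 0) = 0 by rewrite reu leNgt t1u.
    have z2 : (if re n <= t then child_term f phi M M' M1 n y else 0) = child_term f phi M M' M1 n y by rewrite reu ut.
    have Grem v : G v = (if re n <= v then child_term f phi M M' M1 n y else 0) +
        \sum_(n' <- rem n s) (if re n' <= v then child_term f phi M M' M1 n' y else 0) by rewrite /G (big_rem n ns).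
    rewrite !Grem z1 z2 add0r addrC lerD2l.
    rewrite big_seq [leRHS]big_seq; apply: ler_sum => n' /mem_rem ns'.
    case: (leP (re n') t1) => k1; first by rewrite (le_trans k1 t1t).
    by case: ifP => // _; exact: gt0.
  have k1 := EJ k _ _ Tu Ju Tt (le_trans (JJ _ _ _ Ju Jt) _).
  have k2 := pd_tri (h (t1, y)) (h (u, y)) (h (t, y)).
  have d2' : d <= 2 * d by lra_from d0.
  have := k1 d2'; rewrite jump_n in k2; lra_from k2 ttri IH1 GG.
pose K := (Num.truncn (2 / d)).+1.
have bK : b <= K%:R * d - 1.
  have p : 0 <= 2 / d by rewrite divr_ge0 // ltW.
  have /andP[_] := truncn_itv p; rewrite -/K ltr_pdivrMr // => k1; lra_from k1 b1.
have := claim K b Tb bK.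
have -> : jump f M' M1 y = pd (h (- b, y)) (h (b, y)) by rewrite /jump (clamp_id hy) pdC.
move=> k1; apply: le_trans k1 _; apply: lerD.
  rewrite /G big_seq [leRHS]big_seq; apply: ler_sum => n ns.
  by case: ifP => // _; exact: gt0.
(* Exchanging the sums over cells and discs: a disc is charged by at most 2 (C + 1) + 1 cells, and
   only at heights within C d of its centre. *)
pose W n i : R := rad M1 (phi n) * ind ((cen M n).2 - C * d) ((cen M n).2 + C * d) y *
  (if `|i%:R - ((cen M n).1 + 1) / d| <= C + 1 then 1 else 0).
have W0 n i : n \in s' -> 0 <= W n i.
  move=> ns; rewrite /W !mulr_ge0 ?ind_ge0 ?(ltW (r10 _ ns)) //; by case: ifP.
have EW i : E i <= 2 * C * \sum_(n <- s') W n i.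
  rewrite /E; case: asboolP => [hne|_]; last first.
    rewrite mulr_ge0 ?mulr_ge0 ?(ltW C0) // big_seq; apply: sumr_ge0 => n ns; exact: W0.
  have [n1 n2' n3 _] := hnd _ hne.
  rewrite ler_pM2l ?mulr_gt0 //; apply: le_trans (sum_seq1 n1 (fun m hm => W0 m i hm)).
  rewrite /W n3 mulr1 /ind.
  have -> : (cen M (nd i)).2 - C * d <= y <= (cen M (nd i)).2 + C * d.
    by move: n2'; rewrite ler_norml => /andP[j1 j2]; clear - j1 j2; apply/andP; split; lra.
  by rewrite mulr1.
apply: (@le_trans _ _ (\sum_(i < K) 2 * C * \sum_(n <- s') W n i)); first by apply: ler_sum => i _; exact: EW.
rewrite -mulr_sumr -[leRHS]mulrA ler_pM2l ?mulr_gt0 // exchange_big /= mulr_sumr.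
rewrite big_seq [leRHS]big_seq; apply: ler_sum => n ns.
rewrite /W -mulr_sumr mulrC; apply: ler_wpM2r; first by rewrite mulr_ge0 ?ind_ge0 ?(ltW (r10 _ ns)).
apply: count_near; lra_from C0.
Qed.

End LineBound.

(** * The integrated jump inequality *)

Section OneLevel.
Variable R : realType.
Implicit Types (d tau : R).

Record conf (S : set (pt R)) N (S1 : set (pt R)) N1 f g phi psi q (d0 : R) : Prop := mkconf {
  cf_sd : SD S N; cf_sd1 : SD S1 N1; cf_hm : HM S S1 f g; cf_md : match_discs S N N1 f phi psi;
  cf_q : S q; cf_lqs : lqs S f q; cf_d0 : 0 < d0; cf_co : cocompact S d0; cf_co1 : cocompact S1 d0 }.

Variables (S : set (pt R)) (N : set (vec R)) (S1 : set (pt R)) (N1 : set (vec R)).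
Variables (f g : pt R -> pt R) (phi psi : vec R -> vec R) (q : pt R) (d0 : R).
Hypothesis cf : conf S N S1 N1 f g phi psi q d0.
Let sd := cf_sd cf. Let sd1 := cf_sd1 cf. Let hm := cf_hm cf. Let md := cf_md cf.

Section InState.
Variables (M M' M1 M1' : vec R -> vec R) (o : vec R).
Hypotheses (H : st N M M' o) (H1 : st N1 M1 M1' (phi o)).

Lemma packing2 (s : seq (vec R)) : uniq s -> (forall n, n \in s -> proper N o n) ->
  \sum_(n <- s) rad M n ^+ 2 <= 1 /\ \sum_(n <- s) rad M1 (phi n) ^+ 2 <= 1.
Proof.
move=> us hs; split; first exact: (packing sd H us hs).
rewrite -(big_map phi xpredT (fun m => rad M1 m ^+ 2)); apply: (packing sd1 H1).
  rewrite map_inj_in_uniq // => n m /hs[Nn _] /hs[Nm _] e.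
  by rewrite -(md_K md Nn) e (md_K md Nm).
by move=> _ /mapP[n /hs pn ->]; exact: (phi_proper md (st_o H) pn).
Qed.

Lemma prod_le1 (s : seq (vec R)) : uniq s -> (forall n, n \in s -> proper N o n) ->
  \sum_(n <- s) rad M n * rad M1 (phi n) <= 1.
Proof.
move=> us hs; have [h1 h2] := packing2 us hs.
have : 2 * \sum_(n <- s) rad M n * rad M1 (phi n) <= \sum_(n <- s) rad M n ^+ 2 + \sum_(n <- s) rad M1 (phi n) ^+ 2.
  rewrite mulr_sumr -big_split /=; apply: ler_sum => n _.
  by have := sqr_ge0 (rad M n - rad M1 (phi n)); rewrite !expr2; lra.
lra.
Qed.

Let r0 n : proper N o n -> 0 < rad M n.
Proof. exact: (proper_rad sd H). Qed.
Let r1 n : proper N o n -> 0 < rad M1 (phi n).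
Proof. by move=> pn; apply: (proper_rad sd1 H1); exact: (phi_proper md (st_o H) pn). Qed.

(* Pigeonhole: disjoint ranges of scales cannot all carry a fixed part of a convergent sum. *)
Lemma thin_scale (C d1 e : R) : 1 <= C -> 0 < d1 -> 0 < e -> exists d s, [/\ 0 < d <= d1, uniq s,
  forall n, n \in s <-> proper N o n /\ d / C <= rad M n <= C * d &
  \sum_(n <- s) rad M n * rad M1 (phi n) <= e].
Proof.
move=> C1 d10 e0; have C0 : 0 < C by apply: lt_le_trans C1.
apply: contrapT => hn.
(* Dividing the scale by [L] puts its upper end C d / L = d / (2 C) below the lower end d / C of the
   previous range, so that the lists are disjoint. *)
pose L := 2 * C ^+ 2.
have C2 : 1 <= C ^+ 2 by rewrite expr2 -[1]mulr1; apply: ler_pM.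
have L0 : 0 < L by rewrite /L; lra.
have scale d : 0 < d <= d1 -> exists s, [/\ uniq s,
    forall n, n \in s -> proper N o n /\ d / C <= rad M n <= C * d & e < \sum_(n <- s) rad M n * rad M1 (phi n)].
  move=> hd; have /andP[dp _] := hd.
  have [s [us hs]] := finite_discs sd H (divr_gt0 dp C0).
  exists [seq n <- s | rad M n <= C * d]; split; first exact: filter_uniq.
    by move=> n; rewrite mem_filter => /andP[h1 /hs[h2 h3]]; rewrite h3 h1.
  rewrite ltNge; apply/negP => h; apply: hn; exists d, [seq n <- s | rad M n <= C * d]; split=> //.
    exact: filter_uniq.
  move=> n; rewrite mem_filter; split; first by move=> /andP[h1 /hs[h2 h3]]; rewrite h3 h1.
  by move=> [h1 /andP[h2 h3]]; rewrite h3; apply/hs.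
have build k : exists d s, [/\ 0 < d <= d1, uniq s, forall n, n \in s -> proper N o n /\ C * d < rad M n &
    k%:R * e <= \sum_(n <- s) rad M n * rad M1 (phi n)].
  elim: k => [|k [d [s [hd us hs hk]]]].
    by exists d1, [::]; rewrite big_nil mul0r d10 lexx.
  have [s' [us' hs' he]] := scale d hd; have /andP[dp dd1] := hd.
  exists (d / L), (s' ++ s); split.
  - rewrite divr_gt0 //=; apply: le_trans dd1; rewrite ler_pdivrMr // ler_peMr ?(ltW dp) // /L; lra.
  - rewrite cat_uniq us' us andbT; apply/hasPn => n /hs[_ h1]; apply/negP => /hs'[_ /andP[_ h2]].
    by have := lt_le_trans h1 h2; rewrite ltxx.
  - have k1 : C * (d / L) < d / C.
      rewrite /L (_ : C * (d / (2 * C ^+ 2)) = d / C / 2); last by field; rewrite gt_eqF.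
      by have := divr_gt0 dp C0; lra.
    move=> n; rewrite mem_cat => /orP[/hs'[h1 /andP[h2 _]]|/hs[h1 h2]]; split=> //; first exact: lt_le_trans h2.
    apply: lt_trans k1 _; apply: le_lt_trans h2; rewrite ler_pdivrMr // mulrAC -expr2 ler_peMl // ltW //.
  - by rewrite big_cat /= -natr1 mulrDl mul1r addrC; apply: lerD => //; exact: ltW.
have p : 0 <= e^-1 by rewrite invr_ge0 ltW.
have [d [s [_ us hs hk]]] := build (Num.truncn e^-1).+1.
have := prod_le1 us (fun n hn => (hs n hn).1).
have /andP[_] := truncn_itv p; rewrite -[X in X < _]mul1r ltr_pdivrMr // => k1; lra.
Qed.

Lemma adm_child n : proper N o n -> adm (child_term f phi M M' M1 n) /\
  Int (child_term f phi M M' M1 n) = rad M n * rad M1 (phi n) * Int (jump f (chM' M M' n) (chM M1 (phi n))).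
Proof.
move=> pn; have [Nn no] := pn; have [Np po] := phi_proper md (st_o H) pn.
have cs := child_st sd H Nn no; have cs1 := child_st sd1 H1 Np po.
have [a1 a2] := Int_affine (A := 2) (cen M n).2 (r0 pn) (jump_cont sd sd1 hm cs cs1) (jump_ge0 _ _ _)
  (jump_le2 sd sd1 hm cs cs1) (fun y hy => jump_out f _ _ (lt_trans (ltr1n R 2) hy)).
split; first by apply: admZ => //; exact: ltW (r1 pn).
have -> : Int (child_term f phi M M' M1 n) = _ := IntZ (ltW (r1 pn)) a1.
by rewrite a2 mulrA (mulrC (rad M1 _)).
Qed.

(** Integrate [line_bound] over the heights outside a thin strip around q. The sum over discs of
    size about [d] integrates to a multiple of sum r_n r~_n at that scale, which [thin_scale] makes
    small. *)
Lemma one_level (e : R) : 0 < e -> exists s, [/\ uniq s, forall n, n \in s -> proper N o n &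
  Int (jump f M' M1) <= \sum_(n <- s) rad M n * rad M1 (phi n) * Int (jump f (chM' M M' n) (chM M1 (phi n))) + e].
Proof.
(* The strip has width 2 tau and jumps are at most 2, so it costs e / 2. *)
move=> e0; pose tau := e / 8.
have tau0 : 0 < tau by rewrite divr_gt0.
have [C [d1 [C1 d10 hD]]] := disc_scale sd sd1 hm md (cf_q cf) (cf_lqs cf) (cf_d0 cf) (cf_co cf) H H1 tau0.
have C0 : 0 < C by apply: lt_le_trans C1.
pose B := 2 * C * (2 * (C + 1) + 1).
have B0 : 0 < B by rewrite /B !mulr_gt0 //; lra.
(* The small discs cost at most 2 B C^2 times their product sum: each indicator has integral 2 C d,
   and d <= C r_n. The threshold makes this e / 2. *)
have [|d [s' [hd us' hs' hsum]]] := @thin_scale C d1 (e / (4 * B * C ^+ 2)) C1 d10.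
  by apply: divr_gt0 => //; apply: mulr_gt0; [apply: mulr_gt0 | exact: exprn_gt0].
have /andP[dp _] := hd.
have [s [us hs]] := finite_discs sd H (half_pos dp).
exists s; split=> //; first by move=> n /hs[].
pose Q2 := (ch M q).2.
pose A1 y := \sum_(n <- s) child_term f phi M M' M1 n y.
pose A2 y := \sum_(n <- s') rad M1 (phi n) * ind ((cen M n).2 - C * d) ((cen M n).2 + C * d) y.
have pt y : jump f M' M1 y <= A1 y + (B * A2 y + 2 * ind (Q2 - tau) (Q2 + tau) y).
  have A10 : 0 <= A1 y.
    by rewrite /A1 big_seq; apply: sumr_ge0 => n /hs[pn _]; exact: (child_term_ge0 _ sd sd1 md H H1 pn).
  have A20 : 0 <= B * A2 y.
    rewrite mulr_ge0 ?(ltW B0) // /A2 big_seq; apply: sumr_ge0 => n /hs'[pn _].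
    by rewrite mulr_ge0 ?ind_ge0 // ltW // r1.
  have I0 := ind_ge0 (Q2 - tau) (Q2 + tau) y.
  have [h1|h1] := leP `|y| 1; last by rewrite (jump_out f M' M1 h1); lra.
  rewrite ler_norml in h1.
  have [h2|h2] := leP tau `|y - Q2|.
    have := line_bound sd sd1 hm md H H1 C1 dp h1 h2 _ hs hs'.
    move=> /(_ (fun z Sz zq => hD z d Sz zq hd)); rewrite -/B -/(A1 y) -/(A2 y); lra.
  have -> : ind (Q2 - tau) (Q2 + tau) y = 1.
    by rewrite /ind; move: h2; rewrite ltr_norml => /andP[k1 k2]; case: ifP => // /negP[]; apply/andP; split; lra.
  have := jump_le2 sd sd1 hm H H1 y; lra.
have aA1 : adm A1 /\ Int A1 = \sum_(n <- s) rad M n * rad M1 (phi n) * Int (jump f (chM' M M' n) (chM M1 (phi n))).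
  rewrite /A1; have hp n : n \in s -> proper N o n by move=> /hs[].
  elim: (s) hp => [|n t IH] hp.
    have E : (fun y => \sum_(m <- [::]) child_term f phi M M' M1 m y) = (fun=> 0) by apply/funext => y; rewrite big_nil.
    by rewrite E big_nil; split; [exact: adm0 | exact: Int0].
  have [i1 i2] := IH (fun m hm => hp m (mem_behead (s := n :: t) hm)).
  have [j1 j2] := adm_child (hp n (mem_head n t)).
  have E : (fun y => \sum_(m <- n :: t) child_term f phi M M' M1 m y) =
    (fun y => child_term f phi M M' M1 n y + \sum_(m <- t) child_term f phi M M' M1 m y).
    by apply/funext => y; rewrite big_cons.
  by rewrite E big_cons -i2 -j2; split; [exact: admD | exact: IntD].
have r1' n : n \in s' -> 0 < rad M1 (phi n) by move=> /hs'[pn _]; exact: r1.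
have aA2 : adm A2 /\ Int A2 = \sum_(n <- s') rad M1 (phi n) * (2 * C * d).
  rewrite /A2; move: r1'; elim: (s') => [|n t IH] hp.
    have E : (fun y => \sum_(m <- [::]) rad M1 (phi m) * ind ((cen M m).2 - C * d) ((cen M m).2 + C * d) y) = (fun=> 0) by apply/funext => y; rewrite big_nil.
    by rewrite E big_nil; split; [exact: adm0 | exact: Int0].
  have [i1 i2] := IH (fun m hm => hp m (mem_behead (s := n :: t) hm)).
  have p1 := hp n (mem_head n t).
  have E : (fun y => \sum_(m <- n :: t) rad M1 (phi m) * ind ((cen M m).2 - C * d) ((cen M m).2 + C * d) y) =
    (fun y => rad M1 (phi n) * ind ((cen M n).2 - C * d) ((cen M n).2 + C * d) y +
      \sum_(m <- t) rad M1 (phi m) * ind ((cen M m).2 - C * d) ((cen M m).2 + C * d) y).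
    by apply/funext => y; rewrite big_cons.
  have j1 := adm_ind ((cen M n).2 - C * d) ((cen M n).2 + C * d).
  have Cd : 0 < C * d by rewrite mulr_gt0.
  rewrite E big_cons -i2; split; first by apply: admD => //; apply: admZ => //; exact: ltW.
  rewrite IntD //; last by apply: admZ => //; exact: ltW.
  rewrite IntZ ?(ltW p1) // Int_ind; last by lra.
  by congr (_ * _ + _); ring.
have [a1 i1] := aA1; have [a2 i2] := aA2.
have a3 := adm_ind (Q2 - tau) (Q2 + tau).
have a2' : adm (fun y => B * A2 y) by apply: admZ => //; exact: ltW.
have a3' : adm (fun y => 2 * ind (Q2 - tau) (Q2 + tau) y) by apply: admZ.
have a23 := admD a2' a3'.
have := Int_le (adm_jump sd sd1 hm H H1) (admD a1 a23) pt.
rewrite IntD // IntD // IntZ ?(ltW B0) // IntZ // i1 i2 Int_ind; last by lra.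
have : B * \sum_(n <- s') rad M1 (phi n) * (2 * C * d) <= e / 2.
  rewrite -mulr_suml; apply: (@le_trans _ _ (B * (2 * C ^+ 2 * \sum_(n <- s') rad M n * rad M1 (phi n)))).
    rewrite ler_pM2l // mulrC mulr_sumr mulr_sumr big_seq [leRHS]big_seq; apply: ler_sum => n ns.
    have /hs'[pn /andP[h1 _]] := ns; rewrite ler_pdivrMr // in h1.
    rewrite mulrA ler_pM2r ?r1' //.
    have : 2 * C * d <= 2 * C * (rad M n * C) by rewrite ler_pM2l // mulr_gt0.
    by rewrite expr2; lra.
  have P : 0 < B * (2 * C ^+ 2) by apply: mulr_gt0 => //; apply: mulr_gt0 => //; exact: exprn_gt0.
  rewrite mulrA; apply: le_trans (ler_wpM2l (ltW P) hsum) _.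
  by rewrite le_eqVlt; apply/orP; left; apply/eqP; field; rewrite !gt_eqF.
rewrite /tau; lra.
Qed.

End InState.
End OneLevel.

(** * Near-extremal states and comparison of radii *)

Section TwoLevel.
Variable R : realType.

(** Expanding the squares, the sum of (a - b)^2 is at most 1 + 1 - 2 (1 - e). *)
Lemma sum_close (T : eqType) (s : seq T) (a b : T -> R) (e : R) : \sum_(n <- s) a n ^+ 2 <= 1 ->
  \sum_(n <- s) b n ^+ 2 <= 1 -> 1 - e <= \sum_(n <- s) a n * b n -> forall n, n \in s -> (a n - b n) ^+ 2 <= 2 * e.
Proof.
move=> ha hb hab n ns.
apply: le_trans (sum_seq1 (F := fun m => (a m - b m) ^+ 2) ns (fun m _ => sqr_ge0 _)) _.
have -> : \sum_(m <- s) (a m - b m) ^+ 2 = \sum_(m <- s) a m ^+ 2 + \sum_(m <- s) b m ^+ 2 - 2 * \sum_(m <- s) a m * b m.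
  by rewrite mulr_sumr -big_split -sumrB /=; apply: eq_bigr => m _; ring.
light_lra.
Qed.

Variables (S : set (pt R)) (N : set (vec R)) (S1 : set (pt R)) (N1 : set (vec R)).
Variables (f g : pt R -> pt R) (phi psi : vec R -> vec R) (q : pt R) (d0 : R).
Hypothesis cf : conf S N S1 N1 f g phi psi q d0.
Let sd := cf_sd cf. Let sd1 := cf_sd1 cf. Let hm := cf_hm cf. Let md := cf_md cf.

Definition pair_st (M M' M1 M1' : vec R -> vec R) o := st N M M' o /\ st N1 M1 M1' (phi o).

Lemma child_pair M M' M1 M1' o n : pair_st M M' M1 M1' o -> proper N o n ->
  pair_st (chM M n) (chM' M M' n) (chM M1 (phi n)) (chM' M1 M1' (phi n)) n.
Proof.
move=> [H H1] pn; have [Np po] := phi_proper md (st_o H) pn; have [Nn no] := pn.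
by split; [exact: (child_st sd H Nn no) | exact: (child_st sd1 H1 Np po)].
Qed.

(** Every child state is again a state, so its integral is bounded by the same supremum m. Two
    applications of [one_level] and division by m give the estimate. *)
Lemma near_extremal (e : R) : 0 < e -> exists M M' M1 M1' o, pair_st M M' M1 M1' o /\
  exists (s : seq (vec R)) (t : vec R -> seq (vec R)), [/\ uniq s, forall n, n \in s -> proper N o n,
    forall n, n \in s -> uniq (t n) /\ forall k, k \in t n -> proper N n k &
    1 - e <= \sum_(n <- s) (rad M n * rad M1 (phi n)) *
       \sum_(k <- t n) rad (chM M n) k * rad (chM M1 (phi n)) (phi k)].
Proof.
move=> e0; pose E := [set I : R | exists M M' M1 M1' o, pair_st M M' M1 M1' o /\ I = Int (jump f M' M1)].
have [ o No] := sd_ne sd.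
have [M0 [M0' H0]] := st_exists No (sd_unit sd No).
have Np := md_phi md No; have [M2 [M2' H2]] := st_exists Np (sd_unit sd1 Np).
have hE : has_sup E.
  split; first by exists (Int (jump f M0' M2)), M0, M0', M2, M2', o.
  by exists 4 => _ [M [M' [M1 [M1' [p [[H H1] ->]]]]]]; exact: (Int_jump_le sd sd1 hm H H1).
pose m := sup E.
have ub M M' M1 M1' p : pair_st M M' M1 M1' p -> Int (jump f M' M1) <= m.
  by move=> hp; apply: ub_le_sup; [case: hE | exists M, M', M1, M1', p].
have m0 : 0 < m.
  apply: (@lt_le_trans _ _ (Int (jump f M0' M2))); first exact: (Int_jump_gt0 sd sd1 hm H0 H2).
  by apply: (ub M0 M0' M2 M2' o).
(* The error budget is e m: half for missing the supremum and a quarter for each of the two levels,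
   the second weighted by a product sum at most 1. *)
have em : 0 < e * m / 2 by rewrite divr_gt0 // mulr_gt0.
have [_ [M [M' [M1 [M1' [p [hp ->]]]]]] hI] := sup_adherent em hE.
exists M, M', M1, M1', p; split=> //; have [H H1] := hp.
have em4 : 0 < e * m / 4 by rewrite divr_gt0 // mulr_gt0.
have [s [us hs hsum]] := one_level cf H H1 em4.
have Q n : exists t, n \in s -> [/\ uniq t, forall k, k \in t -> proper N n k &
    Int (jump f (chM' M M' n) (chM M1 (phi n))) <= m * \sum_(k <- t) rad (chM M n) k * rad (chM M1 (phi n)) (phi k) + e * m / 4].
  have [ns|ns] := EM (n \in s); last by exists [::].
  have cp := child_pair hp (hs n ns); have [Hc Hc1] := cp.
  have [t [ut ht htsum]] := one_level cf Hc Hc1 em4.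
  exists t => _; split=> //; apply: le_trans htsum _; rewrite lerD2r mulr_sumr big_seq [leRHS]big_seq.
  apply: ler_sum => k /ht pk; have cpk := child_pair cp pk.
  rewrite mulrC; apply: ler_wpM2r; last exact: ub cpk.
  rewrite mulr_ge0 // ltW //; first exact: (proper_rad sd Hc pk).
  exact: (proper_rad sd1 Hc1 (phi_proper md (st_o Hc) pk)).
have [t ht] := choice Q; exists s, t; split=> //.
  by move=> n ns; have [] := ht n ns.
have r0 n : n \in s -> 0 <= rad M n * rad M1 (phi n).
  move=> /hs pn; rewrite mulr_ge0 // ltW //; first exact: (proper_rad sd H pn).
  exact: (proper_rad sd1 H1 (phi_proper md (st_o H) pn)).
set SS := \sum_(n <- s) _ in hsum *; rewrite -/m in hI.
set TT := \sum_(n <- s) _.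
have : SS <= m * TT + e * m / 4.
  apply: (@le_trans _ _ (\sum_(n <- s) (rad M n * rad M1 (phi n)) *
    (m * \sum_(k <- t n) rad (chM M n) k * rad (chM M1 (phi n)) (phi k) + e * m / 4))).
    rewrite /SS big_seq [leRHS]big_seq; apply: ler_sum => n ns; apply: ler_wpM2l; first exact: r0.
    by have [] := ht n ns.
  under eq_bigr do rewrite mulrDr.
  rewrite big_split /=; apply: lerD.
    by rewrite /TT mulr_sumr; apply: ler_sum => n _; rewrite mulrCA.
  rewrite -mulr_suml -[leRHS]mul1r; apply: ler_wpM2r; first exact: ltW.
  exact: (prod_le1 cf H H1 us hs).
move=> h1; rewrite -(ler_pM2l m0); lra.
Qed.

(* The state is taken where the integrated jump nearly attains its supremum. *)
Lemma radii_close (e : R) : 0 < e -> exists M M' M1 M1' o, pair_st M M' M1 M1' o /\ forall n, proper N o n ->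
  (rad M n - rad M1 (phi n)) ^+ 2 <= 2 * e /\ forall k, proper N n k ->
  (rad M n * rad (chM M n) k - rad M1 (phi n) * rad (chM M1 (phi n)) (phi k)) ^+ 2 <= 2 * e.
Proof.
move=> e0; have [M [M' [M1 [M1' [ o [hp [s [t [us hs ht hsum]]]]]]]]] := near_extremal e0.
exists M, M', M1, M1', o; split=> // n0 pn0; have [H H1] := hp.
have r0 n : proper N o n -> 0 <= rad M n * rad M1 (phi n).
  move=> pn; rewrite mulr_ge0 // ltW //; first exact: (proper_rad sd H pn).
  exact: (proper_rad sd1 H1 (phi_proper md (st_o H) pn)).
have c0 n k : proper N o n -> proper N n k -> 0 <= rad (chM M n) k * rad (chM M1 (phi n)) (phi k).
  move=> pn pk; have [Hc Hc1] := child_pair hp pn.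
  rewrite mulr_ge0 // ltW //; first exact: (proper_rad sd Hc pk).
  exact: (proper_rad sd1 Hc1 (phi_proper md (st_o Hc) pk)).
(* The finite lists may miss the disc under study. Adding it, and below adding [k0] to its list of
   children, only increases the product sum and keeps the packing bounds. *)
pose s' := if n0 \in s then s else n0 :: s.
have ns' : n0 \in s' by rewrite /s'; case: ifP => // _; rewrite mem_head.
have us' : uniq s' by rewrite /s'; case: ifP => // h; rewrite /= h us.
have hs' n : n \in s' -> proper N o n.
  by rewrite /s'; case: ifP => _; [exact: hs | rewrite inE => /orP[/eqP -> //|/hs]].
have ext (F F' : vec R -> R) : (forall n, n \in s -> F n <= F' n) -> (forall n, n \in s' -> 0 <= F' n) ->
    \sum_(n <- s) F n <= \sum_(n <- s') F' n.
  move=> h1 h2; apply: (@le_trans _ _ (\sum_(n <- s) F' n)).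
    by rewrite big_seq [leRHS]big_seq; apply: ler_sum.
  move: (h2 n0 ns'); rewrite /s'; case: ifP => // _ h; by rewrite big_cons lerDr.
split.
  have [p1 p2] := packing2 cf H H1 us' hs'.
  apply: (sum_close (a := rad M) (b := fun n => rad M1 (phi n)) p1 p2 _ ns').
  apply: le_trans hsum (ext _ _ _ _) => n ns; last exact: (r0 n (hs' n ns)).
  have [utn htn] := ht n ns; have [Hc Hc1] := child_pair hp (hs n ns).
  rewrite -[leRHS]mulr1; apply: ler_wpM2l; first exact: (r0 n (hs n ns)).
  exact: (prod_le1 cf Hc Hc1 utn htn).
move=> k0 pk0.
pose t0 n := if n \in s then t n else [::].
pose t' n := if (n == n0) && (k0 \notin t0 n) then k0 :: t0 n else t0 n.
have ht0 n : uniq (t0 n) /\ forall k, k \in t0 n -> proper N n k.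
  by rewrite /t0; case: ifP => // /ht.
have ht' n : uniq (t' n) /\ forall k, k \in t' n -> proper N n k.
  have [h1 h2] := ht0 n; rewrite /t'; case: ifP => // /andP[/eqP -> h3]; rewrite /= -/(t0 n0).
  split=> [|k]; first by rewrite h3 (ht0 n0).1.
  by rewrite inE => /orP[/eqP -> //|/(ht0 n0).2].
have kt' : k0 \in t' n0 by rewrite /t' eqxx /=; case: ifP => [_|/negbT]; [rewrite mem_head | rewrite negbK].
(* The products of radii over both levels still have square sum at most 1, so [sum_close] applies to
   pairs. *)
pose L := [seq (n, k) | n <- s', k <- t' n].
have inL : (n0, k0) \in L by apply/allpairsPdep; exists n0, k0.
pose a (nk : vec R * vec R) := rad M nk.1 * rad (chM M nk.1) nk.2.
pose b (nk : vec R * vec R) := rad M1 (phi nk.1) * rad (chM M1 (phi nk.1)) (phi nk.2).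
have sumL (F : vec R * vec R -> R) : \sum_(nk <- L) F nk = \sum_(n <- s') \sum_(k <- t' n) F (n, k).
  by rewrite /L big_allpairs_dep.
have [p1 p2] := packing2 cf H H1 us' hs'.
have level (F : vec R -> R) (G : vec R -> vec R -> R) : \sum_(n <- s') F n ^+ 2 <= 1 ->
    (forall n, n \in s' -> \sum_(k <- t' n) G n k ^+ 2 <= 1) ->
    \sum_(n <- s') \sum_(k <- t' n) (F n * G n k) ^+ 2 <= 1.
  move=> h1 h2; apply: le_trans h1; rewrite big_seq [leRHS]big_seq; apply: ler_sum => n ns.
  under eq_bigr do rewrite exprMn.
  by rewrite -mulr_sumr -[leRHS]mulr1; apply: ler_wpM2l; [exact: sqr_ge0 | exact: h2].
have q1 : \sum_(nk <- L) a nk ^+ 2 <= 1.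
  rewrite sumL; apply: (level (rad M) (fun n => rad (chM M n))) => // n ns; have [Hc Hc1] := child_pair hp (hs' n ns).
  by have [utn htn] := ht' n; have [] := packing2 cf Hc Hc1 utn htn.
have q2 : \sum_(nk <- L) b nk ^+ 2 <= 1.
  rewrite sumL; apply: (level (fun n => rad M1 (phi n)) (fun n k => rad (chM M1 (phi n)) (phi k))) => // n ns; have [Hc Hc1] := child_pair hp (hs' n ns).
  by have [utn htn] := ht' n; have [] := packing2 cf Hc Hc1 utn htn.
apply: (sum_close q1 q2 _ inL).
rewrite sumL; apply: le_trans hsum (ext _ _ _ _) => n ns; last first.
  rewrite big_seq; apply: sumr_ge0 => k kt; rewrite /a /b /= mulrACA mulr_ge0 ?(r0 n (hs' n ns)) //.
  exact: (c0 n k (hs' n ns) ((ht' n).2 k kt)).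
rewrite mulr_sumr.
have -> : \sum_(k <- t' n) a (n, k) * b (n, k) = \sum_(k <- t' n) rad M n * rad M1 (phi n) *
    (rad (chM M n) k * rad (chM M1 (phi n)) (phi k)) by apply: eq_bigr => k _; rewrite /a /b /= mulrACA.
have nn := hs n ns.
have t0n : t0 n = t n by rewrite /t0 ns.
rewrite /t' t0n; case: ifP => [/andP[/eqP e1' _]|_] //.
rewrite big_cons lerDr mulr_ge0 ?(r0 n nn) //; apply: c0 => //; by rewrite e1'.
Qed.

End TwoLevel.

(** * Passage to the limit *)

Section LTLimit.
Variable R : realType.
Implicit Types (u v w : vec R) (x y : pt R) (K d : R) (L : vec R -> vec R).

Definition bnd K v := [/\ `|c1 v| <= K, `|c2 v| <= K, `|c3 v| <= K & `|c4 v| <= K].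
Definition ucvv (s : nat -> vec R) v := [/\ ucv (fun i => c1 (s i)) (c1 v), ucv (fun i => c2 (s i)) (c2 v),
  ucv (fun i => c3 (s i)) (c3 v) & ucv (fun i => c4 (s i)) (c4 v)].

Lemma ucvv_uniq (s : nat -> vec R) u v : ucvv s u -> ucvv s v -> u = v.
Proof. by move=> [a1 a2 a3 a4] [b1 b2 b3 b4]; apply: vext; [exact: ucv_uniq b1 | exact: ucv_uniq b2 | exact: ucv_uniq b3 | exact: ucv_uniq b4]. Qed.

Lemma ucvv_cst v : ucvv (fun=> v) v. Proof. by split; exact: ucv_cst. Qed.

Lemma ucvv_eq (s t : nat -> vec R) v : UU [set i | s i = t i] -> ucvv s v -> ucvv t v.
Proof. by move=> U [a1 a2 a3 a4]; split; [apply: ucv_eq a1 | apply: ucv_eq a2 | apply: ucv_eq a3 | apply: ucv_eq a4]; apply: UU_imp U => i /= ->. Qed.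

Lemma ucvv_lc (a b : nat -> R) (s t : nat -> vec R) a0 b0 u v : ucv a a0 -> ucv b b0 -> ucvv s u -> ucvv t v ->
  ucvv (fun i => lc (a i) (s i) (b i) (t i)) (lc a0 u b0 v).
Proof. by move=> ha hb [s1 s2 s3 s4] [t1 t2 t3 t4]; split; apply: ucvD; apply: ucvM. Qed.

Lemma ucv_lf (s t : nat -> vec R) u v : ucvv s u -> ucvv t v -> ucv (fun i => lf (s i) (t i)) (lf u v).
Proof.
move=> [s1 s2 s3 s4] [t1 t2 t3 t4].
exact: (ucvB (ucvD (ucvD (ucvM s1 t1) (ucvM s2 t2)) (ucvM s3 t3)) (ucvM s4 t4)).
Qed.

Lemma ucvv_ex (s : nat -> vec R) K : (forall i, bnd K (s i)) -> exists2 v, bnd K v & ucvv s v.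
Proof.
move=> h.
have h1 i : `|c1 (s i)| <= K by have [] := h i.
have [a1 k1 u1] := ucv_ex (UU_all h1).
have h2 i : `|c2 (s i)| <= K by have [] := h i.
have [a2 k2 u2] := ucv_ex (UU_all h2).
have h3 i : `|c3 (s i)| <= K by have [] := h i.
have [a3 k3 u3] := ucv_ex (UU_all h3).
have h4 i : `|c4 (s i)| <= K by have [] := h i.
have [a4 k4 u4] := ucv_ex (UU_all h4).
by exists (a1, a2, a3, a4).
Qed.

Lemma vec_basis u : u = lc 1 (lc (c1 u) (e1 R) (c2 u) (e2 R)) 1 (lc (c3 u) (e3 R) (c4 u) (e4 R)).
Proof. by apply: vext; rewrite /lc /e1 /e2 /e3 /e4 /c1 /c2 /c3 /c4 /=; ring. Qed.

Lemma bnd_lc a b K1 K2 u v : bnd K1 u -> bnd K2 v -> bnd (`|a| * K1 + `|b| * K2) (lc a u b v).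
Proof.
move=> [s1 s2 s3 s4] [t1 t2 t3 t4]; split; apply: le_trans (ler_normD _ _) _; rewrite !normrM;
  by apply: lerD; apply: ler_wpM2l.
Qed.

Lemma lf_bnd K1 K2 u v : bnd K1 u -> bnd K2 v -> `|lf u v| <= 4 * (K1 * K2).
Proof.
move=> [s1 s2 s3 s4] [t1 t2 t3 t4].
have p a b : `|a| <= K1 -> `|b| <= K2 -> `|a * b| <= K1 * K2 by move=> h1 h2; rewrite normrM; apply: ler_pM.
have := p _ _ s1 t1; have := p _ _ s2 t2; have := p _ _ s3 t3; have := p _ _ s4 t4.
rewrite /lf !ler_norml => /andP[x1 x2] /andP[x3 x4] /andP[x5 x6] /andP[x7 x8]; apply/andP; split; light_lra.
Qed.

Lemma fut_bnd K v : fut v -> c4 v <= K -> bnd K v.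
Proof.
move=> [lv v4] vK.
have s1 := sqr_ge0 (c1 v); have s2 := sqr_ge0 (c2 v); have s3 := sqr_ge0 (c3 v).
have h : c1 v ^+ 2 + c2 v ^+ 2 + c3 v ^+ 2 <= c4 v ^+ 2 by move: lv; rewrite /lf !expr2; light_lra.
have g a : a ^+ 2 <= c4 v ^+ 2 -> `|a| <= K.
  by move=> ha; apply: le_trans vK; apply: ler_sqr_abs; [exact: ltW | rewrite real_normK ?num_real].
by split; [apply: g; light_lra | apply: g; light_lra | apply: g; light_lra | rewrite gtr0_norm].
Qed.

Lemma LT_c4C L L' : LT L L' -> c4 (L' (e4 R)) = c4 (L (e4 R)).
Proof.
move=> H; have E u : lf u (e4 R) = - c4 u by rewrite /lf /e4 /c1 /c2 /c3 /c4 /=; ring.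
by have := LT_adj (e4 R) (e4 R) H; rewrite E lfC E => /oppr_inj.
Qed.

(** c4 (L e4) is the hyperbolic cosine of the displacement of the centre of the ball, and it bounds
    the whole matrix. *)
Lemma LT_bnd L L' K v V : LT L L' -> c4 (L (e4 R)) <= K -> bnd V v -> bnd (8 * K * V) (L v).
Proof.
move=> H hK hv.
have E4 : lf (e4 R) (e4 R) = -1 by rewrite /lf /e4 /c1 /c2 /c3 /c4 /=; ring.
have f4 : fut (e4 R) by split; rewrite ?E4 ?oppr_le0 ?ler01 // /c4 /=; exact: ltr01.
have b4 : bnd (2 * K) (L (e4 R)).
  apply: fut_bnd; first exact: (LT_fut H).
  have [_ h0] := LT_fut H f4; light_lra.
(* A unit space vector [e] is half the difference of the light-like future vectors e4 + e and e4 -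
   e. Their images have positive time coordinates of sum 2 c4 (L e4), and a future vector is bounded
   by its time coordinate. *)
have half e : lf e e = 1 -> c4 e = 0 -> lf e (e4 R) = 0 -> bnd (2 * K) (L e).
  move=> e11 e40 ee4.
  have fp : fut (lc 1 (e4 R) 1 e).
    split; first by rewrite lf_lcl !lf_lcr E4 e11 (lfC _ e) ee4; light_lra.
    by rewrite /lc /c4 /= -/(c4 e) e40 mulr0 addr0 mul1r ltr01.
  have fm : fut (lc 1 (e4 R) (-1) e).
    split; first by rewrite lf_lcl !lf_lcr E4 e11 (lfC _ e) ee4; light_lra.
    by rewrite /lc /c4 /= -/(c4 e) e40 mulr0 addr0 mul1r ltr01.
  have [_ p0] := LT_fut H fp; have [_ m0] := LT_fut H fm.
  have ep : c4 (L (lc 1 (e4 R) 1 e)) = c4 (L (e4 R)) + c4 (L e) by rewrite (LT_lin H) /lc {1}/c4 /= !mul1r.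
  have em : c4 (L (lc 1 (e4 R) (-1) e)) = c4 (L (e4 R)) - c4 (L e) by rewrite (LT_lin H) /lc {1}/c4 /= mul1r mulN1r.
  have bp : bnd (2 * K) (L (lc 1 (e4 R) 1 e)) by apply: fut_bnd; [exact: (LT_fut H) | light_lra].
  have bm : bnd (2 * K) (L (lc 1 (e4 R) (-1) e)) by apply: fut_bnd; [exact: (LT_fut H) | light_lra].
  have -> : e = lc (1 / 2) (lc 1 (e4 R) 1 e) (- (1 / 2)) (lc 1 (e4 R) (-1) e).
    by apply: vext; rewrite /lc /c1 /c2 /c3 /c4 /=; field.
  rewrite (LT_lin H); have := bnd_lc (1 / 2) (- (1 / 2)) bp bm.
  rewrite normrN ger0_norm ?divr_ge0 // (_ : 1 / 2 * (2 * K) + 1 / 2 * (2 * K) = 2 * K); [exact | by field].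
have b1 : bnd (2 * K) (L (e1 R)) by apply: half; rewrite /lf /e1 /e4 /c1 /c2 /c3 /c4 /=; ring.
have b2 : bnd (2 * K) (L (e2 R)) by apply: half; rewrite /lf /e2 /e4 /c1 /c2 /c3 /c4 /=; ring.
have b3 : bnd (2 * K) (L (e3 R)) by apply: half; rewrite /lf /e3 /e4 /c1 /c2 /c3 /c4 /=; ring.
have K0 : 0 <= 2 * K by have [h _ _ _] := b4; apply: le_trans h.
have [h1 h2 h3 h4] := hv.
rewrite (vec_basis v) !(LT_lin H).
have := bnd_lc 1 1 (bnd_lc (c1 v) (c2 v) b1 b2) (bnd_lc (c3 v) (c4 v) b3 b4).
rewrite normr1 !mul1r => -[k1 k2 k3 k4].
have t : `|c1 v| * (2 * K) + `|c2 v| * (2 * K) + (`|c3 v| * (2 * K) + `|c4 v| * (2 * K)) <= 8 * K * V.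
  have := ler_wpM2r K0 h1; have := ler_wpM2r K0 h2; have := ler_wpM2r K0 h3; have := ler_wpM2r K0 h4; light_lra.
by split; apply: le_trans t.
Qed.

Lemma bnd_e1 : bnd 1 (e1 R). Proof. by split; rewrite /e1 /c1 /c2 /c3 /c4 /= ?normr0 ?normr1. Qed.
Lemma bnd_e2 : bnd 1 (e2 R). Proof. by split; rewrite /e2 /c1 /c2 /c3 /c4 /= ?normr0 ?normr1. Qed.
Lemma bnd_e3 : bnd 1 (e3 R). Proof. by split; rewrite /e3 /c1 /c2 /c3 /c4 /= ?normr0 ?normr1. Qed.
Lemma bnd_e4 : bnd 1 (e4 R). Proof. by split; rewrite /e4 /c1 /c2 /c3 /c4 /= ?normr0 ?normr1. Qed.

(** Compactness of bounded sets of Lorentz maps: take limits of the images of the basis. Convergence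
    is stated jointly in the map and the vector because the discs will vary as well. *)
Lemma LT_limit (L L' : nat -> vec R -> vec R) K : (forall i, LT (L i) (L' i)) -> (forall i, c4 (L i (e4 R)) <= K) ->
  exists M M', [/\ LT M M', forall s v, ucvv s v -> ucvv (fun i => L i (s i)) (M v) &
    forall s v, ucvv s v -> ucvv (fun i => L' i (s i)) (M' v)].
Proof.
move=> H hK; have H' i := LT_sym (H i).
have hK' i : c4 (L' i (e4 R)) <= K by rewrite (LT_c4C (H i)).
have lim (A A' : nat -> vec R -> vec R) : (forall i, LT (A i) (A' i)) -> (forall i, c4 (A i (e4 R)) <= K) ->
    exists M, forall s v, ucvv s v -> ucvv (fun i => A i (s i)) (M v).
  move=> HA KA.
  have [E1 _ u1] := ucvv_ex (fun i => LT_bnd (HA i) (KA i) bnd_e1).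
  have [E2 _ u2] := ucvv_ex (fun i => LT_bnd (HA i) (KA i) bnd_e2).
  have [E3 _ u3] := ucvv_ex (fun i => LT_bnd (HA i) (KA i) bnd_e3).
  have [E4 _ u4] := ucvv_ex (fun i => LT_bnd (HA i) (KA i) bnd_e4).
  exists (fun v => lc 1 (lc (c1 v) E1 (c2 v) E2) 1 (lc (c3 v) E3 (c4 v) E4)) => s v [s1 s2 s3 s4].
  have o1 : @ucv R (fun=> 1) 1 := ucv_cst 1.
  apply: ucvv_eq (ucvv_lc o1 o1 (ucvv_lc s1 s2 u1 u2) (ucvv_lc s3 s4 u3 u4)).
  by apply: UU_all => i /=; rewrite [in RHS](vec_basis (s i)) !(LT_lin (HA i)).
have [M hM] := lim _ _ H hK; have [M' hM'] := lim _ _ H' hK'.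
exists M, M'; split=> //; apply: LT_intro.
- move=> a u b v; apply: ucvv_uniq (hM _ _ (ucvv_cst (lc a u b v))) _.
  apply: ucvv_eq (ucvv_lc (ucv_cst a) (ucv_cst b) (hM _ _ (ucvv_cst u)) (hM _ _ (ucvv_cst v))).
  by apply: UU_all => i /=; rewrite (LT_lin (H i)).
- move=> v; apply: ucvv_uniq (hM' _ _ (hM _ _ (ucvv_cst v))) _.
  by apply: ucvv_eq (ucvv_cst v); apply: UU_all => i /=; rewrite (LT_K (H i)).
- move=> v; apply: ucvv_uniq (hM _ _ (hM' _ _ (ucvv_cst v))) _.
  by apply: ucvv_eq (ucvv_cst v); apply: UU_all => i /=; rewrite (LT_K' (H i)).
- move=> u v; apply: ucv_uniq (ucv_lf (hM _ _ (ucvv_cst u)) (hM _ _ (ucvv_cst v))) _.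
  by apply: ucv_eq (ucv_cst (lf u v)); apply: UU_all => i /=; rewrite (LT_lf (H i)).
move=> u fu; have [lu u4] := fu.
have [_ _ _ k4] := hM _ _ (ucvv_cst u).
have MM v w : lf (M v) (M w) = lf v w.
  apply: ucv_uniq (ucv_lf (hM _ _ (ucvv_cst v)) (hM _ _ (ucvv_cst w))) _.
  by apply: ucv_eq (ucv_cst (lf v w)); apply: UU_all => i /=; rewrite (LT_lf (H i)).
have l4 : lf (M u) (M u) <= 0 by rewrite MM.
split=> //; rewrite lt_def; apply/andP; split; last first.
  apply: (ucv_le (ucv_cst 0) k4); apply: UU_all => i /=; apply: ltW.
  by have [] := LT_fut (H i) fu.
apply/eqP => z4; have := fut0 l4 z4 (M (e4 R)); rewrite MM.
have -> : lf u (e4 R) = - c4 u by rewrite /lf /e4 /c1 /c2 /c3 /c4 /=; ring.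
by move/eqP; rewrite oppr_eq0 gt_eqF.
Qed.

(** A map that keeps a separated triple separated has bounded displacement: two of the points are
    away from the pole, where a large factor t would contract them. *)
Lemma LT_spread L L' d y1 y2 y3 : LT L L' -> 0 < d -> sphere y1 -> sphere y2 -> sphere y3 ->
  [/\ d <= edist y1 y2, d <= edist y2 y3 & d <= edist y1 y3] ->
  [/\ 1 <= edist (act L y1) (act L y2), 1 <= edist (act L y2) (act L y3) & 1 <= edist (act L y1) (act L y3)] ->
  c4 (L (e4 R)) <= 64 / d ^+ 2.
Proof.
move=> H d0 s1 s2 s3 [d12 d23 d13] [f12 f23 f13].
have [t [u [t1 su hu _]]] := pole H.
have t0 : 0 < t by apply: lt_le_trans t1.
have key x y : sphere x -> sphere y -> 1 <= edist (act L x) (act L y) -> d / 2 <= edist x u -> d / 2 <= edist y u ->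
    t <= 32 / d ^+ 2.
  move=> sx sy f kx ky; have E := act_dist H sx sy.
  have d2p : 0 < d ^+ 2 by rewrite exprn_gt0.
  have lb z : sphere z -> d / 2 <= edist z u -> t * (d ^+ 2 / 16) <= c4 (L (X z)).
    move=> sz kz; have /andP[h _] := hu _ sz; apply: le_trans h; rewrite ler_pM2l //.
    have d20 : 0 <= d / 2 by rewrite divr_ge0 // ltW.
    by have := sqr_mono d20 kz; rewrite expr_div_n; clear; lra.
  have g0 : 0 <= t * (d ^+ 2 / 16) by rewrite mulr_ge0 ?(ltW t0) // divr_ge0 // ltW.
  have h : (t * (d ^+ 2 / 16)) ^+ 2 <= 2 ^+ 2.
    apply: (@le_trans _ _ (edist x y ^+ 2)); last by apply: sqr_mono; [exact: edist_ge0 | exact: edist_le2].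
    rewrite -E -[leLHS]mul1r; apply: ler_pM => //; first exact: sqr_ge0.
      by have := sqr_mono ler01 f; rewrite expr1n.
    by rewrite expr2; apply: ler_pM => //; exact: lb.
  have h2 : t * (d ^+ 2 / 16) <= 2 by apply: ler_sqr_abs.
  rewrite ler_pdivlMr //; lra_from h2.
have two a b : d <= edist a b -> d / 2 <= edist a u \/ d / 2 <= edist b u.
  move=> h; have := edist_tri a u b; rewrite (edistC u b) => tri.
  have [k|k] := leP (d / 2) (edist a u); [by left | right; lra_from h k tri].
have tb : t <= 32 / d ^+ 2.
  have [a1|a1] := leP (d / 2) (edist y1 u).
    have [a2|a2] := leP (d / 2) (edist y2 u); first exact: (key y1 y2).
    have [a3|a3] := two _ _ d23; first by have := le_lt_trans a3 a2; rewrite ltxx.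
    exact: (key y1 y3).
  have [a2|a2] := two _ _ d12; first by have := le_lt_trans a2 a1; rewrite ltxx.
  have [a3|a3] := two _ _ d13; first by have := le_lt_trans a3 a1; rewrite ltxx.
  exact: (key y2 y3).
(* [e4] is the mean of the light-like vectors of two antipodal points, so its image is bounded by
   the factors there. *)
pose y' := mkpt (- px y1) (- py y1) (- pz y1).
have sy' : sphere y' by move: s1; rewrite /sphere /= !dotE !px_mk !py_mk !pz_mk !mulrNN.
have -> : e4 R = lc (1 / 2) (X y1) (1 / 2) (X y').
  by apply: vext; rewrite /lc /e4 /X /y' px_mk py_mk pz_mk /c1 /c2 /c3 /c4 /=; field.
have -> : c4 (L (lc (1 / 2) (X y1) (1 / 2) (X y'))) = 1 / 2 * c4 (L (X y1)) + 1 / 2 * c4 (L (X y')).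
  by rewrite (LT_lin H) /lc {1}/c4 /=.
have /andP[_ h1] := hu _ s1; have /andP[_ h2] := hu _ sy'.
apply: (@le_trans _ _ (2 * t)); first by lra_from h1 h2.
by have -> : 64 / d ^+ 2 = 2 * (32 / d ^+ 2); [by rewrite mulrA -natrM | rewrite ler_pM2l].
Qed.

End LTLimit.

(** * Moving states into a bounded family *)

Section Normalised.
Variable R : realType.
Implicit Types (x y : pt R) (d K e : R).

Lemma symS_comp_st (S : set (pt R)) N M M' o L L' : SD S N -> st N M M' o -> symS S L L' ->
  st N (M \o L') (L \o M') (L o).
Proof.
move=> sd H sy; have [HL _] := sy; split.
- exact: (LT_comp (st_LT H) (LT_sym HL)).
- exact: symS_N sd sy (st_o H).
- by rewrite /= (LT_K HL) (st_e H).
Qed.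

(** Inverse stereographic projection restricts to an isometry of the unit circle onto the
    equator. *)
Lemma edist_ich_id (w w' : R * R) : n2 w = 1 -> n2 w' = 1 -> edist (prj (vz w)) (prj (vz w')) ^+ 2 = d2 w w'.
Proof.
have E z : n2 z = 1 -> vz z = X (prj (vz z)) :> vec R.
  move=> h; have c41 : c4 (vz z) = 1 by rewrite /vz /c4 /= h; field.
  have c40 : c4 (vz z) != 0 by rewrite c41 oner_neq0.
  by have := prjK c40; rewrite c41 sc1.
have sp (z : R * R) : n2 z = 1 -> sphere (prj (vz z)).
  move=> h; apply: prj_sphere; last exact: lf_vz0.
  by rewrite (_ : c4 (vz z) = 1) ?oner_neq0 // /vz /c4 /= h; field.
by move=> h h'; rewrite (edist_lf (sp _ h) (sp _ h')) -!E // lf_vz; field.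
Qed.

Lemma act_ich M M' (z : R * R) : LT M M' -> act M (ich M' z) = prj (vz z).
Proof.
move=> H; have [_ h4] := LT_fut' H (fut_vz z).
have h40 : c4 (M' (vz z)) != 0 by rewrite gt_eqF.
have := prjK h40; rewrite -/(ich M' z); set c := c4 (M' (vz z)) in h40 * => e.
have e3 : vz z = sc c (M (X (ich M' z))) by rewrite -(LT_sc _ _ H) e (LT_K' H).
by rewrite e3 prj_sc.
Qed.

(** The points 1, i, -1 of the unit circle give three points of S. After a symmetry has spread them,
    the moved frame sends a separated triple to a fixed one, and [LT_spread] bounds it. *)
Lemma normalise_state (S : set (pt R)) N M M' o d0 : SD S N -> 0 < d0 -> cocompact S d0 -> st N M M' o ->
  exists L L', symS S L L' /\ c4 ((M \o L') (e4 R)) <= 64 / d0 ^+ 2.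
Proof.
move=> sd d00 co H.
have n1 : n2 (1, 0) = 1 :> R by rewrite /n2 /= expr1n expr0n addr0.
have n2' : n2 (0, 1) = 1 :> R by rewrite /n2 /= expr1n expr0n add0r.
have n3 : n2 (-1, 0) = 1 :> R by rewrite /n2 /= sqrrN expr1n expr0n addr0.
have [S1 _] := circle_S sd H n1; have [S2 _] := circle_S sd H n2'; have [S3 _] := circle_S sd H n3.
have ne (w w' : R * R) : w <> w' -> ich M' w <> ich M' w'.
  by move=> h /(congr1 (ch M)); rewrite !(ichK _ (st_LT H)).
have [||| L [L' [sy hL]]] := co _ _ _ S1 S2 S3.
- by apply: ne => -[]; light_lra.
- by apply: ne => -[]; light_lra.
- by apply: ne => -[]; light_lra.
exists L, L'; split=> //; have [HL _] := sy.
have Ss x : S x -> sphere x by move=> Sx; exact: ((sd_S sd x).1 Sx).1.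
have B := LT_comp (st_LT H) (LT_sym HL).
have aB w : S (ich M' w) -> act (M \o L') (act L (ich M' w)) = prj (vz w).
  move=> Sw; rewrite (act_comp (st_LT H) (LT_sym HL) (act_sphere HL (Ss _ Sw))) (actK HL (Ss _ Sw)).
  exact: act_ich (st_LT H).
apply: (LT_spread B d00 (act_sphere HL (Ss _ S1)) (act_sphere HL (Ss _ S2)) (act_sphere HL (Ss _ S3)) hL).
rewrite !aB //.
have ge1 w w' : n2 w = 1 -> n2 w' = 1 -> 1 <= d2 w w' -> 1 <= edist (prj (vz w)) (prj (vz w')) :> R.
  move=> h h' hd; apply: ler_sqr_abs; first exact: edist_ge0.
  by rewrite expr1n edist_ich_id.
by split; apply: ge1; rewrite // /d2 /= ?subr0 ?sub0r ?opprK ?sqrrN ?expr1n ?expr0n /=; light_lra.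
Qed.

(* The bound K confines the two Moebius maps to a compact part of the group. *)
Record nst (N N1 : set (vec R)) (K e : R) B B' B1 B1' p ph ps : Prop := mknst {
  ns_st : st N B B' p; ns_st1 : st N1 B1 B1' (ph p);
  ns_K : c4 (B (e4 R)) <= K; ns_K1 : c4 (B1 (e4 R)) <= K;
  ns_ph : forall n, N n -> N1 (ph n); ns_ps : forall m, N1 m -> N (ps m);
  ns_phK : forall n, N n -> ps (ph n) = n; ns_psK : forall m, N1 m -> ph (ps m) = m;
  ns_r : forall n, proper N p n -> (rad B n - rad B1 (ph n)) ^+ 2 <= e;
  ns_rr : forall n k, proper N p n -> proper N n k ->
    (rad B n * rad (chM B n) k - rad B1 (ph n) * rad (chM B1 (ph n)) (ph k)) ^+ 2 <= e }.

Lemma normalised (S : set (pt R)) N S1 N1 f g phi psi q d0 e : conf S N S1 N1 f g phi psi q d0 -> 0 < e ->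
  exists B B' B1 B1' p ph ps, nst N N1 (64 / d0 ^+ 2) e B B' B1 B1' p ph ps.
Proof.
move=> cf e0; have [sd sd1 hm md _ _ d00 co co1] := cf.
have e20 : 0 < e / 2 by rewrite divr_gt0.
have [M [M' [M1 [M1' [ o [[H H1] hr]]]]]] := radii_close cf e20.
rewrite (_ : 2 * (e / 2) = e) in hr; last by field.
have [L [L' [sy hK]]] := normalise_state sd d00 co H.
have [L1 [L1' [sy1 hK1]]] := normalise_state sd1 d00 co1 H1.
have [HL _] := sy; have [HL1 _] := sy1.
(* Source and target are moved by independent symmetries, so the matching is conjugated to
   [L1 \o phi \o L'], while the radii are unchanged. *)
exists (M \o L'), (L \o M'), (M1 \o L1'), (L1 \o M1'), (L o), (fun n => L1 (phi (L' n))), (fun m => L (psi (L1' m))).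
have NL n : N n -> N (L' n) := symS_N sd (symS_sym sy).
have NL1 n : N1 n -> N1 (L1' n) := symS_N sd1 (symS_sym sy1).
have pr n m : proper N n m -> proper N (L' n) (L' m).
  by move=> [Nm mn]; split; [exact: NL | move=> /(congr1 L); rewrite !(LT_K' HL)].
have pro n : proper N (L o) n -> proper N o (L' n) by move=> /pr; rewrite (LT_K HL).
split=> //.
- exact: symS_comp_st sd H sy.
- by rewrite /= (LT_K HL); exact: (symS_comp_st sd1 H1 sy1).
- by move=> n Nn; apply: symS_N sd1 sy1 _; apply: (md_phi md); exact: NL.
- by move=> n Nn; apply: symS_N sd sy _; apply: (md_psi md); exact: NL1.
- by move=> n Nn; rewrite (LT_K HL1) (md_K md (NL _ Nn)) (LT_K' HL).
- by move=> n Nn; rewrite (LT_K HL) (md_K' md (NL1 _ Nn)) (LT_K' HL1).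
- move=> n /pro pn; have [h _] := hr _ pn.
  by rewrite /rad /= (LT_K HL1).
- move=> n k /pro pn /pr pk; have [_ h] := hr _ pn; have := h _ pk.
  by rewrite /chM /rad /cen /= !(LT_K HL1).
Qed.

End Normalised.

(** * Stabilisation of the matchings and equality of the radii *)

Section LimitPair.
Variable R : realType.
Implicit Types (K e : R) (n m : vec R).

(** In a fixed state [uc] is a Lorentz product with a fixed vector, so bounded normals have radii
    bounded below, and such discs are finite in number. *)
Lemma finite_bounded (S : set (pt R)) N K : SD S N -> exists s : seq (vec R), forall n, N n -> bnd K n -> n \in s.
Proof.
move=> sd; have [ o0 No] := sd_ne sd; have [M [M' H]] := st_exists No (sd_unit sd No).
pose a := M' (nu R); pose A := `|c1 a| + `|c2 a| + `|c3 a| + `|c4 a|.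
have ba : bnd A a.
  have := normr_ge0 (c1 a); have := normr_ge0 (c2 a); have := normr_ge0 (c3 a); have := normr_ge0 (c4 a).
  by rewrite /A; split; light_lra.
pose U := 4 * (A * `|K|) + 1.
have U0 : 0 < U.
  have : 0 <= A * `|K| by rewrite mulr_ge0 // !addr_ge0.
  rewrite /U; light_lra.
have iU : 0 < U^-1 by rewrite invr_gt0.
have [s [_ hs]] := finite_discs sd H iU.
exists (o0 :: s) => n Nn bn; rewrite inE; have [->|no] := eqVneq n o0; first by [].
apply/hs; split; first by split=> //; apply/eqP.
have u0 := st_uc sd H Nn (elimN eqP no).
rewrite /rad lef_pV2 ?posrE //.
have E : uc (M n) = - lf a n by rewrite (LT_adj (nu R) n (LT_sym (st_LT H)) : lf a n = _) lf_nu opprK.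
have bn' : bnd `|K| n by have [h1 h2 h3 h4] := bn; split; apply: (le_trans _ (ler_norm K)).
have := lf_bnd ba bn'; rewrite ler_norml E /U => /andP[h _]; light_lra.
Qed.

Lemma disc_bnd (S : set (pt R)) N B B' p m (r : R) : SD S N -> st N B B' p -> proper N p m -> 0 < r -> r <= rad B m ->
  bnd (r^-1 + 1) (B m).
Proof.
move=> sd H pm r0 hr; have [Nm mp] := pm.
have u0 := st_uc sd H Nm mp; have r1 := st_rad sd H Nm mp.
have uU : uc (B m) <= r^-1 by rewrite -[uc _]invrK lef_pV2 ?posrE.
have rad1 : rad B m <= 1.
  have us : uniq [:: m] by [].
  have := packing sd H us; rewrite big_seq1 => h.
  apply: ler_sqr_abs => //; rewrite expr1n; apply: h => n; rewrite inE => /eqP -> //.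
have u1 : 1 <= uc (B m) by rewrite -[uc _]invrK -[leLHS]invr1 lef_pV2 ?posrE.
have cn : n2 (cen B m) < 1 by apply: (st_in sd H Nm mp); rewrite d2zz sqr_ge0.
have l1 : lf (B m) (B m) = 1 by rewrite (LT_lf (st_LT H)) (sd_unit sd Nm).
have un : uc (B m) != 0 by rewrite gt_eqF.
have [e3' e4'] := unit_w l1 un.
have E1 : c1 (B m) = uc (B m) * (cen B m).1 by rewrite /cen /pl /= mulrC divfK.
have E2 : c2 (B m) = uc (B m) * (cen B m).2 by rewrite /cen /pl /= mulrC divfK.
have q1 := sqr_ge0 (cen B m).1; have q2 := sqr_ge0 (cen B m).2.
have b1 : `|(cen B m).1| <= 1.
  by apply: ler_sqr_abs => //; rewrite real_normK ?num_real // expr1n; move: cn; rewrite /n2; lra_from q2.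
have b2 : `|(cen B m).2| <= 1.
  by apply: ler_sqr_abs => //; rewrite real_normK ?num_real // expr1n; move: cn; rewrite /n2; lra_from q1.
have w : -1 <= (c1 (B m) ^+ 2 + c2 (B m) ^+ 2 - 1) / uc (B m) <= uc (B m).
  have -> : c1 (B m) ^+ 2 + c2 (B m) ^+ 2 = uc (B m) ^+ 2 * n2 (cen B m).
    by rewrite E1 E2 /n2; ring.
  have n20 := n2_ge0 (cen B m).
  apply/andP; split.
    rewrite ler_pdivlMr // mulN1r.
    have : 0 <= uc (B m) ^+ 2 * n2 (cen B m) by rewrite mulr_ge0 ?sqr_ge0.
    lra_from u1.
  rewrite ler_pdivrMr // -expr2.
  have : uc (B m) ^+ 2 * n2 (cen B m) <= uc (B m) ^+ 2 by rewrite ler_piMr ?sqr_ge0 // ltW.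
  clear; lra.
have uc0 := ltW u0.
have ub (x : R) : `|x| <= 1 -> `|uc (B m) * x| <= r^-1 + 1.
  move=> hx; rewrite normrM (gtr0_norm u0); have := ler_wpM2l uc0 hx; lra_from uU.
move/andP: w => [w1 w2]; split.
- by rewrite E1; exact: ub.
- by rewrite E2; exact: ub.
- by rewrite e3' ler_norml; clear - w1 w2 uU u1; apply/andP; split; lra.
- by rewrite e4' ler_norml; clear - w1 w2 uU u1; apply/andP; split; lra.
Qed.

(** In a bounded family of frames, discs of radius at least [r] have bounded normals, hence finitely
    many possible values, and one value occurs along the ultrafilter. *)
Lemma const_index (S : set (pt R)) N (B B' : nat -> vec R -> vec R) (p m : nat -> vec R) K r : SD S N ->
  (forall i, st N (B i) (B' i) (p i)) -> (forall i, c4 (B i (e4 R)) <= K) -> (forall i, N (m i)) -> 0 < r ->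
  UU [set i | m i = p i \/ m i <> p i /\ r <= rad (B i) (m i)] -> exists2 c, N c & UU [set i | m i = c].
Proof.
move=> sd H hK Nm r0 U; have [s hs] := finite_bounded (8 * K * (r^-1 + 1)) sd.
have Us : UU [set i | m i \in s].
  apply: UU_imp U => i /= hi; apply: hs => //.
  have HB := LT_sym (st_LT (H i)); have hK' : c4 (B' i (e4 R)) <= K by rewrite (LT_c4C (st_LT (H i))).
  rewrite -(LT_K (st_LT (H i)) (m i)); apply: LT_bnd HB hK' _.
  case: hi => [->|[np hr]]; last exact: (disc_bnd sd (H i)).
  have r1 : 1 <= r^-1 + 1 by rewrite lerDr invr_ge0 ltW.
  by rewrite (st_e (H i)); have [h1 h2 h3 h4] := bnd_e3 R; split; apply: le_trans r1.
have [c _ hc] := UU_const Us; exists c => //.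
by have [i /= <-] := UU_ex hc.
Qed.

Lemma ucv_sqr0 (u : nat -> R) : ucv (fun i => u i ^+ 2) 0 -> ucv u 0.
Proof.
move=> /ucv_sqrt; rewrite sqrtr0 => h; apply: (ucv_squeeze h); apply: UU_all => i /=.
by rewrite subr0 sqrtr_sqr.
Qed.

Lemma ucv_uc (s : nat -> vec R) v : ucvv s v -> ucv (fun i => uc (s i)) (uc v).
Proof. by move=> [_ _ h3 h4]; exact: ucvB. Qed.

(** The limit frames and limit matchings inherit equality of all radii on two levels; [child_uc]
    converts the second level into equality of Lorentz products. *)
Lemma limit_pair (S : set (pt R)) N S1 N1 f g phi psi q d0 : conf S N S1 N1 f g phi psi q d0 ->
  exists (B B' B1 B1' : vec R -> vec R) p Phi Psi, [/\ st N B B' p, st N1 B1 B1' (Phi p),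
    [/\ forall n, N n -> N1 (Phi n), forall m, N1 m -> N (Psi m),
      forall n, N n -> Psi (Phi n) = n & forall m, N1 m -> Phi (Psi m) = m],
    forall n k, N n -> N k -> lf n k = lf (Phi n) (Phi k) &
    forall n, proper N p n -> uc (B n) = uc (B1 (Phi n))].
Proof.
move=> cf; have [sd sd1 _ _ _ _ _ _ _] := cf.
pose K := 64 / d0 ^+ 2.
have Q i := normalised cf (@eps_gt0 R i).
have [B Q1] := choice Q; have [B' Q2] := choice Q1; have [B1 Q3] := choice Q2; have [B1' Q4] := choice Q3.
have [p Q5] := choice Q4; have [ph Q6] := choice Q5; have [ps h] := choice Q6.
move=> {Q Q1 Q2 Q3 Q4 Q5 Q6}.
have hs i := ns_st (h i); have hs1 i := ns_st1 (h i).
have hK i : c4 (B i (e4 R)) <= K by exact: ns_K (h i).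
have hK1 i : c4 (B1 i (e4 R)) <= K by exact: ns_K1 (h i).
have [Bl [Bl' [HB lB lB']]] := LT_limit (fun i => st_LT (hs i)) hK.
have [Cl [Cl' [HC lC lC']]] := LT_limit (fun i => st_LT (hs1 i)) hK1.
have Np i : N (p i) := st_o (hs i).
have [p0 Np0 Up] : exists2 c, N c & UU [set i | p i = c].
  by apply: (const_index (r := 1) sd hs hK Np ltr01); apply: UU_all => i; left.
have stB : st N Bl Bl' p0.
  split=> //; apply: ucvv_uniq (lB _ _ (ucvv_cst p0)) _.
  by apply: ucvv_eq (ucvv_cst (e3 R)); apply: UU_imp Up => i /= <-; rewrite (st_e (hs i)).
have pU n : n <> p0 -> UU [set i | n <> p i] by move=> np; apply: UU_imp Up => i /= ->.
have radB n : N n -> n <> p0 -> ucv (fun i => rad (B i) n) (rad Bl n).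
  move=> Nn np; apply: ucvV; first by rewrite gt_eqF // (st_uc sd stB).
  by apply: ucv_uc; exact: lB (ucvv_cst n).
(* The radius of [n] has a positive limit and the radius of its partner has the same limit, so
   [const_index] applies to the partners. *)
have [Phi hPhi] : exists Phi : vec R -> vec R, forall n, N n -> N1 (Phi n) /\ UU [set i | ph i n = Phi n].
  have Q n : exists c, N n -> N1 c /\ UU [set i | ph i n = c].
    have [Nn|] := EM (N n); last by exists n.
    have Nph i : N1 (ph i n) := ns_ph (h i) Nn.
    have [np|np] := EM (n = p0).
      have [|c Nc Uc] := const_index (r := 1) sd1 hs1 hK1 Nph ltr01; last by exists c.
      by apply: UU_imp Up => i /= e; left; rewrite e np.
    have r0 := st_rad sd stB Nn np; have r2 : 0 < rad Bl n / 2 by rewrite divr_gt0.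
    have hlt : rad Bl n / 2 < rad Bl n by light_lra.
    have d0' : ucv (fun i => rad (B i) n - rad (B1 i) (ph i n)) 0.
      apply: ucv_sqr0; apply: (ucv_squeeze (@eps_ucv R)); apply: UU_imp (pU n np) => i /= ni.
      by rewrite subr0 ger0_norm ?sqr_ge0 //; apply: ns_r (h i) _ _.
    have lim := ucvB (radB n Nn np) d0'; rewrite subr0 in lim.
    have [|c Nc Uc] := const_index sd1 hs1 hK1 Nph r2; last by exists c.
    apply: UU_imp (UU_and (pU n np) (ucv_gt lim hlt)) => i /= [ni hi]; right; split.
      by move=> e; apply: ni; rewrite -(ns_phK (h i) Nn) e (ns_phK (h i) (Np i)).
    by apply: ltW; move: hi; rewrite opprB addrC subrK.
  by have [F hF] := choice Q; exists F.
have stC : st N1 Cl Cl' (Phi p0).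
  split=> //; first by have [] := hPhi _ Np0.
  apply: ucvv_uniq (lC _ _ (ucvv_cst _)) _.
  apply: ucvv_eq (ucvv_cst (e3 R)); apply: UU_imp (UU_and Up (hPhi _ Np0).2) => i /= [e1' <-].
  by rewrite -e1' (st_e (hs1 i)).
have [Psi hPsi] : exists Psi : vec R -> vec R, forall m, N1 m -> N (Psi m) /\ UU [set i | ps i m = Psi m].
  have Q m : exists c, N1 m -> N c /\ UU [set i | ps i m = c].
    have [Nm|] := EM (N1 m); last by exists m.
    have Nps i : N (ps i m) := ns_ps (h i) Nm.
    have UPhi := (hPhi _ Np0).2.
    have [np|np] := EM (m = Phi p0).
      have [|c Nc Uc] := const_index (r := 1) sd hs hK Nps ltr01; last by exists c.
      by apply: UU_imp (UU_and Up UPhi) => i /= [e1' e2']; left; rewrite np -e2' -e1' (ns_phK (h i)).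
    have r0 := st_rad sd1 stC Nm np; have r2 : 0 < rad Cl m / 2 by rewrite divr_gt0.
    have hlt : rad Cl m / 2 < rad Cl m by light_lra.
    have npU : UU [set i | ps i m <> p i].
      apply: UU_imp (UU_and Up UPhi) => i /= [e1' e2'] e3'; apply: np.
      by rewrite -e2' -e1' -e3' (ns_psK (h i) Nm).
    have lim1 : ucv (fun i => rad (B1 i) m) (rad Cl m).
      apply: ucvV; first by rewrite gt_eqF // (st_uc sd1 stC).
      by apply: ucv_uc; exact: lC (ucvv_cst m).
    have d0' : ucv (fun i => rad (B i) (ps i m) - rad (B1 i) m) 0.
      apply: ucv_sqr0; apply: (ucv_squeeze (@eps_ucv R)); apply: UU_imp npU => i /= ni.
      rewrite subr0 ger0_norm ?sqr_ge0 //.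
      by have := ns_r (h i) (conj (Nps i) ni); rewrite (ns_psK (h i) Nm).
    have lim := ucvD d0' lim1; rewrite add0r in lim.
    have [|c Nc Uc] := const_index sd hs hK Nps r2; last by exists c.
    apply: UU_imp (UU_and npU (ucv_gt lim hlt)) => i /= [ni hi]; right; split=> //.
    by apply: ltW; move: hi; rewrite subrK.
  by have [F hF] := choice Q; exists F.
have bij1 n : N n -> Psi (Phi n) = n.
  move=> Nn; have [Np' U1] := hPhi _ Nn; have [_ U2] := hPsi _ Np'.
  by have [i /= [e1' <-]] := UU_ex (UU_and U1 U2); rewrite -e1' (ns_phK (h i) Nn).
have bij2 m : N1 m -> Phi (Psi m) = m.
  move=> Nm; have [Np' U1] := hPsi _ Nm; have [_ U2] := hPhi _ Np'.
  by have [i /= [e1' <-]] := UU_ex (UU_and U1 U2); rewrite -e1' (ns_psK (h i) Nm).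
have Pp n : proper N p0 n -> proper N1 (Phi p0) (Phi n).
  move=> [Nn np]; split; first by have [] := hPhi _ Nn.
  by move=> e; apply: np; rewrite -(bij1 n Nn) e bij1.
have radC n : proper N p0 n -> ucv (fun i => rad (B1 i) (ph i n)) (rad Cl (Phi n)).
  move=> pn; have [Nn np] := pn; have [Nq qp] := Pp n pn.
  have := ucv_uc (lC _ _ (ucvv_cst (Phi n))).
  move=> /(ucvV (_ : uc (Cl (Phi n)) != 0)); rewrite gt_eqF ?(st_uc sd1 stC) // => /(_ isT).
  by apply: ucv_eq; apply: UU_imp (hPhi _ Nn).2 => i /= ->.
have req n : proper N p0 n -> rad Bl n = rad Cl (Phi n).
  move=> pn; have [Nn np] := pn.
  have d0' : ucv (fun i => rad (B i) n - rad (B1 i) (ph i n)) 0.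
    apply: ucv_sqr0; apply: (ucv_squeeze (@eps_ucv R)); apply: UU_imp (pU n np) => i /= ni.
    by rewrite subr0 ger0_norm ?sqr_ge0 //; apply: ns_r (h i) _ _.
  apply/eqP; rewrite -subr_eq0; apply/eqP.
  exact: ucv_uniq (ucvB (radB n Nn np) (radC n pn)) d0'.
have uceq n : proper N p0 n -> uc (Bl n) = uc (Cl (Phi n)).
  by move=> /req e; rewrite -[uc (Bl n)]invrK -[uc (Cl _)]invrK -/(rad Bl n) e.
(* Here [k] may be [p0], in which case [uc] is -1 on both sides. *)
have gram n k : proper N p0 n -> proper N n k -> lf n k = lf (Phi n) (Phi k).
  move=> pn pk; have [Nn np] := pn; have [Nk kn] := pk.
  have pPn := Pp n pn; have [Nq qp] := pPn.
  have pPk : proper N1 (Phi n) (Phi k).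
    split; first by have [] := hPhi _ Nk.
    by move=> e; apply: kn; rewrite -(bij1 k Nk) e bij1.
  have ucK : uc (Bl k) = uc (Cl (Phi k)).
    by have [->|kp] := EM (k = p0); [rewrite (st_e stB) (st_e stC) | exact: uceq].
  have D1 := st_uc sd (child_st sd stB Nn np) Nk kn.
  have D2 := st_uc sd1 (child_st sd1 stC Nq qp) pPk.1 pPk.2.
  rewrite (child_uc sd stB Nn np) in D1; rewrite (child_uc sd1 stC Nq qp) in D2.
  set X1 := rad Bl n * uc (Bl k) - 2 * lf n k in D1.
  set X2 := rad Cl (Phi n) * uc (Cl (Phi k)) - 2 * lf (Phi n) (Phi k) in D2.
  have C2 (x : R) : ucv (fun=> x) x := ucv_cst x.
  have l1 : ucv (fun i => rad (B i) n * rad (chM (B i) n) k) (rad Bl n * X1^-1).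
    have lim := ucvB (ucvM (radB n Nn np) (ucv_uc (lB _ _ (ucvv_cst k)))) (C2 (2 * lf n k)).
    have X10 : X1 != 0 by rewrite gt_eqF.
    have := ucvM (radB n Nn np) (ucvV X10 lim).
    apply: ucv_eq; apply: UU_imp (pU n np) => i /= ni.
    by rewrite [rad (chM _ _) _]/rad (child_uc sd (hs i) Nn ni).
  have l2 : ucv (fun i => rad (B1 i) (ph i n) * rad (chM (B1 i) (ph i n)) (ph i k)) (rad Cl (Phi n) * X2^-1).
    have lim := ucvB (ucvM (radC n pn) (ucv_uc (lC _ _ (ucvv_cst (Phi k))))) (C2 (2 * lf (Phi n) (Phi k))).
    have X20 : X2 != 0 by rewrite gt_eqF.
    have := ucvM (radC n pn) (ucvV X20 lim).
    apply: ucv_eq; apply: UU_imp (UU_and (pU n np) (UU_and (hPhi _ Nn).2 (hPhi _ Nk).2)) => i /= [ni [e1' e2']].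
    have nn : ph i n <> ph i (p i).
      by move=> e; apply: ni; rewrite -(ns_phK (h i) Nn) e (ns_phK (h i) (Np i)).
    by rewrite [rad (chM _ _) _]/rad (child_uc sd1 (hs1 i) (ns_ph (h i) Nn) nn) e1' e2'.
  have d0' : ucv (fun i => rad (B i) n * rad (chM (B i) n) k - rad (B1 i) (ph i n) * rad (chM (B1 i) (ph i n)) (ph i k)) 0.
    apply: ucv_sqr0; apply: (ucv_squeeze (@eps_ucv R)); apply: UU_imp (pU n np) => i /= ni.
    by rewrite subr0 ger0_norm ?sqr_ge0 //; apply: ns_rr (h i) _ _ _ _.
  have e := ucv_uniq (ucvB l1 l2) d0'.
  have r0 := st_rad sd stB Nn np.
  have rn : rad Bl n != 0 by rewrite gt_eqF.
  have : X1 = X2.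
    move/eqP: e; rewrite subr_eq0 -(req n pn) => /eqP /(mulfI rn) /(congr1 (fun x => x^-1)).
    by rewrite !invrK.
  by rewrite /X1 /X2 ucK (req n pn); light_lra.
exists Bl, Bl', Cl, Cl', p0, Phi, Psi; split=> //.
  by split=> // [n /hPhi[]|m /hPsi[]].
move=> n k Nn Nk.
have [->|nk] := EM (n = k).
  by rewrite (sd_unit sd Nk) (sd_unit sd1 (hPhi _ Nk).1).
have [np|np] := EM (n = p0); last by apply: gram => //; split=> // e; apply: nk.
rewrite lfC [RHS]lfC; apply: gram; first by split=> // e; apply: nk; rewrite np e.
by split=> // e; apply: nk.
Qed.

End LimitPair.

(** * The Lorentz transformation between the discs *)

Section Align.
Variable R : realType.
Implicit Types (u v w : vec R) (a b z : R * R).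

Definition ip a b : R := a.1 * b.1 + a.2 * b.2.

Definition rot (c s : R) u : vec R := (c * c1 u - s * c2 u, s * c1 u + c * c2 u, c3 u, c4 u).

Lemma rot_LT (c s : R) : c ^+ 2 + s ^+ 2 = 1 -> LT (rot c s) (rot c (- s)).
Proof.
move=> E0; have E : c ^+ 2 = 1 - s ^+ 2 by light_lra.
apply: LT_intro.
- by move=> a u b v; apply: vext; rewrite /rot /lc /c1 /c2 /c3 /c4 /=; ring.
- by move=> u; apply: vext; rewrite /rot /c1 /c2 /c3 /c4 /=; ring: E.
- by move=> u; apply: vext; rewrite /rot /c1 /c2 /c3 /c4 /=; ring: E.
- by move=> u v; rewrite /lf /rot /c1 /c2 /c3 /c4 /=; ring: E.
- move=> u [h1 h2]; split=> //; apply: le_trans h1; rewrite le_eqVlt; apply/orP; left; apply/eqP.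
  by rewrite /lf /rot /c1 /c2 /c3 /c4 /=; ring: E.
Qed.

Definition p12 u : R * R := (c1 u, c2 u).

(** Maps that move only the first two coordinates: they keep [e3] and the point at infinity of the
    chart. *)
Definition planar (O O' : vec R -> vec R) := LT O O' /\ forall u, c3 (O u) = c3 u /\ c4 (O u) = c4 u.

Lemma planar_comp O O' Q Q' : planar O O' -> planar Q Q' -> planar (O \o Q) (Q' \o O').
Proof.
move=> [h1 h2] [k1 k2]; split; first exact: LT_comp.
by move=> u /=; have [-> ->] := h2 (Q u); exact: k2.
Qed.

Lemma planar_ip O O' u v : planar O O' -> ip (p12 (O u)) (p12 (O v)) = ip (p12 u) (p12 v).
Proof.
move=> [h k]; have := LT_lf h u v; rewrite /lf /ip /p12 /=.
by have [-> ->] := k u; have [-> ->] := k v; light_lra.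
Qed.

Lemma ip_det a b z z' : a.1 * b.2 != a.2 * b.1 -> ip a z = ip a z' -> ip b z = ip b z' -> z = z'.
Proof.
rewrite -subr_eq0 /ip => D h1 h2; set e := _ - _ in D.
apply/eqP; rewrite (surjective_pairing z) (surjective_pairing z') xpair_eqE; apply/andP; split; apply/eqP.
  apply: (mulfI D); rewrite /e; have := congr1 ( *%R b.2) h1; have := congr1 ( *%R a.2) h2.
  light_lra.
apply: (mulfI D); rewrite /e; have := congr1 ( *%R b.1) h1; have := congr1 ( *%R a.1) h2.
light_lra.
Qed.

Lemma refl12 (x y r : R) u : r != 0 ->
  p12 (refl (- y / r, x / r, 0, 0) u) = (c1 u + 2 * (x * c2 u - y * c1 u) * y / r ^+ 2,
    c2 u - 2 * (x * c2 u - y * c1 u) * x / r ^+ 2).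
Proof. by move=> r0; rewrite /p12 /refl /lc /lf /c1 /c2 /c3 /c4 /=; congr (_, _); field. Qed.

(** Families in the plane with equal Gram matrices differ by an orthogonal map: rotate one nonzero
    vector into place, and if another vector is still wrong, reflect in the line of the first. Two
    independent vectors then decide all the others. *)
Lemma gram_align (N : set (vec R)) (F G : vec R -> vec R) :
  (forall n k, N n -> N k -> ip (p12 (F n)) (p12 (F k)) = ip (p12 (G n)) (p12 (G k))) ->
  exists O O', planar O O' /\ forall n, N n -> p12 (O (F n)) = p12 (G n).
Proof.
move=> gr.
have zero n : N n -> p12 (F n) = (0, 0) -> p12 (G n) = (0, 0).
  move=> Nn e; have := gr n n Nn Nn; rewrite e /ip /= !mul0r addr0 => h.
  have := sqr_ge0 (c1 (G n)); have := sqr_ge0 (c2 (G n)).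
  have e1' : c1 (G n) ^+ 2 = 0.
    by have := sqr_ge0 (c1 (G n)); have := sqr_ge0 (c2 (G n)); rewrite /= in h; light_lra.
  have e2' : c2 (G n) ^+ 2 = 0.
    by have := sqr_ge0 (c1 (G n)); have := sqr_ge0 (c2 (G n)); rewrite /= in h; light_lra.
  move=> _ _; move/eqP: e1'; move/eqP: e2'; rewrite !sqrf_eq0 /p12 => /eqP -> /eqP -> //.
have [[n1 [Nn1 nz]]|al] := EM (exists n, N n /\ p12 (F n) <> (0, 0)); last first.
  exists id, id; split; first by split; [exact: LT_id|].
  move=> n Nn; have [e|ne] := EM (p12 (F n) = (0, 0)); first by rewrite e (zero _ Nn e).
  by case: al; exists n.
pose a := p12 (F n1); pose b := p12 (G n1); pose D := ip a a.
have DE : D = a.1 ^+ 2 + a.2 ^+ 2 by rewrite /D /ip !expr2.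
have Db : D = b.1 ^+ 2 + b.2 ^+ 2 by rewrite /D (gr _ _ Nn1 Nn1) /ip !expr2.
have D0 : D != 0.
  apply/eqP => e; apply: nz; have q1 := sqr_ge0 a.1; have q2 := sqr_ge0 a.2.
  have /eqP : a.1 ^+ 2 = 0 by light_lra.
  have /eqP : a.2 ^+ 2 = 0 by light_lra.
  by rewrite !sqrf_eq0 /a /p12 /= => /eqP -> /eqP ->.
(* Cosine and sine of the angle from [a] to [b], two vectors of equal length. *)
pose c := (b.1 * a.1 + b.2 * a.2) / D; pose s := (b.2 * a.1 - b.1 * a.2) / D.
have cs : c ^+ 2 + s ^+ 2 = 1.
  have -> : c ^+ 2 + s ^+ 2 = (b.1 ^+ 2 + b.2 ^+ 2) * (a.1 ^+ 2 + a.2 ^+ 2) / D ^+ 2 by rewrite /c /s; field.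
  by rewrite -DE -Db; field.
have PO : planar (rot c s) (rot c (- s)) by split; [exact: rot_LT|].
have Oa : p12 (rot c s (F n1)) = b.
  have -> : p12 (rot c s (F n1)) = (c * a.1 - s * a.2, s * a.1 + c * a.2) by [].
  have -> : c * a.1 - s * a.2 = b.1 * (a.1 ^+ 2 + a.2 ^+ 2) / D by rewrite /c /s; field.
  have -> : s * a.1 + c * a.2 = b.2 * (a.1 ^+ 2 + a.2 ^+ 2) / D by rewrite /c /s; field.
  by rewrite -DE !mulfK // -surjective_pairing.
have gr' n k : N n -> N k -> ip (p12 (rot c s (F n))) (p12 (rot c s (F k))) = ip (p12 (G n)) (p12 (G k)).
  by move=> Nn Nk; rewrite (planar_ip _ _ PO) gr.
have [al|ne] := EM (forall n, N n -> p12 (rot c s (F n)) = p12 (G n)).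
  by exists (rot c s), (rot c (- s)).
have [n2 [Nn2 n2e]] : exists n, N n /\ p12 (rot c s (F n)) <> p12 (G n).
  by apply: contrapT => h; apply: ne => n Nn; apply: contrapT => h'; apply: h; exists n.
pose x := p12 (rot c s (F n2)); pose y := p12 (G n2).
have Dp : 0 < D by rewrite lt_def D0 DE addr_ge0 // sqr_ge0.
have sD : 0 < Num.sqrt D by rewrite sqrtr_gt0.
(* The unit normal to [b]: the reflection fixes [b] and changes the sign of the component across it,
   which is the only freedom left. *)
pose m : vec R := (- b.2 / Num.sqrt D, b.1 / Num.sqrt D, 0, 0).
have sDn : Num.sqrt D != 0 by rewrite gt_eqF.
have sDD : Num.sqrt D ^+ 2 = D by rewrite sqr_sqrtr // ltW.
have mm : lf m m = 1.
  have -> : lf m m = (b.1 ^+ 2 + b.2 ^+ 2) / Num.sqrt D ^+ 2.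
    by rewrite /lf /m /c1 /c2 /c3 /c4 /=; field.
  by rewrite -Db sDD divff.
have Pm : planar (refl m) (refl m).
  split; first exact: refl_LT.
  by move=> u; rewrite /refl /lc /m /c3 /c4 /= !mulr0 !addr0 !mul1r.
have refE u : p12 (refl m u) = (c1 u + 2 * (b.1 * c2 u - b.2 * c1 u) * b.2 / D,
    c2 u - 2 * (b.1 * c2 u - b.2 * c1 u) * b.1 / D).
  by rewrite /m refl12 // sDD.
have i1 : ip x b = ip y b by rewrite -[in LHS]Oa; exact: gr'.
have i2 : ip x x = ip y y by exact: gr'.
pose t := b.1 * x.2 - b.2 * x.1; pose t' := b.1 * y.2 - b.2 * y.1.
have lag : t ^+ 2 = t' ^+ 2.
  have -> : t ^+ 2 = (b.1 ^+ 2 + b.2 ^+ 2) * ip x x - ip x b ^+ 2 by rewrite /t /ip; ring.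
  have -> : t' ^+ 2 = (b.1 ^+ 2 + b.2 ^+ 2) * ip y y - ip y b ^+ 2 by rewrite /t' /ip; ring.
  by rewrite i1 i2.
have rec (z : R * R) : z = ((ip z b * b.1 - (b.1 * z.2 - b.2 * z.1) * b.2) / D, (ip z b * b.2 + (b.1 * z.2 - b.2 * z.1) * b.1) / D).
  have -> : ip z b * b.1 - (b.1 * z.2 - b.2 * z.1) * b.2 = z.1 * (b.1 ^+ 2 + b.2 ^+ 2) by rewrite /ip; ring.
  have -> : ip z b * b.2 + (b.1 * z.2 - b.2 * z.1) * b.1 = z.2 * (b.1 ^+ 2 + b.2 ^+ 2) by rewrite /ip; ring.
  by rewrite -Db !mulfK // -surjective_pairing.
have tt : t' = - t.
  move/eqP: lag; rewrite eqf_sqr => /orP[/eqP e|/eqP ->]; last by rewrite opprK.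
  by case: n2e; rewrite -/x -/y (rec x) (rec y) i1 -/t -/t' e.
have t0 : t != 0.
  apply/eqP => e; case: n2e.
  by rewrite -/x -/y (rec x) (rec y) i1 -/t -/t' tt e oppr0.
have PQ := planar_comp Pm PO.
exists (refl m \o rot c s), (rot c (- s) \o refl m); split=> // n Nn.
have fx u : p12 u = b -> p12 (refl m u) = b.
  move=> e; rewrite refE; have -> : c1 u = b.1 by rewrite -e. 
  have -> : c2 u = b.2 by rewrite -e.
  have -> : b.1 * b.2 - b.2 * b.1 = 0 by ring.
  by rewrite mulr0 !mul0r subr0 addr0 -surjective_pairing.
have Q1 : p12 ((refl m \o rot c s) (F n1)) = b by exact: fx Oa.
have Q2 : p12 ((refl m \o rot c s) (F n2)) = y.
  rewrite [p12 _](refE (rot c s (F n2))) [y]rec -i1 -/t' tt.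
  have -> : c1 (rot c s (F n2)) = x.1 by [].
  have -> : c2 (rot c s (F n2)) = x.2 by [].
  rewrite -/t.
  have -> : ip x b * b.1 - - t * b.2 = (b.1 ^+ 2 + b.2 ^+ 2) * x.1 + 2 * t * b.2 by rewrite /ip /t; ring.
  have -> : ip x b * b.2 + - t * b.1 = (b.1 ^+ 2 + b.2 ^+ 2) * x.2 - 2 * t * b.1 by rewrite /ip /t; ring.
  by rewrite -Db; congr (_, _); field.
have g1 := planar_ip (F n1) (F n) PQ; have g2 := planar_ip (F n2) (F n) PQ.
rewrite Q1 gr // in g1; rewrite Q2 gr // in g2.
apply: (@ip_det b y) g1 g2.
rewrite -subr_eq0 -/t'.
by rewrite tt oppr_eq0.
Qed.

(** c3 is the product with the exterior disc and [uc] is an inverse radius, so both match, and c4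
    with them. The planar parts then have equal Gram matrices, and [gram_align] supplies the
    remaining orthogonal map. *)
Lemma aligned (S : set (pt R)) N S1 N1 B B' B1 B1' p (Phi : vec R -> vec R) : SD S N -> SD S1 N1 ->
  st N B B' p -> st N1 B1 B1' (Phi p) -> (forall n, N n -> N1 (Phi n)) ->
  (forall n k, N n -> N k -> lf n k = lf (Phi n) (Phi k)) -> (forall n, proper N p n -> uc (B n) = uc (B1 (Phi n))) ->
  exists A A', LT A A' /\ forall n, N n -> A n = Phi n.
Proof.
move=> sd sd1 H H1 hP gr hu.
have Np := st_o H.
have E3 n : N n -> c3 (B n) = c3 (B1 (Phi n)).
  move=> Nn; rewrite -[LHS]lf_e3 -[RHS]lf_e3 -{1}(st_e H) -(st_e H1) (LT_lf (st_LT H)) (LT_lf (st_LT H1)).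
  exact: gr.
have EU n : N n -> uc (B n) = uc (B1 (Phi n)).
  move=> Nn; have [->|np] := EM (n = p); first by rewrite (st_e H) (st_e H1).
  exact: hu.
have E4 n : N n -> c4 (B n) = c4 (B1 (Phi n)).
  by move=> Nn; have := EU n Nn; have := E3 n Nn; rewrite /uc => -> /addIr.
have gr12 n k : N n -> N k -> ip (p12 (B n)) (p12 (B k)) = ip (p12 (B1 (Phi n))) (p12 (B1 (Phi k))).
  move=> Nn Nk; have e : lf (B n) (B k) = lf (B1 (Phi n)) (B1 (Phi k)).
    by rewrite (LT_lf (st_LT H)) (LT_lf (st_LT H1)) gr.
  by move: e; rewrite /lf (E3 _ Nn) (E4 _ Nn) (E3 _ Nk) (E4 _ Nk) /ip /=; light_lra.
have [T [T' [[LT_T hT] al]]] := @gram_align N B (B1 \o Phi) gr12.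
exists (B1' \o (T \o B)), ((B' \o T') \o B1); split.
  exact: LT_comp (LT_sym (st_LT H1)) (LT_comp LT_T (st_LT H)).
move=> n Nn /=; rewrite -[RHS](LT_K (st_LT H1)); congr B1'.
have [h3 h4] := hT (B n); have [h1 h2] : c1 (T (B n)) = c1 (B1 (Phi n)) /\ c2 (T (B n)) = c2 (B1 (Phi n)).
  by have := al _ Nn => -[].
by apply: vext; rewrite ?h1 ?h2 ?h3 ?h4 ?E3 ?E4.
Qed.

End Align.

(** * From the Lorentz map to the Moebius transformation *)

Section Conclusion.
Variable R : realType.
Implicit Types (x y : pt R) (d : R).

Lemma cocompact_le (S : set (pt R)) d d' : d' <= d -> cocompact S d -> cocompact S d'.
Proof.
move=> h co x y z Sx Sy Sz xy yz xz; have [L [L' [sL [h1 h2 h3]]]] := co x y z Sx Sy Sz xy yz xz.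
exists L, L'; split; first exact: sL.
by split; [exact: le_trans h h1 | exact: le_trans h h2 | exact: le_trans h h3].
Qed.

(** Membership in S is a sign condition against all normals; the Lorentz map permutes these
    conditions up to positive factors. *)
Lemma LT_mobius (S S1 : set (pt R)) N N1 A A' (Phi Psi : vec R -> vec R) : SD S N -> SD S1 N1 -> LT A A' ->
  (forall n, N n -> A n = Phi n) -> (forall n, N n -> N1 (Phi n)) -> (forall m, N1 m -> N (Psi m)) ->
  (forall m, N1 m -> Phi (Psi m) = m) -> exists2 m : pt R -> pt R, mobius m & m @` S = S1.
Proof.
move=> sd sd1 LA hA h1 h2 h3; have [f [hf rf]] := LT_hyp_isom LA.
have AS x : sphere x -> S x <-> S1 (act A x).
  move=> sx; have sy := act_sphere LA sx; have c0 := LT_c4 LA sx.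
  split=> [/(sd_S sd)[_ h]|/(sd_S sd1)[_ h]].
    apply/(sd_S sd1); split=> // m /[dup] Nm /h2 Np.
    have := h _ Np; rewrite (lf_act _ LA sx) (hA _ Np) (h3 _ Nm) pmulr_rle0 //.
  apply/(sd_S sd); split=> // n Nn.
  by rewrite (lf_act _ LA sx) (hA _ Nn) pmulr_rle0 //; apply: h; exact: h1.
exists (fun x => if dot x x <= 1 then f x else x); first by exists f.
have fE x : sphere x -> (if dot x x <= 1 then f x else x) = act A x.
  by move=> sx; have [_ ->] := rf x sx; rewrite (sx : dot x x = 1) lexx.
apply/seteqP; split=> [y [x Sx <-]|y Sy] /=.
  by have [sx _] := (sd_S sd x).1 Sx; rewrite fE //; apply/(AS _ sx).
have [sy _] := (sd_S sd1 y).1 Sy; have sx := act_sphere (LT_sym LA) sy.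
have e := actK (LT_sym LA) sy.
by exists (act A' y); [apply/(AS _ sx); rewrite e | rewrite fE].
Qed.

End Conclusion.

Theorem theorem1p4 (R : realType) (Gam Gam' : set (pt R -> pt R)) (p p' : pt R) :
  kleinian Gam -> kleinian Gam' ->
  schottky_set (limit_set Gam) -> schottky_set (limit_set Gam') ->
  uniform_convergence_action Gam (limit_set Gam) ->
  uniform_convergence_action Gam' (limit_set Gam') ->
  limit_set Gam p -> limit_set Gam' p' ->
  (exists (Z : Type) (d : Z -> Z -> R) (z : Z)
          (Z' : Type) (d' : Z' -> Z' -> R) (z' : Z') (f : Z -> Z'),
      [/\ is_metric d, complete_metric d & weak_tangent (limit_set Gam) p d z] /\
      [/\ is_metric d', complete_metric d' & weak_tangent (limit_set Gam') p' d' z'] /\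
      quasisymmetric d d' f) ->
  exists2 m : pt R -> pt R, mobius m & m @` limit_set Gam = limit_set Gam'.
Proof.
move=> kG kG' sS sS' uG uG' _ _ [Z [d [z [Z' [d' [z' [F [[mZ _ wt] [[mZ' _ wt'] qs]]]]]]]]].
have [N sd] := schottky_SD sS; have [N1 sd1] := schottky_SD sS'.
have sph (T : set (pt R)) : schottky_set T -> T `<=` sphere (R := R) by case=> _ [].
have [da da0 coa] := group_cocompact kG (sph _ sS) uG.
have [db db0 cob] := group_cocompact kG' (sph _ sS') uG'.
have [E [q tl]] := tangent_limit_ex sd da0 coa mZ wt.
have [E' [q' tl']] := tangent_limit_ex sd1 db0 cob mZ' wt'.
have [f [g [hm _ lq]]] := limit_map sd sd1 mZ mZ' tl tl' qs.
have [phi [psi md]] := matching sd sd1 hm.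
(* A common separation constant for both groups, as [conf] carries a single one. *)
have d0 : 0 < Num.min da db by rewrite lt_min da0.
have coa' : cocompact (limit_set Gam) (Num.min da db) by apply: cocompact_le coa; rewrite ge_min lexx.
have cob' : cocompact (limit_set Gam') (Num.min da db) by apply: cocompact_le cob; rewrite ge_min lexx orbT.
have cf := mkconf sd sd1 hm md (tl_q tl) lq d0 coa' cob'.
have [B [B' [B1 [B1' [p0 [Phi [Psi [H H1 [h1 h2 h3 h4] gr hu]]]]]]]] := limit_pair cf.
have [A [A' [LA hA]]] := aligned sd sd1 H H1 h1 gr hu.
exact: LT_mobius sd sd1 LA hA h1 h2 h4.
Qed.
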